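(* Let $\phi$ be a compactly supported contactomorphism of $(\mathbb{R}^{2n}\times S^1,\xi=\ker(dz-y\,dx))$, contact isotopic to the identity through compactly supported contactomorphisms, which is positive, i.e. $\phi$ is the time-1 map of a compactly supported contact isotopy generated by a contact Hamiltonian that is positive in the interior of its support (and $\phi\neq\mathrm{id}$). Then $\phi$ has infinitely many non-trivial, geometrically distinct iterated translated points; that is, there are infinitely many distinct points $q\in\mathbb{R}^{2n}\times S^1$ such that, for some integer $k\geq1$, $q$ is a translated point of $\phi^k$ with nonzero contact action $\mathcal{A}_{\phi^k}(q)\neq0$.
   Context: Coordinates on $\mathbb{R}^{2n}\times S^1$ are $(x,y,z)$ with $x,y\in\mathbb{R}^n$, $z\in S^1=\mathbb{R}/\mathbb{Z}$, and $y\,dx=\sum_i y_i\,dx_i$; the contact form is $\alpha=dz-y\,dx$, whose Reeb vector field is $\partial/\partial z$. For a contactomorphism $\psi$ let $g_\psi$ be the function with $\psi^*\alpha=e^{g_\psi}\alpha$. A point $q$ is a translated point of $\psi$ if $\psi(q)$ and $q$ lie on the same Reeb orbit (i.e. $\psi(q)$ has the same $x,y$ coordinates as $q$) and $g_\psi(q)=0$. An iterated translated point of $\phi$ is a translated point of some iterate $\phi^k$, $k\geq1$. To define the contact action, regard a compactly supported contactomorphism $\psi$ of $\mathbb{R}^{2n}\times S^1$ isotopic to the identity as its lift to a contactomorphism $\psi=(\psi_1,\psi_2,\psi_3)$ of $\mathbb{R}^{2n+1}$ which is 1-periodic in $z$ (the lift equal to the identity outside the preimage of the support); for a translated point $q=(x,y,z)$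 the contact action is the real number $\mathcal{A}_\psi(q)=\psi_3(q)-z$. The translated point is non-trivial if $\mathcal{A}_\psi(q)\neq0$. *)

(* Defs.v *)
From Stdlib Require Import Reals Lra Lia ZArith Arith.
Open Scope R_scope.

Definition Idx (m : nat) := {i : nat | (i < m)%nat}.
Definition vec (m : nat) := Idx m -> R.

Definition get {m : nat} (v : vec m) (i : nat) : R :=
  match Compare_dec.lt_dec i m with
  | left h => v (exist _ i h)
  | right _ => 0
  end.

Definition vadd {m : nat} (u v : vec m) : vec m := fun i => u i + v i.
Definition vscale {m : nat} (s : R) (v : vec m) : vec m := fun i => s * v i.
Definition vsub {m : nat} (u v : vec m) : vec m := fun i => u i - v i.
Definition ebasis (m i : nat) : vec m :=
  fun j => if Nat.eq_dec (proj1_sig j) i then 1 else 0.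

Fixpoint rsum (k : nat) (f : nat -> R) : R :=
  match k with O => 0 | S k' => rsum k' f + f k' end.

Definition vnorm {m : nat} (v : vec m) : R := rsum m (fun i => Rabs (get v i)).

Definition cont {m : nat} (f : vec m -> R) : Prop :=
  forall p eps, 0 < eps -> exists delta, 0 < delta /\
    forall q, vnorm (vsub q p) < delta -> Rabs (f q - f p) < eps.

Fixpoint Ck {m : nat} (k : nat) (f : vec m -> R) {struct k} : Prop :=
  cont f /\
  match k with
  | O => True
  | S k' => exists D : nat -> vec m -> R,
      forall i, (i < m)%nat ->
        (forall p, derivable_pt_lim
                     (fun s => f (vadd p (vscale s (ebasis m i)))) 0 (D i p))
        /\ Ck k' (D i)
  end.

Definition smooth {m : nat} (f : vec m -> R) : Prop := forall k, Ck k f.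

Definition smooth_map {m : nat} (F : vec m -> vec m) : Prop :=
  forall j, (j < m)%nat -> smooth (fun p => get (F p) j).

(** * The lifted contact manifold R^{2n+1} (lift of R^{2n} x S^1)
    coordinates: x_i = coordinate i, y_i = coordinate n+i (i<n), z = coordinate 2n *)
Definition E (n : nat) := vec (2 * n + 1).
Definition xc {n : nat} (p : E n) (i : nat) : R := get p i.
Definition yc {n : nat} (p : E n) (i : nat) : R := get p (n + i).
Definition zc {n : nat} (p : E n) : R := get p (2 * n).
Definition ez (n : nat) : E n := ebasis (2 * n + 1) (2 * n).

Definition alpha (n : nat) (p v : E n) : R :=
  zc v - rsum n (fun i => yc p i * xc v i).

Definition has_dderiv (n : nat) (F : E n -> E n) (p v w : E n) : Prop :=
  forall j, (j < 2 * n + 1)%nat ->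
    derivable_pt_lim (fun s => get (F (vadd p (vscale s v))) j) 0 (get w j).

Definition conformal_factor (n : nat) (psi : E n -> E n) (g : E n -> R) : Prop :=
  forall p v w, has_dderiv n psi p v w -> alpha n (psi p) w = exp (g p) * alpha n p v.

Definition contactomorphism (n : nat) (psi : E n -> E n) : Prop :=
  smooth_map psi /\
  (exists psi_inv : E n -> E n, smooth_map psi_inv /\
     (forall p, psi_inv (psi p) = p) /\ (forall p, psi (psi_inv p) = p)) /\
  (exists g, conformal_factor n psi g).

(** translated point: psi q on the Reeb orbit of q and g_psi(q) = 0 *)
Definition translated_point (n : nat) (psi : E n -> E n) (q : E n) : Prop :=
  (forall i, (i < n)%nat -> xc (psi q) i = xc q i /\ yc (psi q) i = yc q i) /\
  (exists g, conformal_factor n psi g /\ g q = 0).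

Definition action (n : nat) (psi : E n -> E n) (q : E n) : R := zc (psi q) - zc q.

Definition xy_norm (n : nat) (p : E n) : R := rsum (2 * n) (fun i => Rabs (get p i)).

(** joint smoothness of the isotopy in (t,p) in R^{2n+2}; time = coordinate 2n+1 *)
Definition st_smooth (n : nat) (Phi : R -> E n -> E n) : Prop :=
  forall j, (j < 2 * n + 1)%nat ->
    smooth (m := 2 * n + 2)
      (fun u => get (Phi (get u (2 * n + 1)) (fun i => get u (proj1_sig i))) j).

Definition generates (n : nat) (Phi : R -> E n -> E n) (H : R -> E n -> R) : Prop :=
  forall t p (w : E n), 0 <= t <= 1 ->
    (forall j, (j < 2 * n + 1)%nat ->
       derivable_pt_lim (fun s => get (Phi s p) j) t (get w j)) ->
    H t (Phi t p) = alpha n (Phi t p) w.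

Definition closure {m : nat} (S : vec m -> Prop) (q : vec m) : Prop :=
  forall eps, 0 < eps -> exists q', S q' /\ vnorm (vsub q' q) < eps.
Definition interior {m : nat} (S : vec m -> Prop) (q : vec m) : Prop :=
  exists r, 0 < r /\ forall q', vnorm (vsub q' q) < r -> S q'.
Definition support {m : nat} (f : vec m -> R) : vec m -> Prop :=
  closure (fun q => f q <> 0).

Definition positive_ham (n : nat) (H : R -> E n -> R) : Prop :=
  forall t q, 0 <= t <= 1 -> interior (support (H t)) q -> 0 < H t q.

(* Submission.v *)
(** Suppose first n > 0. Each iterate phi^k is a product of short time steps of the isotopy, and each
    step has a generating function F(x, Y, z) in mixed initial and final coordinates, nonnegative because
    the Hamiltonian is. Summing these gives an action on broken trajectories which is 1-periodic in z and,
    far out, a nondegenerate quadratic form of balanced signature, so it has a linking minimax level c_k;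
    critical points of that level are translated points of phi^k with contact action c_k. The linking
    needs only that a continuous map of R^d with bounded displacement is onto, a consequence of
    Sperner's lemma. Moreover:
    - c_k > 0, and c_k < c_(k+1): the action for k+1 dominates that for k, and if the levels were equal, a
      critical point would lie where both actions agree, hence where the additional steps do nothing,
      i.e. at a fixed point of phi, where the action vanishes;
    - c_k is at most the maximum of a function K(y_0) whose flow displaces the support of phi: inserting
      the flow of K as an extra step only raises the levels, and K o phi^k has no critical point of level
      above sup K.
    So for large L there are L translated points q_k with distinct actions in a bounded interval. If
    q_k = q_k' with k < k', then phi^k(q_k) is a translated point of phi^(k'-k) with action c_k' - c_k;
    finitely many points would leave room for boundedly many triples (q_k, integer part of the final z,
    phi^k(q_k)), while these triples are distinct.

    For n = 0 the isotopy gives a lift h >= id of a circle diffeomorphism and the condition is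
    (h^k)'(q) = 1, h^k(q) <> q. The maxima of h^k - id and the same counting either produce infinitely
    many points or a point with h^m(r) = r + j; then T = h^m - j has a fixed point, and extrema of
    T^k - id on a component of the complement of Fix(T) accumulate at an end of that component. *)

(* Three obstacles shape the argument. Generating functions are obtained without the implicit
   function theorem: a short step in mixed coordinates expands distances and has bounded
   displacement, so it is a bijection with Lipschitz inverse, and the contact condition cancels the
   first-order terms in that inverse. Iterates naturally live on spaces of different dimensions;
   padding each with idle steps up to a common length makes their actions functions of the same
   variables, so that monotonicity of the levels is a pointwise comparison. Finally the action is
   not proper, even modulo the period: far out with small jumps no uniform decrease is available,
   but there the action is almost bounded by the supremum of the extra Hamiltonian, and only levels
   above this supremum are claimed to be critical. A gradient flow is replaced by two explicit steps
   with cutoffs, one along the gradient on a compact core, one along the main part of the gradient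
   of the quadratic form outside; the deformed family stays at bounded distance from the linear one
   and therefore still links. *)
Require Import Defs.
From Stdlib Require Import Reals ZArith Arith Lra Lia List ClassicalEpsilon FunctionalExtensionality.
From Stdlib Require FinFun.
From Coquelicot Require Compactness Derive.
From mathcomp Require all_boot all_fingroup.
Import ListNotations.
Open Scope R_scope.

(** * Sperner's lemma *)

Module Sperner.
Import all_boot all_fingroup.
Local Open Scope nat_scope.
Set Implicit Arguments. Unset Strict Implicit. Unset Printing Implicit Defensive.

Lemma involution_card_even (T : finType) (A : {set T}) (f : T -> T) :
  (forall x, x \in A -> f x \in A) -> (forall x, x \in A -> f (f x) = x) ->
  (forall x, x \in A -> f x != x) -> ~~ odd #|A|.
Proof.
have [n] := ubnP #|A|; elim: n A => // n IHn A An fA ffx fx.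
have [->|[x xA]] := set_0Vmem A; first by rewrite cards0.
have fxA : f x \in A :\ x by rewrite !inE fx // fA.
rewrite (cardsD1 x) xA (cardsD1 (f x)) fxA /= negbK.
apply: IHn.
- by move: An; rewrite (cardsD1 x) xA (cardsD1 (f x)) fxA /= => /ltnW.
- move=> y; rewrite !inE => /and3P[y1 y2 yA]; rewrite fA // andbT.
  apply/andP; split; apply/eqP => E.
    by move: y2; rewrite -(ffx y) // E ffx // eqxx.
  by move: y1; rewrite -(ffx y) // E eqxx.
- by move=> y; rewrite !inE => /and3P[_ _ yA]; apply: ffx.
- by move=> y; rewrite !inE => /and3P[_ _ yA]; apply: fx.
Qed.

(** Vertices and colours of a simplex share the type [T]; [j] stands for the facet opposite vertex
    [j], a door in the usual proof of Sperner's lemma. *)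
Definition door (T : finType) (c0 : T) (g : T -> T) (j : T) : bool :=
  [forall c, (c != c0) ==> [exists i, (i != j) && (g i == c)]].

(** A bijective colouring has one door, opposite the vertex coloured [c0]. Otherwise a door [i1]
    leaves just enough vertices for the remaining colours, so the colouring is injective off [i1],
    exactly one other vertex [i2] repeats the colour of [i1], and the doors are [i1] and [i2]. *)
Lemma doors_parity (T : finType) (c0 : T) (g : T -> T) :
  odd #|[set j | door c0 g j]| = injectiveb g.
Proof.
have [/injectiveP gi|ni] := boolP (injectiveb g).
  have -> : [set j | door c0 g j] = [set invF gi c0].
    apply/setP => j; rewrite !inE; apply/forallP/eqP => [D|-> c].
      rewrite -[j](invF_f gi); congr (invF gi _); apply/eqP; apply: contraT => gj.
      have /existsP[i /andP[ij /eqP/gi E]] := implyP (D (g j)) gj.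
      by rewrite E eqxx in ij.
    apply/implyP => cc; apply/existsP; exists (invF gi c).
    by rewrite f_invF eqxx andbT; apply: contra cc => /eqP E; rewrite -(f_invF gi c) E f_invF.
  by rewrite cards1.
have [->|[i1 D1]] := set_0Vmem [set j | door c0 g j]; first by rewrite cards0.
rewrite inE in D1.
have inj1 : {in [set~ i1] &, injective g}.
  apply/imset_injP; rewrite eqn_leq leq_imset_card /=.
  have : [set~ c0] \subset g @: [set~ i1].
    apply/subsetP => c; rewrite !inE => cc.
    have /existsP[i /andP[ij /eqP E]] := implyP (forallP D1 c) cc.
    by rewrite -E; apply: imset_f; rewrite !inE.
  by move/subset_leq_card; rewrite !cardsC1.
have /existsP[i2 /andP[i21 /eqP gi2]] : [exists i2, (i2 != i1) && (g i2 == g i1)].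
  apply: contraNT ni; rewrite negb_exists => /forallP H; apply/injectiveP => x y E.
  have [ex|nx] := eqVneq x i1; have [ey|ny] := eqVneq y i1; subst => //.
  - by have := H y; rewrite ny E eqxx.
  - by have := H x; rewrite nx E eqxx.
  - by apply: inj1; rewrite ?inE.
have -> : [set j | door c0 g j] = [set i1; i2].
  apply/setP => j; rewrite !inE; have [->|nj1] /= := eqVneq j i1; first by rewrite D1.
  have [->|nj2] /= := eqVneq j i2.
    apply/forallP => c; apply/implyP => cc.
    have /existsP[i /andP[ij /eqP E]] := implyP (forallP D1 c) cc.
    have [e2|ne] := eqVneq i i2; apply/existsP; [exists i1|exists i].
      by rewrite eq_sym i21 -gi2 -e2 E eqxx.
    by rewrite ne E eqxx.
  apply/negbTE; apply: contraT; rewrite negbK => /forallP Dj.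
  have gjc : g j != c0.
    apply/eqP => E.
    have sub : [set~ c0] \subset g @: ([set~ i1] :\ j).
      apply/subsetP => c; rewrite !inE => cc.
      have /existsP[i /andP[ij /eqP Ei]] := implyP (forallP D1 c) cc.
      rewrite -Ei; apply: imset_f; rewrite !inE ij andbT.
      by apply: contra cc => /eqP ej; rewrite -Ei ej E.
    have := leq_trans (subset_leq_card sub) (leq_imset_card _ _).
    have jin : j \in [set~ i1] by rewrite !inE.
    by have := cardsD1 j [set~ i1]; rewrite jin !cardsC1 => -> ; rewrite add1n ltnn.
  have /existsP[i /andP[ij /eqP Ei]] := implyP (Dj (g j)) gjc.
  have [e|ne] := eqVneq i i1.
    have E2 : g i2 = g j by rewrite gi2 -Ei e.
    by have := inj1 i2 j; rewrite !inE i21 nj1 => /(_ isT isT E2) e2; rewrite e2 eqxx in nj2.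
  by have := inj1 i j; rewrite !inE ne nj1 => /(_ isT isT Ei) e2; rewrite e2 eqxx in ij.
by rewrite cards2 eq_sym i21.
Qed.

(** * Parity of the rainbow simplices on a triangulated torus *)

Section Torus.
Variables (n m : nat).
Notation d := n.+1.
Notation vert := {ffun 'I_d -> 'I_m}.
Notation simplex := (vert * 'S_d)%type.

(* Freudenthal's triangulation: the [j]-th vertex has raised exactly the coordinates of rank below [j]. *)
Definition vertex (s : simplex) (j : nat) : vert :=
  [ffun k => if s.2 k < j then ordS (s.1 k) else s.1 k].

Definition rup : 'S_d := perm (can_inj (@ordSK d)).
Definition rdown : 'S_d := perm (can_inj (@ord_predK d)).

(** Crossing the facet opposite vertex [j]. Without its first vertex a simplex continues by raising
    the coordinate of rank 0 once more at the end: the base moves and the ranks rotate. Dropping the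
    last vertex is the inverse move, and dropping a middle one exchanges two consecutive ranks. *)
Definition flip (p : simplex * 'I_d.+1) : simplex * 'I_d.+1 :=
  let: (s, j) := p in
  if j == ord0 then
    (([ffun k => if s.2 k == ord0 then ordS (s.1 k) else s.1 k], (s.2 * rdown)%g), ord_max)
  else if j == ord_max then
    (([ffun k => if s.2 k == ord_max then ord_pred (s.1 k) else s.1 k], (s.2 * rup)%g), ord0)
  else ((s.1, (s.2 * tperm (inord j.-1) (inord j))%g), j).

Lemma rdown0 : rdown ord0 = ord_max.
Proof. by apply: val_inj; rewrite permE /= modn_small. Qed.
Lemma rup_max : rup ord_max = ord0.
Proof. by apply: val_inj; rewrite permE /= modnn. Qed.
Lemma rup_down : (rup * rdown = 1)%g.
Proof. by apply/permP => i; rewrite permM perm1 !permE ordSK. Qed.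
Lemma rdown_up : (rdown * rup = 1)%g.
Proof. by apply/permP => i; rewrite permM perm1 !permE ord_predK. Qed.
Lemma rdown_val (i : 'I_d) : i != ord0 -> rdown i = i.-1 :> nat.
Proof.
move=> i0; rewrite permE /=; case: i i0 => [[|i] lt] //= _.
by rewrite modnDr modn_small // ltnW.
Qed.
Lemma rup_val (i : 'I_d) : i != ord_max -> rup i = i.+1 :> nat.
Proof.
move=> i0; rewrite permE /= modn_small // ltnS ltn_neqAle -ltnS ltn_ord andbT.
by apply: contra i0 => /eqP E; apply/eqP/val_inj.
Qed.

Lemma flipK p : flip (flip p) = p.
Proof.
case: p => [[z r] j]; rewrite /flip /=.
have [->|j0] := eqVneq j ord0.
  rewrite /= eqxx; congr ((_, _), _); last by rewrite -mulgA rdown_up mulg1.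
  apply/ffunP => k; rewrite !ffunE permM -{1}rdown0 (inj_eq perm_inj).
  by case: eqP => // _; rewrite ordSK.
have [->|jm] := eqVneq j ord_max.
  rewrite /=; congr ((_, _), _); last by rewrite -mulgA rup_down mulg1.
  apply/ffunP => k; rewrite !ffunE permM -{1}rup_max (inj_eq perm_inj).
  by case: eqP => // _; rewrite ord_predK.
rewrite (negbTE j0) (negbTE jm) /=; congr ((_, _), _).
by rewrite -mulgA tperm2 mulg1.
Qed.

Lemma middle_bounds (j : 'I_d.+1) : j != ord0 -> j != ord_max -> (0 < j) && (j < d).
Proof.
move=> j0 jm; rewrite lt0n; apply/andP; split.
  by apply: contra j0 => /eqP E; apply/eqP/val_inj.
rewrite ltn_neqAle -ltnS ltn_ord andbT.
by apply: contra jm => /eqP E; apply/eqP/val_inj.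
Qed.

Lemma flip_neq p : flip p != p.
Proof.
case: p => [s j]; rewrite /flip /=.
have [->|j0] := eqVneq j ord0; first by apply/eqP => -[].
have [->|jm] := eqVneq j ord_max; first by apply/eqP => -[].
have /andP[jp jd] := middle_bounds j0 jm.
apply/eqP => -[/(congr1 snd)/= E]; have := congr1 (fun r => (s.2^-1 * r)%g) E.
rewrite mulgA mulVg mul1g => /permP/(_ (inord j.-1)); rewrite tpermL perm1.
move=> /(congr1 (@nat_of_ord d)); rewrite !inordK //; last exact: leq_ltn_trans (leq_pred _) jd.
by case: (nat_of_ord j) jp => //= k _ /eqP; rewrite -[_ == _]/(k.+1 == k) gtn_eqF.
Qed.

Lemma flip_vertices s j i : i != j ->
  exists2 i', i' != (flip (s, j)).2 & vertex (flip (s, j)).1 i' = vertex s i.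
Proof.
move=> ij; case: s => z r; rewrite /flip /=.
have [j0|j0] := eqVneq j ord0.
  have ip : 0 < i by rewrite lt0n; apply: contra ij => /eqP E; apply/eqP/val_inj; rewrite j0.
  have ltd : i.-1 < d by rewrite prednK // -ltnS ltn_ord.
  exists (Ordinal (leqW ltd)).
    by apply/eqP => /(congr1 val)/= E; rewrite E ltnn in ltd.
  apply/ffunP => k; rewrite !ffunE /= permM.
  have [->|rk] := eqVneq (r k) ord0.
    by rewrite rdown0 /= ip ltnNge -ltnS ltd.
  by rewrite rdown_val // ltn_predRL prednK // lt0n; apply: contra rk => /eqP E; apply/eqP/val_inj.
have [jm|jm] := eqVneq j ord_max.
  have id : i < d.
    rewrite ltn_neqAle -ltnS ltn_ord andbT; apply: contra ij => /eqP E.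
    by apply/eqP/val_inj; rewrite jm.
  exists (Ordinal (id : i.+1 < d.+1)).
    by apply/eqP => /(congr1 val).
  apply/ffunP => k; rewrite !ffunE /= permM.
  have [->|rk] := eqVneq (r k) ord_max.
    by rewrite rup_max /= ord_predK ltnNge -ltnS id.
  by rewrite rup_val // ltnS.
exists i => //; have /andP[jp jd] := middle_bounds j0 jm.
have j1d : j.-1 < d by exact: leq_ltn_trans (leq_pred _) jd.
have ij' : nat_of_ord i != j by apply: contra ij => /eqP E; apply/eqP/val_inj.
apply/ffunP => k; rewrite !ffunE /= permM; congr (if _ then _ else _).
have E : (j < i) = (j.-1 < i).
  case: (nat_of_ord j) jp ij' => //= l _ il.
  by rewrite [RHS]leq_eqVlt [l.+1 == i]eq_sym (negbTE il).
by case: tpermP => [->|->|_ _]; rewrite ?inordK.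
Qed.

Variable lab : vert -> 'I_d.+1.
Definition slab (s : simplex) (j : 'I_d.+1) := lab (vertex s j).
Definition rainbow (s : simplex) := injectiveb (slab s).

(** A torus has no boundary, so [flip] pairs all doors; summing [doors_parity] over the simplices
    carries the evenness over to the rainbow ones. *)
Lemma rainbow_even : ~~ odd #|[set s | rainbow s]|.
Proof.
pose D := [set p : simplex * 'I_d.+1 | door ord_max (slab p.1) p.2].
have even : ~~ odd #|D|.
  apply: (@involution_card_even _ _ flip) => [[s j]|p _|p _]; last exact: flip_neq.
    rewrite !inE => /forallP Dj; apply/forallP => c; apply/implyP => cc.
    have /existsP[i /andP[ij /eqP E]] := implyP (Dj c) cc.
    have [i' ij' E'] := flip_vertices s ij.
    by apply/existsP; exists i'; rewrite ij' /= /slab E' -E eqxx.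
  exact: flipK.
have : #|D| = \sum_(s : simplex) #|[set j | door ord_max (slab s) j]|.
  rewrite -sum1_card (eq_bigl (fun p => true && door ord_max (slab p.1) p.2)); last first.
    by move=> p; rewrite inE.
  rewrite -(pair_big_dep xpredT (fun s j => door ord_max (slab s) j) (fun _ _ => 1)) /=.
  by apply: eq_bigr => s _; rewrite -sum1_card; apply: eq_bigl => j; rewrite inE.
move=> ED; suff -> : odd #|[set s | rainbow s]| = odd #|D| by [].
rewrite ED -sum1_card big_mkcond /=.
apply: (big_ind2 (fun a b => odd a = odd b)) => // [a b c e ab ce|s _].
  by rewrite !oddD ab ce.
by rewrite doors_parity inE -/(rainbow s); case: (rainbow s).
Qed.
End Torus.

(** * A rainbow simplex inside the box, by comparison with a standard labelling *)

Section Box.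
Variables (n m h : nat).
Hypotheses (h_gt0 : 0 < h) (h_lt : h < m).
Notation d := n.+1.
Notation vert := {ffun 'I_d -> 'I_m}.
Notation simplex := (vert * 'S_d)%type.

(** The label is the first coordinate below [h], or [d] if there is none: what the identity map with
    origin at [h] would receive. *)
Definition std_spec (v : vert) (c : nat) :=
  (forall k : 'I_d, k < c -> h <= v k) /\ (forall k : 'I_d, k = c :> nat -> v k < h).

Lemma std_exists (v : vert) : exists c : 'I_d.+1, std_spec v c.
Proof.
pose p i := if insub i is Some k then (v k < h) else true.
have ex : exists i, p i by exists d; rewrite /p insubF ?ltnn.
have [c pc minc] := ex_minnP ex.
have cd : c < d.+1 by rewrite ltnS; apply: minc; rewrite /p insubF ?ltnn.
exists (Ordinal cd); split=> k /= kc.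
  rewrite leqNgt; apply/negP => vk.
  suff : c <= k by rewrite leqNgt kc.
  by apply: minc; rewrite /p valK.
by move: pc; rewrite /p -kc valK.
Qed.

Lemma std_unique (v : vert) (c c' : nat) : c < d.+1 -> c' < d.+1 ->
  std_spec v c -> std_spec v c' -> c = c'.
Proof.
move=> cd cd' [A B] [A' B'].
case: (ltngtP c c') => // cc.
  have cd2 : c < d by apply: leq_trans cc _.
  by have := A' (Ordinal cd2) cc; rewrite leqNgt B.
have cd2 : c' < d by apply: leq_trans cc _.
by have := A (Ordinal cd2) cc; rewrite leqNgt B'.
Qed.

Definition inner (s : simplex) := [forall k, (s.1 k).+1 < m].

Lemma inner_vertex s j k : inner s -> vertex s j k = s.1 k + (s.2 k < j) :> nat.
Proof.
move=> /forallP/(_ k) lt; rewrite ffunE; case: ifP => _; last by rewrite addn0.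
by rewrite /= modn_small // addn1.
Qed.

Lemma increasing_id (f : 'I_d.+1 -> 'I_d.+1) :
  (forall i j : 'I_d.+1, i < j -> f i < f j) -> forall i, f i = i :> nat.
Proof.
move=> fm.
have up : forall k (i : 'I_d.+1), i = k :> nat -> k <= f i.
  elim=> // k IH i ik.
  have kd : k < d.+1 := ltnW (eq_ind _ (fun a => a < d.+1) (ltn_ord i) _ ik).
  have := IH (Ordinal kd) erefl => /leq_ltn_trans; apply.
  by apply: fm; rewrite /= ik.
have dn : forall k (i : 'I_d.+1), i + k = d -> f i + k <= d.
  elim=> [i _|k IH i ik]; first by rewrite addn0 -ltnS.
  have kd : i.+1 < d.+1 by rewrite ltnS -[X in _ < X]ik addnS ltnS leq_addr.
  apply: leq_trans (IH (Ordinal kd) _); last by rewrite /= addSn -addnS.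
  by rewrite addnS -addSn leq_add2r; apply: fm.
move=> i; apply/eqP; rewrite eqn_leq up // andbT.
have id : i <= d by rewrite -ltnS.
have := dn (d - i) i (subnKC id); move: (f i : nat) => fi.
by rewrite -[X in _ <= X -> _](subnKC id) leq_add2r.
Qed.

Definition std_specb (v : vert) (c : 'I_d.+1) :=
  [forall k : 'I_d, (k < c) ==> (h <= v k)] &&
  [forall k : 'I_d, (k == c :> nat) ==> (v k < h)].

Lemma std_specP v (c : 'I_d.+1) : reflect (std_spec v c) (std_specb v c).
Proof.
apply: (iffP andP) => [[/forallP A /forallP B]|[A B]].
  by split=> k kc; [apply: (implyP (A k))|apply: (implyP (B k)); apply/eqP].
by split; apply/forallP => k; apply/implyP; [exact: A|move=> /eqP; exact: B].
Qed.

Lemma std_existsb v : exists c, std_specb v c.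
Proof. by have [c /std_specP] := std_exists v; exists c. Qed.

Definition std_lab v := xchoose (std_existsb v).

Lemma std_labP v : std_spec v (std_lab v).
Proof. exact/std_specP/(xchooseP (std_existsb v)). Qed.

Lemma std_labE v (c : 'I_d.+1) : std_spec v c -> std_lab v = c.
Proof. by move=> /(std_unique (ltn_ord _) (ltn_ord _) (std_labP v)) E; apply: val_inj. Qed.

Lemma std_lab_mono (v w : vert) : (forall k, v k <= w k) -> std_lab v <= std_lab w.
Proof.
move=> vw; rewrite leqNgt; apply/negP => lt.
have [A _] := std_labP v; have [_ B] := std_labP w.
have cd : std_lab w < d by apply: leq_trans lt _; rewrite -ltnS.
have := B (Ordinal cd) erefl; rewrite ltnNge.
by rewrite (leq_trans (A (Ordinal cd) lt) (vw _)).
Qed.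

Definition center : simplex := ([ffun=> Ordinal (leq_ltn_trans (leq_pred h) h_lt)], 1%g).

Lemma inner_center : inner center.
Proof. by apply/forallP => k; rewrite ffunE /= prednK. Qed.

(** Labels grow along the vertices of an unwrapped simplex, so in a rainbow one vertex [k] has label
    [k]. Then coordinate [k] reaches [h] exactly between vertices [k] and [k+1], which determines
    both base and order. *)
Lemma inner_rainbow_std s : inner s && rainbow std_lab s = (s == center).
Proof.
apply/andP/eqP => [[is_ /injectiveP inj]|->]; last first.
  split; first exact: inner_center.
  have E j : slab std_lab center j = j.
    apply: std_labE; split=> k kj.
      by rewrite inner_vertex ?inner_center // ffunE /= perm1 kj addn1 prednK.
    by rewrite inner_vertex ?inner_center // ffunE /= perm1 kj ltnn addn0 prednK.
  by apply/injectiveP => i j; rewrite !E.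
have idl : forall i, slab std_lab s i = i :> nat.
  apply: increasing_id => i j ij; rewrite ltn_neqAle; apply/andP; split.
    by apply: contraTneq ij => E; rewrite (inj i j (val_inj E)) ltnn.
  apply: std_lab_mono => k; rewrite !inner_vertex // leq_add2l.
  case: (s.2 k < i) (@ltn_trans i (s.2 k) j) => // /(_ isT ij) -> //.
have key : forall k : 'I_d, s.2 k = k /\ s.1 k = h.-1 :> nat.
  move=> k; have k1 : k < d.+1 by rewrite ltnW // ltnS.
  have k2 : k.+1 < d.+1 by rewrite ltnS.
  have [_ B] := std_labP (vertex s k); have [A _] := std_labP (vertex s k.+1).
  have E1 := idl (Ordinal k1); have E2 := idl (Ordinal k2).
  have lo : vertex s k k < h by apply: B; exact: (esym E1).
  have hi : h <= vertex s k.+1 k.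
    by apply: A; have -> : std_lab (vertex s k.+1) = k.+1 :> nat by exact: E2.
  move: lo hi; rewrite !inner_vertex // => lo hi.
  have rk : s.2 k = k.
    apply: val_inj; apply/eqP; rewrite eqn_leq -ltnS; apply/andP; split.
      by apply: contraLR hi => /negbTE->; rewrite addn0 -ltnNge (leq_ltn_trans (leq_addr _ _) lo).
    rewrite leqNgt; apply: contraTN hi => lt; rewrite ltnS (ltnW lt).
    by move: lo; rewrite lt -ltnNge.
  split=> //; move: lo hi; rewrite rk ltnn addn0 ltnSn addn1 => lo hi.
  by apply/eqP; rewrite -eqSS prednK // eqn_leq lo.
case: s {is_ inj idl} key => z r /= key; congr (_, _).
  by apply/ffunP => k; apply: ord_inj; rewrite ffunE (key k).2.
by apply/permP => k; have [-> _] := key k; rewrite perm1.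
Qed.

(** A simplex that wraps around has a coordinate in which all its vertices are [m-1] or [0], so both
    labellings agree on it. Both totals are even and the standard labelling has exactly one inner
    rainbow simplex, so those of [lab] cannot all be wrapped. *)
Lemma inner_rainbow_exists (lab : vert -> 'I_d.+1) :
  (forall v : vert, (exists k, v k = 0 :> nat \/ (v k).+1 = m) -> lab v = std_lab v) ->
  exists2 s, inner s & rainbow lab s.
Proof.
move=> seam; apply/exists_inP; apply: contraT => /exists_inPn none.
have seamE : forall s, ~~ inner s -> rainbow lab s = rainbow std_lab s.
  move=> s; rewrite negb_forall => /existsP[k]; rewrite -leqNgt => km.
  have zk : (s.1 k).+1 = m by apply/eqP; rewrite eqn_leq km ltn_ord.
  have E : slab lab s =1 slab std_lab s.
    move=> j; apply: seam; exists k; rewrite ffunE; case: ifP => _; last by right.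
    by left; rewrite /= zk modnn.
  apply/injectiveP/injectiveP => inj i j; first by rewrite -!E; apply: inj.
  by rewrite !E; apply: inj.
have := rainbow_even std_lab; have := rainbow_even lab.
rewrite (cardsD1 center [set s | rainbow std_lab s]) inE.
have := inner_rainbow_std center; rewrite eqxx => /andP[_ ->] /=.
suff -> : [set s | rainbow std_lab s] :\ center = [set s | rainbow lab s].
  by move=> /negbTE->.
apply/setP => s; rewrite !inE -inner_rainbow_std.
by have [/none/negbTE->|/seamE->] := boolP (inner s); rewrite ?andNb ?andbT //= andNb.
Qed.
End Box.

(** Free of finite types: the entries up to [n] of a vertex matter, [z] is the base of the simplex
    and [w c] its vertex with label [c]. *)
Theorem sperner (n m h : nat) (lab : (nat -> nat) -> nat) :
  lt 0 h -> lt h m ->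
  (forall v, le (lab v) (S n)) ->
  (forall v w, (forall k, le k n -> v k = w k) -> lab v = lab w) ->
  (forall v, (forall k, le k n -> lt (v k) m) ->
     (exists k, le k n /\ (v k = 0 \/ S (v k) = m)) ->
     (forall k, lt k (lab v) -> le k n -> le h (v k)) /\ (le (lab v) n -> lt (v (lab v)) h)) ->
  exists (z : nat -> nat) (w : nat -> nat -> nat), forall c, le c (S n) ->
    lab (w c) = c /\
    forall k, le k n -> le (z k) (w c k) /\ le (w c k) (S (z k)) /\ lt (w c k) m.
Proof.
move=> /ltP h0 /ltP hm lab_le lab_ext seam.
have m0 : 0 < m by apply: ltn_trans hm.
pose ext (v : {ffun 'I_n.+1 -> 'I_m}) (k : nat) : nat := v (inord k).
pose lab' v : 'I_n.+2 := inord (lab (ext v)).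
have lab'E v : lab' v = lab (ext v) :> nat.
  by rewrite inordK //; have /leP := lab_le (ext v); rewrite -ltnS.
have [|s si /injectiveP rb] := @inner_rainbow_exists n m h h0 hm lab'.
  move=> v [k vk]; apply/esym/std_labE.
  have [||A B] := seam (ext v).
  - by move=> i _; apply/ltP; exact: ltn_ord.
  - exists k; split; first by apply/leP; exact: (ltn_ord k).
    by rewrite /ext inord_val.
  rewrite lab'E; split=> i ik.
    have := A i; rewrite /ext inord_val => H; apply/leP/H; first exact/ltP.
    by apply/leP; exact: (ltn_ord i).
  have := B; rewrite -ik /ext inord_val => H; apply/ltP/H.
  by apply/leP; exact: (ltn_ord i).
exists (ext s.1), (fun c => ext (vertex s (invF rb (inord c)))) => c /leP cn.
split.
  by rewrite -lab'E -[lab' _]/(slab lab' s _) f_invF inordK.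
move=> k _; rewrite /ext; split; first by apply/leP; rewrite inner_vertex // leq_addr.
split; last by apply/ltP; exact: ltn_ord.
apply/leP; rewrite inner_vertex //; move: (nat_of_ord (s.1 _)) => a.
by case: (_ < _); rewrite ?addn1 ?addn0.
Qed.
End Sperner.

(** * Calculus on finitely many coordinates *)

Lemma forall_list_radius {A} (L : list A) (P : A -> R -> Prop) :
  (forall a d d', P a d -> 0 < d' <= d -> P a d') ->
  (forall a, In a L -> exists d, 0 < d /\ P a d) ->
  exists d, 0 < d /\ forall a, In a L -> P a d.
Proof.
  intros mono; induction L as [|a L IH]; intros H.
  - exists 1; split; [lra|intros a []].
  - destruct IH as [d [d0 Hd]]; [intros b Hb; apply H; now right|].
    destruct (H a (or_introl eq_refl)) as [e [e0 He]].
    exists (Rmin d e); split; [now apply Rmin_pos|].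
    intros b [<-|Hb].
    + apply mono with e; auto. split; [now apply Rmin_pos|apply Rmin_r].
    + apply mono with d; auto. split; [now apply Rmin_pos|apply Rmin_l].
Qed.

Lemma list_bound {A} (l : list A) (Q : A -> R -> Prop) :
  (forall a x y, Q a x -> x <= y -> Q a y) -> (forall a, In a l -> exists x, 0 < x /\ Q a x) ->
  exists x, 0 < x /\ forall a, In a l -> Q a x.
Proof.
  intros mono; induction l as [|a l IH]; intros H; [exists 1; split; [lra|intros a []]|].
  destruct IH as [x [x0 hx]]; [intros; apply H; now right|].
  destruct (H a (or_introl eq_refl)) as [y [y0 hy]].
  exists (Rmax x y). split; [apply Rlt_le_trans with x; [auto|apply Rmax_l]|].
  intros b [<-|hb]; [eapply mono; [exact hy|apply Rmax_r]|eapply mono; [apply hx, hb|apply Rmax_l]].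
Qed.

Lemma mean_value (f f' : R -> R) a b :
  (forall c, derivable_pt_lim f c (f' c)) ->
  exists c, f b - f a = f' c * (b - a) /\ Rmin a b <= c <= Rmax a b.
Proof.
  intros H. destruct (Rtotal_order a b) as [ab|[->|ab]].
  - destruct (MVT_cor2 f f' a b ab) as [c [E [h1 h2]]]; [intros; apply H|].
    exists c; split; auto. rewrite Rmin_left, Rmax_right; lra.
  - exists b; split; [lra|]. rewrite Rmin_left, Rmax_left; lra.
  - destruct (MVT_cor2 f f' b a ab) as [c [E [h1 h2]]]; [intros; apply H|].
    exists c; split; [lra|]. rewrite Rmin_right, Rmax_left; lra.
Qed.

Lemma derivable_eq f g x l l' :
  derivable_pt_lim f x l -> (forall t, f t = g t) -> l = l' -> derivable_pt_lim g x l'.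
Proof.
  intros H E ->. now replace g with f by (apply functional_extensionality; auto).
Qed.

Lemma derivable_affine c k t : derivable_pt_lim (fun t => c + t * k) t k.
Proof.
  intros e e0. exists (mkposreal 1 Rlt_0_1). intros h hn _.
  replace ((c + (t + h) * k - (c + t * k)) / h - k) with 0 by (field; auto).
  now rewrite Rabs_R0.
Qed.

Fixpoint sumL {A} (L : list A) (f : A -> R) : R :=
  match L with [] => 0 | a :: L => f a + sumL L f end.

Section Sums.
Context {A : Type}.
Implicit Types (L : list A) (f g : A -> R).

Lemma sumL_ext L f g : (forall a, In a L -> f a = g a) -> sumL L f = sumL L g.
Proof.
  induction L as [|a L IH]; simpl; intros H; auto.
  rewrite H by auto. f_equal. apply IH; auto.
Qed.
Lemma sumL_plus L f g : sumL L (fun a => f a + g a) = sumL L f + sumL L g.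
Proof. induction L as [|a L IH]; simpl; [lra|rewrite IH; lra]. Qed.
Lemma sumL_minus L f g : sumL L (fun a => f a - g a) = sumL L f - sumL L g.
Proof. induction L as [|a L IH]; simpl; [lra|rewrite IH; lra]. Qed.
Lemma sumL_scal L c f : sumL L (fun a => c * f a) = c * sumL L f.
Proof. induction L as [|a L IH]; simpl; [lra|rewrite IH; lra]. Qed.
Lemma sumL_zero L f : (forall a, In a L -> f a = 0) -> sumL L f = 0.
Proof.
  induction L as [|a L IH]; simpl; intros H; auto.
  rewrite H, IH by auto. lra.
Qed.
Lemma sumL_le L f g : (forall a, In a L -> f a <= g a) -> sumL L f <= sumL L g.
Proof.
  induction L as [|a L IH]; simpl; intros H; [lra|].
  apply Rplus_le_compat; auto.
Qed.
Lemma sumL_nonneg L f : (forall a, In a L -> 0 <= f a) -> 0 <= sumL L f.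
Proof. intros H. rewrite <- (sumL_zero L (fun _ => 0)); auto. now apply sumL_le. Qed.
Lemma sumL_abs L f : Rabs (sumL L f) <= sumL L (fun a => Rabs (f a)).
Proof.
  induction L as [|a L IH]; simpl; [rewrite Rabs_R0; lra|].
  eapply Rle_trans; [apply Rabs_triang|lra].
Qed.
Lemma sumL_term L f a : In a L -> (forall b, In b L -> 0 <= f b) -> f a <= sumL L f.
Proof.
  induction L as [|b L IH]; simpl; [tauto|]; intros [E|E] H.
  - subst. assert (0 <= sumL L f) by (apply sumL_nonneg; auto). lra.
  - assert (f a <= sumL L f) by (apply IH; auto). assert (0 <= f b) by auto. lra.
Qed.
Lemma sumL_const L c : sumL L (fun _ => c) = INR (length L) * c.
Proof.
  induction L as [|a L IH]; simpl sumL; [simpl; lra|].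
  rewrite IH. cbn [length]. rewrite S_INR. lra.
Qed.
Lemma sumL_bound L f c : (forall a, In a L -> f a <= c) -> sumL L f <= INR (length L) * c.
Proof. intros H. rewrite <- sumL_const. now apply sumL_le. Qed.
Lemma sumL_app L L' f : sumL (L ++ L') f = sumL L f + sumL L' f.
Proof. induction L as [|a L IH]; simpl; [lra|rewrite IH; lra]. Qed.
Lemma sumL_map {B} (h : B -> A) (M : list B) f : sumL (map h M) f = sumL M (fun b => f (h b)).
Proof. induction M as [|a L IH]; simpl; [lra|rewrite IH; lra]. Qed.
Lemma sumL_delta (dec : forall a b : A, {a = b} + {a <> b}) L a f :
  NoDup L -> In a L -> sumL L (fun b => if dec a b then f b else 0) = f a.
Proof.
  induction L as [|b L IH]; intros nd; simpl; [tauto|]. inversion nd; subst.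
  intros [->|H].
  - destruct (dec a a); [|congruence]. rewrite sumL_zero; [lra|].
    intros c Hc. destruct (dec a c); congruence.
  - destruct (dec a b) as [->|]; [congruence|]. rewrite IH; auto. lra.
Qed.
End Sums.

Lemma sumL_swap {A B} (L : list A) (K : list B) (f : A -> B -> R) :
  sumL L (fun i => sumL K (f i)) = sumL K (fun a => sumL L (fun i => f i a)).
Proof.
  induction L as [|i L IH]; cbn [sumL]; [symmetry; now apply sumL_zero|].
  now rewrite IH, sumL_plus.
Qed.

(** * Continuity in finitely many coordinates *)

Section Continuity.
Context {A : Type}.
Implicit Types (L : list A) (p q : A -> R).

(** Points are total functions of which only the coordinates in [L] are measured. Continuity in this
    sense makes a function independent of all other coordinates, see [cont_ext]. *)
Definition near L (d : R) p q := forall a, In a L -> Rabs (q a - p a) < d.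

Definition cont_at L (f : (A -> R) -> R) p :=
  forall eps, 0 < eps -> exists d, 0 < d /\ forall q, near L d p q -> Rabs (f q - f p) < eps.

Definition contL L f := forall p, cont_at L f p.

Lemma near_refl L d p : 0 < d -> near L d p p.
Proof. intros H a _. unfold Rminus. rewrite Rplus_opp_r, Rabs_R0. auto. Qed.
Lemma near_le L d d' p q : d <= d' -> near L d p q -> near L d' p q.
Proof. intros H N a Ha. specialize (N a Ha). lra. Qed.
Lemma near_trans L d d' p q r : near L d p q -> near L d' q r -> near L (d + d') p r.
Proof.
  intros N N' a Ha. specialize (N a Ha). specialize (N' a Ha).
  replace (r a - p a) with ((r a - q a) + (q a - p a)) by ring.
  eapply Rle_lt_trans; [apply Rabs_triang|lra].
Qed.

Lemma cont_const L c p : cont_at L (fun _ => c) p.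
Proof. intros e e0. exists 1. split; [lra|]. intros. unfold Rminus. rewrite Rplus_opp_r, Rabs_R0. auto. Qed.

Lemma cont_coord L a p : In a L -> cont_at L (fun q => q a) p.
Proof. intros H e e0. exists e. split; auto. Qed.

Lemma cont_comp2 L (f g : (A -> R) -> R) (op : R -> R -> R) p :
  (forall eps, 0 < eps -> exists d, 0 < d /\ forall u v,
     Rabs (u - f p) < d -> Rabs (v - g p) < d -> Rabs (op u v - op (f p) (g p)) < eps) ->
  cont_at L f p -> cont_at L g p -> cont_at L (fun q => op (f q) (g q)) p.
Proof.
  intros H cf cg e e0. destruct (H e e0) as [d [d0 Hd]].
  destruct (cf d d0) as [d1 [d10 H1]]. destruct (cg d d0) as [d2 [d20 H2]].
  exists (Rmin d1 d2). split; [now apply Rmin_pos|]. intros q N. apply Hd.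
  - apply H1. eapply near_le; [apply Rmin_l|exact N].
  - apply H2. eapply near_le; [apply Rmin_r|exact N].
Qed.

Lemma cont_plus L f g p : cont_at L f p -> cont_at L g p -> cont_at L (fun q => f q + g q) p.
Proof.
  apply cont_comp2. intros e e0. exists (e/2). split; [lra|]. intros u v Hu Hv.
  replace (u + v - (f p + g p)) with ((u - f p) + (v - g p)) by ring.
  eapply Rle_lt_trans; [apply Rabs_triang|lra].
Qed.
Lemma cont_minus L f g p : cont_at L f p -> cont_at L g p -> cont_at L (fun q => f q - g q) p.
Proof.
  apply cont_comp2. intros e e0. exists (e/2). split; [lra|]. intros u v Hu Hv.
  replace (u - v - (f p - g p)) with ((u - f p) + - (v - g p)) by ring.
  eapply Rle_lt_trans; [apply Rabs_triang|rewrite Rabs_Ropp; lra].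
Qed.
Lemma cont_mult L f g p : cont_at L f p -> cont_at L g p -> cont_at L (fun q => f q * g q) p.
Proof.
  apply cont_comp2. intros e e0. set (M := 1 + Rabs (f p) + Rabs (g p)).
  assert (M1 : 1 <= M) by (unfold M; pose proof (Rabs_pos (f p)); pose proof (Rabs_pos (g p)); lra).
  exists (Rmin 1 (e / (3 * M))).
  assert (K : 0 < e / (3 * M)) by (apply Rdiv_lt_0_compat; lra).
  split; [apply Rmin_pos; lra|]. intros u v Hu Hv.
  pose proof (Rmin_l 1 (e / (3 * M))). pose proof (Rmin_r 1 (e / (3 * M))).
  set (d := Rmin 1 (e / (3 * M))) in *.
  replace (u * v - f p * g p) with ((u - f p) * (v - g p) + (f p * (v - g p) + g p * (u - f p))) by ring.
  assert (d * M <= e / 3).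
  { replace (e / 3) with (e / (3 * M) * M) by (field; lra). apply Rmult_le_compat_r; lra. }
  pose proof (Rabs_pos (f p)); pose proof (Rabs_pos (g p)).
  pose proof (Rabs_pos (u - f p)); pose proof (Rabs_pos (v - g p)).
  assert (d0 : 0 < d) by lra.
  eapply Rle_lt_trans; [apply Rabs_triang|].
  eapply Rle_lt_trans; [apply Rplus_le_compat_l, Rabs_triang|]. rewrite !Rabs_mult.
  assert (Rabs (u - f p) * Rabs (v - g p) <= d * M) by nra.
  assert (Rabs (f p) * Rabs (v - g p) <= M * d) by (unfold M in *; nra).
  assert (Rabs (g p) * Rabs (u - f p) <= Rabs (g p) * d) by nra.
  assert (Rabs (f p) * Rabs (v - g p) <= Rabs (f p) * d) by nra.
  assert (Rabs (u - f p) * Rabs (v - g p) <= 1 * Rabs (v - g p)) by (apply Rmult_le_compat_r; lra).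
  unfold M in *. nra.
Qed.
Lemma cont_comp1 L f (h : R -> R) p :
  continuity_pt h (f p) -> cont_at L f p -> cont_at L (fun q => h (f q)) p.
Proof.
  intros ch cf e e0. destruct (ch e e0) as [d [d0 Hd]].
  destruct (cf d d0) as [d1 [d10 H1]]. exists d1; split; auto. intros q N.
  destruct (Req_dec (f q) (f p)) as [E|ne].
  - rewrite E. unfold Rminus. rewrite Rplus_opp_r, Rabs_R0. auto.
  - apply (Hd (f q)). split; [split; [exact I|auto]|]. apply H1; auto.
Qed.
Lemma cont_Rabs L f p : cont_at L f p -> cont_at L (fun q => Rabs (f q)) p.
Proof. apply cont_comp1. apply Rcontinuity_abs. Qed.
Lemma cont_Rmax L f g p : cont_at L f p -> cont_at L g p -> cont_at L (fun q => Rmax (f q) (g q)) p.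
Proof.
  apply cont_comp2. intros e e0. exists e. split; auto. intros u v Hu Hv.
  apply Rabs_def2 in Hu. apply Rabs_def2 in Hv.
  apply Rabs_def1; unfold Rmax; destruct (Rle_dec u v), (Rle_dec (f p) (g p)); lra.
Qed.
Lemma cont_Rmin L f g p : cont_at L f p -> cont_at L g p -> cont_at L (fun q => Rmin (f q) (g q)) p.
Proof.
  apply cont_comp2. intros e e0. exists e. split; auto. intros u v Hu Hv.
  apply Rabs_def2 in Hu. apply Rabs_def2 in Hv.
  apply Rabs_def1; unfold Rmin; destruct (Rle_dec u v), (Rle_dec (f p) (g p)); lra.
Qed.
Lemma cont_inv L f p : f p <> 0 -> cont_at L f p -> cont_at L (fun q => / f q) p.
Proof.
  intros n0 H. apply (cont_comp1 L f Rinv); auto.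
  apply (continuity_pt_inv id); auto. apply derivable_continuous_pt, derivable_pt_id.
Qed.
Lemma cont_div L f g p : g p <> 0 -> cont_at L f p -> cont_at L g p ->
  cont_at L (fun q => f q / g q) p.
Proof. intros n0 Hf Hg. apply cont_mult; auto. now apply cont_inv. Qed.
Lemma cont_sumL {B} L (M : list B) (f : B -> (A -> R) -> R) p :
  (forall b, In b M -> cont_at L (f b) p) -> cont_at L (fun q => sumL M (fun b => f b q)) p.
Proof.
  induction M as [|b M IH]; intros H; simpl; [apply cont_const|].
  apply cont_plus; [apply H; now left|apply IH; intros; apply H; now right].
Qed.
Lemma cont_ext L f p q : cont_at L f p -> (forall a, In a L -> q a = p a) -> f q = f p.
Proof.
  intros H E. apply cond_eq. intros e e0. destruct (H e e0) as [d [d0 Hd]]. apply Hd.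
  intros a Ha. rewrite E; auto. unfold Rminus. rewrite Rplus_opp_r, Rabs_R0. auto.
Qed.

Lemma cont_eq L f g p : (forall q, f q = g q) -> cont_at L f p -> cont_at L g p.
Proof. intros E H. now replace g with f by (apply functional_extensionality; auto). Qed.
End Continuity.

Lemma cont_comp {A B} (L : list A) (M : list B) (f : (B -> R) -> R) (g : (A -> R) -> B -> R) p :
  cont_at M f (g p) -> (forall b, In b M -> cont_at L (fun q => g q b) p) ->
  cont_at L (fun q => f (g q)) p.
Proof.
  intros cf cg e e0. destruct (cf e e0) as [d [d0 Hd]].
  destruct (forall_list_radius M (fun b r => forall q, near L r p q -> Rabs (g q b - g p b) < d))
    as [r [r0 Hr]].
  - intros b r r' H [r0 rr] q N. apply H. eapply near_le; [exact rr|exact N].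
  - intros b Hb. exact (cg b Hb d d0).
  - exists r. split; auto. intros q N. apply Hd. intros b Hb. now apply Hr.
Qed.

(** * Compactness of boxes *)

Section Gauge.
Context {A : Type} (dec : forall a b : A, {a = b} + {a <> b}).

Definition upd (p : A -> R) (a : A) (t : R) : A -> R := fun b => if dec a b then t else p b.

Lemma upd_same p a t : upd p a t a = t.
Proof. unfold upd. now destruct (dec a a). Qed.
Lemma upd_other p a t b : a <> b -> upd p a t b = p b.
Proof. unfold upd. now destruct (dec a b). Qed.
Lemma upd_upd p a s t : upd (upd p a s) a t = upd p a t.
Proof. apply functional_extensionality; intros b. unfold upd. now destruct (dec a b). Qed.
Lemma upd_id p a : upd p a (p a) = p.
Proof. apply functional_extensionality; intros b. unfold upd. destruct (dec a b); congruence. Qed.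

Definition in_box (L : list A) (lo hi : A -> R) (p : A -> R) := forall a, In a L -> lo a <= p a <= hi a.

(* A form of the Lebesgue number lemma. *)
Lemma gauge (L : list A) (lo hi : A -> R) (delta : (A -> R) -> R) (b : A -> R) :
  (forall p, 0 < delta p) ->
  exists eps, 0 < eps /\ forall p, in_box L lo hi p ->
    exists c, in_box L lo hi c /\ near L (delta c) c p /\ eps <= delta c.
Proof.
  intros dp.
  (* Pinning the centre to [b] off [L] makes the induction work: for a newly added coordinate the
     centres of a slice then have exactly the value of the slice. *)
  enough (H : forall b : A -> R, exists eps, 0 < eps /\ forall p, in_box L lo hi p ->
    exists c, in_box L lo hi c /\ near L (delta c) c p /\ eps <= delta c /\
      forall a, ~ In a L -> c a = b a).
  { destruct (H b) as [e [e0 He]]. exists e; split; auto. intros p Hp.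
    destruct (He p Hp) as [c [h1 [h2 [h3 _]]]]. now exists c. }
  clear b. induction L as [|a L IH]; intros b.
  - exists (delta b); split; auto. intros p _. exists b.
    split; [intros a []|split; [intros a []|split; [lra|auto]]].
  - destruct (in_dec dec a L) as [i|ni].
    + destruct (IH b) as [e [e0 He]]. exists e; split; auto. intros p Hp.
      destruct (He p) as [c [h1 [h2 [h3 h4]]]]; [intros x Hx; apply Hp; now right|].
      exists c. split; [|split; [|split; [exact h3|]]].
      * intros x [<-|]; apply h1; auto.
      * intros x [<-|]; apply h2; auto.
      * intros x Hx. apply h4. intros i'. apply Hx. now right.
    + set (good := fun t e => 0 < e /\ forall p, in_box L lo hi p ->
        exists c, in_box L lo hi c /\ near L (delta c) c p /\ e <= delta c /\
        forall x, ~ In x L -> c x = upd b a t x).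
      assert (ex : forall t, exists e : R, good t e) by (intros t; exact (IH (upd b a t))).
      set (r := fun t => proj1_sig (constructive_indefinite_description _ (ex t))).
      assert (Hr : forall t, good t (r t))
        by (intros t; exact (proj2_sig (constructive_indefinite_description _ (ex t)))).
      (* Compactness in the new coordinate alone: each value is within [r t] of some [t] with [r t]
         at least [d], and [r t] is at most the gauge of the centres chosen over [t]. *)
      destruct (Compactness.compactness_value_1d (lo a) (hi a)
        (fun t => mkposreal (r t) (proj1 (Hr t)))) as [d Hd].
      exists d. split; [apply cond_pos|]. intros p Hp.
      destruct (Classical_Prop.NNPP _ (Hd (p a) (Hp a (or_introl eq_refl)))) as [t [ht [h1 h2]]].
      simpl in h1, h2. destruct (proj2 (Hr t) p) as [c [k1 [k2 [k3 k4]]]].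
      { intros x Hx; apply Hp; now right. }
      assert (ca : c a = t) by (rewrite k4, upd_same; auto).
      exists c. split; [|split; [|split]].
      * intros x [<-|Hx]; [rewrite ca; auto|now apply k1].
      * intros x [<-|Hx]; [|now apply k2]. rewrite ca. lra.
      * lra.
      * intros x Hx. rewrite k4 by (intros i; apply Hx; now right).
        apply upd_other. intros E. apply Hx. now left.
Qed.

Lemma bounded_on_box L lo hi (f : (A -> R) -> R) :
  contL L f -> exists M, 0 < M /\ forall p, in_box L lo hi p -> Rabs (f p) <= M.
Proof.
  intros cf.
  assert (ex : forall c, exists d, 0 < d /\ forall q, near L d c q -> Rabs (f q - f c) < 1)
    by (intros c; apply (cf c); lra).
  set (r := fun c => proj1_sig (constructive_indefinite_description _ (ex c))).
  assert (Hr : forall c, 0 < r c /\ forall q, near L (r c) c q -> Rabs (f q - f c) < 1)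
    by (intros c; exact (proj2_sig (constructive_indefinite_description _ (ex c)))).
  assert (K : forall c, 0 < / (Rabs (f c) + 1))
    by (intros c; apply Rinv_0_lt_compat; pose proof (Rabs_pos (f c)); lra).
  (* The radius is also kept below the inverse of [|f c| + 1], so that the positive lower bound for
     the radii becomes an upper bound for [|f|] at the centres. *)
  destruct (gauge L lo hi (fun c => Rmin (r c) (/ (Rabs (f c) + 1))) (fun _ => 0)) as [e [e0 He]].
  { intros c. apply Rmin_pos; [apply Hr|apply K]. }
  exists (/ e + 1). split; [pose proof (Rinv_0_lt_compat e e0); lra|]. intros p Hp.
  destruct (He p Hp) as [c [_ [h1 h2]]].
  assert (h3 : Rabs (f p - f c) < 1) by (apply Hr; eapply near_le; [apply Rmin_l|exact h1]).
  assert (h4 : e <= / (Rabs (f c) + 1)) by (eapply Rle_trans; [exact h2|apply Rmin_r]).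
  assert (Rabs (f c) + 1 <= / e).
  { rewrite <- (Rinv_inv (Rabs (f c) + 1)). now apply Rinv_le_contravar. }
  replace (f p) with ((f p - f c) + f c) by ring.
  eapply Rle_trans; [apply Rabs_triang|lra].
Qed.

Lemma positive_on_box L lo hi (f : (A -> R) -> R) :
  contL L f -> (forall p, in_box L lo hi p -> 0 < f p) ->
  exists m, 0 < m /\ forall p, in_box L lo hi p -> m <= f p.
Proof.
  intros cf pos.
  assert (ex : forall c, exists d, 0 < d /\ (in_box L lo hi c -> forall q, near L d c q -> f c / 2 < f q)).
  { intros c. destruct (Classical_Prop.classic (in_box L lo hi c)) as [i|n].
    - specialize (pos c i). destruct (cf c (f c / 2)) as [d [d0 Hd]]; [lra|]. exists d; split; auto.
      intros _ q N. specialize (Hd q N). apply Rabs_def2 in Hd. lra.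
    - exists 1; split; [lra|tauto]. }
  set (r := fun c => proj1_sig (constructive_indefinite_description _ (ex c))).
  assert (Hr : forall c, 0 < r c /\ (in_box L lo hi c -> forall q, near L (r c) c q -> f c / 2 < f q))
    by (intros c; exact (proj2_sig (constructive_indefinite_description _ (ex c)))).
  (* Again a value is stored in the radius, now half of [f c]; 1 is a default where [f] is not
     positive. *)
  set (g := fun c => if Rlt_dec 0 (f c) then f c / 2 else 1).
  destruct (gauge L lo hi (fun c => Rmin (r c) (g c)) (fun _ => 0)) as [e [e0 He]].
  { intros c. apply Rmin_pos; [apply Hr|]. unfold g. destruct (Rlt_dec 0 (f c)); lra. }
  exists e; split; auto. intros p Hp. destruct (He p Hp) as [c [ic [h1 h2]]].
  assert (f c / 2 < f p) by (apply Hr; auto; eapply near_le; [apply Rmin_l|exact h1]).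
  assert (e <= g c) by (eapply Rle_trans; [exact h2|apply Rmin_r]).
  specialize (pos c ic). unfold g in *. destruct (Rlt_dec 0 (f c)); lra.
Qed.

Lemma uniform_on_box L lo hi (f : (A -> R) -> R) eps :
  contL L f -> 0 < eps -> exists d, 0 < d /\ forall p q, in_box L lo hi p -> near L d p q ->
    Rabs (f q - f p) < eps.
Proof.
  intros cf e0.
  assert (ex : forall c, exists d, 0 < d /\ forall q, near L d c q -> Rabs (f q - f c) < eps / 2)
    by (intros c; apply (cf c); lra).
  set (r := fun c => proj1_sig (constructive_indefinite_description _ (ex c))).
  assert (Hr : forall c, 0 < r c /\ forall q, near L (r c) c q -> Rabs (f q - f c) < eps / 2)
    by (intros c; exact (proj2_sig (constructive_indefinite_description _ (ex c)))).
  destruct (gauge L lo hi (fun c => r c / 2) (fun _ => 0)) as [e [e1 He]].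
  { intros c. destruct (Hr c); lra. }
  exists e; split; auto. intros p q Hp N. destruct (He p Hp) as [c [_ [h1 h2]]].
  destruct (Hr c) as [r0 H].
  assert (Rabs (f p - f c) < eps / 2) by (apply H; eapply near_le; [|exact h1]; lra).
  assert (Rabs (f q - f c) < eps / 2).
  { apply H. eapply near_le; [|eapply near_trans; [exact h1|exact N]]. lra. }
  replace (f q - f p) with ((f q - f c) + - (f p - f c)) by ring.
  eapply Rle_lt_trans; [apply Rabs_triang|rewrite Rabs_Ropp; lra].
Qed.
End Gauge.

(** * Differentiability in finitely many coordinates *)

Section Differentiability.
Context {A : Type} (dec : forall a b : A, {a = b} + {a <> b}).
Implicit Types (L : list A) (p q : A -> R).

Definition frechet L (f : (A -> R) -> R) p (D : A -> R) :=
  forall eps, 0 < eps -> exists d, 0 < d /\ forall q, near L d p q ->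
    Rabs (f q - f p - sumL L (fun a => D a * (q a - p a))) <= eps * sumL L (fun a => Rabs (q a - p a)).

Definition C1 L (f : (A -> R) -> R) (D : A -> (A -> R) -> R) :=
  contL L f /\ forall a, In a L -> contL L (D a) /\
    forall p t, derivable_pt_lim (fun t => f (upd dec p a t)) t (D a (upd dec p a t)).

(** Coordinates are moved from [p] to [q] one at a time through [mix]. The mean value theorem for
    each costs at most [eps] times its increment, because all intermediate points stay near [p]. *)
Lemma C1_frechet L f D p : NoDup L -> C1 L f D -> frechet L f p (fun a => D a p).
Proof.
  intros nd [cf HD] eps e0.
  destruct (forall_list_radius L (fun a d => forall q, near L d p q -> Rabs (D a q - D a p) < eps))
    as [d [d0 Hd]].
  { intros a d d' H [h0 h1] q N. apply H. eapply near_le; [exact h1|exact N]. }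
  { intros a Ha. destruct (HD a Ha) as [cD _]. exact (cD p eps e0). }
  exists d; split; auto. intros q N.
  set (mix := fun (K : list A) b => if in_dec dec b K then q b else p b).
  assert (key : forall K, NoDup K -> incl K L ->
    Rabs (f (mix K) - f p - sumL K (fun a => D a p * (q a - p a))) <=
      eps * sumL K (fun a => Rabs (q a - p a))).
  { induction K as [|a K IH]; intros ndK iK.
    - simpl. replace (mix []) with p by (apply functional_extensionality; reflexivity).
      rewrite Rminus_0_r. unfold Rminus. rewrite Rplus_opp_r, Rabs_R0. lra.
    - inversion ndK as [|? ? na ndK']; subst.
      assert (aL : In a L) by (apply iK; now left).
      specialize (IH ndK' (fun x Hx => iK x (or_intror Hx))).
      destruct (HD a aL) as [_ der].
      destruct (mean_value _ _ (p a) (q a) (der (mix K))) as [c [E hc]].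
      assert (E1 : upd dec (mix K) a (q a) = mix (a :: K)).
      { apply functional_extensionality; intros b. unfold upd, mix.
        destruct (dec a b) as [<-|n].
        - destruct (in_dec dec a (a :: K)) as [_|n']; auto. exfalso; apply n'; now left.
        - destruct (in_dec dec b K), (in_dec dec b (a :: K)); auto; exfalso.
          + apply n0; now right.
          + destruct i as [|]; auto. }
      assert (E2 : upd dec (mix K) a (p a) = mix K).
      { rewrite <- (upd_id dec (mix K) a) at 2. f_equal. unfold mix.
        destruct (in_dec dec a K); tauto. }
      rewrite E1, E2 in E.
      assert (Rabs (D a (upd dec (mix K) a c) - D a p) < eps).
      { apply Hd; auto. intros b Hb. unfold upd. pose proof (N b Hb) as Nb.
        destruct (dec a b) as [<-|n].
        - apply Rabs_def2 in Nb. revert hc. unfold Rmin, Rmax.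
          destruct (Rle_dec (p a) (q a)); intros; apply Rabs_def1; lra.
        - unfold mix. destruct (in_dec dec b K); auto.
          unfold Rminus. rewrite Rplus_opp_r, Rabs_R0. auto. }
      cbn [sumL].
      replace (f (mix (a :: K)) - f p - (D a p * (q a - p a) + sumL K (fun a => D a p * (q a - p a))))
        with ((D a (upd dec (mix K) a c) - D a p) * (q a - p a) +
              (f (mix K) - f p - sumL K (fun a => D a p * (q a - p a))))
        by (replace (f (mix (a :: K))) with (f (mix K) + D a (upd dec (mix K) a c) * (q a - p a)) by lra; ring).
      eapply Rle_trans; [apply Rabs_triang|]. rewrite Rabs_mult.
      pose proof (Rabs_pos (q a - p a)). nra. }
  specialize (key L nd (fun x h => h)).
  replace (f (mix L)) with (f q) in key; auto.
  apply (cont_ext L); auto. intros a Ha. unfold mix. destruct (in_dec dec a L); tauto.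
Qed.

Lemma frechet_curve L f (g : R -> A -> R) t0 D v :
  frechet L f (g t0) D -> (forall a, In a L -> derivable_pt_lim (fun t => g t a) t0 (v a)) ->
  derivable_pt_lim (fun t => f (g t)) t0 (sumL L (fun a => D a * v a)).
Proof.
  intros fr der eps e0.
  set (V := sumL L (fun a => Rabs (v a) + 1)).
  assert (V0 : 0 <= V) by (apply sumL_nonneg; intros; pose proof (Rabs_pos (v a)); lra).
  set (W := sumL L (fun a => Rabs (D a))).
  assert (W0 : 0 <= W) by (apply sumL_nonneg; intros; apply Rabs_pos).
  destruct (fr (eps / 2 / (V + 1))) as [d [d0 Hd]]; [apply Rdiv_lt_0_compat; lra|].
  (* The bound [eta <= 1] also controls the difference quotients by [|v a| + 1], which explains the
     summand 1 in [V]. *)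
  set (eta := Rmin 1 (eps / 2 / (W + 1))).
  assert (eta0 : 0 < eta) by (apply Rmin_pos; [lra|apply Rdiv_lt_0_compat; lra]).
  destruct (forall_list_radius L (fun a r => forall h, h <> 0 -> Rabs h < r ->
    Rabs ((g (t0 + h) a - g t0 a) / h - v a) < eta)) as [r [r0 Hr]].
  { intros a r r' H [h0 h1] h hn hr. apply H; auto. lra. }
  { intros a Ha. destruct (der a Ha eta eta0) as [[r r0] H]. exists r. auto. }
  assert (M : exists M, 0 < M /\ forall a, In a L -> Rabs (v a) + 1 <= M).
  { exists (V + 1). split; [lra|]. intros a Ha.
    pose proof (sumL_term L (fun a => Rabs (v a) + 1) a Ha) as T. simpl in T.
    unfold V. assert (forall b, In b L -> 0 <= Rabs (v b) + 1)
      by (intros; pose proof (Rabs_pos (v b)); lra). specialize (T H). lra. }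
  destruct M as [M [M0 HM]].
  assert (rr0 : 0 < Rmin r (d / M)) by (apply Rmin_pos; auto; apply Rdiv_lt_0_compat; lra).
  exists (mkposreal _ rr0). simpl. intros h hn hr.
  assert (hr1 : Rabs h < r) by (eapply Rlt_le_trans; [exact hr|apply Rmin_l]).
  assert (hr2 : Rabs h < d / M) by (eapply Rlt_le_trans; [exact hr|apply Rmin_r]).
  assert (hp : 0 < Rabs h) by (now apply Rabs_pos_lt).
  set (e := fun a => (g (t0 + h) a - g t0 a) / h - v a).
  assert (He : forall a, In a L -> Rabs (e a) < eta) by (intros; now apply Hr).
  assert (Eg : forall a, g (t0 + h) a - g t0 a = h * (v a + e a)) by (intros; unfold e; field; auto).
  assert (eta1 : eta <= 1) by apply Rmin_l.
  assert (Hva : forall a, In a L -> Rabs (v a + e a) <= Rabs (v a) + 1).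
  { intros a Ha. eapply Rle_trans; [apply Rabs_triang|]. specialize (He a Ha). lra. }
  assert (N : near L d (g t0) (g (t0 + h))).
  { intros a Ha. rewrite Eg, Rabs_mult. specialize (Hva a Ha). specialize (HM a Ha).
    apply Rle_lt_trans with (Rabs h * M); [apply Rmult_le_compat_l; lra|].
    replace d with (d / M * M) by (field; lra). now apply Rmult_lt_compat_r. }
  specialize (Hd _ N).
  set (X := f (g (t0 + h)) - f (g t0)) in *.
  set (Sg := sumL L (fun a => D a * (g (t0 + h) a - g t0 a))) in *.
  assert (ES : Sg = h * (sumL L (fun a => D a * v a) + sumL L (fun a => D a * e a))).
  { unfold Sg. rewrite <- sumL_plus, <- sumL_scal. apply sumL_ext. intros. rewrite Eg. ring. }
  assert (EA : sumL L (fun a => Rabs (g (t0 + h) a - g t0 a)) <= Rabs h * V).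
  { unfold V. rewrite <- sumL_scal. apply sumL_le. intros a Ha. rewrite Eg, Rabs_mult.
    apply Rmult_le_compat_l; [lra|]. now apply Hva. }
  assert (ED : Rabs (sumL L (fun a => D a * e a)) <= eta * W).
  { eapply Rle_trans; [apply sumL_abs|]. unfold W. rewrite <- sumL_scal. apply sumL_le.
    intros a Ha. rewrite Rabs_mult. specialize (He a Ha). pose proof (Rabs_pos (D a)). nra. }
  assert (K1 : eta * W < eps / 2).
  { assert (eta <= eps / 2 / (W + 1)) by apply Rmin_r.
    apply Rle_lt_trans with (eps / 2 / (W + 1) * W); [apply Rmult_le_compat_r; lra|].
    apply Rlt_le_trans with (eps / 2 / (W + 1) * (W + 1)).
    - apply Rmult_lt_compat_l; [apply Rdiv_lt_0_compat|]; lra.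
    - right. field. lra. }
  assert (K2 : Rabs ((X - Sg) / h) <= eps / 2).
  { unfold Rdiv. rewrite Rabs_mult, Rabs_inv.
    apply Rle_trans with (eps / 2 / (V + 1) * (Rabs h * V) * / Rabs h).
    - apply Rmult_le_compat_r; [left; now apply Rinv_0_lt_compat|].
      eapply Rle_trans; [exact Hd|]. apply Rmult_le_compat_l; auto.
      left. apply Rdiv_lt_0_compat; lra.
    - replace (eps / 2 / (V + 1) * (Rabs h * V) * / Rabs h) with (eps / 2 / (V + 1) * V) by (field; lra).
      apply Rle_trans with (eps / 2 / (V + 1) * (V + 1)); [|right; field; lra].
      apply Rmult_le_compat_l; [left; apply Rdiv_lt_0_compat|]; lra. }
  replace (X / h - sumL L (fun a => D a * v a)) with ((X - Sg) / h + sumL L (fun a => D a * e a))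
    by (rewrite ES; field; auto).
  eapply Rle_lt_trans; [apply Rabs_triang|]. lra.
Qed.

Lemma C1_segment L f D p v t : NoDup L -> C1 L f D ->
  derivable_pt_lim (fun t => f (fun a => p a + t * v a)) t
    (sumL L (fun a => D a (fun a => p a + t * v a) * v a)).
Proof.
  intros nd H. apply (frechet_curve L f (fun t a => p a + t * v a) t
    (fun a => D a (fun a => p a + t * v a))); [now apply C1_frechet|].
  intros a _. apply derivable_affine.
Qed.

Lemma C1_lipschitz L f D K p q : NoDup L -> C1 L f D -> 0 <= K ->
  (forall a r, In a L -> Rabs (D a r) <= K) ->
  Rabs (f q - f p) <= K * sumL L (fun a => Rabs (q a - p a)).
Proof.
  intros nd H K0 HK.
  destruct (mean_value (fun t => f (fun a => p a + t * (q a - p a))) _ 0 1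
    (fun t => C1_segment L f D p (fun a => q a - p a) t nd H)) as [c [E _]].
  replace (fun a => p a + 1 * (q a - p a)) with q in E by (apply functional_extensionality; intros; ring).
  replace (fun a => p a + 0 * (q a - p a)) with p in E by (apply functional_extensionality; intros; ring).
  rewrite E, Rminus_0_r, Rmult_1_r. eapply Rle_trans; [apply sumL_abs|].
  rewrite <- sumL_scal. apply sumL_le. intros a Ha. rewrite Rabs_mult.
  apply Rmult_le_compat_r; [apply Rabs_pos|]. now apply HK.
Qed.

Lemma C1_minus L f g D D' : C1 L f D -> C1 L g D' ->
  C1 L (fun p => f p - g p) (fun a p => D a p - D' a p).
Proof.
  intros [cf Hf] [cg Hg]. split; [intros p; now apply cont_minus|].
  intros a Ha. destruct (Hf a Ha) as [c1 d1], (Hg a Ha) as [c2 d2]. split.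
  - intros p. now apply cont_minus.
  - intros p t. now apply derivable_pt_lim_minus.
Qed.
Lemma C1_const L c : C1 L (fun _ => c) (fun _ _ => 0).
Proof.
  split; [intros p; apply cont_const|]. intros a _. split; [intros p; apply cont_const|].
  intros p t. apply derivable_pt_lim_const.
Qed.
Lemma C1_plus L f g D D' : C1 L f D -> C1 L g D' ->
  C1 L (fun p => f p + g p) (fun a p => D a p + D' a p).
Proof.
  intros [cf Hf] [cg Hg]. split; [intros p; now apply cont_plus|].
  intros a Ha. destruct (Hf a Ha) as [c1 d1], (Hg a Ha) as [c2 d2]. split.
  - intros p. now apply cont_plus.
  - intros p t. now apply derivable_pt_lim_plus.
Qed.
Lemma C1_mult L f g D D' : C1 L f D -> C1 L g D' ->
  C1 L (fun p => f p * g p) (fun a p => D a p * g p + f p * D' a p).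
Proof.
  intros [cf Hf] [cg Hg]. split; [intros p; now apply cont_mult|].
  intros a Ha. destruct (Hf a Ha) as [c1 d1], (Hg a Ha) as [c2 d2]. split.
  - intros p. apply cont_plus; apply cont_mult; auto.
  - intros p t. now apply (derivable_pt_lim_mult (fun t => f (upd dec p a t)) (fun t => g (upd dec p a t))).
Qed.
Lemma C1_scal L c f D : C1 L f D -> C1 L (fun p => c * f p) (fun a p => c * D a p).
Proof.
  intros [cf Hf]. split; [intros p; apply cont_mult; [apply cont_const|apply cf]|].
  intros a Ha. destruct (Hf a Ha) as [c1 d1]. split.
  - intros p. apply cont_mult; [apply cont_const|apply c1].
  - intros p t. now apply derivable_pt_lim_scal.
Qed.
Lemma C1_sumL {I} (Z : list I) L (f : I -> (A -> R) -> R) D :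
  (forall i, In i Z -> C1 L (f i) (D i)) ->
  C1 L (fun p => sumL Z (fun i => f i p)) (fun a p => sumL Z (fun i => D i a p)).
Proof.
  induction Z as [|i Z IH]; intros H; cbn [sumL]; [apply C1_const|].
  apply C1_plus; [apply H; now left|apply IH; intros; apply H; now right].
Qed.
End Differentiability.

(** * Surjectivity of maps with bounded displacement *)

Fixpoint first_neg (u : nat -> R) (k n : nat) : nat :=
  match n with
  | O => k
  | S n => if Rlt_dec (u k) 0 then k else first_neg u (S k) n
  end.

Lemma first_neg_spec u k n : let c := first_neg u k n in
  (k <= c <= k + n)%nat /\ (forall i, (k <= i < c)%nat -> 0 <= u i) /\ ((c < k + n)%nat -> u c < 0).
Proof.
  revert k; induction n as [|n IH]; intros k; cbn.
  - split; [lia|]. split; intros; [lia|lia].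
  - destruct (Rlt_dec (u k) 0) as [l|l].
    + split; [lia|]. split; [intros; lia|auto].
    + destruct (IH (S k)) as [h1 [h2 h3]]. split; [lia|]. split.
      * intros i hi. destruct (Nat.eq_dec i k) as [->|]; [lra|]. apply h2. lia.
      * intros hc. apply h3. lia.
Qed.

Lemma first_neg_ext u u' k n :
  (forall i, (k <= i < k + n)%nat -> u i = u' i) -> first_neg u k n = first_neg u' k n.
Proof.
  revert k; induction n as [|n IH]; intros k H; simpl; auto.
  rewrite <- (H k) by lia. destruct (Rlt_dec (u k) 0); auto. apply IH. intros; apply H; lia.
Qed.

(** Grid points are labelled by the first negative component of [g]. Far out this is the standard
    labelling, so a rainbow cell exists at every mesh. Without a zero, some component would keep its
    sign on a whole small cell, while it is negative at the vertex bearing its label and nonnegative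
    at the vertex labelled [n+1]. *)
Lemma zero_of_identity_at_infinity n (g : (nat -> R) -> nat -> R) K :
  0 < K ->
  (forall i, (i <= n)%nat -> contL (seq 0 (S n)) (fun p => g p i)) ->
  (forall p, (exists k, (k <= n)%nat /\ K <= Rabs (p k)) -> forall i, (i <= n)%nat -> g p i = p i) ->
  exists p, forall i, (i <= n)%nat -> g p i = 0.
Proof.
  intros K0 cg idg. set (L := seq 0 (S n)).
  assert (inL : forall i, In i L <-> (i <= n)%nat) by (intros; unfold L; rewrite in_seq; lia).
  apply Classical_Prop.NNPP. intros no.
  assert (ex : forall c, exists id : nat * R, (fst id <= n)%nat /\ 0 < snd id /\
    forall q, near L (snd id) c q -> 0 < g q (fst id) * g c (fst id)).
  { intros c. destruct (Classical_Prop.classic (exists i, (i <= n)%nat /\ g c i <> 0)) as [[i [hi gi]]|N].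
    - destruct (cg i hi c (Rabs (g c i))) as [d [d0 Hd]]; [now apply Rabs_pos_lt|].
      exists (i, d). simpl. repeat split; auto. intros q Nq. specialize (Hd q Nq).
      apply Rabs_def2 in Hd. revert Hd. unfold Rabs. destruct (Rcase_abs (g c i)); intros; nra.
    - exfalso. apply no. exists c. intros i hi. apply Classical_Prop.NNPP. intros h. apply N. eauto. }
  set (r := fun c => proj1_sig (constructive_indefinite_description _ (ex c))).
  assert (Hr : forall c, (fst (r c) <= n)%nat /\ 0 < snd (r c) /\
    forall q, near L (snd (r c)) c q -> 0 < g q (fst (r c)) * g c (fst (r c)))
    by (intros c; exact (proj2_sig (constructive_indefinite_description _ (ex c)))).
  destruct (INR_unbounded K) as [N HN].
  destruct (gauge Nat.eq_dec L (fun _ => - INR N) (fun _ => INR N) (fun c => snd (r c) / 2) (fun _ => 0))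
    as [e [e0 He]].
  { intros c. destruct (Hr c) as [_ [h _]]. lra. }
  destruct (archimed_cor1 e e0) as [M [HM M0]].
  assert (M1 : 0 < INR M) by (now apply lt_0_INR).
  (* Grid points have spacing [1/M] on the cube of radius [N], and index [h] is the origin: an index
     below [h] means a negative coordinate. *)
  set (h := (M * N)%nat). set (m := (2 * h + 1)%nat).
  set (pos := fun (v : nat -> nat) k => (INR (v k) - INR h) / INR M).
  set (lab := fun v => first_neg (g (pos v)) 0 (S n)).
  assert (N0 : (0 < N)%nat) by (apply INR_lt; simpl; lra).
  assert (Eh : INR h = INR M * INR N) by (unfold h; apply mult_INR).
  destruct (@Sperner.sperner n m h lab) as [z [w Hw]].
  - unfold h. apply Nat.mul_pos_pos; auto.
  - unfold m. lia.
  - intros v. destruct (first_neg_spec (g (pos v)) 0 (S n)) as [h1 _]. fold (lab v) in h1. lia.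
  - intros v v' E. apply first_neg_ext. intros i hi.
    apply (cont_ext L (fun p => g p i) (pos v')); [apply cg; lia|].
    intros a Ha. unfold pos. rewrite E; auto. now apply inL.
  - intros v vm [k [kn vk]].
    assert (idv : forall i, (i <= n)%nat -> g (pos v) i = pos v i).
    { apply idg. exists k. split; auto. apply Rle_trans with (INR N); [lra|].
      unfold pos. destruct vk as [vk|vk].
      - rewrite vk, Eh. replace ((INR 0 - INR M * INR N) / INR M) with (- INR N) by (simpl; field; lra).
        rewrite Rabs_Ropp. apply RRle_abs.
      - replace (v k) with (2 * h)%nat by (unfold m in vk; lia). rewrite mult_INR, Eh.
        replace ((INR 2 * (INR M * INR N) - INR M * INR N) / INR M) with (INR N) by (simpl; field; lra).
        apply RRle_abs. }
    destruct (first_neg_spec (g (pos v)) 0 (S n)) as [h1 [h2 h3]]. fold (lab v) in *.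
    split.
    + intros i hi hin. specialize (h2 i ltac:(lia)). rewrite idv in h2 by auto.
      apply INR_le. unfold pos in h2. apply (Rmult_le_compat_r (INR M)) in h2; [|lra].
      unfold Rdiv in h2. rewrite Rmult_assoc, Rinv_l in h2; lra.
    + intros hl. specialize (h3 ltac:(lia)). rewrite idv in h3 by auto.
      apply INR_lt. unfold pos in h3. apply (Rmult_lt_compat_r (INR M)) in h3; [|lra].
      unfold Rdiv in h3. rewrite Rmult_assoc, Rinv_l in h3; lra.
  - assert (inb : forall c, (c <= S n)%nat -> in_box L (fun _ => - INR N) (fun _ => INR N) (pos (w c))).
    { intros c hc k hk. apply inL in hk. destruct (Hw c hc) as [_ H]. destruct (H k hk) as [_ [_ lt]].
      assert (le : (w c k <= 2 * h)%nat) by (unfold m in lt; lia).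
      apply le_INR in le. rewrite mult_INR, Eh in le. simpl in le. pose proof (pos_INR (w c k)).
      unfold pos. rewrite Eh. split.
      - apply Rmult_le_reg_r with (INR M); auto. unfold Rdiv. rewrite Rmult_assoc, Rinv_l; lra.
      - apply Rmult_le_reg_r with (INR M); auto. unfold Rdiv. rewrite Rmult_assoc, Rinv_l; lra. }
    destruct (He (pos (w O)) (inb O ltac:(lia))) as [c [_ [h1 h2]]].
    destruct (Hr c) as [i0 [d0 Hd]]. set (i := fst (r c)) in *.
    assert (sgn : forall j, (j <= S n)%nat -> 0 < g (pos (w j)) i * g c i).
    { intros j hj. apply Hd. apply (near_le L (snd (r c) / 2 + snd (r c) / 2)); [lra|].
      eapply near_trans; [exact h1|].
      - intros k hk. apply inL in hk. destruct (Hw j hj) as [_ H]. destruct (H k hk) as [l1 [l2 _]].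
        destruct (Hw O ltac:(lia)) as [_ H']. destruct (H' k hk) as [l3 [l4 _]].
        apply le_INR in l1, l2, l3, l4. rewrite S_INR in l2, l4. unfold pos.
        replace ((INR (w j k) - INR h) / INR M - (INR (w O k) - INR h) / INR M)
          with ((INR (w j k) - INR (w O k)) * / INR M) by (field; lra).
        rewrite Rabs_mult, (Rabs_right (/ INR M)) by (left; now apply Rinv_0_lt_compat).
        apply Rle_lt_trans with (1 * / INR M); [|lra].
        apply Rmult_le_compat_r; [left; now apply Rinv_0_lt_compat|]. apply Rabs_le. lra. }
    assert (neg : g (pos (w i)) i < 0).
    { destruct (Hw i ltac:(lia)) as [E _].
      destruct (first_neg_spec (g (pos (w i))) 0 (S n)) as [_ [_ h3]]. fold (lab (w i)) in h3.
      rewrite E in h3. apply h3. lia. }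
    assert (nn : 0 <= g (pos (w (S n))) i).
    { destruct (Hw (S n) ltac:(lia)) as [E _].
      destruct (first_neg_spec (g (pos (w (S n)))) 0 (S n)) as [_ [h3 _]]. fold (lab (w (S n))) in h3.
      rewrite E in h3. apply h3. lia. }
    pose proof (sgn i ltac:(lia)). pose proof (sgn (S n) ltac:(lia)). nra.
Qed.

(** A cutoff switches the displacement off far away. At a zero of the modified map every coordinate
    is at most [C] in absolute value, which lies where the cutoff equals 1, so it is a zero of
    [f]. *)
Lemma bounded_displacement_zero_nat d (f : (nat -> R) -> nat -> R) C :
  (forall i, (i < d)%nat -> contL (seq 0 d) (fun p => f p i)) ->
  (forall p i, (i < d)%nat -> Rabs (f p i - p i) <= C) ->
  exists p, forall i, (i < d)%nat -> f p i = 0.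
Proof.
  destruct d as [|n]; intros cf Hf; [exists (fun _ => 0); intros; lia|].
  set (L := seq 0 (S n)) in *.
  assert (inL : forall i, In i L <-> (i <= n)%nat) by (intros; unfold L; rewrite in_seq; lia).
  set (norm := fun p : nat -> R => sumL L (fun i => Rabs (p i))).
  assert (C0 : 0 <= C) by (eapply Rle_trans; [apply Rabs_pos|apply (Hf (fun _ => 0) O); lia]).
  set (B := INR (S n) * C + 1). assert (0 <= INR (S n)) by apply pos_INR.
  assert (B1 : 1 <= B) by (unfold B; nra).
  set (chi := fun p => Rmax 0 (Rmin 1 (B + 1 - norm p))).
  assert (chi01 : forall p, 0 <= chi p <= 1).
  { intros p. unfold chi. split; [apply Rmax_l|]. apply Rmax_lub; [lra|apply Rmin_l]. }
  destruct (zero_of_identity_at_infinity n (fun p i => p i + chi p * (f p i - p i)) (B + 1)) as [p Hp].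
  - lra.
  - intros i hi p. assert (In i L) by (now apply inL). fold L.
    apply cont_plus; [now apply cont_coord|]. apply cont_mult.
    + apply cont_Rmax; [apply cont_const|]. apply cont_Rmin; [apply cont_const|].
      apply cont_minus; [apply cont_const|]. apply cont_sumL. intros b hb.
      apply cont_Rabs. now apply cont_coord.
    + apply cont_minus; [apply cf; lia|now apply cont_coord].
  - intros p [k [hk pk]] i hi. replace (chi p) with 0; [ring|].
    assert (Rabs (p k) <= norm p).
    { apply (sumL_term L (fun i => Rabs (p i))); [now apply inL|]. intros; apply Rabs_pos. }
    unfold chi. rewrite Rmax_left; auto. apply Rle_trans with (B + 1 - norm p); [apply Rmin_r|lra].
  - exists p. assert (chi p = 1) as E.
    { assert (norm p <= INR (S n) * C).
      { unfold norm. replace (S n) with (length L) by (unfold L; now rewrite length_seq).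
        apply sumL_bound. intros i hi. apply inL in hi. specialize (Hp i hi).
        replace (p i) with (- (chi p * (f p i - p i))) by lra. rewrite Rabs_Ropp, Rabs_mult.
        specialize (Hf p i ltac:(lia)). rewrite (Rabs_right (chi p)) by (destruct (chi01 p); lra).
        destruct (chi01 p). pose proof (Rabs_pos (f p i - p i)). nra. }
      unfold chi, B. rewrite Rmin_left by lra. apply Rmax_right. lra. }
    intros i hi. specialize (Hp i ltac:(lia)). rewrite E in Hp. lra.
Qed.

(** Subtracting the target changes the displacement by a bounded amount only; numbering the entries
    of [L] reduces to the previous lemma. *)
Theorem bounded_displacement_onto {A} (dec : forall a b : A, {a = b} + {a <> b}) (L : list A)
    (f : (A -> R) -> A -> R) C (t : A -> R) :
  NoDup L -> (forall a, In a L -> contL L (fun p => f p a)) ->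
  (forall p a, In a L -> Rabs (f p a - p a) <= C) ->
  exists p, forall a, In a L -> f p a = t a.
Proof.
  intros nd cf Hf. destruct L as [|a0 L']; [exists (fun _ => 0); intros a []|].
  set (L := a0 :: L') in *. set (d := length L).
  set (idx := fix idx (M : list A) (a : A) : nat :=
    match M with [] => O | b :: M => if dec b a then O else S (idx M a) end).
  assert (idx_nth : forall (M : list A) a, In a M -> (idx M a < length M)%nat /\ nth (idx M a) M a0 = a).
  { induction M as [|b M IH]; intros a; [intros []|]. intros Ha. simpl.
    destruct (dec b a) as [->|ne]; [split; [lia|auto]|].
    destruct Ha as [|Ha]; [congruence|]. destruct (IH a Ha). split; [lia|auto]. }
  assert (nth_idx : forall i, (i < d)%nat -> idx L (nth i L a0) = i).
  { intros i hi. destruct (idx_nth L (nth i L a0)) as [h1 h2]; [now apply nth_In|].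
    eapply NoDup_nth; eauto. }
  set (P := fun (u : nat -> R) (a : A) => u (idx L a)).
  destruct (bounded_displacement_zero_nat d
    (fun u i => f (P u) (nth i L a0) - t (nth i L a0))
    (C + sumL L (fun a => Rabs (t a)))) as [u Hu].
  - intros i hi u. apply cont_minus; [|apply cont_const].
    assert (Hi : In (nth i L a0) L) by (now apply nth_In).
    apply (cont_comp (seq 0 d) L (fun p => f p (nth i L a0)) P); [now apply cf|].
    intros b Hb. unfold P. apply (cont_coord (seq 0 d) (idx L b)).
    apply in_seq. destruct (idx_nth L b Hb). unfold d. lia.
  - intros u i hi. assert (Hi : In (nth i L a0) L) by (now apply nth_In).
    replace (f (P u) (nth i L a0) - t (nth i L a0) - u i)
      with ((f (P u) (nth i L a0) - P u (nth i L a0)) + - t (nth i L a0))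
      by (unfold P; rewrite nth_idx by auto; ring).
    eapply Rle_trans; [apply Rabs_triang|]. rewrite Rabs_Ropp. apply Rplus_le_compat; [now apply Hf|].
    apply (sumL_term L (fun a => Rabs (t a))); auto. intros; apply Rabs_pos.
  - exists (P u). intros a Ha. destruct (idx_nth L a Ha) as [h1 h2].
    specialize (Hu (idx L a) h1). rewrite h2 in Hu. lra.
Qed.

(** * The action of a broken trajectory *)

(** A generating function depends on initial [x], final [Y] and initial [z]. A closed broken
    trajectory consists of the [x] and [Y] of each step and the first [z], which determines the
    later ones. *)
Inductive gidx := GX (i : nat) | GY (i : nat) | GZ.
Inductive cidx := CX (j i : nat) | CY (j i : nat) | CZ.

Definition cidx_dec (a b : cidx) : {a = b} + {a <> b}.
Proof. decide equality; apply Nat.eq_dec. Defined.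

(** Differentiability in the Fréchet sense, because generating functions come from an implicit
    change of coordinates, with a first-order expansion in place of partial derivatives. *)
Definition C1f {A} (L : list A) (f : (A -> R) -> R) (D : A -> (A -> R) -> R) :=
  contL L f /\ (forall a, In a L -> contL L (D a)) /\ forall p, frechet L f p (fun a => D a p).

Definition LG (n : nat) : list gidx := GZ :: map GX (seq 0 n) ++ map GY (seq 0 n).

Lemma in_LG n g : In g (LG n) <-> match g with GX i | GY i => (i < n)%nat | GZ => True end.
Proof.
  unfold LG. cbn [In]. rewrite in_app_iff, !in_map_iff. split.
  - intros [<-|[[x [<- h]]|[x [<- h]]]]; [auto|apply in_seq in h; lia|apply in_seq in h; lia].
  - destruct g; intros h; auto.
    + right; left. exists i. split; auto. apply in_seq; lia.
    + right; right. exists i. split; auto. apply in_seq; lia.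
Qed.

Lemma sumL_LG n f : sumL (LG n) f =
  f GZ + sumL (seq 0 n) (fun i => f (GX i)) + sumL (seq 0 n) (fun i => f (GY i)).
Proof. unfold LG. cbn [sumL]. rewrite sumL_app, !sumL_map. ring. Qed.

Definition LC (n M : nat) : list cidx :=
  CZ :: map (fun p => CX (fst p) (snd p)) (list_prod (seq 0 (S M)) (seq 0 n)) ++
        map (fun p => CY (fst p) (snd p)) (list_prod (seq 0 (S M)) (seq 0 n)).

Lemma in_LC n M c : In c (LC n M) <->
  match c with CX j i | CY j i => (j <= M)%nat /\ (i < n)%nat | CZ => True end.
Proof.
  unfold LC. cbn [In]. rewrite in_app_iff, !in_map_iff. split.
  - intros [<-|[[[x y] [<- h]]|[[x y] [<- h]]]]; [auto| |];
      apply in_prod_iff in h; rewrite !in_seq in h; cbn [fst snd]; lia.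
  - destruct c; intros h; auto.
    + right; left. exists (j, i). split; auto. apply in_prod_iff; rewrite !in_seq; lia.
    + right; right. exists (j, i). split; auto. apply in_prod_iff; rewrite !in_seq; lia.
Qed.

Lemma NoDup_list_prod {A B} (l : list A) (l' : list B) :
  NoDup l -> NoDup l' -> NoDup (list_prod l l').
Proof.
  intros H H'. induction H as [|a l na H IH]; simpl; [constructor|].
  apply NoDup_app; auto.
  - apply FinFun.Injective_map_NoDup; auto. intros x y E. now inversion E.
  - intros [x y] h1 h2. apply in_map_iff in h1. destruct h1 as [z [E _]]. inversion E; subst.
    apply in_prod_iff in h2. tauto.
Qed.

Lemma NoDup_LC n M : NoDup (LC n M).
Proof.
  assert (nd : NoDup (list_prod (seq 0 (S M)) (seq 0 n))) by (apply NoDup_list_prod; apply seq_NoDup).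
  unfold LC. constructor.
  - rewrite in_app_iff, !in_map_iff. intros [[x [E _]]|[x [E _]]]; discriminate.
  - apply NoDup_app.
    + apply FinFun.Injective_map_NoDup; auto. intros [x y] [x' y'] E. now inversion E.
    + apply FinFun.Injective_map_NoDup; auto. intros [x y] [x' y'] E. now inversion E.
    + intros c h1 h2. apply in_map_iff in h1, h2.
      destruct h1 as [? [<- _]], h2 as [? [E _]]; discriminate.
Qed.

Section Action.
Variables (n M : nat) (F : nat -> (gidx -> R) -> R) (DF : nat -> gidx -> (gidx -> R) -> R).

Notation sn := (sumL (seq 0 n)).

Definition arg (u : cidx -> R) (j : nat) (z : R) (g : gidx) : R :=
  match g with GX i => u (CX j i) | GY i => u (CY j i) | GZ => z end.

Definition nx (j : nat) : nat := if Nat.eq_dec j M then 0%nat else S j.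

Definition aa (u : cidx -> R) (j i : nat) : R := u (CX (nx j) i) - u (CX j i).

(* Lift to R of the Reeb coordinate along a broken trajectory which jumps, after each step,
   from the end point to the next initial [x] at constant [Y]. *)
Fixpoint zz (u : cidx -> R) (j : nat) : R :=
  match j with
  | O => u CZ
  | S j => zz u j + F j (arg u j (zz u j)) + sn (fun i => u (CY j i) * aa u j i)
  end.

Definition act (u : cidx -> R) : R := zz u (S M) - u CZ.

Definition DFa (u : cidx -> R) (j : nat) (g : gidx) : R := DF j g (arg u j (zz u j)).

(** The differential of [zz u j] in direction [W]; the factor [1 + DFa u j GZ] is the conformal
    factor of step [j]. *)
Fixpoint dz (u W : cidx -> R) (j : nat) : R :=
  match j with
  | O => W CZ
  | S j => (1 + DFa u j GZ) * dz u W j +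
      sn (fun i => (DFa u j (GX i) - u (CY j i)) * W (CX j i) + u (CY j i) * W (CX (nx j) i) +
                   (DFa u j (GY i) + aa u j i) * W (CY j i))
  end.

Definition dact (u W : cidx -> R) : R := dz u W (S M) - W CZ.

Lemma nx_le j : (j <= M)%nat -> (nx j <= M)%nat.
Proof. unfold nx. destruct (Nat.eq_dec j M); lia. Qed.

Hypothesis HF : forall j, (j <= M)%nat -> C1f (LG n) (F j) (DF j).

Lemma cont_aa j i u : (j <= M)%nat -> (i < n)%nat -> cont_at (LC n M) (fun u => aa u j i) u.
Proof.
  intros hj hi. apply cont_minus; apply (cont_coord (LC n M)); apply in_LC; split; auto.
  now apply nx_le.
Qed.

Lemma cont_arg_comp j (f : (gidx -> R) -> R) (z : (cidx -> R) -> R) u :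
  (j <= M)%nat -> contL (LG n) f -> cont_at (LC n M) z u ->
  cont_at (LC n M) (fun u => f (arg u j (z u))) u.
Proof.
  intros hj cf cz. apply (cont_comp (LC n M) (LG n) f (fun u => arg u j (z u))); [apply cf|].
  intros g hg. apply in_LG in hg.
  destruct g; simpl; auto; apply (cont_coord (LC n M)); now apply in_LC.
Qed.

Lemma cont_zz j u : (j <= S M)%nat -> cont_at (LC n M) (fun u => zz u j) u.
Proof.
  revert u. induction j as [|j IH]; intros u hj; simpl.
  - apply (cont_coord (LC n M)). now apply in_LC.
  - apply cont_plus; [apply cont_plus|].
    + apply IH; lia.
    + apply cont_arg_comp; [lia|apply HF; lia|apply IH; lia].
    + apply cont_sumL. intros i hi. apply in_seq in hi. apply cont_mult.
      * apply (cont_coord (LC n M)). apply in_LC. lia.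
      * apply cont_aa; lia.
Qed.

Lemma cont_act : contL (LC n M) act.
Proof.
  intros u. apply cont_minus; [now apply cont_zz|].
  apply (cont_coord (LC n M)). now apply in_LC.
Qed.

Lemma cont_DFa j g u : (j <= M)%nat -> In g (LG n) -> cont_at (LC n M) (fun u => DFa u j g) u.
Proof.
  intros hj hg. unfold DFa. apply cont_arg_comp; auto; [now apply HF|apply cont_zz; lia].
Qed.

Lemma cont_dz W j u : (j <= S M)%nat -> cont_at (LC n M) (fun u => dz u W j) u.
Proof.
  revert u. induction j as [|j IH]; intros u hj; simpl; [apply cont_const|].
  apply cont_plus.
  - apply cont_mult; [|apply IH; lia]. apply cont_plus; [apply cont_const|].
    apply cont_DFa; [lia|]. now apply in_LG.
  - apply cont_sumL. intros i hi. apply in_seq in hi.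
    assert (cy : cont_at (LC n M) (fun u => u (CY j i)) u)
      by (apply (cont_coord (LC n M)); apply in_LC; lia).
    apply cont_plus; [apply cont_plus|]; apply cont_mult; try apply cont_const; auto.
    + apply cont_minus; auto. apply cont_DFa; [lia|]. apply in_LG. lia.
    + apply cont_plus; [|apply cont_aa; lia]. apply cont_DFa; [lia|]. apply in_LG. lia.
Qed.

Lemma cont_dact W : contL (LC n M) (fun u => dact u W).
Proof. intros u. apply cont_minus; [now apply cont_dz|apply cont_const]. Qed.

Lemma derivable_sumL {B} (L : list B) (f : B -> R -> R) (l : B -> R) t :
  (forall b, In b L -> derivable_pt_lim (f b) t (l b)) ->
  derivable_pt_lim (fun t => sumL L (fun b => f b t)) t (sumL L l).
Proof.
  induction L as [|b L IH]; intros H; simpl; [apply derivable_pt_lim_const|].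
  apply (derivable_pt_lim_plus (f b)); [apply H; now left|]. apply IH; intros; apply H; now right.
Qed.

Lemma zz_deriv (U : R -> cidx -> R) W t j : (j <= S M)%nat ->
  (forall c, derivable_pt_lim (fun t => U t c) t (W c)) ->
  derivable_pt_lim (fun t => zz (U t) j) t (dz (U t) W j).
Proof.
  intros hj HU. induction j as [|j IH]; simpl; [apply HU|].
  specialize (IH ltac:(lia)).
  eapply derivable_eq; [|intros; reflexivity|].
  - apply derivable_pt_lim_plus; [apply derivable_pt_lim_plus|].
    + exact IH.
    + apply (frechet_curve (LG n) (F j) (fun t => arg (U t) j (zz (U t) j)) t
        (fun g => DF j g (arg (U t) j (zz (U t) j)))
        (fun g => match g with GX i => W (CX j i) | GY i => W (CY j i) | GZ => dz (U t) W j end)).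
      * apply HF; lia.
      * intros g _. destruct g; simpl; auto.
    + apply (derivable_sumL _ (fun i t => U t (CY j i) * aa (U t) j i)
        (fun i => W (CY j i) * aa (U t) j i + U t (CY j i) * (W (CX (nx j) i) - W (CX j i)))).
      intros i hi. apply (derivable_pt_lim_mult (fun t => U t (CY j i)) (fun t => aa (U t) j i)); auto.
      apply (derivable_pt_lim_minus (fun t => U t (CX (nx j) i)) (fun t => U t (CX j i))); auto.
  - rewrite sumL_LG. unfold DFa.
    set (w := arg (U t) j (zz (U t) j)).
    rewrite (sumL_ext (seq 0 n) (fun i => (DF j (GX i) w - U t (CY j i)) * W (CX j i) +
        U t (CY j i) * W (CX (nx j) i) + (DF j (GY i) w + aa (U t) j i) * W (CY j i))
      (fun i => (DF j (GX i) w * W (CX j i) + DF j (GY i) w * W (CY j i)) +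
        (W (CY j i) * aa (U t) j i + U t (CY j i) * (W (CX (nx j) i) - W (CX j i)))))
      by (intros; ring).
    rewrite !sumL_plus. ring.
Qed.

Lemma act_deriv u W t :
  derivable_pt_lim (fun t => act (fun c => u c + t * W c)) t (dact (fun c => u c + t * W c) W).
Proof.
  apply (derivable_pt_lim_minus (fun t => zz (fun c => u c + t * W c) (S M)) (fun t => u CZ + t * W CZ)).
  - apply (zz_deriv (fun t c => u c + t * W c)); auto. intros; apply derivable_affine.
  - apply derivable_affine.
Qed.

(** One explicit step along [W], controlled by the mean value theorem on the segment, takes the
    place of a flow. *)
Lemma act_descent u W s m : 0 <= s ->
  (forall t, 0 <= t <= s -> m <= dact (fun c => u c - t * W c) W) ->
  act (fun c => u c - s * W c) <= act u - s * m.
Proof.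
  intros s0 H.
  destruct (mean_value (fun t => act (fun c => u c + t * W c)) _ (- s) 0 (act_deriv u W)) as [t [E ht]].
  rewrite Rmin_left, Rmax_right in ht by lra.
  replace (fun c => u c + 0 * W c) with u in E by (apply functional_extensionality; intros; ring).
  replace (fun c => u c + - s * W c) with (fun c => u c - s * W c) in E
    by (apply functional_extensionality; intros; ring).
  specialize (H (- t) ltac:(lra)).
  replace (fun c => u c - - t * W c) with (fun c => u c + t * W c) in H
    by (apply functional_extensionality; intros; ring).
  nra.
Qed.

Definition delta (a : cidx) (c : cidx) : R := if cidx_dec a c then 1 else 0.

Lemma dz_linear u W j : (j <= S M)%nat ->
  dz u W j = sumL (LC n M) (fun a => W a * dz u (delta a) j).
Proof.
  assert (coord : forall c, In c (LC n M) -> W c = sumL (LC n M) (fun a => W a * delta a c)).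
  { intros c hc. transitivity (sumL (LC n M) (fun b => if cidx_dec c b then W b else 0)).
    { symmetry. apply sumL_delta; auto using NoDup_LC. }
    apply sumL_ext. intros b hb. unfold delta.
    destruct (cidx_dec c b), (cidx_dec b c); subst; try congruence; ring. }
  induction j as [|j IH]; intros hj; cbn [dz]; [now apply coord, in_LC|].
  rewrite IH by lia.
  rewrite <- sumL_scal.
  assert (E : forall i, In i (seq 0 n) ->
    (DFa u j (GX i) - u (CY j i)) * W (CX j i) + u (CY j i) * W (CX (nx j) i) +
      (DFa u j (GY i) + aa u j i) * W (CY j i) =
    sumL (LC n M) (fun a => W a * ((DFa u j (GX i) - u (CY j i)) * delta a (CX j i) +
      u (CY j i) * delta a (CX (nx j) i) + (DFa u j (GY i) + aa u j i) * delta a (CY j i)))).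
  { intros i hi. apply in_seq in hi.
    rewrite (coord (CX j i)), (coord (CX (nx j) i)), (coord (CY j i));
      try (apply in_LC; split; try apply nx_le; lia).
    rewrite <- !sumL_scal, <- !sumL_plus. apply sumL_ext. intros; ring. }
  rewrite (sumL_ext (seq 0 n) _ _ E).
  rewrite sumL_swap, <- sumL_plus. apply sumL_ext. intros a ha. rewrite sumL_scal. ring.
Qed.

(** Turns the recursively defined differential into a gradient with entries [dact u (delta a)], used
    both for descent and to pass from a vanishing gradient to all directions. *)
Lemma dact_linear u W : dact u W = sumL (LC n M) (fun a => W a * dact u (delta a)).
Proof.
  unfold dact. rewrite dz_linear by lia.
  rewrite (sumL_ext (LC n M) (fun a => W a * (dz u (delta a) (S M) - delta a CZ))
    (fun a => W a * dz u (delta a) (S M) - (if cidx_dec CZ a then W a else 0))).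
  - rewrite sumL_minus. f_equal. symmetry. apply (sumL_delta cidx_dec); [apply NoDup_LC|now apply in_LC].
  - intros a ha. unfold delta. destruct (cidx_dec a CZ), (cidx_dec CZ a); subst; try congruence; ring.
Qed.

(* [eta] is the initial [y] of a step, recovered from the generating function. *)
Definition eta (u : cidx -> R) (j i : nat) : R :=
  (u (CY j i) - DFa u j (GX i)) / (1 + DFa u j GZ).

Lemma zz_sum u j :
  zz u j = u CZ + sumL (seq 0 j) (fun k => F k (arg u k (zz u k)) + sn (fun i => u (CY k i) * aa u k i)).
Proof.
  induction j as [|j IH]; [simpl; ring|].
  rewrite seq_S, sumL_app. cbn [sumL Nat.add]. change (zz u (S j)) with
    (zz u j + F j (arg u j (zz u j)) + sn (fun i => u (CY j i) * aa u j i)).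
  rewrite IH at 1. ring.
Qed.

Lemma sum_aa u i : sumL (seq 0 M) (fun j => aa u j i) + aa u M i = 0.
Proof.
  assert (H : forall m, (m <= M)%nat -> sumL (seq 0 m) (fun j => aa u j i) = u (CX m i) - u (CX 0 i)).
  { induction m as [|m IH]; intros hm; [simpl; ring|].
    rewrite seq_S, sumL_app, IH by lia. cbn [sumL Nat.add]. unfold aa, nx.
    destruct (Nat.eq_dec m M); [lia|ring]. }
  rewrite H by lia. unfold aa, nx. destruct (Nat.eq_dec M M); [ring|lia].
Qed.

(* The [y]-jumps relative to the last step turn the bilinear part into a nondegenerate pairing. *)
Lemma act_formula u : act u = sumL (seq 0 (S M)) (fun j => F j (arg u j (zz u j))) +
  sumL (seq 0 M) (fun j => sn (fun i => aa u j i * (u (CY j i) - u (CY M i)))).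
Proof.
  unfold act. rewrite zz_sum, sumL_plus.
  assert (E : sumL (seq 0 (S M)) (fun k => sn (fun i => u (CY k i) * aa u k i)) =
    sumL (seq 0 M) (fun j => sn (fun i => aa u j i * (u (CY j i) - u (CY M i))))).
  { rewrite seq_S, sumL_app. cbn [sumL Nat.add]. rewrite Rplus_0_r.
    rewrite (sumL_ext (seq 0 n) _ (fun i => - u (CY M i) * sumL (seq 0 M) (fun j => aa u j i))).
    2:{ intros i _. pose proof (sum_aa u i). replace (aa u M i) with (- sumL (seq 0 M) (fun j => aa u j i)) by lra. ring. }
    rewrite (sumL_ext (seq 0 n) _ (fun i => sumL (seq 0 M) (fun j => - u (CY M i) * aa u j i)))
      by (intros; now rewrite sumL_scal).
    rewrite (sumL_swap (seq 0 n) (seq 0 M)), <- sumL_plus. apply sumL_ext. intros j _. rewrite <- sumL_plus. apply sumL_ext.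
    intros; ring. }
  rewrite E. ring.
Qed.
End Action.

(** * Decrease of the action *)

Lemma sumL_LC n M f : sumL (LC n M) f = f CZ +
  sumL (seq 0 (S M)) (fun j => sumL (seq 0 n) (fun i => f (CX j i) + f (CY j i))).
Proof.
  assert (P : forall g : nat * nat -> R, forall l, sumL (list_prod l (seq 0 n)) g =
    sumL l (fun j => sumL (seq 0 n) (fun i => g (j, i)))).
  { intros g. induction l as [|j l IH]; cbn [sumL list_prod]; auto.
    now rewrite sumL_app, sumL_map, IH. }
  unfold LC. cbn [sumL]. rewrite sumL_app, !sumL_map, !P, <- sumL_plus. f_equal.
  apply sumL_ext. intros j _. now rewrite <- sumL_plus.
Qed.

(** Cauchy-Schwarz against the constant 1. *)
Lemma sumL_square {A} (L : list A) f :
  sumL L (fun a => Rabs (f a)) * sumL L (fun a => Rabs (f a)) <=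
  INR (length L) * sumL L (fun a => f a * f a).
Proof.
  induction L as [|a L IH]; cbn [sumL length]; [simpl; lra|]. rewrite S_INR.
  set (s := sumL L (fun a => Rabs (f a))) in *. set (t := sumL L (fun a => f a * f a)) in *.
  set (l := INR (length L)) in *. assert (l0 : 0 <= l) by apply pos_INR.
  assert (t0 : 0 <= t) by (apply sumL_nonneg; intros; nra).
  assert (E : Rabs (f a) * Rabs (f a) = f a * f a)
    by (rewrite <- Rabs_mult; apply Rabs_right; nra).
  set (x := Rabs (f a)) in *. assert (0 <= x) by apply Rabs_pos.
  assert (s0 : 0 <= s) by (apply sumL_nonneg; intros; apply Rabs_pos).
  rewrite <- E.
  destruct (Rle_lt_or_eq_dec 0 l l0) as [lp|lz].
  - assert (2 * (x * s) <= l * (x * x) + t).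
    { apply Rmult_le_reg_l with l; auto. assert (0 <= (l * x - s) * (l * x - s)) by apply Rle_0_sqr. nra. }
    nra.
  - rewrite <- lz in *. assert (s = 0) by nra. rewrite H0. nra.
Qed.

Section DirectionalLowerBound.
Variables (n M : nat) (F : nat -> (gidx -> R) -> R) (DF : nat -> gidx -> (gidx -> R) -> R).
Notation sn := (sumL (seq 0 n)).
Notation DFa := (DFa n M F DF).
Notation eta := (eta n M F DF).

(** Counts the errors [m] accumulated after [j] steps: each step adds one before the multiplication
    by its factor, at most [Lam], and one after it. *)
Fixpoint gam (Lam : R) (j : nat) : R :=
  match j with O => 0 | S j => Lam * (gam Lam j + 1) + 1 end.

(* With e_j = dz_j - Y_{j-1} dx_j the differential of the action satisfies
   e_{j+1} = rho_j (e_j + (Y_{j-1} - eta_j) dx_j) + (F_Y + a_j) dY_j and e_{M+1} is the total. *)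
Lemma dact_lower (q w : cidx -> R) C kap lam Lam :
  w CZ = 0 -> (forall i, w (CX 0 i) = 0) -> (forall i, w (CY M i) = 0) ->
  0 <= C -> 0 <= kap -> 0 < lam <= 1 -> 1 <= Lam ->
  (forall j, (j <= M)%nat -> lam <= 1 + DFa q j GZ <= Lam) ->
  (forall j i, (j <= M)%nat -> (i < n)%nat -> Rabs (q (CY j i) - eta q j i) <= C) ->
  (forall j i, (j < M)%nat -> (i < n)%nat -> Rabs (DFa q j (GY i)) <= C) ->
  (forall j i, (j < M)%nat -> (i < n)%nat ->
     Rabs (q (CY j i) - q (CY (S j) i) - w (CX (S j) i)) <= kap) ->
  (forall j i, (j < M)%nat -> (i < n)%nat -> Rabs (aa M q j i - w (CY j i)) <= kap) ->
  lam ^ S M / 2 * sumL (LC n M) (fun c => w c * w c) - gam Lam (S M) * (INR n * ((C + kap) * (C + kap)))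
    <= dact n M F DF q w.
Proof.
  intros wz wx wy C0 k0 [l0 l1] L1 Hrho Heta HFY Hd Ha.
  set (m := INR n * ((C + kap) * (C + kap))).
  assert (m0 : 0 <= m) by (apply Rmult_le_pos; [apply pos_INR|apply Rle_0_sqr]).
  (* Completing the square: half of [y^2] survives, and the distance of the factors costs at most
     its square. *)
  assert (quad : forall x y : R, Rabs (x - y) <= C + kap ->
    y * y / 2 - (C + kap) * (C + kap) <= x * y).
  { intros x y h. pose proof (Rmult_le_compat _ _ _ _ (Rabs_pos _) (Rabs_pos _) h h) as h2.
    rewrite <- Rabs_mult, Rabs_right in h2 by (apply Rle_ge, Rle_0_sqr).
    pose proof (Rle_0_sqr x). pose proof (Rle_0_sqr (C + kap)). unfold Rsqr in *. lra. }
  assert (quads : forall x y : nat -> R, (forall i, (i < n)%nat -> Rabs (x i - y i) <= C + kap) ->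
    sn (fun i => y i * y i / 2) - m <= sn (fun i => x i * y i)).
  { intros x y h. unfold m. replace n with (length (seq 0 n)) at 2 by apply length_seq.
    rewrite <- sumL_const, <- sumL_minus. apply sumL_le. intros i hi. apply in_seq in hi.
    apply quad. apply h. lia. }
  set (e := fun j => dz n M F DF q w j -
    match j with O => 0 | S j' => sn (fun i => q (CY j' i) * w (CX (nx M j') i)) end).
  set (T := fun j => sumL (seq 0 j) (fun k => sn (fun i => w (CX k i) * w (CX k i) / 2) +
     sn (fun i => w (CY k i) * w (CY k i) / 2))).
  assert (Tn : forall j, 0 <= T j).
  { intros j. apply sumL_nonneg. intros k _. apply Rplus_le_le_0_compat; apply sumL_nonneg; intros; nra. }
  assert (gn : forall j, 0 <= gam Lam j) by (induction j; simpl; nra).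
  assert (pw : forall j, 0 < lam ^ j <= 1).
  { induction j; simpl; [lra|]. nra. }
  assert (rec : forall j, (j <= M)%nat -> exists X,
    sn (fun i => w (CX j i) * w (CX j i) / 2) - m <= X /\
    e (S j) = (1 + DFa q j GZ) * (e j + X) + sn (fun i => (DFa q j (GY i) + aa M q j i) * w (CY j i))).
  { intros j hj.
    assert (r0 : 1 + DFa q j GZ <> 0) by (specialize (Hrho j hj); lra).
    assert (E : e (S j) = (1 + DFa q j GZ) * (dz n M F DF q w j - sn (fun i => eta q j i * w (CX j i))) +
      sn (fun i => (DFa q j (GY i) + aa M q j i) * w (CY j i))).
    { unfold e. cbn [dz].
      assert (A : sn (fun i => (DFa q j (GX i) - q (CY j i)) * w (CX j i) + q (CY j i) * w (CX (nx M j) i) +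
          (DFa q j (GY i) + aa M q j i) * w (CY j i)) =
        - (1 + DFa q j GZ) * sn (fun i => eta q j i * w (CX j i)) +
        sn (fun i => q (CY j i) * w (CX (nx M j) i)) +
        sn (fun i => (DFa q j (GY i) + aa M q j i) * w (CY j i))).
      { rewrite <- sumL_scal, <- !sumL_plus. apply sumL_ext. intros i _. unfold Submission.eta.
        field. exact r0. }
      rewrite A. ring. }
    rewrite E. destruct j as [|j].
    (* The direction has no component at the first [x], so step 0 gains and loses nothing in [x]. *)
    - exists 0. split.
      + rewrite sumL_zero; [lra|]. intros i _. rewrite wx. lra.
      + f_equal. f_equal. unfold e. rewrite (sumL_zero _ (fun i => eta q 0 i * _)); [ring|].
        intros i _. rewrite wx. ring.
    - exists (sn (fun i => (q (CY j i) - eta q (S j) i) * w (CX (S j) i))). split.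
      + apply quads. intros i hi.
        replace (q (CY j i) - eta q (S j) i - w (CX (S j) i)) with
          ((q (CY (S j) i) - eta q (S j) i) + (q (CY j i) - q (CY (S j) i) - w (CX (S j) i))) by ring.
        eapply Rle_trans; [apply Rabs_triang|]. apply Rplus_le_compat; [apply Heta|apply Hd]; lia.
      + f_equal. f_equal. unfold e.
        replace (nx M j) with (S j) by (unfold nx; destruct (Nat.eq_dec j M); lia).
        assert (Y : sn (fun i => (q (CY j i) - eta q (S j) i) * w (CX (S j) i)) =
          sn (fun i => q (CY j i) * w (CX (S j) i)) - sn (fun i => eta q (S j) i * w (CX (S j) i)))
          by (rewrite <- sumL_minus; apply sumL_ext; intros; ring).
        rewrite Y. ring. }
  (* The gains, squares of entries of [w], shrink at worst by [lam] per step, while the errors grow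
     at worst by [Lam]. *)
  assert (low : forall j, (j <= S M)%nat -> lam ^ j * T j - gam Lam j * m <= e j).
  { induction j as [|j IH]; intros hj.
    - unfold e, T. cbn [dz sumL seq gam pow]. rewrite wz. lra.
    - specialize (IH ltac:(lia)). destruct (rec j ltac:(lia)) as [X [hX E]]. rewrite E.
      assert (hY : sn (fun i => w (CY j i) * w (CY j i) / 2) - m <=
        sn (fun i => (DFa q j (GY i) + aa M q j i) * w (CY j i))).
      { destruct (Nat.eq_dec j M) as [->|ne].
        - rewrite !sumL_zero; [lra| |]; intros i _; rewrite wy; lra.
        - apply quads. intros i hi.
          replace (DFa q j (GY i) + aa M q j i - w (CY j i)) with
            (DFa q j (GY i) + (aa M q j i - w (CY j i))) by ring.
          eapply Rle_trans; [apply Rabs_triang|]. apply Rplus_le_compat; [apply HFY|apply Ha]; lia. }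
      assert (ET : T (S j) = T j + sn (fun i => w (CX j i) * w (CX j i) / 2) +
        sn (fun i => w (CY j i) * w (CY j i) / 2)).
      { unfold T. rewrite seq_S, sumL_app. cbn [sumL Nat.add]. ring. }
      rewrite ET. cbn [pow gam].
      set (t1 := sn (fun i => w (CX j i) * w (CX j i) / 2)) in *.
      set (t2 := sn (fun i => w (CY j i) * w (CY j i) / 2)) in *.
      assert (0 <= t1) by (apply sumL_nonneg; intros; nra).
      assert (0 <= t2) by (apply sumL_nonneg; intros; nra).
      destruct (Hrho j ltac:(lia)) as [rl rL]. set (rho := 1 + DFa q j GZ) in *.
      specialize (Tn j). specialize (gn j). destruct (pw j) as [p0 p1].
      set (P := lam ^ j * T j + t1). set (G := (gam Lam j + 1) * m).
      assert (0 <= P) by (unfold P; nra). assert (0 <= G) by (unfold G; nra).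
      assert (b1 : P - G <= e j + X) by (unfold P, G; lra).
      assert (b2 : lam * P - Lam * G <= rho * (e j + X)).
      { apply Rle_trans with (rho * (P - G)); [|apply Rmult_le_compat_l; lra].
        assert (lam * P <= rho * P) by (apply Rmult_le_compat_r; lra).
        assert (rho * G <= Lam * G) by (apply Rmult_le_compat_r; lra). lra. }
      assert (b3 : lam * lam ^ j * (T j + t1 + t2) <= lam * P + t2).
      { unfold P. assert (lam * lam ^ j * t1 <= lam * t1).
        { apply Rmult_le_compat_r; nra. }
        assert (lam * lam ^ j * t2 <= 1 * t2) by (apply Rmult_le_compat_r; nra). nra. }
      unfold G in b2. lra. }
  assert (Ed : dact n M F DF q w = e (S M)).
  { unfold dact, e. rewrite wz. rewrite sumL_zero; [ring|]. intros i _.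
    unfold nx. destruct (Nat.eq_dec M M); [|lia]. rewrite wx. ring. }
  rewrite Ed. specialize (low (S M) ltac:(lia)).
  assert (ET : sumL (LC n M) (fun c => w c * w c) = 2 * T (S M)).
  { rewrite sumL_LC, wz. unfold T. rewrite <- sumL_scal, Rmult_0_l, Rplus_0_l. apply sumL_ext.
    intros j _. rewrite <- sumL_plus, <- sumL_scal. apply sumL_ext. intros; field. }
  rewrite ET. fold m. lra.
Qed.
End DirectionalLowerBound.

(** * Descent away from a compact set *)

Definition clip (x : R) : R := Rmax 0 (Rmin 1 x).
Lemma clip_01 x : 0 <= clip x <= 1.
Proof. unfold clip. split; [apply Rmax_l|]. apply Rmax_lub; [lra|apply Rmin_l]. Qed.
Lemma clip_0 x : x <= 0 -> clip x = 0.
Proof. intros h. unfold clip. apply Rmax_left. eapply Rle_trans; [apply Rmin_r|auto]. Qed.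
Lemma clip_1 x : 1 <= x -> clip x = 1.
Proof. intros h. unfold clip. rewrite Rmin_left by auto. apply Rmax_right. lra. Qed.
Lemma cont_clip {A} (L : list A) f p : cont_at L f p -> cont_at L (fun q => clip (f q)) p.
Proof. intros h. apply cont_Rmax; [apply cont_const|]. apply cont_Rmin; [apply cont_const|auto]. Qed.

Definition tick (w : gidx -> R) (k : Z) (g : gidx) : R :=
  match g with GZ => w GZ + IZR k | g => w g end.
Definition shift (u : cidx -> R) (k : Z) (c : cidx) : R :=
  match c with CZ => u CZ + IZR k | c => u c end.

Definition wnorm (n : nat) (w : gidx -> R) : R :=
  sumL (seq 0 n) (fun i => Rabs (w (GX i)) + Rabs (w (GY i))).

(** [1 + DF GZ] is the conformal factor of the step and [(Y - F_x) / (1 + F_z)] its initial [y];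
    thus [sb_eta] bounds the displacement in [y], as [sb_Y] does in [x]. *)
Record step_bounds (n : nat) (C lam Lam B : R) (F : (gidx -> R) -> R)
    (DF : gidx -> (gidx -> R) -> R) : Prop := {
  sb_C1 : C1f (LG n) F DF;
  sb_F : forall w, 0 <= F w <= C;
  sb_Y : forall w i, (i < n)%nat -> Rabs (DF (GY i) w) <= C;
  sb_rho : forall w, lam <= 1 + DF GZ w <= Lam;
  sb_eta : forall w i, (i < n)%nat ->
    Rabs (w (GY i) - (w (GY i) - DF (GX i) w) / (1 + DF GZ w)) <= C;
  sb_per : forall w k, F (tick w k) = F w;
  sb_Dper : forall w k g, In g (LG n) -> DF g (tick w k) = DF g w;
  sb_supp : forall w, B < wnorm n w -> F w = 0;
  sb_Dsupp : forall w g, B < wnorm n w -> In g (LG n) -> DF g w = 0 }.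

(* The generating function of a step which translates [x_0] by an amount depending on [y_0] only. *)
Definition kF (K : R -> R) (w : gidx -> R) : R := K (w (GY 0)).
Definition kDF (K' : R -> R) (g : gidx) (w : gidx -> R) : R :=
  match g with GY 0 => K' (w (GY 0%nat)) | _ => 0 end.

(** Step [M] is kept apart because [K] is bounded but not compactly supported. As a function of a
    single [y] it has conformal factor 1 and leaves every [y] unchanged. *)
Record ksteps (n M : nat) (C lam Lam B CK : R) (K K' : R -> R)
    (F : nat -> (gidx -> R) -> R) (DF : nat -> gidx -> (gidx -> R) -> R) : Prop := {
  ks_n : (0 < n)%nat;
  ks_M : (0 < M)%nat;
  ks_C : 0 <= C;
  ks_lam : 0 < lam <= 1;
  ks_Lam : 1 <= Lam;
  ks_B : 0 <= B;
  ks_steps : forall j, (j < M)%nat -> step_bounds n C lam Lam B (F j) (DF j);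
  ks_F : F M = kF K;
  ks_DF : DF M = kDF K';
  ks_K : forall y, 0 <= K y <= CK;
  ks_K' : forall y, derivable_pt_lim K y (K' y);
  ks_K'c : forall y, continuity_pt K' y }.

Lemma kF_C1f n K K' : (0 < n)%nat -> (forall y, derivable_pt_lim K y (K' y)) ->
  (forall y, continuity_pt K' y) -> C1f (LG n) (kF K) (kDF K').
Proof.
  intros n0 der cK'.
  assert (i0 : In (GY 0) (LG n)) by (now apply in_LG).
  split; [|split].
  - intros p. apply (cont_comp1 (LG n) (fun w => w (GY 0)) K).
    + apply derivable_continuous_pt. exists (K' (p (GY 0%nat))). apply der.
    + now apply (cont_coord (LG n)).
  - intros g hg p. unfold kDF. destruct g as [i|[|i]|]; try apply cont_const.
    apply (cont_comp1 (LG n) (fun w => w (GY 0)) K'); [apply cK'|]. now apply (cont_coord (LG n)).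
  - intros p eps e0. destruct (der (p (GY 0%nat)) eps e0) as [[d d0] Hd]. simpl in Hd.
    exists d; split; auto. intros q N.
    set (h := q (GY 0%nat) - p (GY 0%nat)).
    assert (E : sumL (LG n) (fun a => kDF K' a p * (q a - p a)) = K' (p (GY 0%nat)) * h).
    { rewrite sumL_LG. rewrite (sumL_zero (seq 0 n) (fun i => kDF K' (GX i) p * _)) by (intros; simpl; ring).
      rewrite (sumL_ext (seq 0 n) _ (fun i => if Nat.eq_dec 0 i then K' (p (GY 0%nat)) * h else 0)).
      - rewrite (sumL_delta Nat.eq_dec (seq 0 n) 0%nat (fun _ => K' (p (GY 0%nat)) * h)); [simpl; ring|apply seq_NoDup|apply in_seq; lia].
      - intros i _. destruct i; simpl; [reflexivity|ring]. }
    rewrite E. unfold kF. apply Rle_trans with (eps * Rabs h).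
    + destruct (Req_dec h 0) as [h0|hn].
      * assert (Eq : q (GY 0%nat) = p (GY 0%nat)) by (unfold h in h0; lra).
        rewrite h0, Eq, Rmult_0_r, !Rminus_diag, Rabs_R0. lra.
      * specialize (Hd h hn (N _ i0)). replace (p (GY 0%nat) + h) with (q (GY 0%nat)) in Hd by (unfold h; ring).
        replace (K (q (GY 0%nat)) - K (p (GY 0%nat)) - K' (p (GY 0%nat)) * h) with
          (((K (q (GY 0%nat)) - K (p (GY 0%nat))) / h - K' (p (GY 0%nat))) * h) by (field; auto).
        rewrite Rabs_mult. apply Rmult_le_compat_r; [apply Rabs_pos|lra].
    + apply Rmult_le_compat_l; [lra|].
      apply (sumL_term (LG n) (fun a => Rabs (q a - p a))); auto. intros; apply Rabs_pos.
Qed.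

Section Steps.
Variables (n M : nat) (C lam Lam B CK : R) (K K' : R -> R).
Variables (F : nat -> (gidx -> R) -> R) (DF : nat -> gidx -> (gidx -> R) -> R).
Hypothesis HS : ksteps n M C lam Lam B CK K K' F DF.
Notation act := (act n M F).
Notation dact := (dact n M F DF).
Notation L := (LC n M).

Lemma ks_C1 j : (j <= M)%nat -> C1f (LG n) (F j) (DF j).
Proof.
  intros hj. destruct (Nat.eq_dec j M) as [->|ne].
  - rewrite (ks_F _ _ _ _ _ _ _ _ _ _ _ HS), (ks_DF _ _ _ _ _ _ _ _ _ _ _ HS).
    apply kF_C1f; apply HS.
  - apply (sb_C1 n C lam Lam B). apply HS. lia.
Qed.

Lemma F_nonneg j w : (j <= M)%nat -> 0 <= F j w.
Proof.
  intros hj. destruct (Nat.eq_dec j M) as [->|ne].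
  - rewrite (ks_F _ _ _ _ _ _ _ _ _ _ _ HS). apply HS.
  - apply (sb_F n C lam Lam B (F j) (DF j)). apply HS. lia.
Qed.

Lemma F_tick j w k : (j <= M)%nat -> F j (tick w k) = F j w.
Proof.
  intros hj. destruct (Nat.eq_dec j M) as [->|ne].
  - now rewrite (ks_F _ _ _ _ _ _ _ _ _ _ _ HS).
  - apply (sb_per n C lam Lam B _ (DF j)). apply HS. lia.
Qed.

Lemma DF_tick j w k g : (j <= M)%nat -> In g (LG n) -> DF j g (tick w k) = DF j g w.
Proof.
  intros hj hg. destruct (Nat.eq_dec j M) as [->|ne].
  - rewrite (ks_DF _ _ _ _ _ _ _ _ _ _ _ HS). now destruct g as [|[]|].
  - apply (sb_Dper n C lam Lam B (F j)); auto. apply HS. lia.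
Qed.

Lemma zz_shift u k j : (j <= S M)%nat -> zz n M F (shift u k) j = zz n M F u j + IZR k.
Proof.
  induction j as [|j IH]; intros hj; [reflexivity|]. cbn [zz].
  rewrite IH by lia.
  replace (arg (shift u k) j (zz n M F u j + IZR k)) with (tick (arg u j (zz n M F u j)) k)
    by (apply functional_extensionality; intros []; reflexivity).
  rewrite F_tick by lia. unfold aa. simpl. ring.
Qed.

Lemma act_shift u k : act (shift u k) = act u.
Proof. unfold Submission.act. rewrite zz_shift by lia. simpl. ring. Qed.

Lemma dz_shift u k W j : (j <= S M)%nat -> dz n M F DF (shift u k) W j = dz n M F DF u W j.
Proof.
  induction j as [|j IH]; intros hj; [reflexivity|]. cbn [dz].
  assert (E : forall g, In g (LG n) -> DFa n M F DF (shift u k) j g = DFa n M F DF u j g).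
  { intros g hg. unfold DFa. rewrite zz_shift by lia.
    replace (arg (shift u k) j (zz n M F u j + IZR k)) with (tick (arg u j (zz n M F u j)) k)
      by (apply functional_extensionality; intros []; reflexivity).
    apply DF_tick; auto; lia. }
  rewrite IH by lia. rewrite E by (now apply in_LG). f_equal. apply sumL_ext. intros i hi.
  apply in_seq in hi. rewrite !E by (apply in_LG; lia). reflexivity.
Qed.

Lemma dact_shift u k W : dact (shift u k) W = dact u W.
Proof. unfold Submission.dact. now rewrite dz_shift by lia. Qed.

(** The gradient of the quadratic part in [act_formula] with the entries at the first [x] and the
    last [Y] removed; it vanishes exactly when all [x] agree and all [Y] agree. *)
Definition W0 (u : cidx -> R) (c : cidx) : R :=
  match c with
  | CZ | CX 0 _ => 0
  | CX (S j) i => u (CY j i) - u (CY (S j) i)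
  | CY j i => if Nat.eq_dec j M then 0 else aa M u j i
  end.

Definition n1 (u : cidx -> R) : R := sumL L (fun c => Rabs (W0 u c)).
Definition V (u : cidx -> R) : R := sumL L (fun c => W0 u c * W0 u c).
(** [n1] controls the jumps and [rr] the position; together they are proper modulo integer shifts of
    [z]. *)
Definition rr (u : cidx -> R) : R :=
  sumL (seq 0 n) (fun i => Rabs (u (CX 0 i)) + Rabs (u (CY M i))).
Notation m0 := (INR (length L)).

Lemma m0_pos : 1 <= m0.
Proof. change 1 with (INR 1). apply le_INR. unfold LC. simpl. lia. Qed.

Lemma n1_pos u : 0 <= n1 u.
Proof. apply sumL_nonneg. intros; apply Rabs_pos. Qed.
Lemma V_pos u : 0 <= V u.
Proof. apply sumL_nonneg. intros; nra. Qed.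
Lemma n1_V u : n1 u * n1 u <= m0 * V u.
Proof. apply sumL_square. Qed.
Lemma W0_le u c : In c L -> Rabs (W0 u c) <= n1 u.
Proof. intros h. apply (sumL_term L (fun c => Rabs (W0 u c))); auto. intros; apply Rabs_pos. Qed.

Lemma aa_le u j i : (j < M)%nat -> (i < n)%nat -> Rabs (aa M u j i) <= n1 u.
Proof.
  intros hj hi. pose proof (W0_le u (CY j i)) as H. simpl in H.
  destruct (Nat.eq_dec j M); [lia|]. apply H. apply in_LC. lia.
Qed.
Lemma dd_le u j i : (j < M)%nat -> (i < n)%nat -> Rabs (u (CY j i) - u (CY (S j) i)) <= n1 u.
Proof. intros hj hi. apply (W0_le u (CX (S j) i)). apply in_LC. lia. Qed.

Lemma x_drift u j i : (j <= M)%nat -> (i < n)%nat ->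
  Rabs (u (CX j i) - u (CX 0 i)) <= INR M * n1 u.
Proof.
  intros hj hi. pose proof (n1_pos u). apply Rle_trans with (INR j * n1 u).
  2:{ apply Rmult_le_compat_r; auto. now apply le_INR. }
  induction j as [|j IH].
  - rewrite Rminus_diag, Rabs_R0. simpl. lra.
  - replace (u (CX (S j) i) - u (CX 0 i)) with (aa M u j i + (u (CX j i) - u (CX 0 i))).
    2:{ unfold aa, nx. destruct (Nat.eq_dec j M); [lia|ring]. }
    eapply Rle_trans; [apply Rabs_triang|]. pose proof (aa_le u j i ltac:(lia) hi).
    specialize (IH ltac:(lia)). rewrite S_INR. lra.
Qed.

Lemma y_drift u j i : (j <= M)%nat -> (i < n)%nat ->
  Rabs (u (CY j i) - u (CY M i)) <= INR M * n1 u.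
Proof.
  intros hj hi. pose proof (n1_pos u).
  assert (H' : forall d, (d <= M)%nat -> Rabs (u (CY (M - d) i) - u (CY M i)) <= INR d * n1 u).
  { induction d as [|d IH]; intros hd.
    - rewrite Nat.sub_0_r, Rminus_diag, Rabs_R0. simpl. lra.
    - replace (u (CY (M - S d) i) - u (CY M i)) with
        ((u (CY (M - S d) i) - u (CY (S (M - S d)) i)) + (u (CY (M - d) i) - u (CY M i)))
        by (replace (S (M - S d)) with (M - d)%nat by lia; ring).
      eapply Rle_trans; [apply Rabs_triang|]. pose proof (dd_le u (M - S d) i ltac:(lia) hi).
      specialize (IH ltac:(lia)). rewrite S_INR. lra. }
  replace j with (M - (M - j))%nat by lia. eapply Rle_trans; [apply H'; lia|].
  apply Rmult_le_compat_r; auto. apply le_INR. lia.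
Qed.

Lemma cont_W0 c u : In c L -> cont_at L (fun u => W0 u c) u.
Proof.
  intros hc. apply in_LC in hc. destruct c as [[|j] i|j i|]; simpl; try apply cont_const.
  - apply cont_minus; apply (cont_coord L); apply in_LC; lia.
  - destruct (Nat.eq_dec j M); [apply cont_const|]. apply cont_aa; lia.
Qed.

Lemma cont_n1 u : cont_at L n1 u.
Proof. apply cont_sumL. intros c hc. apply cont_Rabs. now apply cont_W0. Qed.

Lemma cont_rr u : cont_at L rr u.
Proof.
  apply cont_sumL. intros i hi. apply in_seq in hi.
  apply cont_plus; apply cont_Rabs; apply (cont_coord L); apply in_LC; lia.
Qed.

Lemma W0_shift u k : W0 (shift u k) = W0 u.
Proof. apply functional_extensionality. intros [[] |j i|]; reflexivity. Qed.
Lemma n1_shift u k : n1 (shift u k) = n1 u.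
Proof. unfold n1. now rewrite W0_shift. Qed.
Lemma rr_shift u k : rr (shift u k) = rr u.
Proof. reflexivity. Qed.

Lemma moved_close u t c : 0 <= t -> In c L ->
  Rabs ((u c - t * W0 u c) - u c) <= t * n1 u.
Proof.
  intros t0 hc. replace (u c - t * W0 u c - u c) with (- (t * W0 u c)) by ring.
  rewrite Rabs_Ropp, Rabs_mult, (Rabs_right t) by lra.
  apply Rmult_le_compat_l; auto. now apply W0_le.
Qed.

(** The drift along the trajectory is at most [M * n1 u] in each of the [2n] coordinates, and
    passing from [u] to [q] adds at most 1. *)
Lemma far_supp q u j : (j < M)%nat -> (forall c, In c L -> Rabs (q c - u c) <= 1) ->
  B + 2 * INR n * (INR M * n1 u + 1) < rr u -> B < wnorm n (arg q j (zz n M F q j)).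
Proof.
  intros hj hq hr. unfold wnorm, arg.
  enough (rr u - sumL (seq 0 n) (fun i => Rabs (q (CX j i)) + Rabs (q (CY j i))) <=
    2 * INR n * (INR M * n1 u + 1)) by lra.
  unfold rr. rewrite <- sumL_minus.
  replace (2 * INR n * (INR M * n1 u + 1)) with
    (INR (length (seq 0 n)) * (2 * (INR M * n1 u + 1))) by (rewrite length_seq; ring).
  apply sumL_bound. intros i hi. apply in_seq in hi.
  assert (tri : forall a b c : R, Rabs a <= Rabs b + Rabs (c - a) + Rabs (b - c)).
  { intros a b c. replace a with (b + (- (c - a) + - (b - c))) at 1 by ring.
    eapply Rle_trans; [apply Rabs_triang|]. rewrite Rplus_assoc. apply Rplus_le_compat_l.
    eapply Rle_trans; [apply Rabs_triang|]. rewrite !Rabs_Ropp. lra. }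
  pose proof (tri (u (CX 0 i)) (q (CX j i)) (u (CX j i))).
  pose proof (tri (u (CY M i)) (q (CY j i)) (u (CY j i))).
  pose proof (x_drift u j i ltac:(lia) ltac:(lia)). pose proof (y_drift u j i ltac:(lia) ltac:(lia)).
  pose proof (hq (CX j i) ltac:(apply in_LC; lia)). pose proof (hq (CY j i) ltac:(apply in_LC; lia)).
  lra.
Qed.

Lemma last_DFa q g : DFa n M F DF q M g = match g with GY 0 => K' (q (CY M 0)) | _ => 0 end.
Proof. unfold DFa. rewrite (ks_DF _ _ _ _ _ _ _ _ _ _ _ HS). now destruct g as [|[]|]. Qed.

Definition pw : R := lam ^ S M.
Lemma pw_pos : 0 < pw <= 1.
Proof.
  unfold pw. destruct (ks_lam _ _ _ _ _ _ _ _ _ _ _ HS) as [l0 l1].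
  generalize (S M). induction n0; simpl; [lra|]. nra.
Qed.

Lemma moved_jumps u t : 0 <= t -> let q := fun c => u c - t * W0 u c in
  (forall j i, (j < M)%nat -> (i < n)%nat ->
     Rabs (q (CY j i) - q (CY (S j) i) - W0 u (CX (S j) i)) <= 2 * (t * n1 u)) /\
  (forall j i, (j < M)%nat -> (i < n)%nat -> Rabs (aa M q j i - W0 u (CY j i)) <= 2 * (t * n1 u)).
Proof.
  intros t0 q.
  assert (tri : forall c c', In c L -> In c' L -> Rabs ((q c - u c) - (q c' - u c')) <= 2 * (t * n1 u)).
  { intros c c' hc hc'. pose proof (moved_close u t c t0 hc). pose proof (moved_close u t c' t0 hc').
    unfold Rminus at 1. eapply Rle_trans; [apply Rabs_triang|]. rewrite Rabs_Ropp. unfold q. lra. }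
  split; intros j i hj hi.
  - simpl. replace (q (CY j i) - q (CY (S j) i) - (u (CY j i) - u (CY (S j) i))) with
      ((q (CY j i) - u (CY j i)) - (q (CY (S j) i) - u (CY (S j) i))) by ring.
    apply tri; apply in_LC; lia.
  - cbn [W0]. destruct (Nat.eq_dec j M); [lia|]. unfold aa.
    replace (q (CX (nx M j) i) - q (CX j i) - (u (CX (nx M j) i) - u (CX j i))) with
      ((q (CX (nx M j) i) - u (CX (nx M j) i)) - (q (CX j i) - u (CX j i))) by ring.
    apply tri; apply in_LC; split; auto; try lia. apply nx_le; lia.
Qed.

(** Two regimes. For large jumps the square of [W0] beats the bounded contribution of the steps. Far
    out compared with the jumps, all steps but the last vanish and [dact_lower] applies with [C = 0]
    and both factors equal to 1. *)
Lemma descent_W0 : exists s0 R0, 0 < s0 <= 1 /\ 1 <= R0 /\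
  forall u t, 0 <= t -> t * (1 + n1 u) <= s0 ->
    R0 <= n1 u \/ B + 2 * INR n * (INR M * n1 u + 1) < rr u ->
    pw / 4 * V u <= dact (fun c => u c - t * W0 u c) (W0 u).
Proof.
  destruct HS as [Hn HM HC [Hl0 Hl1] HL HB Hst HFM HDM HK _ _].
  destruct pw_pos as [p0 p1]. pose proof m0_pos as m1.
  assert (nn : 0 <= INR n) by apply pos_INR.
  assert (gn : forall La j, 0 <= La -> 0 <= gam La j) by (intros La j h; induction j; simpl; nra).
  set (g := gam Lam (S M)). set (g1 := gam 1 (S M)).
  assert (g0 : 0 <= g) by (apply gn; lra). assert (g10 : 0 <= g1) by (apply gn; lra).
  set (a := g * INR n * m0). set (a1 := g1 * INR n * m0).
  assert (a0 : 0 <= a) by (unfold a; apply Rmult_le_pos; [nra|lra]).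
  assert (a10 : 0 <= a1) by (unfold a1; apply Rmult_le_pos; [nra|lra]).
  (* Along the segment the jumps change by at most [2 * s0], and also by a small multiple of [n1];
     the two entries keep the resulting quadratic error below a fixed fraction of [V] in the first
     and second regime. *)
  set (s0 := Rmin (pw / (64 * (a + 1))) (1 / (16 * (a1 + 1)))).
  assert (s0a : s0 * (64 * (a + 1)) <= pw).
  { apply Rle_trans with (pw / (64 * (a + 1)) * (64 * (a + 1))).
    - apply Rmult_le_compat_r; [lra|apply Rmin_l].
    - right. field. lra. }
  assert (s0b : s0 * (16 * (a1 + 1)) <= 1).
  { apply Rle_trans with (1 / (16 * (a1 + 1)) * (16 * (a1 + 1))).
    - apply Rmult_le_compat_r; [lra|apply Rmin_r].
    - right. field. lra. }
  assert (s00 : 0 < s0).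
  { unfold s0. apply Rmin_pos; apply Rdiv_lt_0_compat; lra. }
  assert (s01 : s0 <= 1) by nra.
  (* Then [m0 * V >= n1^2 >= R0], which absorbs the constant error [2 g n C^2] in [pw/8 * V]. *)
  set (R0 := 1 + 16 * a * (C * C) / pw).
  assert (R01 : 1 <= R0).
  { unfold R0. assert (0 <= 16 * a * (C * C) / pw); [|lra].
    apply Rmult_le_pos; [|left; now apply Rinv_0_lt_compat]. apply Rmult_le_pos; nra. }
  assert (R0b : 16 * a * (C * C) <= pw * R0).
  { unfold R0. rewrite Rmult_plus_distr_l. unfold Rdiv.
    replace (pw * (16 * a * (C * C) * / pw)) with (16 * a * (C * C)) by (field; lra). lra. }
  exists s0, R0. split; [lra|]. split; auto. intros u t t0 ht zone.
  pose proof (n1_pos u) as N0. pose proof (V_pos u) as V0. pose proof (n1_V u) as NV.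
  destruct (moved_jumps u t t0) as [J1 J2].
  set (q := fun c => u c - t * W0 u c) in *.
  assert (w1 : W0 u CZ = 0) by reflexivity.
  assert (w2 : forall i, W0 u (CX 0 i) = 0) by reflexivity.
  assert (w3 : forall i, W0 u (CY M i) = 0) by (intros; simpl; destruct (Nat.eq_dec M M); congruence).
  assert (tn : t * n1 u <= s0) by nra.
  assert (ts : t <= s0) by nra.
  set (k := 2 * (t * n1 u)) in *.
  assert (k0 : 0 <= k) by (unfold k; nra).
  assert (kk : k * k <= 4 * s0 * (m0 * V u)).
  { unfold k. replace (2 * (t * n1 u) * (2 * (t * n1 u))) with (4 * (t * t) * (n1 u * n1 u)) by ring.
    apply Rmult_le_compat; nra. }
  destruct zone as [zone|zone].
  - assert (H := dact_lower n M F DF q (W0 u) C k lam Lam w1 w2 w3 HC k0 (conj Hl0 Hl1) HL).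
    eapply Rle_trans; [|apply H; auto].
    + fold (V u). fold pw. fold g.
      assert (e1 : (C + k) * (C + k) <= 2 * (C * C) + 2 * (k * k)) by (pose proof (Rle_0_sqr (C - k)); unfold Rsqr in *; lra).
      assert (e2 : g * (INR n * ((C + k) * (C + k))) <= g * (INR n * (2 * (C * C) + 8 * s0 * (m0 * V u)))).
      { apply Rmult_le_compat_l; auto. apply Rmult_le_compat_l; auto. lra. }
      replace (g * (INR n * (2 * (C * C) + 8 * s0 * (m0 * V u)))) with
        (2 * (g * INR n * (C * C)) + 8 * s0 * a * V u) in e2 by (unfold a; ring).
      assert (e3 : 8 * s0 * a * V u <= pw / 8 * V u) by (apply Rmult_le_compat_r; auto; nra).
      assert (e4 : 2 * (g * INR n * (C * C)) <= pw / 8 * V u).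
      { assert (R0 <= m0 * V u) by nra.
        apply Rmult_le_reg_r with m0; [lra|].
        replace (2 * (g * INR n * (C * C)) * m0) with (2 * a * (C * C)) by (unfold a; ring).
        replace (pw / 8 * V u * m0) with (pw / 8 * (m0 * V u)) by ring.
        apply Rle_trans with (pw / 8 * R0); [lra|]. apply Rmult_le_compat_l; lra. }
      lra.
    + intros j hj. destruct (Nat.eq_dec j M) as [->|ne].
      * rewrite last_DFa. lra.
      * apply (sb_rho n C lam Lam B (F j)). apply Hst. lia.
    + intros j i hj hi. destruct (Nat.eq_dec j M) as [->|ne].
      * unfold eta. rewrite !last_DFa.
        replace (q (CY M i) - (q (CY M i) - 0) / (1 + 0)) with 0 by field. rewrite Rabs_R0; auto.
      * apply (sb_eta n C lam Lam B (F j) (DF j) (Hst j ltac:(lia)) (arg q j (zz n M F q j)) i hi).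
    + intros j i hj hi. apply (sb_Y n C lam Lam B (F j) (DF j) (Hst j hj)); auto.
  - assert (supp : forall j g, (j < M)%nat -> In g (LG n) -> DFa n M F DF q j g = 0).
    { intros j h hj hh. apply (sb_Dsupp n C lam Lam B (F j) (DF j) (Hst j hj)); auto.
      apply (far_supp q u); auto. intros c hc. eapply Rle_trans; [now apply moved_close|lra]. }
    assert (H := dact_lower n M F DF q (W0 u) 0 k 1 1 w1 w2 w3 (Rle_refl 0) k0 ltac:(lra) (Rle_refl 1)).
    eapply Rle_trans; [|apply H; auto].
    + fold (V u). fold g1. rewrite pow1, Rplus_0_l.
      assert (e2 : g1 * (INR n * (k * k)) <= g1 * (INR n * (4 * s0 * (m0 * V u)))).
      { apply Rmult_le_compat_l; auto. apply Rmult_le_compat_l; auto. }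
      replace (g1 * (INR n * (4 * s0 * (m0 * V u)))) with (4 * s0 * a1 * V u) in e2 by (unfold a1; ring).
      assert (e3 : 4 * s0 * a1 * V u <= 1 / 4 * V u) by (apply Rmult_le_compat_r; auto; nra).
      assert (pw / 4 * V u <= 1 / 4 * V u) by (apply Rmult_le_compat_r; lra).
      lra.
    + intros j hj. destruct (Nat.eq_dec j M) as [->|ne].
      * rewrite last_DFa. lra.
      * rewrite supp; [lra|lia|]. now apply in_LG.
    + intros j i hj hi. unfold eta. destruct (Nat.eq_dec j M) as [->|ne].
      * rewrite !last_DFa. replace (q (CY M i) - (q (CY M i) - 0) / (1 + 0)) with 0 by field.
        rewrite Rabs_R0; lra.
      * rewrite !supp; try lia; try (now apply in_LG).
        replace (q (CY j i) - (q (CY j i) - 0) / (1 + 0)) with 0 by field. rewrite Rabs_R0; lra.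
    + intros j i hj hi. rewrite supp; auto; [rewrite Rabs_R0; lra|now apply in_LG].
Qed.

(** Covers the place where descent along [W0] is not uniform: far out with small jumps the action is
    nearly at most [CK]. *)
Lemma act_far u : B + 2 * INR n * (INR M * n1 u + 1) < rr u ->
  act u <= CK + INR M * INR n * INR M * (n1 u * n1 u).
Proof.
  intros h. rewrite act_formula.
  assert (E : sumL (seq 0 (S M)) (fun j => F j (arg u j (zz n M F u j))) <= CK).
  { rewrite seq_S, sumL_app, sumL_zero.
    - cbn [sumL Nat.add]. rewrite (ks_F _ _ _ _ _ _ _ _ _ _ _ HS).
      destruct (ks_K _ _ _ _ _ _ _ _ _ _ _ HS (arg u M (zz n M F u M) (GY 0))). unfold kF. lra.
    - intros j hj. apply in_seq in hj.
      apply (sb_supp n C lam Lam B (F j) (DF j)); [apply HS; lia|]. apply (far_supp u u); auto; try lia.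
      intros c _. rewrite Rminus_diag, Rabs_R0. lra. }
  assert (Q : sumL (seq 0 M) (fun j => sumL (seq 0 n) (fun i => aa M u j i * (u (CY j i) - u (CY M i)))) <=
    INR (length (seq 0 M)) * (INR (length (seq 0 n)) * (n1 u * (INR M * n1 u)))).
  { apply sumL_bound. intros j hj. apply in_seq in hj. apply sumL_bound. intros i hi. apply in_seq in hi.
    eapply Rle_trans; [apply RRle_abs|]. rewrite Rabs_mult.
    apply Rmult_le_compat; try apply Rabs_pos; [apply aa_le|apply y_drift]; lia. }
  rewrite !length_seq in Q. lra.
Qed.

Lemma descent_outside : exists (sigma : (cidx -> R) -> cidx -> R) (R0 R2 : R),
  0 <= R0 /\ 0 <= R2 /\
  (forall c, In c L -> contL L (fun u => sigma u c)) /\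
  (forall u c, In c L -> Rabs (sigma u c - u c) <= 1) /\
  (forall u, act (sigma u) <= act u) /\
  forall nu, 0 < nu -> exists mu, 0 < mu /\ forall u, R0 + 1 <= n1 u \/ R2 + 1 <= rr u ->
    act u <= CK + nu \/ act (sigma u) <= act u - mu.
Proof.
  destruct descent_W0 as [s0 [R0 [[s00 s01] [R01 H]]]].
  set (R2 := B + 2 * INR n * (INR M * R0 + 1)).
  assert (nn : 0 <= INR n) by apply pos_INR. assert (MM : 0 <= INR M) by apply pos_INR.
  assert (Bn : 0 <= B) by apply HS.
  assert (R20 : 0 <= R2).
  { unfold R2. assert (0 <= INR M * R0) by nra. nra. }
  (* The cutoff confines the motion to the region of descent, and division by [1 + n1] bounds the
     displacement by [s0], since the entries of [W0] are at most [n1]. *)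
  set (theta := fun u => clip (Rmax (n1 u - R0) (rr u - R2))).
  set (s := fun u => s0 * theta u / (1 + n1 u)).
  assert (n1p := n1_pos). destruct pw_pos as [p0 p1]. pose proof m0_pos as m1.
  assert (s_pos : forall u, 0 <= s u).
  { intros u. unfold s. specialize (n1p u). destruct (clip_01 (Rmax (n1 u - R0) (rr u - R2))).
    fold (theta u) in *. apply Rmult_le_pos; [nra|]. left. apply Rinv_0_lt_compat. lra. }
  assert (s_le : forall u, s u * (1 + n1 u) <= s0).
  { intros u. unfold s. specialize (n1p u). destruct (clip_01 (Rmax (n1 u - R0) (rr u - R2))).
    fold (theta u) in *. replace (s0 * theta u / (1 + n1 u) * (1 + n1 u)) with (s0 * theta u) by (field; lra).
    nra. }
  assert (zone : forall u, s u = 0 \/ (R0 <= n1 u \/ B + 2 * INR n * (INR M * n1 u + 1) < rr u)).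
  { intros u. destruct (Rle_dec R0 (n1 u)) as [a|a]; [auto|].
    destruct (Rlt_dec R2 (rr u)) as [b|b].
    - right; right. eapply Rle_lt_trans; [|exact b]. unfold R2. apply Rplus_le_compat_l.
      apply Rmult_le_compat_l; [lra|]. apply Rplus_le_compat_r. apply Rmult_le_compat_l; lra.
    - left. unfold s, theta. rewrite clip_0; [unfold Rdiv; ring|]. apply Rmax_lub; lra. }
  set (sigma := fun u c => u c - s u * W0 u c).
  assert (desc : forall u, act (sigma u) <= act u - s u * (pw / 4 * V u)).
  { intros u. destruct (zone u) as [z|z].
    - unfold sigma. rewrite z.
      replace (fun c => u c - 0 * W0 u c) with u by (apply functional_extensionality; intros; ring). lra.
    - apply (act_descent n M F DF ks_C1); auto. intros t ht. apply H; auto; [lra|].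
      eapply Rle_trans; [|apply (s_le u)]. apply Rmult_le_compat_r; [specialize (n1p u)|]; lra. }
  exists sigma, R0, R2. split; [lra|]. split; auto. repeat split.
  - intros c hc u. unfold sigma. apply cont_minus; [now apply (cont_coord L)|].
    apply cont_mult; [|now apply cont_W0]. unfold s. apply cont_div.
    + specialize (n1p u). lra.
    + apply cont_mult; [apply cont_const|]. apply cont_clip. apply cont_Rmax.
      * apply cont_minus; [apply cont_n1|apply cont_const].
      * apply cont_minus; [apply cont_rr|apply cont_const].
    + apply cont_plus; [apply cont_const|apply cont_n1].
  - intros u c hc. eapply Rle_trans; [now apply moved_close|].
    specialize (s_le u). specialize (s_pos u). specialize (n1p u). nra.
  - intros u. eapply Rle_trans; [apply desc|]. specialize (s_pos u). pose proof (V_pos u).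
    assert (0 <= s u * (pw / 4 * V u)) by (apply Rmult_le_pos; nra). lra.
  - intros nu nu0. set (c2 := INR M * INR n * INR M + 1).
    assert (c20 : 1 <= c2) by (unfold c2; assert (0 <= INR M * INR n * INR M); [|lra]; apply Rmult_le_pos; nra).
    (* [e1] bounds [V / (1 + n1)] from below for large jumps; [e2] does so for small ones, unless
       [act_far] already puts the action below [CK + nu]. *)
    set (e1 := 1 / (2 * m0)). set (e2 := nu / ((1 + R0) * (c2 * m0))).
    assert (e10 : 0 < e1) by (apply Rdiv_lt_0_compat; lra).
    assert (e20 : 0 < e2) by (apply Rdiv_lt_0_compat; [lra|]; apply Rmult_lt_0_compat; nra).
    exists (s0 * (pw / 4) * Rmin e1 e2). split.
    { apply Rmult_lt_0_compat; [nra|]. now apply Rmin_pos. }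
    intros u hu.
    assert (th : theta u = 1).
    { apply clip_1. destruct hu; [apply Rle_trans with (n1 u - R0); [lra|apply Rmax_l]|
        apply Rle_trans with (rr u - R2); [lra|apply Rmax_r]]. }
    assert (key : act u <= CK + nu \/ Rmin e1 e2 * (1 + n1 u) <= V u).
    { specialize (n1p u). pose proof (n1_V u) as NV. pose proof (V_pos u).
      destruct (Rle_dec R0 (n1 u)) as [a|a].
      - right. apply Rle_trans with (e1 * (1 + n1 u)); [apply Rmult_le_compat_r; [lra|apply Rmin_l]|].
        apply Rmult_le_reg_l with m0; [lra|]. unfold e1.
        replace (m0 * (1 / (2 * m0) * (1 + n1 u))) with ((1 + n1 u) / 2) by (field; lra). nra.
      - assert (far : B + 2 * INR n * (INR M * n1 u + 1) < rr u).
        { destruct (zone u) as [z|[z|z]]; auto; [|lra]. exfalso. unfold s in z. rewrite th in z.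
          assert (0 < s0 * 1 / (1 + n1 u)) by (apply Rdiv_lt_0_compat; lra). lra. }
        pose proof (act_far u far) as AF.
        destruct (Rle_dec (c2 * (n1 u * n1 u)) nu) as [b|b].
        + left. unfold c2 in b. nra.
        + right. apply Rle_trans with (e2 * (1 + n1 u)); [apply Rmult_le_compat_r; [lra|apply Rmin_r]|].
          apply Rle_trans with (e2 * (1 + R0)); [apply Rmult_le_compat_l; lra|].
          unfold e2. replace (nu / ((1 + R0) * (c2 * m0)) * (1 + R0)) with (nu / (c2 * m0))
            by (field; repeat split; lra).
          apply Rmult_le_reg_l with (c2 * m0); [nra|].
          replace (c2 * m0 * (nu / (c2 * m0))) with nu by (field; split; lra).
          assert (c2 * (n1 u * n1 u) <= c2 * (m0 * V u)) by (apply Rmult_le_compat_l; lra). lra. }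
    destruct key as [key|key]; [now left|right].
    eapply Rle_trans; [apply desc|]. unfold Rminus. apply Rplus_le_compat_l, Ropp_le_contravar.
    unfold s. rewrite th. specialize (n1p u).
    replace (s0 * 1 / (1 + n1 u) * (pw / 4 * V u)) with (s0 * (pw / 4) * (V u / (1 + n1 u))) by (field; lra).
    apply Rmult_le_compat_l; [nra|].
    apply Rmult_le_reg_r with (1 + n1 u); [lra|]. unfold Rdiv. rewrite Rmult_assoc, Rinv_l; lra.
Qed.
End Steps.

(** * The minimax level *)

(** Coordinates of the linear family: first [x], last [Y], [z], and a jump for each step but the
    last. *)
Inductive pidx := PX (i : nat) | PY (i : nat) | PZ | PA (j i : nat).
Definition pidx_dec (a b : pidx) : {a = b} + {a <> b}.
Proof. decide equality; apply Nat.eq_dec. Defined.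

Definition LP (n M : nat) : list pidx :=
  PZ :: map PX (seq 0 n) ++ map PY (seq 0 n) ++
  map (fun p => PA (fst p) (snd p)) (list_prod (seq 0 M) (seq 0 n)).

Lemma in_LP n M a : In a (LP n M) <->
  match a with PX i | PY i => (i < n)%nat | PZ => True | PA j i => (j < M)%nat /\ (i < n)%nat end.
Proof.
  unfold LP. cbn [In]. rewrite !in_app_iff, !in_map_iff. split.
  - intros [<-|[[x [<- h]]|[[x [<- h]]|[[x y] [<- h]]]]]; auto.
    + apply in_seq in h; lia.
    + apply in_seq in h; lia.
    + apply in_prod_iff in h; rewrite !in_seq in h; simpl; lia.
  - destruct a; intros h; auto; right.
    + left. exists i. split; auto. apply in_seq; lia.
    + right; left. exists i. split; auto. apply in_seq; lia.
    + right; right. exists (j, i). split; auto. apply in_prod_iff; rewrite !in_seq; lia.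
Qed.

Lemma NoDup_LP n M : NoDup (LP n M).
Proof.
  unfold LP. constructor.
  - rewrite !in_app_iff, !in_map_iff. intros [[x [E _]]|[[x [E _]]|[x [E _]]]]; discriminate.
  - apply NoDup_app; [|apply NoDup_app|].
    + apply FinFun.Injective_map_NoDup; [|apply seq_NoDup]. intros x y E. now inversion E.
    + apply FinFun.Injective_map_NoDup; [|apply seq_NoDup]. intros x y E. now inversion E.
    + apply FinFun.Injective_map_NoDup; [|apply NoDup_list_prod; apply seq_NoDup].
      intros [x y] [x' y'] E. now inversion E.
    + intros c h1 h2. apply in_map_iff in h1, h2.
      destruct h1 as [? [<- _]], h2 as [? [E _]]; discriminate.
    + intros c h1 h2. rewrite in_app_iff, !in_map_iff in h2. apply in_map_iff in h1.
      destruct h1 as [? [<- _]], h2 as [[? [E _]]|[? [E _]]]; discriminate.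
Qed.

Section Linking.
Variables (n M : nat).
Notation L := (LC n M).
Notation P := (LP n M).

(* The linear space on which the quadratic part of the action is nonpositive ... *)
Definition iota (p : pidx -> R) (c : cidx) : R :=
  match c with
  | CZ => p PZ
  | CX j i => p (PX i) + sumL (seq 0 j) (fun k => p (PA k i))
  | CY j i => p (PY i) - (if Nat.eq_dec j M then 0 else p (PA j i))
  end.

(* ... and the linear projection onto it whose fibres carry a nonnegative quadratic part. *)
Definition proj (u : cidx -> R) (a : pidx) : R :=
  match a with
  | PZ => u CZ
  | PX i => u (CX 0 i)
  | PY i => u (CY M i)
  | PA j i => (aa M u j i - (u (CY j i) - u (CY M i))) / 2
  end.

Lemma aa_iota p j i : (j < M)%nat -> aa M (iota p) j i = p (PA j i).
Proof.
  intros hj. unfold aa, nx. destruct (Nat.eq_dec j M); [lia|]. unfold iota.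
  rewrite seq_S, sumL_app. cbn [sumL Nat.add]. ring.
Qed.

Lemma proj_iota p a : In a P -> proj (iota p) a = p a.
Proof.
  intros h. apply in_LP in h. destruct a; simpl; try ring.
  - destruct (Nat.eq_dec M M); [ring|congruence].
  - rewrite aa_iota by lia. destruct (Nat.eq_dec j M); [lia|].
    destruct (Nat.eq_dec M M); [field|congruence].
Qed.

(** Bounded distance from [iota] replaces a boundary condition: it survives the deformations below
    and forces a family to meet every fibre of [proj]. *)
Definition admissible (h : (pidx -> R) -> cidx -> R) : Prop :=
  (forall c, In c L -> contL P (fun p => h p c)) /\
  exists D, forall p c, In c L -> Rabs (h p c - iota p c) <= D.

Lemma admissible_iota : admissible iota.
Proof.
  split.
  - intros c hc p. apply in_LC in hc. destruct c; simpl.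
    + apply cont_plus; [apply (cont_coord P); apply in_LP; lia|]. apply cont_sumL. intros k hk.
      apply in_seq in hk. apply (cont_coord P), in_LP. lia.
    + apply cont_minus; [apply (cont_coord P); apply in_LP; lia|].
      destruct (Nat.eq_dec j M); [apply cont_const|]. apply (cont_coord P), in_LP. lia.
    + apply (cont_coord P). now apply in_LP.
  - exists 0. intros. rewrite Rminus_diag, Rabs_R0. lra.
Qed.

Lemma admissible_comp h sigma D : admissible h ->
  (forall c, In c L -> contL L (fun u => sigma u c)) ->
  (forall u c, In c L -> Rabs (sigma u c - u c) <= D) ->
  admissible (fun p => sigma (h p)).
Proof.
  intros [ch [D' Hh]] cs Hs. split.
  - intros c hc p. apply (cont_comp P L (fun u => sigma u c) h); [now apply cs|].
    intros b hb. now apply ch.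
  - exists (D + D'). intros p c hc.
    replace (sigma (h p) c - iota p c) with ((sigma (h p) c - h p c) + (h p c - iota p c)) by ring.
    eapply Rle_trans; [apply Rabs_triang|]. apply Rplus_le_compat; auto.
Qed.

Lemma linking h t : admissible h -> exists p, forall a, In a P -> proj (h p) a = t a.
Proof.
  intros [ch [D Hh]].
  (* An entry of [proj] is a single coordinate or half a combination of four, hence the factor 2. *)
  apply (bounded_displacement_onto pidx_dec P (fun p => proj (h p)) (2 * D)); [apply NoDup_LP| |].
  - intros a ha p.
    assert (co : forall c, In c L -> cont_at P (fun p => h p c) p) by (intros; now apply ch).
    apply in_LP in ha. destruct a; simpl; try (apply co; apply in_LC; lia).
    unfold aa. apply cont_div; [lra| |apply cont_const].
    pose proof (nx_le M j ltac:(lia)).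
    repeat apply cont_minus; apply co; apply in_LC; lia.
  - intros p a ha. rewrite <- (proj_iota p a ha) at 1.
    apply in_LP in ha.
    assert (b : forall c, In c L -> - D <= h p c - iota p c <= D).
    { intros c hc. specialize (Hh p c hc). revert Hh. unfold Rabs. destruct (Rcase_abs _); lra. }
    assert (D0 : 0 <= D) by (specialize (b CZ ltac:(now apply in_LC)); lra).
    apply Rabs_le. destruct a; simpl.
    + pose proof (b (CX 0 i) ltac:(apply in_LC; lia)). simpl in H. lra.
    + pose proof (b (CY M i) ltac:(apply in_LC; lia)). simpl in H. lra.
    + pose proof (b CZ ltac:(now apply in_LC)). simpl in H. lra.
    + pose proof (nx_le M j ltac:(lia)).
      pose proof (b (CX j i) ltac:(apply in_LC; lia)) as b1. pose proof (b (CX (nx M j) i) ltac:(apply in_LC; lia)) as b2.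
      pose proof (b (CY j i) ltac:(apply in_LC; lia)) as b3. pose proof (b (CY M i) ltac:(apply in_LC; lia)) as b4.
      unfold aa. cbn [iota] in b1, b2, b3, b4 |- *. lra.
Qed.

Definition is_value (F : nat -> (gidx -> R) -> R) (b : R) : Prop :=
  exists h, admissible h /\ forall p, act n M F (h p) <= b.

(** The minimax: the infimum over admissible families of the supremum of the action. *)
Definition level (F : nat -> (gidx -> R) -> R) (c : R) : Prop :=
  (forall b, is_value F b -> c <= b) /\ forall eps, 0 < eps -> exists b, is_value F b /\ b < c + eps.

Lemma level_exists F d : (forall b, is_value F b -> d <= b) -> (exists b, is_value F b) ->
  exists c, level F c /\ d <= c.
Proof.
  intros lo [b0 H0].
  destruct (completeness (fun x => is_value F (- x))) as [m [ub lub]].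
  - exists (- d). intros x hx. specialize (lo _ hx). lra.
  - exists (- b0). now rewrite Ropp_involutive.
  - exists (- m). split; [split|].
    + intros b hb. assert (- b <= m); [|lra]. apply ub. now rewrite Ropp_involutive.
    + intros eps e0. apply Classical_Prop.NNPP. intros no.
      assert (m <= m - eps); [|lra]. apply lub. intros x hx.
      destruct (Rlt_dec (- x) (- m + eps)); [|lra]. exfalso. apply no. exists (- x). split; auto.
    + assert (m <= - d); [|lra]. apply lub. intros x hx. specialize (lo _ hx). lra.
Qed.

Lemma level_mono F F' c c' : (forall u, act n M F u <= act n M F' u) ->
  level F c -> level F' c' -> c <= c'.
Proof.
  intros le [l1 _] [_ l2]. apply Rnot_lt_le. intros lt.
  destruct (l2 (c - c')) as [b [[h [ah hb]] bl]]; [lra|].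
  assert (c <= b); [|lra]. apply l1. exists h. split; auto. intros p.
  eapply Rle_trans; [apply le|auto].
Qed.
End Linking.

(** * Finiteness and positivity of the levels *)

Section Bounds.
Variables (n M : nat) (C lam Lam B CK : R) (K K' : R -> R).
Variables (F : nat -> (gidx -> R) -> R) (DF : nat -> gidx -> (gidx -> R) -> R).
Hypothesis HS : ksteps n M C lam Lam B CK K K' F DF.
Notation act := (act n M F).
Notation dact := (dact n M F DF).
Notation L := (LC n M).
Notation m0 := (INR (length L)).

(** On the image of [iota] the quadratic part is minus a sum of squares, so only the bounded
    generating functions count. *)
Lemma value_exists : exists b, is_value n M F b.
Proof.
  exists (INR (S M) * (C + CK)), (iota M). split; [apply admissible_iota|]. intros p.
  rewrite act_formula.
  assert (c0 : 0 <= C) by apply HS.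
  assert (k0 : 0 <= CK) by (destruct (ks_K _ _ _ _ _ _ _ _ _ _ _ HS 0); lra).
  assert (sumL (seq 0 (S M)) (fun j => F j (arg (iota M p) j (zz n M F (iota M p) j))) <=
    INR (length (seq 0 (S M))) * (C + CK)).
  { apply sumL_bound. intros j hj. apply in_seq in hj. destruct (Nat.eq_dec j M) as [->|ne].
    - rewrite (ks_F _ _ _ _ _ _ _ _ _ _ _ HS). unfold kF.
      destruct (ks_K _ _ _ _ _ _ _ _ _ _ _ HS (arg (iota M p) M (zz n M F (iota M p) M) (GY 0))). lra.
    - destruct (sb_F n C lam Lam B (F j) (DF j) (ks_steps _ _ _ _ _ _ _ _ _ _ _ HS j ltac:(lia))
        (arg (iota M p) j (zz n M F (iota M p) j))). lra. }
  rewrite length_seq in H.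
  assert (sumL (seq 0 M) (fun j => sumL (seq 0 n) (fun i =>
    - (aa M (iota M p) j i * (iota M p (CY j i) - iota M p (CY M i))))) >= 0).
  { apply Rle_ge, sumL_nonneg. intros j hj. apply in_seq in hj. apply sumL_nonneg. intros i _.
    rewrite aa_iota by lia. cbn [iota]. destruct (Nat.eq_dec j M); [lia|].
    destruct (Nat.eq_dec M M); [|congruence]. nra. }
  assert (E : sumL (seq 0 M) (fun j => sumL (seq 0 n) (fun i =>
    - (aa M (iota M p) j i * (iota M p (CY j i) - iota M p (CY M i))))) =
    - sumL (seq 0 M) (fun j => sumL (seq 0 n) (fun i =>
      aa M (iota M p) j i * (iota M p (CY j i) - iota M p (CY M i))))).
  { replace (- sumL (seq 0 M) _) with (-1 * sumL (seq 0 M) (fun j => sumL (seq 0 n) (fun i =>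
      aa M (iota M p) j i * (iota M p (CY j i) - iota M p (CY M i))))) by ring.
    rewrite <- sumL_scal. apply sumL_ext. intros j _. rewrite <- sumL_scal. apply sumL_ext. intros; ring. }
  lra.
Qed.

(** Every family meets the fibre over the constant trajectory at [w], on which the quadratic part is
    the sum of the squared jumps. Either some jump is at least [rho], or the family passes near the
    constant trajectory, whose action is positive. *)
Lemma value_lower_bound (w : gidx -> R) j0 : (j0 <= M)%nat -> 0 < F j0 w ->
  exists d, 0 < d /\ forall b, is_value n M F b -> d <= b.
Proof.
  intros hj0 pos.
  set (t := fun a => match a with PX i => w (GX i) | PY i => w (GY i) | PZ => w GZ | PA _ _ => 0 end).
  assert (Fp := F_nonneg _ _ _ _ _ _ _ _ _ _ _ HS).
  assert (fib : forall u, (forall a, In a (LP n M) -> proj M u a = t a) ->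
    forall j i, (j < M)%nat -> (i < n)%nat -> u (CY j i) - u (CY M i) = aa M u j i).
  { intros u hu j i hj hi. specialize (hu (PA j i) ltac:(apply in_LP; lia)). simpl in hu. lra. }
  assert (low : forall u, (forall a, In a (LP n M) -> proj M u a = t a) ->
    sumL (seq 0 M) (fun j => sumL (seq 0 n) (fun i => aa M u j i * aa M u j i)) <= act u).
  { intros u hu. rewrite act_formula.
    assert (0 <= sumL (seq 0 (S M)) (fun j => F j (arg u j (zz n M F u j)))).
    { apply sumL_nonneg. intros j hj. apply in_seq in hj. apply Fp. lia. }
    assert (E : sumL (seq 0 M) (fun j => sumL (seq 0 n) (fun i => aa M u j i * aa M u j i)) =
      sumL (seq 0 M) (fun j => sumL (seq 0 n) (fun i => aa M u j i * (u (CY j i) - u (CY M i))))).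
    { apply sumL_ext. intros j hj. apply in_seq in hj. apply sumL_ext. intros i hi. apply in_seq in hi.
      rewrite (fib u hu) by lia. reflexivity. }
    lra. }
  assert (act0 : 0 < act (iota M t)).
  { rewrite act_formula.
    assert (Z : sumL (seq 0 M) (fun j => sumL (seq 0 n) (fun i =>
      aa M (iota M t) j i * (iota M t (CY j i) - iota M t (CY M i)))) = 0).
    { apply sumL_zero. intros j hj. apply in_seq in hj. apply sumL_zero. intros i _.
      rewrite aa_iota by lia. simpl. ring. }
    rewrite Z, Rplus_0_r.
    destruct (Rle_lt_or_eq_dec 0 (sumL (seq 0 (S M)) (fun j => F j (arg (iota M t) j (zz n M F (iota M t) j)))))
      as [|E0]; auto.
    { apply sumL_nonneg. intros j hj. apply in_seq in hj. apply Fp. lia. }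
    (* Zero action would make every generating function vanish along the trajectory, which would
       then stay at [w], against [0 < F j0 w]. *)
    exfalso.
    assert (F0 : forall j, (j <= M)%nat -> F j (arg (iota M t) j (zz n M F (iota M t) j)) = 0).
    { intros j hj. apply Rle_antisym; [|now apply Fp].
      rewrite E0. apply (sumL_term (seq 0 (S M)) (fun j => F j (arg (iota M t) j (zz n M F (iota M t) j)))).
      - apply in_seq. lia.
      - intros k hk. apply in_seq in hk. apply Fp. lia. }
    assert (a0 : forall j i, (j <= M)%nat -> aa M (iota M t) j i = 0).
    { intros j i hj. destruct (Nat.eq_dec j M) as [->|ne]; [|rewrite aa_iota by lia; reflexivity].
      pose proof (sum_aa M (iota M t) i) as S0. rewrite sumL_zero in S0; [lra|].
      intros k hk. apply in_seq in hk. rewrite aa_iota by lia. reflexivity. }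
    assert (z0 : forall j, (j <= S M)%nat -> zz n M F (iota M t) j = w GZ).
    { induction j as [|j IH]; intros hj; [reflexivity|]. cbn [zz]. rewrite F0 by lia.
      rewrite IH by lia. rewrite sumL_zero; [ring|]. intros i _. rewrite a0 by lia. ring. }
    specialize (F0 j0 hj0). rewrite z0 in F0 by lia.
    enough (E : F j0 (arg (iota M t) j0 (w GZ)) = F j0 w) by lra.
    apply (cont_ext (LG n)); [apply (ks_C1 _ _ _ _ _ _ _ _ _ _ _ HS); auto|].
    intros g hg. apply in_LG in hg. destruct g; simpl.
    - rewrite sumL_zero; [ring|auto].
    - destruct (Nat.eq_dec j0 M); ring.
    - reflexivity. }
  destruct (cont_act n M F DF (ks_C1 _ _ _ _ _ _ _ _ _ _ _ HS) (iota M t) (act (iota M t) / 2)) as [r [r0 Hr]];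
    [lra|].
  set (rho := r / (INR M + 2)).
  assert (MM : 0 <= INR M) by apply pos_INR.
  assert (rho0 : 0 < rho) by (apply Rdiv_lt_0_compat; lra).
  assert (rhoM : INR M * rho < r).
  { unfold rho. apply Rmult_lt_reg_r with (INR M + 2); [lra|].
    replace (INR M * (r / (INR M + 2)) * (INR M + 2)) with (INR M * r) by (field; lra). nra. }
  assert (rho1 : rho < r).
  { unfold rho. apply Rmult_lt_reg_r with (INR M + 2); [lra|].
    replace (r / (INR M + 2) * (INR M + 2)) with r by (field; lra). nra. }
  exists (Rmin (act (iota M t) / 2) (rho * rho)). split; [apply Rmin_pos; [lra|nra]|].
  intros b [h [ah hb]]. destruct (linking n M h t ah) as [p hp].
  eapply Rle_trans; [|apply (hb p)]. set (u := h p) in *.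
  destruct (Classical_Prop.classic (exists j i, (j < M)%nat /\ (i < n)%nat /\ rho <= Rabs (aa M u j i)))
    as [[j [i [hj [hi big]]]]|small].
  - eapply Rle_trans; [apply Rmin_r|]. eapply Rle_trans; [|apply low, hp].
    apply Rle_trans with (aa M u j i * aa M u j i).
    { assert (aa M u j i * aa M u j i = Rabs (aa M u j i) * Rabs (aa M u j i))
        by (rewrite <- Rabs_mult, Rabs_right; [auto|nra]). nra. }
    apply Rle_trans with (sumL (seq 0 n) (fun i => aa M u j i * aa M u j i)).
    + apply (sumL_term (seq 0 n) (fun i => aa M u j i * aa M u j i)); [apply in_seq; lia|intros; nra].
    + apply (sumL_term (seq 0 M) (fun j => sumL (seq 0 n) (fun i => aa M u j i * aa M u j i))).
      * apply in_seq; lia.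
      * intros. apply sumL_nonneg. intros; nra.
  - eapply Rle_trans; [apply Rmin_l|].
    assert (sm : forall j i, (j < M)%nat -> (i < n)%nat -> Rabs (aa M u j i) < rho).
    { intros j i hj hi. apply Rnot_le_lt. intros hh. apply small. eauto. }
    assert (N : near L r (iota M t) u).
    { intros c hc. apply in_LC in hc. destruct c as [j i|j i|].
      - destruct hc as [hj hi].
        assert (X : forall j, (j <= M)%nat -> Rabs (u (CX j i) - w (GX i)) <= INR j * rho).
        { clear j hj. induction j as [|j IH]; intros hj.
          - pose proof (hp (PX i) ltac:(apply in_LP; lia)) as e. simpl in e.
            rewrite e, Rminus_diag, Rabs_R0. simpl. lra.
          - replace (u (CX (S j) i) - w (GX i)) with (aa M u j i + (u (CX j i) - w (GX i))).
            2:{ unfold aa, nx. destruct (Nat.eq_dec j M); [lia|ring]. }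
            eapply Rle_trans; [apply Rabs_triang|]. pose proof (sm j i ltac:(lia) hi).
            specialize (IH ltac:(lia)). rewrite S_INR. lra. }
        simpl. rewrite sumL_zero, Rplus_0_r by auto. eapply Rle_lt_trans; [now apply X|].
        eapply Rle_lt_trans; [|exact rhoM]. apply Rmult_le_compat_r; [lra|]. now apply le_INR.
      - destruct hc as [hj hi]. pose proof (hp (PY i) ltac:(apply in_LP; lia)) as e. simpl in e.
        cbn [iota t]. replace (w (GY i) - (if Nat.eq_dec j M then 0 else 0)) with (u (CY M i))
          by (destruct (Nat.eq_dec j M); lra).
        destruct (Nat.eq_dec j M) as [->|ne]; [rewrite Rminus_diag, Rabs_R0; lra|].
        rewrite (fib u hp) by lia. pose proof (sm j i ltac:(lia) hi). lra.
      - pose proof (hp PZ ltac:(now apply in_LP)) as e. simpl in e. simpl.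
        rewrite e, Rminus_diag, Rabs_R0. lra. }
    specialize (Hr u N). apply Rabs_def2 in Hr. lra.
Qed.
End Bounds.

(** * Criticality of the minimax level *)

Section Core.
Variables (n M : nat) (C lam Lam B CK : R) (K K' : R -> R).
Variables (F : nat -> (gidx -> R) -> R) (DF : nat -> gidx -> (gidx -> R) -> R).
Hypothesis HS : ksteps n M C lam Lam B CK K K' F DF.
Notation act := (act n M F).
Notation dact := (dact n M F DF).
Notation L := (LC n M).
Notation m0 := (INR (length L)).
Notation n1 := (n1 n M).
Notation rr := (rr n M).

Definition box_bound (Ra Rb : R) : R := Rb + INR M * Ra.
Definition box_lo (Ra Rb : R) (c : cidx) : R := match c with CZ => 0 | _ => - box_bound Ra Rb end.
Definition box_hi (Ra Rb : R) (c : cidx) : R := match c with CZ => 1 | _ => box_bound Ra Rb end.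

(** The coordinate [z] is unbounded, but an integer shift brings it to [[0,1]]; here periodicity
    provides compactness. *)
Lemma core_box Ra Rb u : n1 u <= Ra -> rr u <= Rb ->
  exists k, in_box L (box_lo Ra Rb) (box_hi Ra Rb) (shift u k).
Proof.
  intros h1 h2. exists (- Int_part (u CZ))%Z. intros c hc. apply in_LC in hc.
  assert (MM : 0 <= INR M) by apply pos_INR.
  assert (b : forall i, (i < n)%nat -> Rabs (u (CX 0 i)) <= Rb /\ Rabs (u (CY M i)) <= Rb).
  { intros i hi. assert (Rabs (u (CX 0 i)) + Rabs (u (CY M i)) <= rr u).
    { apply (sumL_term (seq 0 n) (fun i => Rabs (u (CX 0 i)) + Rabs (u (CY M i)))); [apply in_seq; lia|].
      intros j _. pose proof (Rabs_pos (u (CX 0 j))). pose proof (Rabs_pos (u (CY M j))). lra. }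
    pose proof (Rabs_pos (u (CX 0 i))). pose proof (Rabs_pos (u (CY M i))). lra. }
  assert (dr : INR M * n1 u <= INR M * Ra) by (apply Rmult_le_compat_l; auto).
  assert (tri : forall x y d, Rabs y <= Rb -> Rabs (x - y) <= d -> - (Rb + d) <= x <= Rb + d).
  { intros x y d k1 k2. revert k1 k2. unfold Rabs. destruct (Rcase_abs y), (Rcase_abs (x - y)); lra. }
  destruct c as [j i|j i|]; cbn [box_lo box_hi shift]; unfold box_bound.
  - destruct hc as [hj hi]. apply (tri _ (u (CX 0 i))); [now apply b|].
    eapply Rle_trans; [now apply (x_drift n M)|auto].
  - destruct hc as [hj hi]. apply (tri _ (u (CY M i))); [now apply b|].
    eapply Rle_trans; [now apply (y_drift n M)|auto].
  - rewrite opp_IZR. pose proof (base_Int_part (u CZ)). lra.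
Qed.

Definition periodic (f : (cidx -> R) -> R) : Prop := forall u k, f (shift u k) = f u.

Lemma core_positive Ra Rb f : contL L f -> periodic f -> (forall u, 0 <= f u) ->
  (forall u, n1 u <= Ra -> rr u <= Rb -> 0 < f u) ->
  exists m, 0 < m /\ forall u, n1 u <= Ra -> rr u <= Rb -> m <= f u.
Proof.
  intros cf pf f0 fp.
  (* The box is larger than the core; the penalty terms make the function positive on all of it and
     vanish on the core. *)
  destruct (positive_on_box cidx_dec L (box_lo Ra Rb) (box_hi Ra Rb)
    (fun u => f u + (Rmax 0 (n1 u - Ra) + Rmax 0 (rr u - Rb)))) as [m [hm H]].
  - intros u. apply cont_plus; [apply cf|].
    apply cont_plus; apply cont_Rmax; try apply cont_const; apply cont_minus; try apply cont_const.
    + apply cont_n1.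
    + apply cont_rr.
  - intros u _. specialize (f0 u). specialize (fp u).
    pose proof (Rmax_l 0 (n1 u - Ra)). pose proof (Rmax_l 0 (rr u - Rb)).
    pose proof (Rmax_r 0 (n1 u - Ra)). pose proof (Rmax_r 0 (rr u - Rb)).
    destruct (Rle_dec (n1 u) Ra) as [h1|]; [|lra]. destruct (Rle_dec (rr u) Rb) as [h2|]; [|lra].
    specialize (fp h1 h2). lra.
  - exists m. split; auto. intros u h1 h2. destruct (core_box Ra Rb u h1 h2) as [k hk].
    specialize (H _ hk). rewrite pf in H.
    rewrite n1_shift, rr_shift in H.
    rewrite !Rmax_left in H by lra. lra.
Qed.

Lemma core_bounded Ra Rb f : contL L f -> periodic f ->
  exists m, 0 < m /\ forall u, n1 u <= Ra -> rr u <= Rb -> Rabs (f u) <= m.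
Proof.
  intros cf pf.
  destruct (bounded_on_box cidx_dec L (box_lo Ra Rb) (box_hi Ra Rb) f cf) as [m [hm H]].
  exists m. split; auto. intros u h1 h2. destruct (core_box Ra Rb u h1 h2) as [k hk].
  rewrite <- (pf u k). auto.
Qed.

Lemma core_uniform Ra Rb f eps : contL L f -> periodic f -> 0 < eps ->
  exists d, 0 < d /\ forall u q, n1 u <= Ra -> rr u <= Rb -> near L d u q -> Rabs (f q - f u) < eps.
Proof.
  intros cf pf e0.
  destruct (uniform_on_box cidx_dec L (box_lo Ra Rb) (box_hi Ra Rb) f eps cf e0) as [d [hd H]].
  exists d. split; auto. intros u q h1 h2 N. destruct (core_box Ra Rb u h1 h2) as [k hk].
  rewrite <- (pf u k), <- (pf q k). apply H; auto. intros c hc. specialize (N c hc).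
  destruct c; simpl; auto. replace (q CZ + IZR k - (u CZ + IZR k)) with (q CZ - u CZ) by ring. auto.
Qed.

Definition grad (u : cidx -> R) (c : cidx) : R := dact u (delta c).
Definition grad2 (u : cidx -> R) : R := sumL L (fun c => grad u c * grad u c).

Lemma cont_grad c : contL L (fun u => grad u c).
Proof. apply cont_dact. apply (ks_C1 _ _ _ _ _ _ _ _ _ _ _ HS). Qed.
Lemma periodic_grad c : periodic (fun u => grad u c).
Proof. intros u k. apply (dact_shift _ _ _ _ _ _ _ _ _ _ _ HS). Qed.
Lemma cont_grad2 : contL L grad2.
Proof. intros u. apply cont_sumL. intros c _. apply cont_mult; apply cont_grad. Qed.
Lemma periodic_grad2 : periodic grad2.
Proof. intros u k. apply sumL_ext. intros c _. now rewrite (periodic_grad c u k). Qed.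
Lemma grad2_pos u : 0 <= grad2 u.
Proof. apply sumL_nonneg. intros; nra. Qed.

(** A cut-off gradient step of prescribed maximal size, never increasing the action and decreasing
    it by a fixed amount on the part of the core where the gradient is not small. *)
Lemma descent_core Ra Rb m d : 0 < m -> 0 < d ->
  exists sigma : (cidx -> R) -> cidx -> R,
  (forall c, In c L -> contL L (fun u => sigma u c)) /\
  (forall u c, In c L -> Rabs (sigma u c - u c) <= d) /\
  (forall u, act (sigma u) <= act u) /\
  exists mu, 0 < mu /\ forall u, n1 u <= Ra -> rr u <= Rb -> 2 * m <= grad2 u ->
    act (sigma u) <= act u - mu.
Proof.
  intros m_pos d_pos. assert (mm : 1 <= m0) by apply m0_pos.
  destruct (list_bound L (fun c x => forall u, n1 u <= Ra + 1 -> rr u <= Rb + 1 -> Rabs (grad u c) <= x))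
    as [G [G0 HG]].
  { intros c x y h xy u h1 h2. eapply Rle_trans; [now apply h|auto]. }
  { intros c _. apply core_bounded; [apply cont_grad|apply periodic_grad]. }
  (* Summed over all entries, the variation of the gradient along the step costs at most
     [m0 * G * om], that is [m / 2]. *)
  set (om := m / (2 * (m0 * G))).
  assert (om0 : 0 < om) by (apply Rdiv_lt_0_compat; [auto|]; apply Rmult_lt_0_compat; nra).
  destruct (forall_list_radius L (fun c d => forall u q, n1 u <= Ra + 1 -> rr u <= Rb + 1 ->
    near L d u q -> Rabs (grad q c - grad u c) < om)) as [r [r0 Hr]].
  { intros c x y h [y0 yx] u q h1 h2 N. apply h; auto. eapply near_le; [exact yx|exact N]. }
  { intros c _. apply core_uniform; [apply cont_grad|apply periodic_grad|auto]. }
  (* Displacements are at most [tau * G], hence within the radius [r] of uniform continuity and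
     within the allowed [d]. *)
  set (tau := Rmin (r / 2) d / G).
  assert (tau0 : 0 < tau) by (apply Rdiv_lt_0_compat; auto; apply Rmin_pos; lra).
  assert (tauG : tau * G = Rmin (r / 2) d) by (unfold tau; field; lra).
  assert (tauG1 : tau * G <= r / 2) by (rewrite tauG; apply Rmin_l).
  assert (tauG2 : tau * G <= d) by (rewrite tauG; apply Rmin_r).
  set (kap := fun u => clip (Rmin (Ra + 1 - n1 u) (Rb + 1 - rr u))).
  set (chi := fun u => clip ((grad2 u - m) / m)).
  set (s := fun u => tau * (kap u * chi u)).
  assert (sb : forall u, 0 <= s u <= tau).
  { intros u. unfold s. destruct (clip_01 (Rmin (Ra + 1 - n1 u) (Rb + 1 - rr u))) as [a1 a2].
    destruct (clip_01 ((grad2 u - m) / m)) as [a3 a4]. fold (kap u) in *. fold (chi u) in *.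
    assert (0 <= kap u * chi u <= 1) by nra. nra. }
  assert (zone : forall u, s u = 0 \/ (n1 u <= Ra + 1 /\ rr u <= Rb + 1 /\ m <= grad2 u)).
  { intros u. destruct (Rle_dec (n1 u) (Ra + 1)) as [h1|h1];
      [destruct (Rle_dec (rr u) (Rb + 1)) as [h2|h2]; [destruct (Rle_dec m (grad2 u)) as [h3|h3]|]|]; auto; left;
      unfold s, kap, chi.
    - rewrite (clip_0 ((grad2 u - m) / m)); [ring|].
      apply Rmult_le_reg_r with m; auto. unfold Rdiv. rewrite Rmult_assoc, Rinv_l; lra.
    - rewrite (clip_0 (Rmin _ _)); [ring|]. eapply Rle_trans; [apply Rmin_r|lra].
    - rewrite (clip_0 (Rmin _ _)); [ring|]. eapply Rle_trans; [apply Rmin_l|lra]. }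
  set (sigma := fun u c => u c - s u * grad u c).
  assert (desc : forall u, act (sigma u) <= act u - s u * (m / 2)).
  { intros u. destruct (zone u) as [z|[h1 [h2 h3]]].
    - unfold sigma. rewrite z.
      replace (fun c => u c - 0 * grad u c) with u by (apply functional_extensionality; intros; ring). lra.
    - destruct (sb u) as [sp st].
      apply (act_descent n M F DF (ks_C1 _ _ _ _ _ _ _ _ _ _ _ HS)); auto. intros t ht.
      set (q := fun c => u c - t * grad u c).
      assert (N : near L r u q).
      { intros c hc. unfold q. replace (u c - t * grad u c - u c) with (- (t * grad u c)) by ring.
        rewrite Rabs_Ropp, Rabs_mult, (Rabs_right t) by lra.
        apply Rle_lt_trans with (tau * G); [|lra].
        apply Rmult_le_compat; try lra; [apply Rabs_pos|now apply HG]. }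
      rewrite dact_linear.
      assert (lo : grad2 u - sumL L (fun c => G * om) <= sumL L (fun c => grad u c * grad q c)).
      { unfold grad2. rewrite <- sumL_minus. apply sumL_le. intros c hc.
        specialize (HG c hc u h1 h2). specialize (Hr c hc u q h1 h2 N).
        assert (Rabs (grad u c * (grad q c - grad u c)) <= G * om).
        { rewrite Rabs_mult. apply Rmult_le_compat; try apply Rabs_pos; lra. }
        assert (- (G * om) <= grad u c * (grad q c - grad u c)); [|lra].
        revert H. unfold Rabs at 1. destruct (Rcase_abs _); lra. }
      rewrite sumL_const in lo.
      replace (m0 * (G * om)) with (m / 2) in lo by (unfold om; field; split; lra).
      change (m / 2 <= sumL L (fun c => grad u c * grad q c)). lra. }
  exists sigma. split; [|split; [|split]].
  - intros c hc u. apply cont_minus; [now apply (cont_coord L)|]. apply cont_mult; [|apply cont_grad].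
    apply cont_mult; [apply cont_const|]. apply cont_mult; apply cont_clip.
    + apply cont_Rmin; (apply cont_minus; [apply cont_const|]); [apply cont_n1|apply cont_rr].
    + apply cont_div; [lra| |apply cont_const]. apply cont_minus; [apply cont_grad2|apply cont_const].
  - intros u c hc. unfold sigma. replace (u c - s u * grad u c - u c) with (- (s u * grad u c)) by ring.
    rewrite Rabs_Ropp, Rabs_mult. destruct (sb u). rewrite (Rabs_right (s u)) by lra.
    destruct (zone u) as [z|[h1 [h2 _]]]; [rewrite z; lra|].
    apply Rle_trans with (tau * G); auto. apply Rmult_le_compat; auto using Rabs_pos.
  - intros u. eapply Rle_trans; [apply desc|]. destruct (sb u). nra.
  - exists (tau * (m / 2)). split; [nra|]. intros u h1 h2 h3.
    replace tau with (s u); [apply desc|]. unfold s, kap, chi. rewrite !clip_1; [ring| |].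
    + apply Rmult_le_reg_r with m; auto. unfold Rdiv. rewrite Rmult_assoc, Rinv_l; lra.
    + apply Rmin_glb; lra.
Qed.

(* Deforming a nearly optimal family for [F'] with the descent of the action of [F] would push the
   latter strictly below its level unless the two actions touch at a critical point. *)
Theorem critical_level F' DF' C' lam' Lam' B' CK' K1 K1' c c' :
  ksteps n M C' lam' Lam' B' CK' K1 K1' F' DF' ->
  (forall u, act u <= Submission.act n M F' u) ->
  level n M F c -> level n M F' c' -> c' <= c -> CK < c ->
  exists u, act u = c /\ Submission.act n M F' u = c /\ forall W, dact u W = 0.
Proof.
  intros HS' le [lev1 lev2] [_ lev2'] cc cK.
  destruct (descent_outside _ _ _ _ _ _ _ _ _ _ _ HS)
    as [sg1 [R0 [R2 [R00 [R20 [c1 [b1 [d1 H1]]]]]]]].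
  set (nu := (c - CK) / 2). assert (nu0 : 0 < nu) by (unfold nu; lra).
  destruct (H1 nu nu0) as [mu1 [mu10 H1']].
  apply Classical_Prop.NNPP. intros no.
  (* [Phi] vanishes only at the points sought: critical, at level [c], and with equal actions. If
     there are none, compactness of the core bounds it below. *)
  set (Phi := fun u => (Submission.act n M F' u - act u) + grad2 u + Rabs (act u - c)).
  assert (cact : contL L act) by (apply (cont_act n M F DF), (ks_C1 _ _ _ _ _ _ _ _ _ _ _ HS)).
  assert (cact' : contL L (Submission.act n M F')) by (apply (cont_act n M F' DF'), (ks_C1 _ _ _ _ _ _ _ _ _ _ _ HS')).
  destruct (core_positive (R0 + 2) (R2 + 2) Phi) as [ms [ms0 Hms]].
  - intros u. apply cont_plus; [apply cont_plus|].
    + apply cont_minus; [apply cact'|apply cact].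
    + apply cont_grad2.
    + apply cont_Rabs, cont_minus; [apply cact|apply cont_const].
  - intros u k. unfold Phi. rewrite periodic_grad2.
    now rewrite (act_shift _ _ _ _ _ _ _ _ _ _ _ HS), (act_shift _ _ _ _ _ _ _ _ _ _ _ HS').
  - intros u. unfold Phi. pose proof (grad2_pos u). pose proof (Rabs_pos (act u - c)). specialize (le u). lra.
  - intros u _ _. unfold Phi. pose proof (grad2_pos u) as g0. pose proof (Rabs_pos (act u - c)) as a0.
    pose proof (le u) as l0.
    destruct (Rlt_dec 0 (Submission.act n M F' u - act u + grad2 u + Rabs (act u - c))) as [|neg]; auto.
    exfalso. apply no. exists u.
    assert (A : Rabs (act u - c) = 0) by lra. assert (Bz : grad2 u = 0) by lra.
    assert (act u = c).
    { destruct (Req_dec (act u - c) 0) as [e|e]; [lra|]. apply Rabs_no_R0 in e. lra. }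
    repeat split; auto; [lra|]. intros W. rewrite dact_linear. apply sumL_zero. intros a ha.
    assert (grad u a * grad u a <= 0).
    { rewrite <- Bz. apply (sumL_term L (fun c => grad u c * grad u c)); auto. intros; nra. }
    assert (g : grad u a = 0) by nra. unfold grad in g. rewrite g. ring.
  (* Moves of this size in each coordinate change [n1] and [rr] by at most 1, so that [sg2] leaves a
     point beyond [R0 + 2] or [R2 + 2] in the range where [sg1] descends. *)
  - set (drift := 1 / (2 * INR n + 4 * m0)).
    assert (mm : 1 <= m0) by apply m0_pos. assert (nn : 0 <= INR n) by apply pos_INR.
    assert (dr0 : 0 < drift) by (apply Rdiv_lt_0_compat; lra).
    assert (dr1 : drift * (2 * INR n) <= 1).
    { unfold drift. apply Rmult_le_reg_r with (2 * INR n + 4 * m0); [lra|].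
      replace (1 / (2 * INR n + 4 * m0) * (2 * INR n) * (2 * INR n + 4 * m0)) with (2 * INR n) by (field; lra). lra. }
    assert (dr2 : drift * (4 * m0) <= 1).
    { unfold drift. apply Rmult_le_reg_r with (2 * INR n + 4 * m0); [lra|].
      replace (1 / (2 * INR n + 4 * m0) * (4 * m0) * (2 * INR n + 4 * m0)) with (4 * m0) by (field; lra). lra. }
    destruct (descent_core (R0 + 2) (R2 + 2) (ms / 4) drift) as [sg2 [c2 [b2 [d2 [mu2 [mu20 H2]]]]]]; [lra|auto|].
    set (eps := Rmin (Rmin (ms / 8) nu) (Rmin (mu1 / 2) (mu2 / 2))).
    assert (e0 : 0 < eps) by (apply Rmin_pos; apply Rmin_pos; lra).
    assert (e1 : eps <= ms / 8) by (eapply Rle_trans; [apply Rmin_l|apply Rmin_l]).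
    assert (e2 : eps <= nu) by (eapply Rle_trans; [apply Rmin_l|apply Rmin_r]).
    assert (e3 : eps <= mu1 / 2) by (eapply Rle_trans; [apply Rmin_r|apply Rmin_l]).
    assert (e4 : eps <= mu2 / 2) by (eapply Rle_trans; [apply Rmin_r|apply Rmin_r]).
    clearbody eps.
    destruct (lev2' eps e0) as [b [[h [ah hb]] hbc]].
    enough (val : is_value n M F (c - eps)) by (specialize (lev1 _ val); lra).
    exists (fun p => sg1 (sg2 (h p))). split.
    { apply (admissible_comp n M (fun p => sg2 (h p)) sg1 1); auto.
      apply (admissible_comp n M h sg2 drift); auto. }
    intros p. set (u := h p). specialize (hb p). fold u in hb.
    assert (up : act u < c + eps) by (specialize (le u); lra).
    destruct (Rle_dec (n1 u) (R0 + 2)) as [h1|h1]; [destruct (Rle_dec (rr u) (R2 + 2)) as [h2|h2]|].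
    (* Otherwise [act u] is within [eps] of [c] and the other action exceeds it by at most [2 eps];
       more than [ms / 2] of [Phi] is left to the gradient, and [sg2] descends by [mu2 >= 2 eps], a
       contradiction. *)
    + destruct (Rle_dec (act (sg1 (sg2 u))) (c - eps)) as [|big]; auto. exfalso.
      pose proof (d1 (sg2 u)). pose proof (d2 u). pose proof (le u).
      specialize (Hms u h1 h2). unfold Phi in Hms.
      assert (Rabs (act u - c) <= eps) by (apply Rabs_le; lra).
      specialize (H2 u h1 h2 ltac:(lra)). lra.
    + assert (out : R2 + 1 <= rr (sg2 u)).
      { enough (rr u - rr (sg2 u) <= drift * (2 * INR n)) by lra.
        unfold Submission.rr. rewrite <- sumL_minus.
        replace (drift * (2 * INR n)) with (INR (length (seq 0 n)) * (2 * drift)) by (rewrite length_seq; ring).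
        apply sumL_bound. intros i hi. apply in_seq in hi.
        pose proof (b2 u (CX 0 i) ltac:(apply in_LC; lia)) as q1. pose proof (b2 u (CY M i) ltac:(apply in_LC; lia)) as q2.
        pose proof (Rabs_triang_inv (u (CX 0 i)) (sg2 u (CX 0 i))) as q3.
        pose proof (Rabs_triang_inv (u (CY M i)) (sg2 u (CY M i))) as q4.
        rewrite Rabs_minus_sym in q1, q2. lra. }
      pose proof (d2 u). destruct (H1' (sg2 u) (or_intror out)).
      * pose proof (d1 (sg2 u)). unfold nu in *. lra.
      * lra.
    + assert (out : R0 + 1 <= n1 (sg2 u)).
      { enough (n1 u - n1 (sg2 u) <= drift * (4 * m0)) by lra.
        unfold Submission.n1. rewrite <- sumL_minus.
        replace (drift * (4 * m0)) with (m0 * (4 * drift)) by ring.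
        apply sumL_bound. intros a ha.
        eapply Rle_trans; [apply Rabs_triang_inv|].
        assert (b2' : forall a, In a L -> - drift <= sg2 u a - u a <= drift).
        { intros a' ha'. specialize (b2 u a' ha'). revert b2. unfold Rabs. destruct (Rcase_abs _); lra. }
        apply in_LC in ha. destruct a as [[|j] i|j i|]; cbn [W0]; try (rewrite Rminus_diag, Rabs_R0; lra).
        - pose proof (b2' (CY j i) ltac:(apply in_LC; lia)). pose proof (b2' (CY (S j) i) ltac:(apply in_LC; lia)).
          apply Rabs_le. lra.
        - destruct (Nat.eq_dec j M); [rewrite Rminus_diag, Rabs_R0; lra|].
          unfold aa. pose proof (nx_le M j ltac:(lia)).
          pose proof (b2' (CX j i) ltac:(apply in_LC; lia)). pose proof (b2' (CX (nx M j) i) ltac:(apply in_LC; lia)).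
          apply Rabs_le. lra. }
      pose proof (d2 u). destruct (H1' (sg2 u) (or_introl out)).
      * pose proof (d1 (sg2 u)). unfold nu in *. lra.
      * lra.
Qed.

Theorem critical_point c : level n M F c -> CK < c -> exists u, act u = c /\ forall W, dact u W = 0.
Proof.
  intros lev cK.
  destruct (critical_level F DF C lam Lam B CK K K' c c HS ltac:(intros; lra) lev lev ltac:(lra) cK)
    as [u [h1 [_ h3]]]. eauto.
Qed.
End Core.

(** * Critical points of the action *)

Section Crit.
Variables (n M : nat) (F : nat -> (gidx -> R) -> R) (DF : nat -> gidx -> (gidx -> R) -> R).
Variable u : cidx -> R.
Notation dz := (dz n M F DF u).
Notation DFa := (DFa n M F DF u).
Notation eta := (eta n M F DF u).
Notation sn := (sumL (seq 0 n)).
Hypothesis Mpos : (0 < M)%nat.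
Hypothesis rho_pos : forall j, (j <= M)%nat -> 0 < 1 + DFa j GZ.
Hypothesis crit : forall W, dact n M F DF u W = 0.

Fixpoint prho (j : nat) : R := match j with O => 1 | S j => (1 + DFa j GZ) * prho j end.

Lemma sum_single (f : nat -> R) i : (i < n)%nat -> (forall i', i' <> i -> f i' = 0) -> sn f = f i.
Proof.
  intros hi h. rewrite <- (sumL_delta Nat.eq_dec (seq 0 n) i f); [|apply seq_NoDup|apply in_seq; lia].
  apply sumL_ext. intros i' _. destruct (Nat.eq_dec i i'); auto.
Qed.

(** Through unvaried steps [dz] is only multiplied by positive conformal factors, and its final
    value vanishes by criticality. *)
Lemma dz_propagate W a : (forall j, (a <= j <= M)%nat -> forall i, (i < n)%nat ->
    W (CX j i) = 0 /\ W (CX (nx M j) i) = 0 /\ W (CY j i) = 0) ->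
  W CZ = 0 -> (a <= S M)%nat -> dz W a = 0.
Proof.
  intros hW wz ha. specialize (crit W). unfold dact in crit. rewrite wz, Rminus_0_r in crit.
  assert (back : forall d, (d <= S M - a)%nat -> dz W (S M - d) = 0).
  { induction d as [|d IH]; intros hd; [now rewrite Nat.sub_0_r|].
    specialize (IH ltac:(lia)). replace (S M - d)%nat with (S (S M - S d)) in IH by lia.
    set (j := (S M - S d)%nat) in *. assert (jm : (a <= j <= M)%nat) by lia. cbn [Submission.dz] in IH.
    rewrite sumL_zero in IH.
    - specialize (rho_pos j ltac:(lia)). nra.
    - intros i hi. apply in_seq in hi. destruct (hW j jm i ltac:(lia)) as [e1 [e2 e3]]. rewrite e1, e2, e3. ring. }
  replace a with (S M - (S M - a))%nat by lia. apply back. lia.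
Qed.

Lemma dz_none W a : (forall j, (j < a)%nat -> forall i, (i < n)%nat ->
    W (CX j i) = 0 /\ W (CX (nx M j) i) = 0 /\ W (CY j i) = 0) ->
  W CZ = 0 -> (a <= S M)%nat -> dz W a = 0.
Proof.
  intros hW wz. induction a as [|a IH]; intros ha; [exact wz|]. cbn [Submission.dz].
  rewrite IH; [|intros; apply hW; lia|lia]. rewrite sumL_zero; [ring|].
  intros i hi. apply in_seq in hi. destruct (hW a ltac:(lia) i ltac:(lia)) as [e1 [e2 e3]].
  rewrite e1, e2, e3. ring.
Qed.

Lemma delta_ne a b : a <> b -> delta a b = 0.
Proof. intros h. unfold delta. destruct (cidx_dec a b); congruence. Qed.
Lemma delta_eq a : delta a a = 1.
Proof. unfold delta. destruct (cidx_dec a a); congruence. Qed.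

(** Variation of [Y_j]: the next [x] is the final [x] of step [j], which is [x_j - F_Y]. *)
Lemma crit_x j i : (j <= M)%nat -> (i < n)%nat -> aa M u j i = - DFa j (GY i).
Proof.
  intros hj hi.
  assert (z : dz (delta (CY j i)) (S j) = 0).
  { apply dz_propagate; [|apply delta_ne; discriminate|lia].
    intros k hk i' _. repeat split; apply delta_ne; intros E; inversion E; lia. }
  cbn [Submission.dz] in z. rewrite dz_none in z.
  - rewrite (sum_single _ i) in z; auto.
    + rewrite delta_eq, !delta_ne in z by discriminate. lra.
    + intros i' ne. rewrite !delta_ne; [ring|intros E; inversion E; lia|discriminate|discriminate].
  - intros k hk i' _. repeat split; apply delta_ne; intros E; inversion E; lia.
  - apply delta_ne. discriminate.
  - lia.
Qed.

(** Variation of [x_(j+1)]: the final [y] of a step is the initial [y] of the next. *)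
Lemma crit_y j i : (j < M)%nat -> (i < n)%nat -> u (CY j i) = eta (S j) i.
Proof.
  intros hj hi. set (W := delta (CX (S j) i)).
  assert (nxj : nx M j = S j) by (unfold nx; destruct (Nat.eq_dec j M); lia).
  assert (nxne : forall k, k <> j -> nx M k <> S j).
  { intros k ne. unfold nx. destruct (Nat.eq_dec k M); lia. }
  assert (z : dz W (S (S j)) = 0).
  { apply dz_propagate; [|apply delta_ne; discriminate|lia].
    intros k hk i' _. repeat split; apply delta_ne; intros E; inversion E as [E']; [lia|].
    revert E'. apply not_eq_sym, nxne. lia. }
  assert (z0 : dz W j = 0).
  { apply dz_none; [|apply delta_ne; discriminate|lia].
    intros k hk i' _. repeat split; apply delta_ne; intros E; inversion E as [E']; [lia|].
    revert E'. apply not_eq_sym, nxne. lia. }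
  assert (z1 : dz W (S j) = u (CY j i)).
  { cbn [Submission.dz]. rewrite z0, nxj, (sum_single _ i); auto.
    - unfold W. rewrite delta_eq, !delta_ne; [ring|discriminate|intros E; inversion E; lia].
    - intros i' ne. unfold W. rewrite !delta_ne; [ring|discriminate|intros E; inversion E; lia|intros E; inversion E; lia]. }
  cbn [Submission.dz] in z, z1. rewrite z1 in z.
  rewrite (sum_single _ i) in z; auto.
  - unfold W in z. rewrite delta_eq in z.
    rewrite (delta_ne _ (CX (nx M (S j)) i)), (delta_ne _ (CY _ _)) in z;
      [|discriminate|intros E; inversion E as [E']; revert E'; apply not_eq_sym, nxne; lia].
    unfold Submission.eta. specialize (rho_pos (S j) ltac:(lia)).
    apply Rmult_eq_reg_l with (1 + DFa (S j) GZ); [|lra]. field_simplify; lra.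
  - intros i' ne. unfold W. rewrite !delta_ne; [ring|discriminate| |]; intros E; inversion E; lia.
Qed.

(** Variation of [z]: the conformal factors multiply to 1, which becomes the condition on [g] at a
    translated point. *)
Lemma crit_rho : prho (S M) = 1.
Proof.
  assert (z : forall j, (j <= S M)%nat -> dz (delta CZ) j = prho j).
  { induction j as [|j IH]; intros hj; [apply delta_eq|]. cbn [Submission.dz prho]. rewrite IH by lia.
    rewrite sumL_zero; [ring|]. intros i _. rewrite !delta_ne by discriminate. ring. }
  specialize (crit (delta CZ)). unfold dact in crit. rewrite z, delta_eq in crit by lia. lra.
Qed.

(** Variation of [x_0], which enters step 0 and the closing jump: as the factors multiply to 1, the
    last [Y] is the initial [y] of step 0. *)
Lemma crit_closing i : (i < n)%nat -> u (CY M i) = eta 0 i.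
Proof.
  intros hi. set (W := delta (CX 0 i)).
  assert (nx0 : forall k, (k < M)%nat -> nx M k = S k) by (intros; unfold nx; destruct (Nat.eq_dec k M); lia).
  assert (z : forall j, (1 <= j <= M)%nat -> dz W j = - prho j * eta 0 i).
  { induction j as [|j IH]; intros hj; [lia|]. cbn [Submission.dz prho]. rewrite nx0 by lia.
    destruct j as [|j].
    - rewrite (sum_single _ i); auto.
      + unfold W. rewrite delta_eq, !delta_ne by discriminate.
        cbn [prho]. unfold Submission.eta. specialize (rho_pos 0%nat ltac:(lia)).
        replace (dz (delta (CX 0 i)) 0) with 0 by (symmetry; apply delta_ne; discriminate).
        field. lra.
      + intros i' ne. unfold W. rewrite !delta_ne; [ring|discriminate|discriminate|intros E; inversion E; lia].
    - rewrite IH by lia. rewrite sumL_zero; [cbn [prho]; ring|].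
      intros i' _. unfold W. rewrite !delta_ne by discriminate. ring. }
  pose proof crit_rho as pr.
  specialize (crit W). unfold dact in crit. cbn [Submission.dz] in crit. rewrite z in crit by lia.
  rewrite (sum_single _ i) in crit; auto.
  - unfold W in crit. unfold nx in crit. destruct (Nat.eq_dec M M); [|lia].
    rewrite delta_eq, !delta_ne in crit; try discriminate; [|intros E; inversion E; lia].
    cbn [prho] in pr.
    replace ((1 + DFa M GZ) * (- prho M * eta 0 i)) with (- ((1 + DFa M GZ) * prho M) * eta 0 i) in crit by ring.
    rewrite pr in crit. lra.
  - intros i' ne. unfold nx. destruct (Nat.eq_dec M M); [|lia]. unfold W.
    rewrite !delta_ne; [ring|discriminate| |]; intros E; inversion E; lia.
Qed.
End Crit.

(** * Contact flows *)

Notation pt := (nat -> R).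
Notation updn := (upd Nat.eq_dec).

(* Coordinates: x_i at i, y_i at n + i, z at 2n, time at 2n + 1. *)
Definition LE (n : nat) : list nat := seq 0 (2 * n + 1).
Definition LT (n : nat) : list nat := seq 0 (2 * n + 2).
Definition xyn (n : nat) (p : pt) : R := sumL (seq 0 (2 * n)) (fun i => Rabs (p i)).
Definition zshift (n : nat) (p : pt) (k : Z) : pt :=
  fun a => if Nat.eq_dec a (2 * n) then p a + IZR k else p a.
Definition st (n : nat) (t : R) (p : pt) : pt := fun a => if Nat.eq_dec a (2 * n + 1) then t else p a.
Definition alphac (n : nat) (p : pt) (a : nat) : R :=
  if lt_dec a n then - p (n + a)%nat else if Nat.eq_dec a (2 * n) then 1 else 0.

Lemma in_LE n a : In a (LE n) <-> (a < 2 * n + 1)%nat.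
Proof. unfold LE. rewrite in_seq. lia. Qed.
Lemma in_LT n a : In a (LT n) <-> (a < 2 * n + 2)%nat.
Proof. unfold LT. rewrite in_seq. lia. Qed.

(** The contact form at [Ph t p] applied to the partial derivative in direction [a]. For [a = 2n]
    this is the conformal factor; for [a = 2n + 1], the time direction, it is the contact
    Hamiltonian along the isotopy. *)
Definition aD (n : nat) (Ph : R -> pt -> pt) (D : nat -> nat -> pt -> R) (t : R) (p : pt) (a : nat) : R :=
  D (2 * n)%nat a (st n t p) - sumL (seq 0 n) (fun i => Ph t p (n + i)%nat * D i a (st n t p)).
Definition cf n Ph D t p := aD n Ph D t p (2 * n).

(** The isotopy on total functions, so that time is one more coordinate. The C1 inverse in [fl_inv]
    is the source of the Lipschitz bounds, and [fl_pos] is nonnegativity of the Hamiltonian. *)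
Record flow (n : nat) (Ph : R -> pt -> pt) (D : nat -> nat -> pt -> R) (B : R) : Prop := {
  fl_B : 0 <= B;
  fl_C1 : forall j, (j < 2 * n + 1)%nat -> C1 Nat.eq_dec (LT n) (fun v => Ph (v (2 * n + 1)%nat) v j) (D j);
  fl_ext : forall t p q, (forall a, (a < 2 * n + 1)%nat -> p a = q a) -> Ph t p = Ph t q;
  fl_0 : forall p j, (j < 2 * n + 1)%nat -> Ph 0 p j = p j;
  fl_per : forall t p k j, 0 <= t <= 1 -> (j < 2 * n + 1)%nat ->
    Ph t (zshift n p k) j = zshift n (Ph t p) k j;
  fl_supp : forall t p j, 0 <= t <= 1 -> B < xyn n p -> (j < 2 * n + 1)%nat -> Ph t p j = p j;
  fl_contact : forall t p a, 0 <= t <= 1 -> (a < 2 * n + 1)%nat ->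
    aD n Ph D t p a = cf n Ph D t p * alphac n p a;
  fl_cf : forall t p, 0 <= t <= 1 -> 0 < cf n Ph D t p;
  fl_inv : forall t, 0 <= t <= 1 -> exists Psi DPsi,
    (forall j, (j < 2 * n + 1)%nat -> C1 Nat.eq_dec (LE n) (fun p => Psi p j) (DPsi j)) /\
    (forall p j, (j < 2 * n + 1)%nat -> Psi (Ph t p) j = p j) /\
    (forall p j, (j < 2 * n + 1)%nat -> Ph t (Psi p) j = p j);
  fl_pos : forall t p, 0 <= t <= 1 -> 0 <= aD n Ph D t p (2 * n + 1) }.

Lemma derivable_local f g x l d : 0 < d -> (forall y, Rabs (y - x) < d -> f y = g y) ->
  derivable_pt_lim f x l -> derivable_pt_lim g x l.
Proof.
  intros d0 E H e e0. destruct (H e e0) as [[r r0] Hr]. simpl in Hr.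
  assert (m0 : 0 < Rmin r d) by (now apply Rmin_pos).
  exists (mkposreal _ m0). simpl. intros h hn hh.
  rewrite <- !E.
  - apply Hr; auto. eapply Rlt_le_trans; [exact hh|apply Rmin_l].
  - rewrite Rminus_diag, Rabs_R0. auto.
  - replace (x + h - x) with h by ring. eapply Rlt_le_trans; [exact hh|apply Rmin_r].
Qed.

Lemma zshift_zshift n p k l : zshift n (zshift n p k) l = zshift n p (k + l).
Proof.
  apply functional_extensionality. intros a. unfold zshift.
  destruct (Nat.eq_dec a (2 * n)); auto. rewrite plus_IZR. ring.
Qed.
Lemma zshift_0 n p : zshift n p 0 = p.
Proof.
  apply functional_extensionality. intros a. unfold zshift. destruct (Nat.eq_dec a (2 * n)); auto. ring.
Qed.
Lemma xyn_upd n p a t : xyn n p - Rabs (t - p a) <= xyn n (updn p a t).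
Proof.
  unfold xyn. assert (H : forall l, NoDup l -> sumL l (fun i => Rabs (p i)) - Rabs (t - p a) <=
    sumL l (fun i => Rabs (updn p a t i)) /\ (~ In a l -> sumL l (fun i => Rabs (p i)) =
    sumL l (fun i => Rabs (updn p a t i)))).
  { induction l as [|b l IH]; intros nd; cbn [sumL].
    - split; auto. pose proof (Rabs_pos (t - p a)). lra.
    - inversion nd; subst. destruct (IH H2) as [h1 h2]. split.
      + destruct (Nat.eq_dec a b) as [<-|ne].
        * rewrite upd_same, <- h2 by auto. pose proof (Rabs_triang_inv (p a) t).
          rewrite (Rabs_minus_sym (p a)) in H. lra.
        * rewrite upd_other by auto. lra.
      + intros ni. rewrite upd_other by (intros ->; apply ni; now left). f_equal. apply h2.
        intros i; apply ni; now right. }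
  apply H. apply seq_NoDup.
Qed.

(** * Derivatives of periodic maps that are the identity far out *)

Section PeriodicDerivatives.
Variables (n : nat) (B : R) (f : pt -> R) (a : nat) (l : pt -> R).
Hypothesis der : forall p, derivable_pt_lim (fun t => f (updn p a t)) (p a) (l p).

Lemma deriv_zshift (d : Z -> R) p k : (forall q, f (zshift n q k) = f q + d k) -> l (zshift n p k) = l p.
Proof.
  intros per. pose proof (der (zshift n p k)) as h1. pose proof (der p) as h2.
  set (e := if Nat.eq_dec a (2 * n) then IZR k else 0).
  assert (E : zshift n p k a = p a + e) by (unfold zshift, e; destruct (Nat.eq_dec a (2 * n)); ring).
  rewrite E in h1.
  apply (uniqueness_limite (fun t => f (updn p a t)) (p a)); auto.
  intros eps e0. destruct (h1 eps e0) as [r hr]. exists r. intros h hn hh.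
  specialize (hr h hn hh).
  assert (T : forall t, f (updn (zshift n p k) a (t + e)) = f (updn p a t) + d k).
  { intros t. rewrite <- per. f_equal. apply functional_extensionality. intros b. unfold upd, zshift, e.
    destruct (Nat.eq_dec a b) as [<-|]; destruct (Nat.eq_dec a (2 * n)); auto; lra. }
  replace (p a + e + h) with (p a + h + e) in hr by ring. rewrite !T in hr.
  replace (f (updn p a (p a + h)) - f (updn p a (p a))) with
    (f (updn p a (p a + h)) + d k - (f (updn p a (p a)) + d k)) by ring. exact hr.
Qed.

Lemma deriv_outside j p : (forall q, B < xyn n q -> f q = q j) -> B < xyn n p ->
  l p = if Nat.eq_dec a j then 1 else 0.
Proof.
  intros out hp.
  apply (uniqueness_limite (fun t => f (updn p a t)) (p a)); auto.
  apply (derivable_local (fun t => updn p a t j) _ _ _ (xyn n p - B)); [lra| |].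
  - intros y hy. symmetry. apply out. pose proof (xyn_upd n p a y). lra.
  - unfold upd. destruct (Nat.eq_dec a j); [apply derivable_pt_lim_id|apply derivable_pt_lim_const].
Qed.
End PeriodicDerivatives.

Lemma xyn_box n B p : xyn n p <= B -> exists k,
  in_box (LE n) (fun a => if Nat.eq_dec a (2 * n) then 0 else - B)
    (fun a => if Nat.eq_dec a (2 * n) then 1 else B) (zshift n p k).
Proof.
  intros hp. exists (- Int_part (p (2 * n)%nat))%Z. intros a ha. apply in_LE in ha. unfold zshift.
  destruct (Nat.eq_dec a (2 * n)) as [->|ne].
  - rewrite opp_IZR. pose proof (base_Int_part (p (2 * n)%nat)). lra.
  - assert (Rabs (p a) <= xyn n p).
    { apply (sumL_term (seq 0 (2 * n)) (fun i => Rabs (p i))); [apply in_seq; lia|intros; apply Rabs_pos]. }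
    revert H. unfold Rabs. destruct (Rcase_abs (p a)); lra.
Qed.

Lemma periodic_bounded n B (f : pt -> R) c : contL (LE n) f ->
  (forall p k, f (zshift n p k) = f p) -> (forall p, B < xyn n p -> f p = c) ->
  exists m, 0 < m /\ forall p, Rabs (f p) <= m.
Proof.
  intros cont_f per out.
  destruct (bounded_on_box Nat.eq_dec (LE n) (fun a => if Nat.eq_dec a (2 * n) then 0 else - B)
    (fun a => if Nat.eq_dec a (2 * n) then 1 else B) f cont_f) as [m [m0 hm]].
  exists (Rmax m (Rabs c)). split; [eapply Rlt_le_trans; [exact m0|apply Rmax_l]|].
  intros p. destruct (Rle_dec (xyn n p) B) as [h|h].
  - destruct (xyn_box n B p h) as [k hk]. rewrite <- (per p k).
    eapply Rle_trans; [now apply hm|apply Rmax_l].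
  - rewrite out by lra. apply Rmax_r.
Qed.

(** * Subdivision into steps that expand distances in mixed coordinates *)

Section Flow.
Variables (n : nat) (Ph : R -> pt -> pt) (D : nat -> nat -> pt -> R) (B : R).
Hypothesis fl : flow n Ph D B.

Lemma st_T t p : st n t p (2 * n + 1) = t.
Proof. unfold st. destruct (Nat.eq_dec (2 * n + 1) (2 * n + 1)); congruence. Qed.
Lemma st_E t p a : (a < 2 * n + 1)%nat -> st n t p a = p a.
Proof. intros h. unfold st. destruct (Nat.eq_dec a (2 * n + 1)); auto; lia. Qed.
Lemma Ph_st t p s : Ph s (st n t p) = Ph s p.
Proof. apply (fl_ext n Ph D B fl). intros a ha. now apply st_E. Qed.

Lemma D_space j a t p : (j < 2 * n + 1)%nat -> (a < 2 * n + 1)%nat ->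
  derivable_pt_lim (fun s => Ph t (updn p a s) j) (p a) (D j a (st n t p)).
Proof.
  intros hj ha. destruct (fl_C1 n Ph D B fl j hj) as [_ H].
  destruct (H a ltac:(apply in_LT; lia)) as [_ der].
  specialize (der (st n t p) (p a)).
  eapply derivable_eq; [exact der| |].
  - intros s. cbv beta. rewrite upd_other by lia. rewrite st_T.
    apply (f_equal (fun q : pt => q j)), (fl_ext n Ph D B fl). intros b hb. unfold upd.
    destruct (Nat.eq_dec a b); auto.
    now apply st_E.
  - f_equal. replace (p a) with (st n t p a) by (apply st_E; auto). apply upd_id.
Qed.

Lemma D_time j t p : (j < 2 * n + 1)%nat ->
  derivable_pt_lim (fun s => Ph s p j) t (D j (2 * n + 1)%nat (st n t p)).
Proof.
  intros hj. destruct (fl_C1 n Ph D B fl j hj) as [_ H].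
  destruct (H (2 * n + 1)%nat ltac:(apply in_LT; lia)) as [_ der].
  specialize (der (st n t p) t).
  eapply derivable_eq; [exact der| |].
  - intros s. cbv beta. rewrite upd_same.
    apply (f_equal (fun q : pt => q j)), (fl_ext n Ph D B fl). intros b hb. unfold upd.
    destruct (Nat.eq_dec (2 * n + 1) b); [lia|]. now apply st_E.
  - f_equal. rewrite <- (st_T t p) at 2. apply upd_id.
Qed.

Lemma cont_st_f (f : pt -> R) t : contL (LT n) f -> contL (LE n) (fun p => f (st n t p)).
Proof.
  intros cont_f p. apply (cont_comp (LE n) (LT n) f (st n t)); [apply cont_f|].
  intros b hb. apply in_LT in hb. unfold st. destruct (Nat.eq_dec b (2 * n + 1)); [apply cont_const|].
  apply (cont_coord (LE n)), in_LE. lia.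
Qed.

Lemma cont_Ph j t : (j < 2 * n + 1)%nat -> contL (LE n) (fun p => Ph t p j).
Proof.
  intros hj p. destruct (fl_C1 n Ph D B fl j hj) as [cPh _].
  eapply cont_eq; [|apply (cont_st_f _ t cPh p)].
  intros q. cbv beta. now rewrite st_T, Ph_st.
Qed.
Lemma cont_D j a t : (j < 2 * n + 1)%nat -> (a < 2 * n + 2)%nat -> contL (LE n) (fun p => D j a (st n t p)).
Proof.
  intros hj ha. apply cont_st_f. destruct (fl_C1 n Ph D B fl j hj) as [_ H].
  apply H. now apply in_LT.
Qed.

Lemma C1_Ph j t : (j < 2 * n + 1)%nat ->
  C1 Nat.eq_dec (LE n) (fun p => Ph t p j) (fun a p => D j a (st n t p)).
Proof.
  intros hj. split; [now apply cont_Ph|]. intros a ha. apply in_LE in ha. split; [apply cont_D; lia|].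
  intros p s. pose proof (D_space j a t (updn p a s) hj ha) as H. rewrite upd_same in H.
  eapply derivable_eq; [exact H| |reflexivity]. intros x. simpl. now rewrite upd_upd.
Qed.

Lemma D_zshift j a t p k : 0 <= t <= 1 -> (j < 2 * n + 1)%nat -> (a < 2 * n + 1)%nat ->
  D j a (st n t (zshift n p k)) = D j a (st n t p).
Proof.
  intros ht hj ha.
  apply (deriv_zshift n (fun p => Ph t p j) a (fun p => D j a (st n t p)) (fun p => D_space j a t p hj ha)
    (fun k => if Nat.eq_dec j (2 * n) then IZR k else 0)).
  intros q. rewrite (fl_per n Ph D B fl) by auto. unfold zshift. destruct (Nat.eq_dec j (2 * n)); ring.
Qed.

Lemma D_outside j a t p : 0 <= t <= 1 -> (j < 2 * n + 1)%nat -> (a < 2 * n + 1)%nat -> B < xyn n p ->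
  D j a (st n t p) = if Nat.eq_dec a j then 1 else 0.
Proof.
  intros ht hj ha hp.
  apply (deriv_outside n B (fun p => Ph t p j) a (fun p => D j a (st n t p)) (fun p => D_space j a t p hj ha)); auto.
  intros q hq. now apply (fl_supp n Ph D B fl).
Qed.

Lemma Ph_inj t p q : 0 <= t <= 1 -> (forall j, (j < 2 * n + 1)%nat -> Ph t p j = Ph t q j) ->
  forall j, (j < 2 * n + 1)%nat -> p j = q j.
Proof.
  intros ht E j hj. destruct (fl_inv n Ph D B fl t ht) as [Psi [DPsi [cP [i1 i2]]]].
  rewrite <- (i1 p j hj), <- (i1 q j hj). destruct (cP j hj) as [cj _].
  apply (cont_ext (LE n) (fun p => Psi p j) (Ph t q)); [apply cj|].
  intros a ha. apply E. now apply in_LE.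
Qed.

Definition dist (p q : pt) : R := sumL (LE n) (fun a => Rabs (q a - p a)).

(** The inverse commutes with the shifts and is the identity far out, so its derivatives are bounded
    and it is Lipschitz. *)
Lemma Ph_expands t : 0 <= t <= 1 ->
  exists kap, 0 < kap /\ forall p q, kap * dist p q <= dist (Ph t p) (Ph t q).
Proof.
  intros ht. destruct (fl_inv n Ph D B fl t ht) as [Psi [DPsi [cP [i1 i2]]]].
  assert (extP : forall p q j, (j < 2 * n + 1)%nat -> (forall a, (a < 2 * n + 1)%nat -> p a = q a) -> Psi p j = Psi q j).
  { intros p q j hj E. destruct (cP j hj) as [cj _].
    apply (cont_ext (LE n) (fun p => Psi p j) q); [apply cj|]. intros a ha. apply E. now apply in_LE. }
  assert (der : forall j a, (j < 2 * n + 1)%nat -> (a < 2 * n + 1)%nat -> forall p,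
    derivable_pt_lim (fun s => Psi (updn p a s) j) (p a) (DPsi j a p)).
  { intros j a hj ha p. destruct (cP j hj) as [_ H]. destruct (H a ltac:(now apply in_LE)) as [_ d].
    specialize (d p (p a)). now rewrite upd_id in d. }
  assert (bnd : forall j a, (j < 2 * n + 1)%nat -> (a < 2 * n + 1)%nat ->
    exists m, 0 < m /\ forall p, Rabs (DPsi j a p) <= m).
  { intros j a hj ha.
    apply (periodic_bounded n B (DPsi j a) (if Nat.eq_dec a j then 1 else 0)).
    - destruct (cP j hj) as [_ H]. apply H. now apply in_LE.
    - intros p k. apply (deriv_zshift n (fun p => Psi p j) a (DPsi j a) (der j a hj ha)
        (fun k => if Nat.eq_dec j (2 * n) then IZR k else 0)).
      intros q. transitivity (zshift n (Psi q) k j).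
      2:{ unfold zshift. destruct (Nat.eq_dec j (2 * n)); ring. }
      revert j hj. apply (Ph_inj t); auto. intros j hj. rewrite i2 by auto.
      rewrite (fl_per n Ph D B fl) by auto. unfold zshift. now rewrite i2.
    - intros p hp. apply (deriv_outside n B (fun p => Psi p j) a (DPsi j a) (der j a hj ha)); auto.
      intros q hq. transitivity (Psi (Ph t q) j); [|now apply i1].
      apply extP; auto. intros b hb. symmetry. now apply (fl_supp n Ph D B fl). }
  assert (all : exists m, 0 < m /\ forall j a, (j < 2 * n + 1)%nat -> (a < 2 * n + 1)%nat -> forall p, Rabs (DPsi j a p) <= m).
  (* The reciprocal of the bound serves as a radius, so that the monotonicity has the required
     direction. *)
  { destruct (forall_list_radius (list_prod (LE n) (LE n))
      (fun ja r => forall p, Rabs (DPsi (fst ja) (snd ja) p) <= / r)) as [r [r0 hr]].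
    - intros ja d d' h [d0 d1] p. eapply Rle_trans; [apply h|]. apply Rinv_le_contravar; auto.
    - intros [j a] hja. apply in_prod_iff in hja. rewrite !in_LE in hja.
      destruct (bnd j a ltac:(lia) ltac:(lia)) as [m [m0 hm]]. exists (/ m). split; [now apply Rinv_0_lt_compat|].
      intros p. rewrite Rinv_inv. apply hm.
    - exists (/ r). split; [now apply Rinv_0_lt_compat|]. intros j a hj ha.
      apply (hr (j, a)). apply in_prod_iff. rewrite !in_LE. lia. }
  destruct all as [m [m0 hm]].
  set (N := INR (length (LE n))).
  assert (N1 : 1 <= N) by (unfold N, LE; rewrite length_seq, plus_INR; pose proof (pos_INR (2 * n)); simpl in *; lra).
  exists (/ (N * m)). assert (Nm : 0 < N * m) by nra. split; [now apply Rinv_0_lt_compat|].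
  intros p q. apply Rmult_le_reg_l with (N * m); auto.
  rewrite <- Rmult_assoc, Rinv_r, Rmult_1_l by lra.
  unfold dist at 1. rewrite Rmult_assoc. apply sumL_bound. intros j hj. apply in_LE in hj.
  rewrite <- (i1 p j hj), <- (i1 q j hj).
  apply (C1_lipschitz Nat.eq_dec (LE n) (fun p => Psi p j) (DPsi j) m); auto; [apply seq_NoDup|lra|].
  intros a r ha. apply in_LE in ha. now apply hm.
Qed.

(** Uniform in all points: modulo shifts of [z] a compact box remains, and outside the ball the
    derivatives do not depend on time. *)
Lemma D_close t0 eps : 0 <= t0 <= 1 -> 0 < eps -> exists d, 0 < d /\ forall s, 0 <= s <= 1 -> Rabs (s - t0) < d ->
  forall j a p, (j < 2 * n + 1)%nat -> (a < 2 * n + 1)%nat ->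
  Rabs (D j a (st n s p) - D j a (st n t0 p)) <= eps.
Proof.
  intros ht0 e0.
  destruct (forall_list_radius (list_prod (LE n) (LE n)) (fun ja d => forall s, 0 <= s <= 1 -> Rabs (s - t0) < d ->
    forall p, Rabs (D (fst ja) (snd ja) (st n s p) - D (fst ja) (snd ja) (st n t0 p)) <= eps)) as [d [d0 hd]].
  - intros ja d d' h [d0 d1] s hs hst. apply h; auto. lra.
  - intros [j a] hja. apply in_prod_iff in hja. rewrite !in_LE in hja. destruct hja as [hj ha].
    destruct (fl_C1 n Ph D B fl j hj) as [_ H]. destruct (H a ltac:(apply in_LT; lia)) as [cD _].
    destruct (uniform_on_box Nat.eq_dec (LT n)
      (fun a => if Nat.eq_dec a (2 * n + 1) then 0 else if Nat.eq_dec a (2 * n) then 0 else - B)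
      (fun a => if Nat.eq_dec a (2 * n + 1) then 1 else if Nat.eq_dec a (2 * n) then 1 else B) _ eps cD e0)
      as [d [d0 hd]].
    exists d. split; auto. simpl. intros s hs hst p.
    destruct (Rle_dec (xyn n p) B) as [h|h].
    + destruct (xyn_box n B p h) as [k hk]. rewrite <- (D_zshift j a s p k), <- (D_zshift j a t0 p k) by auto.
      left. apply hd.
      * intros b hb. apply in_LT in hb. unfold st at 1 2. destruct (Nat.eq_dec b (2 * n + 1)); auto.
        apply hk. apply in_LE. lia.
      * intros b hb. unfold st. destruct (Nat.eq_dec b (2 * n + 1)); auto.
        rewrite Rminus_diag, Rabs_R0. auto.
    + rewrite !D_outside by (auto; lra). rewrite Rminus_diag, Rabs_R0. lra.
  - exists d. split; auto. intros s hs hst j a p hj ha.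
    apply (hd (j, a)); auto. apply in_prod_iff. rewrite !in_LE. auto.
Qed.

(* Mixed initial and final coordinates of the step from time [s] to time [r]. *)
Definition Gam (s r : R) (u : pt) : pt :=
  fun a => if le_dec n a then if lt_dec a (2 * n) then Ph r u a else Ph s u a else Ph s u a.

Definition good (s r : R) : Prop := 0 <= s <= 1 /\ 0 <= r <= 1 /\
  exists kap, 0 < kap /\ forall p q, kap * dist p q <= dist (Gam s r p) (Gam s r q).

Definition ugood (s t : R) : Prop := 0 <= s <= 1 /\ 0 <= t <= 1 /\
  exists kap, 0 < kap /\ forall r, s <= r <= t ->
    forall p q, kap * dist p q <= dist (Gam s r p) (Gam s r q).

(** With both times equal to [t0], [Gam] is [Ph t0], which expands. Nearby, each of the [N]
    components changes by a map with Lipschitz constant [kap / (2 N)], which leaves half of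
    [kap]. *)
Lemma good_near t0 : 0 <= t0 <= 1 -> exists d, 0 < d /\ forall s t, 0 <= s <= 1 -> 0 <= t <= 1 ->
  Rabs (s - t0) < d -> Rabs (t - t0) < d -> ugood s t.
Proof.
  intros ht0. destruct (Ph_expands t0 ht0) as [kap [k0 hk]].
  set (N := INR (length (LE n))).
  assert (N1 : 1 <= N) by (unfold N, LE; rewrite length_seq, plus_INR; pose proof (pos_INR (2 * n)); simpl in *; lra).
  destruct (D_close t0 (kap / (2 * N)) ht0) as [d [d0 hd]]; [apply Rdiv_lt_0_compat; lra|].
  exists d. split; auto. intros s t hs ht hst htt. split; auto. split; auto.
  exists (kap / 2). split; [lra|]. intros r hr p q.
  assert (hr1 : 0 <= r <= 1) by lra.
  assert (hrt : Rabs (r - t0) < d) by (revert hst htt; unfold Rabs; repeat destruct (Rcase_abs _); lra).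
  assert (tri : dist (Ph t0 p) (Ph t0 q) - N * (kap / (2 * N) * dist p q) <= dist (Gam s r p) (Gam s r q)).
  { unfold N. rewrite <- sumL_const. unfold dist at 1 3. rewrite <- sumL_minus. apply sumL_le.
    intros a ha. apply in_LE in ha.
    assert (lip : forall s', 0 <= s' <= 1 -> Rabs (s' - t0) < d ->
      Rabs (Ph t0 q a - Ph t0 p a) - kap / (2 * N) * dist p q <= Rabs (Ph s' q a - Ph s' p a)).
    { intros s' hs' hst'.
      pose proof (C1_lipschitz Nat.eq_dec (LE n) (fun p => Ph t0 p a - Ph s' p a) _ (kap / (2 * N)) p q
        (seq_NoDup _ _) (C1_minus _ _ _ _ _ _ (C1_Ph a t0 ha) (C1_Ph a s' ha))) as l.
      simpl in l. fold N. specialize (l ltac:(left; apply Rdiv_lt_0_compat; lra)).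
      assert (l' : Rabs (Ph t0 q a - Ph s' q a - (Ph t0 p a - Ph s' p a)) <= kap / (2 * N) * dist p q).
      { apply l. intros b v hb. apply in_LE in hb. rewrite Rabs_minus_sym. now apply hd. }
      replace (Ph t0 q a - Ph t0 p a) with
        ((Ph t0 q a - Ph s' q a - (Ph t0 p a - Ph s' p a)) + (Ph s' q a - Ph s' p a)) by ring.
      pose proof (Rabs_triang (Ph t0 q a - Ph s' q a - (Ph t0 p a - Ph s' p a)) (Ph s' q a - Ph s' p a)). lra. }
    unfold Gam. destruct (le_dec n a); [destruct (lt_dec a (2 * n))|]; now apply lip. }
  replace (N * (kap / (2 * N) * dist p q)) with (kap / 2 * dist p q) in tri by (field; lra).
  specialize (hk p q). lra.
Qed.

Lemma subdivision : exists N : nat, (0 < N)%nat /\ forall i, (i < N)%nat -> ugood (INR i / INR N) (INR (S i) / INR N).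
Proof.
  assert (ex : forall c, exists d, 0 < d /\ (0 <= c <= 1 -> forall s t, 0 <= s <= 1 -> 0 <= t <= 1 ->
    Rabs (s - c) < d -> Rabs (t - c) < d -> ugood s t)).
  { intros c. destruct (Classical_Prop.classic (0 <= c <= 1)) as [h|h].
    - destruct (good_near c h) as [d [d0 hd]]. exists d; auto.
    - exists 1; split; [lra|tauto]. }
  set (r := fun c => proj1_sig (constructive_indefinite_description _ (ex c))).
  assert (hr : forall c, 0 < r c /\ (0 <= c <= 1 -> forall s t, 0 <= s <= 1 -> 0 <= t <= 1 ->
    Rabs (s - c) < r c -> Rabs (t - c) < r c -> ugood s t))
    by (intros c; exact (proj2_sig (constructive_indefinite_description _ (ex c)))).
  assert (half : forall c, 0 < r c / 2) by (intros c; destruct (hr c); lra).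
  destruct (Compactness.compactness_value_1d 0 1 (fun c => mkposreal (r c / 2) (half c))) as [d hd].
  destruct (archimed_cor1 d (cond_pos d)) as [N [hN N0]]. exists N. split; auto. intros i hi.
  assert (Np : 0 < INR N) by (now apply lt_0_INR).
  assert (hi' : INR i + 1 <= INR N) by (rewrite <- S_INR; now apply le_INR).
  pose proof (pos_INR i) as i0.
  assert (b : forall x, 0 <= x <= INR N -> 0 <= x / INR N <= 1).
  { intros x hx. split; [apply Rmult_le_pos; [lra|left; now apply Rinv_0_lt_compat]|].
    apply Rmult_le_reg_r with (INR N); auto. unfold Rdiv. rewrite Rmult_assoc, Rinv_l; lra. }
  assert (hs := b (INR i) ltac:(lra)). assert (ht := b (INR (S i)) ltac:(rewrite S_INR; lra)).
  destruct (Classical_Prop.NNPP _ (hd _ hs)) as [c [hc [h1 h2]]]. simpl in h1, h2.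
  apply (proj2 (hr c) hc); auto; [pose proof (half c); lra|].
  replace (INR (S i) / INR N - c) with (/ INR N + (INR i / INR N - c)) by (rewrite S_INR; field; lra).
  eapply Rle_lt_trans; [apply Rabs_triang|].
  rewrite (Rabs_right (/ INR N)) by (left; now apply Rinv_0_lt_compat). lra.
Qed.
End Flow.

(** * Generating functions of short steps *)

Lemma sumL_shift (f : nat -> R) a m : sumL (seq a m) f = sumL (seq 0 m) (fun i => f (a + i)%nat).
Proof.
  revert a. induction m as [|m IH]; intros a; auto.
  rewrite !seq_S, !sumL_app, IH. cbn [sumL]. reflexivity.
Qed.

Lemma sumL_LE n (f : nat -> R) : sumL (LE n) f =
  f (2 * n)%nat + sumL (seq 0 n) f + sumL (seq 0 n) (fun i => f (n + i)%nat).
Proof.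
  unfold LE. replace (2 * n + 1)%nat with (n + (n + 1))%nat by lia.
  rewrite seq_app, seq_app, !sumL_app, (sumL_shift f (0 + n) n). cbn [seq sumL].
  replace (0 + n + n)%nat with (2 * n)%nat by lia. rewrite Rplus_0_r.
  replace (sumL (seq 0 n) (fun i => f (0 + n + i)%nat)) with (sumL (seq 0 n) (fun i => f (n + i)%nat)) by reflexivity.
  ring.
Qed.

Lemma sumL_LT n (f : nat -> R) : sumL (LT n) f = sumL (LE n) f + f (2 * n + 1)%nat.
Proof.
  unfold LT, LE. replace (2 * n + 2)%nat with (S (2 * n + 1)) by lia.
  rewrite seq_S, sumL_app. cbn [sumL]. rewrite Nat.add_0_l. ring.
Qed.

(** [phi] is controlled on [[s,t]] only, so its derivatives at the ends are one-sided. Clamping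
    extends it continuously, and the mean value theorem takes derivatives in the interior. *)
Lemma monotone_on_interval (phi h : R -> R) s t : s <= t ->
  (forall r0, s <= r0 <= t -> forall eps, 0 < eps -> exists d, 0 < d /\ forall r, s <= r <= t ->
     Rabs (r - r0) < d -> Rabs (phi r - phi r0 - h r0 * (r - r0)) <= eps * Rabs (r - r0)) ->
  (forall r, s <= r <= t -> 0 <= h r) -> phi s <= phi t.
Proof.
  intros st H h0. destruct (Rle_lt_or_eq_dec s t st) as [lt|<-]; [|lra].
  set (cl := fun r => Rmax s (Rmin t r)).
  assert (cl_in : forall r, s <= cl r <= t).
  { intros r. unfold cl, Rmax, Rmin. repeat destruct (Rle_dec _ _); lra. }
  assert (cl_id : forall r, s <= r <= t -> cl r = r).
  { intros r hr. unfold cl. rewrite Rmin_right, Rmax_right; lra. }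
  assert (cl_lip : forall r r0, s <= r0 <= t -> Rabs (cl r - r0) <= Rabs (r - r0)).
  { intros r r0 hr. unfold cl, Rmax, Rmin, Rabs.
    repeat first [destruct (Rle_dec _ _)|destruct (Rcase_abs _)]; lra. }
  destruct (Derive.MVT_gen (fun r => phi (cl r)) s t h) as [c [hc E]].
  - rewrite Rmin_left, Rmax_right by lra. intros x hx. apply Derive.is_derive_Reals.
    intros eps e0. destruct (H x ltac:(lra) (eps / 2)) as [d [d0 hd]]; [lra|].
    assert (m0 : 0 < Rmin d (Rmin (x - s) (t - x))) by (repeat apply Rmin_pos; lra).
    exists (mkposreal _ m0). simpl. intros k kn hk.
    assert (k1 : Rabs k < d) by (eapply Rlt_le_trans; [exact hk|apply Rmin_l]).
    assert (k2 : Rabs k < x - s) by (eapply Rlt_le_trans; [exact hk|eapply Rle_trans; [apply Rmin_r|apply Rmin_l]]).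
    assert (k3 : Rabs k < t - x) by (eapply Rlt_le_trans; [exact hk|eapply Rle_trans; [apply Rmin_r|apply Rmin_r]]).
    assert (kin : s <= x + k <= t) by (revert k2 k3; unfold Rabs; destruct (Rcase_abs k); lra).
    rewrite !cl_id by lra. specialize (hd (x + k) kin).
    replace (x + k - x) with k in hd by ring. specialize (hd k1).
    replace ((phi (x + k) - phi x) / k - h x) with ((phi (x + k) - phi x - h x * k) * / k) by (field; auto).
    rewrite Rabs_mult, Rabs_inv. assert (0 < Rabs k) by (now apply Rabs_pos_lt).
    apply Rle_lt_trans with (eps / 2); [|lra]. apply Rmult_le_reg_r with (Rabs k); auto.
    rewrite Rmult_assoc, Rinv_l by lra. lra.
  - rewrite Rmin_left, Rmax_right by lra. intros x hx e e0.
    destruct (H x hx 1) as [d [d0 hd]]; [lra|].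
    set (A := Rabs (h x) + 2). assert (A0 : 2 <= A) by (unfold A; pose proof (Rabs_pos (h x)); lra).
    exists (Rmin d (e / A)). split; [apply Rmin_pos; auto; apply Rdiv_lt_0_compat; lra|].
    intros y [_ hy]. simpl in hy |- *. unfold R_dist in *. rewrite (cl_id x hx).
    pose proof (cl_lip y x hx) as l.
    assert (l1 : Rabs (cl y - x) < d) by (eapply Rle_lt_trans; [exact l|eapply Rlt_le_trans; [exact hy|apply Rmin_l]]).
    assert (l2 : Rabs (cl y - x) < e / A) by (eapply Rle_lt_trans; [exact l|eapply Rlt_le_trans; [exact hy|apply Rmin_r]]).
    specialize (hd (cl y) (cl_in y) l1).
    replace (phi (cl y) - phi x) with ((phi (cl y) - phi x - h x * (cl y - x)) + h x * (cl y - x)) by ring.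
    eapply Rle_lt_trans; [apply Rabs_triang|]. rewrite Rabs_mult.
    apply Rle_lt_trans with (A * Rabs (cl y - x)).
    + unfold A. pose proof (Rabs_pos (cl y - x)). nra.
    + replace e with (A * (e / A)) by (field; lra). apply Rmult_lt_compat_l; lra.
  - rewrite Rmin_left, Rmax_right in hc by lra. rewrite !cl_id in E by lra. specialize (h0 c hc). nra.
Qed.

Lemma frechet_minimum {A} (dec : forall a b : A, {a = b} + {a <> b}) (L : list A) f p D :
  NoDup L -> frechet L f p D -> (forall q, f p <= f q) -> forall a, In a L -> D a = 0.
Proof.
  intros nd fr mn a ha.
  assert (der : derivable_pt_lim (fun t => f (upd dec p a t)) (p a) (D a)).
  { eapply derivable_eq; [|intros; reflexivity|].
    - apply (frechet_curve L f (fun t => upd dec p a t) (p a) D (fun b => if dec a b then 1 else 0)).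
      + rewrite upd_id. exact fr.
      + intros b _. unfold upd. destruct (dec a b); [apply derivable_pt_lim_id|apply derivable_pt_lim_const].
    - transitivity (sumL L (fun b => if dec a b then D b else 0)); [|now apply sumL_delta].
      apply sumL_ext. intros b _. destruct (dec a b); ring. }
  set (pr := exist _ (D a) der : derivable_pt (fun t => f (upd dec p a t)) (p a)).
  pose proof (deriv_minimum (fun t => f (upd dec p a t)) (p a - 1) (p a + 1) (p a) pr) as H.
  rewrite <- H; [reflexivity|lra|lra|]. intros. rewrite upd_id. apply mn.
Qed.

Definition gidx_dec (a b : gidx) : {a = b} + {a <> b}.
Proof. decide equality; apply Nat.eq_dec. Defined.

Lemma NoDup_LG n : NoDup (LG n).
Proof.
  unfold LG. constructor.
  - rewrite in_app_iff, !in_map_iff. intros [[x [E _]]|[x [E _]]]; discriminate.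
  - apply NoDup_app.
    + apply FinFun.Injective_map_NoDup; [|apply seq_NoDup]. intros x y E. now inversion E.
    + apply FinFun.Injective_map_NoDup; [|apply seq_NoDup]. intros x y E. now inversion E.
    + intros c h1 h2. apply in_map_iff in h1, h2. destruct h1 as [? [<- _]], h2 as [? [E _]]; discriminate.
Qed.

Lemma periodic_bounded_LG n B (f : (gidx -> R) -> R) c : contL (LG n) f ->
  (forall w k, f (tick w k) = f w) -> (forall w, B < wnorm n w -> f w = c) ->
  exists m, 0 < m /\ forall w, Rabs (f w) <= m.
Proof.
  intros cont_f per out.
  destruct (bounded_on_box gidx_dec (LG n) (fun g => match g with GZ => 0 | _ => - B end)
    (fun g => match g with GZ => 1 | _ => B end) f cont_f) as [m [m0 hm]].
  exists (Rmax m (Rabs c)). split; [eapply Rlt_le_trans; [exact m0|apply Rmax_l]|].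
  intros w. destruct (Rle_dec (wnorm n w) B) as [h|h].
  - rewrite <- (per w (- Int_part (w GZ))%Z). eapply Rle_trans; [|apply Rmax_l]. apply hm.
    intros g hg. apply in_LG in hg.
    assert (b : forall i, (i < n)%nat -> Rabs (w (GX i)) + Rabs (w (GY i)) <= B).
    { intros i hi. eapply Rle_trans; [|exact h].
      apply (sumL_term (seq 0 n) (fun i => Rabs (w (GX i)) + Rabs (w (GY i)))); [apply in_seq; lia|].
      intros j _. pose proof (Rabs_pos (w (GX j))). pose proof (Rabs_pos (w (GY j))). lra. }
    destruct g; simpl.
    + specialize (b i hg). pose proof (Rabs_pos (w (GY i))).
      assert (Rabs (w (GX i)) <= B) as q by lra. revert q. unfold Rabs. destruct (Rcase_abs _); lra.
    + specialize (b i hg). pose proof (Rabs_pos (w (GX i))).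
      assert (Rabs (w (GY i)) <= B) as q by lra. revert q. unfold Rabs. destruct (Rcase_abs _); lra.
    + rewrite opp_IZR. pose proof (base_Int_part (w GZ)). lra.
  - rewrite out by lra. apply Rmax_r.
Qed.

Definition toP (n : nat) (w : gidx -> R) : pt :=
  fun a => if lt_dec a n then w (GX a) else if lt_dec a (2 * n) then w (GY (a - n)) else w GZ.

Section Step.
Variables (n : nat) (Ph : R -> pt -> pt) (D : nat -> nat -> pt -> R) (B : R).
Hypothesis fl : flow n Ph D B.
Variables (s t kap : R).
Hypothesis (s01 : 0 <= s <= 1) (t01 : 0 <= t <= 1) (le_st : s <= t) (kap0 : 0 < kap).
Hypothesis expand : forall r, s <= r <= t ->
  forall p q, kap * dist n p q <= dist n (Gam n Ph s r p) (Gam n Ph s r q).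
Notation sn := (sumL (seq 0 n)).
Notation Gam := (Gam n Ph s).
Notation zi := (2 * n)%nat.
Notation ti := (2 * n + 1)%nat.

Lemma Gam_x r u i : (i < n)%nat -> Gam r u i = Ph s u i.
Proof. intros. unfold Submission.Gam. destruct (le_dec n i); auto; lia. Qed.
Lemma Gam_y r u i : (i < n)%nat -> Gam r u (n + i) = Ph r u (n + i)%nat.
Proof. intros. unfold Submission.Gam. destruct (le_dec n (n + i)); [|lia]. destruct (lt_dec (n + i) (2 * n)); auto; lia. Qed.
Lemma Gam_z r u : Gam r u zi = Ph s u zi.
Proof. unfold Submission.Gam. destruct (le_dec n zi); auto. destruct (lt_dec zi zi); auto; lia. Qed.

Lemma toP_x w i : (i < n)%nat -> toP n w i = w (GX i).
Proof. intros. unfold toP. destruct (lt_dec i n); auto; lia. Qed.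
Lemma toP_y w i : (i < n)%nat -> toP n w (n + i) = w (GY i).
Proof.
  intros. unfold toP. destruct (lt_dec (n + i) n); [lia|]. destruct (lt_dec (n + i) (2 * n)); [|lia].
  f_equal. f_equal. lia.
Qed.
Lemma toP_z w : toP n w zi = w GZ.
Proof. unfold toP. destruct (lt_dec zi n); [lia|]. destruct (lt_dec zi zi); auto; lia. Qed.

Lemma dist_toP w w' : dist n (toP n w) (toP n w') = sumL (LG n) (fun g => Rabs (w' g - w g)).
Proof.
  unfold dist. rewrite sumL_LE, sumL_LG, !toP_z. f_equal; [f_equal|]; apply sumL_ext; intros i hi;
    apply in_seq in hi; [rewrite !toP_x by lia|rewrite !toP_y by lia]; reflexivity.
Qed.

Lemma Ph_displacement r : 0 <= r <= 1 ->
  exists C, 0 < C /\ forall a, In a (LE n) -> forall u, Rabs (Ph r u a - u a) <= C.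
Proof.
  intros hr. apply (list_bound (LE n) (fun a C => forall u, Rabs (Ph r u a - u a) <= C)).
  - intros a x y h xy u. eapply Rle_trans; [apply h|auto].
  - intros a ha. assert (ha' := ha). apply in_LE in ha'. apply (periodic_bounded n B _ 0).
    + intros p. apply cont_minus; [now apply (cont_Ph n Ph D B fl)|now apply (cont_coord (LE n))].
    + intros p k. rewrite (fl_per n Ph D B fl) by auto. unfold zshift. destruct (Nat.eq_dec a zi); ring.
    + intros p hp. rewrite (fl_supp n Ph D B fl) by auto. ring.
Qed.

(** Onto because it differs from the identity by a bounded amount. Together with [expand], which
    gives injectivity and a Lipschitz inverse, this replaces the inverse function theorem. *)
Lemma Gam_onto r v : s <= r <= t -> exists u, forall a, (a < 2 * n + 1)%nat -> Gam r u a = v a.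
Proof.
  intros hr. destruct (Ph_displacement s s01) as [C1 [C10 h1]].
  destruct (Ph_displacement r ltac:(lra)) as [C2 [C20 h2]].
  destruct (bounded_displacement_onto Nat.eq_dec (LE n) (Gam r) (C1 + C2) v) as [u hu].
  - apply seq_NoDup.
  - intros a ha p. assert (ha' := ha). apply in_LE in ha'. unfold Submission.Gam.
    destruct (le_dec n a); [destruct (lt_dec a (2 * n))|]; now apply (cont_Ph n Ph D B fl).
  - intros p a ha. specialize (h1 a ha p). specialize (h2 a ha p). unfold Submission.Gam.
    destruct (le_dec n a); [destruct (lt_dec a (2 * n))|]; lra.
  - exists u. intros a ha. apply hu. now apply in_LE.
Qed.

Definition U (r : R) (w : gidx -> R) : pt :=
  epsilon (inhabits (fun _ : nat => 0)) (fun u => forall a, (a < 2 * n + 1)%nat -> Gam r u a = toP n w a).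

Lemma U_spec r w a : s <= r <= t -> (a < 2 * n + 1)%nat -> Gam r (U r w) a = toP n w a.
Proof. intros hr. revert a. unfold U. apply epsilon_spec. now apply Gam_onto. Qed.

Lemma U_x r w i : s <= r <= t -> (i < n)%nat -> Ph s (U r w) i = w (GX i).
Proof. intros. rewrite <- (Gam_x r), U_spec, toP_x by (auto; lia). auto. Qed.
Lemma U_y r w i : s <= r <= t -> (i < n)%nat -> Ph r (U r w) (n + i)%nat = w (GY i).
Proof. intros. rewrite <- Gam_y, U_spec, toP_y by (auto; lia). auto. Qed.
Lemma U_z r w : s <= r <= t -> Ph s (U r w) zi = w GZ.
Proof. intros. rewrite <- (Gam_z r), U_spec, toP_z by (auto; lia). auto. Qed.

Definition rat (r : R) (u : pt) : R := cf n Ph D r u / cf n Ph D s u.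

(** [Z - z + Y (x - X)]: the Reeb coordinate gained by the step and by the jump back from [X] to [x]
    at constant [Y]. *)
Definition Fg (r : R) (w : gidx -> R) : R :=
  Ph r (U r w) zi - w GZ + sn (fun i => w (GY i) * (w (GX i) - Ph r (U r w) i)).

Definition DFg (r : R) (g : gidx) (w : gidx -> R) : R :=
  match g with
  | GX i => w (GY i) - rat r (U r w) * Ph s (U r w) (n + i)%nat
  | GY i => w (GX i) - Ph r (U r w) i
  | GZ => rat r (U r w) - 1
  end.

Lemma rat_pos r u : s <= r <= t -> 0 < rat r u.
Proof. intros hr. apply Rdiv_lt_0_compat; apply (fl_cf n Ph D B fl); lra. Qed.

Lemma C1_fixed j : (j < 2 * n + 1)%nat -> C1 Nat.eq_dec (LT n) (fun v => Ph s v j)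
  (fun a v => if Nat.eq_dec a ti then 0 else D j a (st n s v)).
Proof.
  intros hj. split.
  - intros v. apply (cont_comp (LT n) (LE n) (fun p => Ph s p j) (fun v => v)).
    + now apply (cont_Ph n Ph D B fl).
    + intros b hb. apply in_LE in hb. apply (cont_coord (LT n)), in_LT. lia.
  - intros a ha. apply in_LT in ha. destruct (Nat.eq_dec a ti) as [->|ne].
    + split; [intros v; apply cont_const|]. intros p x.
      eapply derivable_eq; [apply (derivable_pt_lim_const (Ph s p j))| |reflexivity].
      intros y. apply (f_equal (fun q : pt => q j)), (fl_ext n Ph D B fl). intros b hb.
      rewrite upd_other by lia. reflexivity.
    + split.
      * intros v. apply (cont_comp (LT n) (LE n) (fun p => D j a (st n s p)) (fun v => v)).
        -- apply (cont_D n Ph D B fl); lia.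
        -- intros b hb. apply in_LE in hb. apply (cont_coord (LT n)), in_LT. lia.
      * intros p x. pose proof (D_space n Ph D B fl j a s (updn p a x) hj ltac:(lia)) as H.
        rewrite upd_same in H. eapply derivable_eq; [exact H| |reflexivity].
        intros y. cbv beta. now rewrite upd_upd.
Qed.

(* Along the graph of the inverse of [Gam] this function is [Fg] minus its linear part. *)
Definition Rh (cx cy : nat -> R) (cz : R) (v : pt) : R :=
  Ph (v ti) v zi - Ph s v zi + sn (fun i => Ph (v ti) v (n + i)%nat * (Ph s v i - Ph (v ti) v i)) -
  (cz * Ph s v zi + sn (fun i => cx i * Ph s v i) + sn (fun i => cy i * Ph (v ti) v (n + i)%nat)).

Definition DRh (cx cy : nat -> R) (cz : R) (a : nat) (v : pt) : R :=
  let Ds j := if Nat.eq_dec a ti then 0 else D j a (st n s v) in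
  D zi a v - Ds zi +
  sn (fun i => D (n + i)%nat a v * (Ph s v i - Ph (v ti) v i) +
               Ph (v ti) v (n + i)%nat * (Ds i - D i a v)) -
  (cz * Ds zi + sn (fun i => cx i * Ds i) + sn (fun i => cy i * D (n + i)%nat a v)).

Lemma C1_Rh cx cy cz : C1 Nat.eq_dec (LT n) (Rh cx cy cz) (DRh cx cy cz).
Proof.
  assert (P : forall j, (j < 2 * n + 1)%nat -> C1 Nat.eq_dec (LT n) (fun v => Ph (v ti) v j) (D j))
    by apply (fl_C1 n Ph D B fl).
  assert (Q := C1_fixed).
  unfold Rh, DRh. apply (C1_minus Nat.eq_dec (LT n)
    (fun v => Ph (v ti) v zi - Ph s v zi + sn (fun i => Ph (v ti) v (n + i)%nat * (Ph s v i - Ph (v ti) v i)))).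
  - apply (C1_plus Nat.eq_dec (LT n) (fun v => Ph (v ti) v zi - Ph s v zi)
      (fun v => sn (fun i => Ph (v ti) v (n + i)%nat * (Ph s v i - Ph (v ti) v i)))
      (fun a v => D zi a v - (if Nat.eq_dec a ti then 0 else D zi a (st n s v)))).
    + apply (C1_minus Nat.eq_dec (LT n) (fun v => Ph (v ti) v zi)); [apply P; lia|apply Q; lia].
    + apply (C1_sumL Nat.eq_dec (seq 0 n) (LT n) (fun i v => Ph (v ti) v (n + i)%nat * (Ph s v i - Ph (v ti) v i))
        (fun i a v => D (n + i)%nat a v * (Ph s v i - Ph (v ti) v i) +
          Ph (v ti) v (n + i)%nat * ((if Nat.eq_dec a ti then 0 else D i a (st n s v)) - D i a v))).
      intros i hi. apply in_seq in hi.
      apply (C1_mult Nat.eq_dec (LT n) (fun v => Ph (v ti) v (n + i)%nat)); [apply P; lia|].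
      apply (C1_minus Nat.eq_dec (LT n) (fun v => Ph s v i)); [apply Q; lia|apply P; lia].
  - apply (C1_plus Nat.eq_dec (LT n) (fun v => cz * Ph s v zi + sn (fun i => cx i * Ph s v i))
      (fun v => sn (fun i => cy i * Ph (v ti) v (n + i)%nat))
      (fun a v => cz * (if Nat.eq_dec a ti then 0 else D zi a (st n s v)) +
        sn (fun i => cx i * (if Nat.eq_dec a ti then 0 else D i a (st n s v))))).
    + apply (C1_plus Nat.eq_dec (LT n) (fun v => cz * Ph s v zi)).
      * apply (C1_scal Nat.eq_dec (LT n) cz (fun v => Ph s v zi)). apply Q; lia.
      * apply (C1_sumL Nat.eq_dec (seq 0 n) (LT n) (fun i v => cx i * Ph s v i)
          (fun i a v => cx i * (if Nat.eq_dec a ti then 0 else D i a (st n s v)))).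
        intros i hi. apply in_seq in hi. apply (C1_scal Nat.eq_dec (LT n) (cx i) (fun v => Ph s v i)). apply Q; lia.
    + apply (C1_sumL Nat.eq_dec (seq 0 n) (LT n) (fun i v => cy i * Ph (v ti) v (n + i)%nat)
        (fun i a v => cy i * D (n + i)%nat a v)).
      intros i hi. apply in_seq in hi.
      apply (C1_scal Nat.eq_dec (LT n) (cy i) (fun v => Ph (v ti) v (n + i)%nat)). apply P; lia.
Qed.

Definition hdot (r : R) (w : gidx -> R) : R := aD n Ph D r (U r w) ti.

(** By the contact condition [dZ - Y dX] is [rat] times [dz - y dx], so subtracting the linear part
    with coefficients [DFg] cancels all space derivatives and leaves the Hamiltonian in the time
    direction. This is why a Lipschitz bound on [U] is enough to differentiate [Fg]. *)
Lemma DRh_at r w a : s <= r <= t -> (a < 2 * n + 2)%nat ->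
  DRh (fun i => DFg r (GX i) w) (fun i => DFg r (GY i) w) (DFg r GZ w) a (st n r (U r w)) =
  if Nat.eq_dec a ti then hdot r w else 0.
Proof.
  intros hr ha. set (u := U r w).
  unfold DRh. rewrite !st_T. rewrite !(Ph_st n Ph D B fl).
  assert (stst : st n s (st n r u) = st n s u).
  { apply functional_extensionality. intros b. unfold st. destruct (Nat.eq_dec b ti); auto. }
  rewrite stst.
  set (Ds := fun j => if Nat.eq_dec a ti then 0 else D j a (st n s u)).
  change (D zi a (st n r u) - Ds zi +
    sn (fun i => D (n + i)%nat a (st n r u) * (Ph s u i - Ph r u i) + Ph r u (n + i)%nat * (Ds i - D i a (st n r u))) -
    (DFg r GZ w * Ds zi + sn (fun i => DFg r (GX i) w * Ds i) + sn (fun i => DFg r (GY i) w * D (n + i)%nat a (st n r u))) =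
    if Nat.eq_dec a ti then hdot r w else 0).
  assert (E1 : sn (fun i => D (n + i)%nat a (st n r u) * (Ph s u i - Ph r u i) + Ph r u (n + i)%nat * (Ds i - D i a (st n r u)))
    = sn (fun i => DFg r (GY i) w * D (n + i)%nat a (st n r u)) +
      (sn (fun i => DFg r (GX i) w * Ds i) + rat r u * sn (fun i => Ph s u (n + i)%nat * Ds i)) -
      sn (fun i => Ph r u (n + i)%nat * D i a (st n r u))).
  { rewrite <- sumL_scal, <- !sumL_plus, <- sumL_minus. apply sumL_ext. intros i hi. apply in_seq in hi.
    pose proof (U_x r w i hr ltac:(lia)) as hx. pose proof (U_y r w i hr ltac:(lia)) as hy.
    simpl DFg. fold u in hx, hy |- *. rewrite hx, hy. ring. }
  rewrite E1. simpl DFg. fold u.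
  assert (E2 : D zi a (st n r u) - sn (fun i => Ph r u (n + i)%nat * D i a (st n r u)) = aD n Ph D r u a) by reflexivity.
  unfold Ds. destruct (Nat.eq_dec a ti) as [->|ne].
  - rewrite (sumL_zero _ (fun i => Ph s u (n + i)%nat * 0)) by (intros; ring).
    unfold hdot. fold u. rewrite <- E2. ring.
  - assert (E3 : D zi a (st n s u) - sn (fun i => Ph s u (n + i)%nat * D i a (st n s u)) = aD n Ph D s u a) by reflexivity.
    rewrite (fl_contact n Ph D B fl) in E2, E3 by (lra || lia).
    assert (c0 : 0 < cf n Ph D s u) by (apply (fl_cf n Ph D B fl); lra).
    assert (rc : rat r u * cf n Ph D s u = cf n Ph D r u) by (unfold rat; field; lra).
    rewrite <- rc in E2.
    replace (D zi a (st n r u)) with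
      (rat r u * cf n Ph D s u * alphac n u a + sn (fun i => Ph r u (n + i)%nat * D i a (st n r u))) by lra.
    replace (D zi a (st n s u)) with
      (cf n Ph D s u * alphac n u a + sn (fun i => Ph s u (n + i)%nat * D i a (st n s u))) by lra.
    ring.
Qed.

Lemma Rh_F r w cx cy cz : s <= r <= t -> Rh cx cy cz (st n r (U r w)) =
  Fg r w - (cz * w GZ + sn (fun i => cx i * w (GX i)) + sn (fun i => cy i * w (GY i))).
Proof.
  intros hr. unfold Rh. rewrite !st_T, !(Ph_st n Ph D B fl), U_z by auto. unfold Fg.
  rewrite (sumL_ext (seq 0 n) (fun i => Ph r (U r w) (n + i)%nat * (Ph s (U r w) i - Ph r (U r w) i))
    (fun i => w (GY i) * (w (GX i) - Ph r (U r w) i))).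
  2:{ intros i hi. apply in_seq in hi. rewrite U_x, U_y by (auto; lia). reflexivity. }
  rewrite (sumL_ext (seq 0 n) (fun i => cx i * Ph s (U r w) i) (fun i => cx i * w (GX i))).
  2:{ intros i hi. apply in_seq in hi. rewrite U_x by (auto; lia). reflexivity. }
  rewrite (sumL_ext (seq 0 n) (fun i => cy i * Ph r (U r w) (n + i)%nat) (fun i => cy i * w (GY i))).
  2:{ intros i hi. apply in_seq in hi. rewrite U_y by (auto; lia). reflexivity. }
  reflexivity.
Qed.

Notation wd := (fun w w' : gidx -> R => sumL (LG n) (fun g => Rabs (w' g - w g))).

Lemma U_lipschitz r w w' : s <= r <= t -> kap * dist n (U r w) (U r w') <= wd w w'.
Proof.
  intros hr. eapply Rle_trans; [now apply (expand r)|]. rewrite <- dist_toP. right.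
  apply sumL_ext. intros a ha. apply in_LE in ha. now rewrite !U_spec.
Qed.

Lemma U_near r0 w0 : s <= r0 <= t -> exists d K, 0 < d /\ 0 < K /\ forall r w, s <= r <= t ->
  Rabs (r - r0) < d -> dist n (U r0 w0) (U r w) <= K * (Rabs (r - r0) + wd w0 w).
Proof.
  intros hr0. set (u0 := U r0 w0).
  (* One constant serves twice: [m] is the Lipschitz constant in time at [r0], and its inverse the
     radius on which this is valid. *)
  destruct (list_bound (LE n) (fun a m => 0 < m /\ forall r, Rabs (r - r0) < / m ->
    Rabs (Ph r u0 a - Ph r0 u0 a) <= m * Rabs (r - r0))) as [m [m0 hm]].
  { intros a x y [x0 h] xy. split; [lra|]. intros r hr. eapply Rle_trans; [apply h|].
    - eapply Rlt_le_trans; [exact hr|]. apply Rinv_le_contravar; lra.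
    - apply Rmult_le_compat_r; [apply Rabs_pos|auto]. }
  { intros a ha. apply in_LE in ha.
    destruct (D_time n Ph D B fl a r0 u0 ha 1 Rlt_0_1) as [[d d0] hd]. cbn [pos] in hd.
    set (l := D a ti (st n r0 u0)) in *. assert (0 <= Rabs l) by apply Rabs_pos.
    assert (i0 : 0 < / d) by (now apply Rinv_0_lt_compat).
    exists (Rabs l + 1 + / d). split; [lra|]. split; [lra|]. intros r hr.
    destruct (Req_dec (r - r0) 0) as [z|nz].
    - replace r with r0 by lra. rewrite !Rminus_diag, Rabs_R0. lra.
    - assert (hrd : Rabs (r - r0) < d).
      { eapply Rlt_le_trans; [exact hr|]. rewrite <- (Rinv_inv d) at 2. apply Rinv_le_contravar; lra. }
      specialize (hd (r - r0) nz hrd). replace (r0 + (r - r0)) with r in hd by ring.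
      set (X := Ph r u0 a - Ph r0 u0 a) in *.
      replace X with ((X / (r - r0) - l + l) * (r - r0)) by (field; auto).
      rewrite Rabs_mult. apply Rmult_le_compat_r; [apply Rabs_pos|].
      eapply Rle_trans; [apply Rabs_triang|lra]. }
  set (N := INR (length (LE n))). assert (N0 : 0 <= N) by apply pos_INR.
  exists (/ m), ((1 + N * m) / kap). split; [now apply Rinv_0_lt_compat|].
  split; [apply Rdiv_lt_0_compat; auto; nra|]. intros r w hr hrr.
  assert (key : kap * dist n u0 (U r w) <= wd w0 w + N * (m * Rabs (r - r0))).
  { eapply Rle_trans; [now apply (expand r)|]. rewrite <- dist_toP. unfold N. rewrite <- sumL_const.
    unfold dist. rewrite <- sumL_plus. apply sumL_le. intros a ha. assert (ha' := ha). apply in_LE in ha'.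
    rewrite U_spec by auto. rewrite <- (U_spec r0 w0 a) by auto. fold u0.
    replace (toP n w a - Gam r u0 a) with ((toP n w a - Gam r0 u0 a) + (Gam r0 u0 a - Gam r u0 a)) by ring.
    eapply Rle_trans; [apply Rabs_triang|]. apply Rplus_le_compat_l.
    unfold Submission.Gam. destruct (le_dec n a); [destruct (lt_dec a (2 * n))|].
    - rewrite Rabs_minus_sym. apply hm; auto.
    - rewrite Rminus_diag, Rabs_R0. pose proof (Rabs_pos (r - r0)). nra.
    - rewrite Rminus_diag, Rabs_R0. pose proof (Rabs_pos (r - r0)). nra. }
  apply Rmult_le_reg_l with kap; auto. eapply Rle_trans; [exact key|].
  replace (kap * ((1 + N * m) / kap * (Rabs (r - r0) + wd w0 w))) with ((1 + N * m) * (Rabs (r - r0) + wd w0 w))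
    by (field; lra).
  pose proof (Rabs_pos (r - r0)).
  assert (0 <= wd w0 w) by (apply sumL_nonneg; intros; apply Rabs_pos).
  assert (0 <= N * m) by nra. nra.
Qed.

(** [Rh] has only a time derivative at the base point, and [U r w] moves by at most a multiple of
    the increments of [r] and [w], so the error of [Rh] is of higher order in these. *)
Lemma Fg_expansion r0 w0 eps : s <= r0 <= t -> 0 < eps -> exists d, 0 < d /\ forall r w, s <= r <= t ->
  Rabs (r - r0) < d -> near (LG n) d w0 w ->
  Rabs (Fg r w - Fg r0 w0 - sumL (LG n) (fun g => DFg r0 g w0 * (w g - w0 g)) - hdot r0 w0 * (r - r0)) <=
    eps * (Rabs (r - r0) + wd w0 w).
Proof.
  intros hr0 e0. destruct (U_near r0 w0 hr0) as [d1 [K [d10 [K0 hU]]]].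
  set (cx := fun i => DFg r0 (GX i) w0). set (cy := fun i => DFg r0 (GY i) w0). set (cz := DFg r0 GZ w0).
  set (v0 := st n r0 (U r0 w0)).
  destruct (C1_frechet Nat.eq_dec (LT n) _ _ v0 (seq_NoDup _ _) (C1_Rh cx cy cz) (eps / (K + 1))) as [d2 [d20 hd]];
    [apply Rdiv_lt_0_compat; lra|].
  set (N := INR (length (LG n))). assert (N0 : 0 <= N) by apply pos_INR.
  set (d := Rmin d1 (d2 / ((K + 1) * (N + 2)))).
  assert (q0 : 0 < (K + 1) * (N + 2)) by nra.
  assert (dpos : 0 < d) by (apply Rmin_pos; auto; now apply Rdiv_lt_0_compat).
  assert (db : (K + 1) * ((N + 1) * d) < d2).
  { apply Rle_lt_trans with ((K + 1) * ((N + 1) * (d2 / ((K + 1) * (N + 2))))).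
    - apply Rmult_le_compat_l; [lra|]. apply Rmult_le_compat_l; [lra|apply Rmin_r].
    - apply Rmult_lt_reg_r with (N + 2); [lra|].
      replace ((K + 1) * ((N + 1) * (d2 / ((K + 1) * (N + 2)))) * (N + 2)) with ((N + 1) * d2) by (field; lra). nra. }
  exists d. split; auto. intros r w hr hrr hw.
  set (v := st n r (U r w)).
  assert (hU' := hU r w hr ltac:(eapply Rlt_le_trans; [exact hrr|apply Rmin_l])).
  set (rho := Rabs (r - r0) + wd w0 w) in *.
  assert (wd0 : 0 <= wd w0 w) by (apply sumL_nonneg; intros; apply Rabs_pos).
  assert (a0 : 0 <= Rabs (r - r0)) by apply Rabs_pos.
  assert (rho0 : 0 <= rho) by (unfold rho; lra).
  assert (tot : sumL (LT n) (fun a => Rabs (v a - v0 a)) <= (K + 1) * rho).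
  { rewrite sumL_LT. unfold v, v0. rewrite !st_T.
    rewrite (sumL_ext (LE n) _ (fun a => Rabs (U r w a - U r0 w0 a)))
      by (intros a ha; apply in_LE in ha; now rewrite !st_E by auto).
    fold (dist n (U r0 w0) (U r w)). unfold rho in *. lra. }
  assert (rhod : rho <= (N + 1) * d).
  { unfold rho. assert (wd w0 w <= N * d).
    { apply sumL_bound. intros g hg. left. now apply hw. } lra. }
  assert (nr : near (LT n) d2 v0 v).
  { intros a ha. eapply Rle_lt_trans; [apply (sumL_term (LT n) (fun a => Rabs (v a - v0 a))); auto; intros; apply Rabs_pos|].
    eapply Rle_lt_trans; [exact tot|]. eapply Rle_lt_trans; [|exact db]. apply Rmult_le_compat_l; lra. }
  specialize (hd v nr).
  assert (E : sumL (LT n) (fun a => DRh cx cy cz a v0 * (v a - v0 a)) = hdot r0 w0 * (r - r0)).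
  { rewrite sumL_LT. rewrite sumL_zero.
    - unfold v0 at 1, cx, cy, cz. rewrite DRh_at by (auto; lia).
      destruct (Nat.eq_dec ti ti); [|congruence]. unfold v, v0. rewrite !st_T. ring.
    - intros a ha. apply in_LE in ha. unfold v0 at 1, cx, cy, cz. rewrite DRh_at by (auto; lia).
      destruct (Nat.eq_dec a ti); [lia|]. ring. }
  rewrite E in hd. unfold v, v0 in hd. rewrite !Rh_F in hd by auto.
  assert (E2 : sumL (LG n) (fun g => DFg r0 g w0 * (w g - w0 g)) =
    (cz * w GZ + sn (fun i => cx i * w (GX i)) + sn (fun i => cy i * w (GY i))) -
    (cz * w0 GZ + sn (fun i => cx i * w0 (GX i)) + sn (fun i => cy i * w0 (GY i)))).
  { rewrite sumL_LG. fold cz.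
    rewrite (sumL_ext (seq 0 n) (fun i => DFg r0 (GX i) w0 * _) (fun i => cx i * w (GX i) - cx i * w0 (GX i)))
      by (intros; unfold cx; ring).
    rewrite (sumL_ext (seq 0 n) (fun i => DFg r0 (GY i) w0 * _) (fun i => cy i * w (GY i) - cy i * w0 (GY i)))
      by (intros; unfold cy; ring).
    rewrite !sumL_minus. ring. }
  rewrite E2.
  match goal with |- Rabs ?x <= _ => match type of hd with Rabs ?y <= _ => replace x with y by ring end end.
  eapply Rle_trans; [exact hd|]. apply Rle_trans with (eps / (K + 1) * ((K + 1) * rho)).
  - apply Rmult_le_compat_l; [left; apply Rdiv_lt_0_compat; lra|exact tot].
  - right. field. lra.
Qed.

Lemma U_cont r a : s <= r <= t -> (a < 2 * n + 1)%nat -> contL (LG n) (fun w => U r w a).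
Proof.
  intros hr ha w e e0. set (N := INR (length (LG n))). assert (0 <= N) by apply pos_INR.
  exists (kap * e / (N + 1)). split; [apply Rdiv_lt_0_compat; nra|]. intros w' nr.
  apply Rmult_lt_reg_l with kap; auto.
  apply Rle_lt_trans with (kap * dist n (U r w) (U r w')).
  { apply Rmult_le_compat_l; [lra|]. apply (sumL_term (LE n) (fun a => Rabs (U r w' a - U r w a))); [now apply in_LE|].
    intros; apply Rabs_pos. }
  eapply Rle_lt_trans; [now apply U_lipschitz|].
  apply Rle_lt_trans with (N * (kap * e / (N + 1))).
  - apply sumL_bound. intros g hg. left. now apply nr.
  - apply Rmult_lt_reg_r with (N + 1); [lra|].
    replace (N * (kap * e / (N + 1)) * (N + 1)) with (N * (kap * e)) by (field; lra). nra.
Qed.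

Lemma cont_PhU r q j : s <= r <= t -> (j < 2 * n + 1)%nat -> contL (LG n) (fun w => Ph q (U r w) j).
Proof.
  intros hr hj w. apply (cont_comp (LG n) (LE n) (fun p => Ph q p j) (U r)); [now apply (cont_Ph n Ph D B fl)|].
  intros b hb. apply in_LE in hb. now apply U_cont.
Qed.

Lemma cont_cf q : contL (LE n) (cf n Ph D q).
Proof.
  intros p. unfold cf, aD. apply cont_minus; [apply (cont_D n Ph D B fl); lia|].
  apply cont_sumL. intros i hi. apply in_seq in hi.
  apply cont_mult; [apply (cont_Ph n Ph D B fl); lia|apply (cont_D n Ph D B fl); lia].
Qed.

Lemma cont_ratU r : s <= r <= t -> contL (LG n) (fun w => rat r (U r w)).
Proof.
  intros hr w.
  assert (c : forall q, cont_at (LG n) (fun w => cf n Ph D q (U r w)) w).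
  { intros q. apply (cont_comp (LG n) (LE n) (cf n Ph D q) (U r)); [apply cont_cf|].
    intros b hb. apply in_LE in hb. now apply U_cont. }
  apply cont_div; auto. pose proof (fl_cf n Ph D B fl s (U r w) s01). lra.
Qed.

Lemma Fg_C1f : C1f (LG n) (Fg t) (DFg t).
Proof.
  assert (ht : s <= t <= t) by lra.
  assert (cw : forall g w, In g (LG n) -> cont_at (LG n) (fun w => w g) w) by (intros; now apply cont_coord).
  split; [|split].
  - intros w. apply cont_plus; [apply cont_minus; [apply cont_PhU; auto; lia|apply cw; now apply in_LG]|].
    apply cont_sumL. intros i hi. apply in_seq in hi.
    apply cont_mult; [apply cw, in_LG; lia|]. apply cont_minus; [apply cw, in_LG; lia|apply cont_PhU; auto; lia].
  - intros g hg w. assert (hg' := hg). apply in_LG in hg. destruct g as [i|i|]; simpl.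
    + apply cont_minus; [apply cw, in_LG; lia|]. apply cont_mult; [now apply cont_ratU|apply cont_PhU; auto; lia].
    + apply cont_minus; [apply cw, in_LG; lia|apply cont_PhU; auto; lia].
    + apply cont_minus; [now apply cont_ratU|apply cont_const].
  - intros w0 eps e0. destruct (Fg_expansion t w0 eps ht e0) as [d [d0 hd]]. exists d. split; auto.
    intros w nr. specialize (hd t w ht). rewrite Rminus_diag, Rabs_R0, Rmult_0_r, Rplus_0_l, Rminus_0_r in hd.
    apply hd; auto.
Qed.

Lemma Fg_start w : Fg s w = 0.
Proof.
  assert (hs : s <= s <= t) by lra. unfold Fg. rewrite U_z by auto. rewrite sumL_zero; [ring|].
  intros i hi. apply in_seq in hi. rewrite U_x by (auto; lia). ring.
Qed.

(** For fixed [w] the derivative in [r] is the Hamiltonian, a Hamilton-Jacobi equation, and the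
    value at [r = s] is zero. *)
Lemma Fg_nonneg w : 0 <= Fg t w.
Proof.
  rewrite <- (Fg_start w).
  apply (monotone_on_interval (fun r => Fg r w) (fun r => hdot r w) s t); auto.
  - intros r0 hr0 eps e0. destruct (Fg_expansion r0 w eps hr0 e0) as [d [d0 hd]]. exists d. split; auto.
    intros r hr hrr. specialize (hd r w hr hrr (near_refl _ _ _ d0)).
    rewrite !sumL_zero in hd by (intros; rewrite Rminus_diag; try rewrite Rabs_R0; ring).
    rewrite Rminus_0_r, Rplus_0_r in hd. exact hd.
  - intros r hr. apply (fl_pos n Ph D B fl). lra.
Qed.

(** A zero is a minimum. This is how vanishing of the additional terms of an action will force the
    additional steps to do nothing. *)
Lemma Fg_zero_critical w g : Fg t w = 0 -> In g (LG n) -> DFg t g w = 0.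
Proof.
  intros F0 hg. destruct Fg_C1f as [_ [_ fr]].
  apply (frechet_minimum gidx_dec (LG n) (Fg t) w (fun g => DFg t g w)); auto using NoDup_LG.
  intros q. rewrite F0. apply Fg_nonneg.
Qed.

(** An image outside the ball is a fixed point, hence by injectivity equal to its preimage. *)
Lemma xyn_Ph r u : 0 <= r <= 1 -> xyn n u <= B -> xyn n (Ph r u) <= B.
Proof.
  intros hr hu. apply Rnot_lt_le. intros lt.
  assert (E : forall j, (j < 2 * n + 1)%nat -> Ph r u j = u j).
  { intros j hj. apply (Ph_inj n Ph D B fl r); auto. intros i hi. now apply (fl_supp n Ph D B fl). }
  assert (xyn n (Ph r u) = xyn n u); [|lra].
  apply sumL_ext. intros i hi. apply in_seq in hi. rewrite E by lia. reflexivity.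
Qed.

Lemma xyn_split p : xyn n p = sn (fun i => Rabs (p i)) + sn (fun i => Rabs (p (n + i)%nat)).
Proof.
  unfold xyn. replace (2 * n)%nat with (n + n)%nat by lia.
  rewrite seq_app, sumL_app, (sumL_shift _ (0 + n)). reflexivity.
Qed.

(** The radius doubles because [x] is read at one end of the step and [Y] at the other, each bounded
    by [B] when the trajectory is in the ball. *)
Lemma Fg_supp w : 2 * B < wnorm n w -> Fg t w = 0.
Proof.
  intros hw. assert (ht : s <= t <= t) by lra. set (u := U t w).
  destruct (Rlt_dec B (xyn n u)) as [out|inn].
  - unfold Fg. fold u.
    assert (Et : forall j, (j < 2 * n + 1)%nat -> Ph t u j = Ph s u j).
    { intros j hj. rewrite !(fl_supp n Ph D B fl) by auto. reflexivity. }
    rewrite Et by lia. unfold u at 1. rewrite U_z by auto. rewrite sumL_zero; [ring|].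
    intros i hi. apply in_seq in hi. rewrite Et by lia. unfold u. rewrite U_x by (auto; lia). ring.
  - exfalso. pose proof (xyn_Ph s u s01 ltac:(lra)) as h1. pose proof (xyn_Ph t u t01 ltac:(lra)) as h2.
    rewrite xyn_split in h1, h2.
    assert (e1 : sn (fun i => Rabs (Ph s u i)) = sn (fun i => Rabs (w (GX i)))).
    { apply sumL_ext. intros i hi. apply in_seq in hi. unfold u. rewrite U_x by (auto; lia). reflexivity. }
    assert (e2 : sn (fun i => Rabs (Ph t u (n + i)%nat)) = sn (fun i => Rabs (w (GY i)))).
    { apply sumL_ext. intros i hi. apply in_seq in hi. unfold u. rewrite U_y by (auto; lia). reflexivity. }
    assert (0 <= sn (fun i => Rabs (Ph s u (n + i)%nat))) by (apply sumL_nonneg; intros; apply Rabs_pos).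
    assert (0 <= sn (fun i => Rabs (Ph t u i))) by (apply sumL_nonneg; intros; apply Rabs_pos).
    unfold wnorm in hw. rewrite sumL_plus in hw. lra.
Qed.

Lemma U_tick w k a : (a < 2 * n + 1)%nat -> U t (tick w k) a = zshift n (U t w) k a.
Proof.
  intros ha. assert (ht : s <= t <= t) by lra.
  assert (Z : dist n (U t (tick w k)) (zshift n (U t w) k) <= 0).
  { apply Rmult_le_reg_l with kap; auto. rewrite Rmult_0_r. eapply Rle_trans; [now apply (expand t)|].
    right. apply sumL_zero. intros b hb. apply in_LE in hb. rewrite U_spec by auto.
    assert (E : Gam t (zshift n (U t w) k) b = zshift n (toP n w) k b).
    { transitivity (zshift n (Gam t (U t w)) k b).
      - unfold Submission.Gam. rewrite !(fl_per n Ph D B fl) by auto. unfold zshift.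
        destruct (Nat.eq_dec b (2 * n)), (le_dec n b); auto; destruct (lt_dec b (2 * n)); auto.
      - unfold zshift. rewrite !U_spec by auto. reflexivity. }
    rewrite E. assert (E2 : zshift n (toP n w) k b = toP n (tick w k) b).
    { unfold zshift, toP. destruct (Nat.eq_dec b (2 * n)); destruct (lt_dec b n); try lia;
        destruct (lt_dec b (2 * n)); try lia; reflexivity. }
    rewrite E2, Rminus_diag. apply Rabs_R0. }
  assert (Rabs (zshift n (U t w) k a - U t (tick w k) a) <= 0).
  { eapply Rle_trans; [|exact Z].
    apply (sumL_term (LE n) (fun a => Rabs (zshift n (U t w) k a - U t (tick w k) a))); [now apply in_LE|].
    intros; apply Rabs_pos. }
  destruct (Req_dec (zshift n (U t w) k a - U t (tick w k) a) 0) as [|ne]; [lra|].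
  apply Rabs_pos_lt in ne. lra.
Qed.

Lemma Ph_U_tick q w k j : 0 <= q <= 1 -> (j < 2 * n + 1)%nat ->
  Ph q (U t (tick w k)) j = zshift n (Ph q (U t w)) k j.
Proof.
  intros hq hj. rewrite <- (fl_per n Ph D B fl) by auto.
  apply (f_equal (fun p : pt => p j)), (fl_ext n Ph D B fl). intros a ha. now apply U_tick.
Qed.

Lemma zshift_lt p k j : (j < 2 * n)%nat -> zshift n p k j = p j.
Proof. intros. unfold zshift. destruct (Nat.eq_dec j (2 * n)); auto; lia. Qed.

Lemma cf_U_tick q w k : 0 <= q <= 1 -> cf n Ph D q (U t (tick w k)) = cf n Ph D q (U t w).
Proof.
  intros hq. transitivity (cf n Ph D q (zshift n (U t w) k)).
  - apply (cont_ext (LE n)); [apply cont_cf|]. intros a ha. apply in_LE in ha. now apply U_tick.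
  - unfold cf, aD. rewrite (D_zshift n Ph D B fl) by (auto; lia). f_equal. apply sumL_ext.
    intros i hi. apply in_seq in hi. rewrite (D_zshift n Ph D B fl), (fl_per n Ph D B fl) by (auto; lia).
    rewrite zshift_lt by lia. reflexivity.
Qed.

Lemma Fg_tick w k : Fg t (tick w k) = Fg t w.
Proof.
  unfold Fg. rewrite Ph_U_tick by (auto; lia). simpl tick. unfold zshift at 1.
  destruct (Nat.eq_dec zi zi); [|congruence].
  f_equal; [ring|]. apply sumL_ext. intros i hi. apply in_seq in hi.
  rewrite Ph_U_tick, zshift_lt by (auto; lia). reflexivity.
Qed.

Lemma DFg_tick w k g : In g (LG n) -> DFg t g (tick w k) = DFg t g w.
Proof.
  intros hg. apply in_LG in hg. unfold DFg, rat.
  destruct g as [i|i|]; rewrite ?(cf_U_tick t), ?(cf_U_tick s) by auto; simpl tick; auto;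
    rewrite Ph_U_tick, zshift_lt by (auto; lia); reflexivity.
Qed.

Lemma bound_family (f : nat -> (gidx -> R) -> R) :
  (forall i, (i < n)%nat -> contL (LG n) (f i)) ->
  (forall i w k, (i < n)%nat -> f i (tick w k) = f i w) ->
  (forall i w, (i < n)%nat -> 2 * B < wnorm n w -> f i w = 0) ->
  exists m, 0 < m /\ forall i w, (i < n)%nat -> Rabs (f i w) <= m.
Proof.
  intros h1 h2 h3. destruct (list_bound (seq 0 n) (fun i m => forall w, Rabs (f i w) <= m)) as [m [m0 hm]].
  - intros i x y h xy w. eapply Rle_trans; [apply h|auto].
  - intros i hi. apply in_seq in hi. apply (periodic_bounded_LG n (2 * B) (f i) 0).
    + apply h1; lia.
    + intros; apply h2; lia.
    + intros; apply h3; auto; lia.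
  - exists m. split; auto. intros i w hi. apply hm. apply in_seq; lia.
Qed.

(** Each quantity is continuous, periodic and constant far out, hence bounded; bounding the
    reciprocal of the conformal factor gives [lam]. *)
Theorem step_generating : exists C lam Lam, 0 <= C /\ 0 < lam <= 1 /\ 1 <= Lam /\
  step_bounds n C lam Lam (2 * B) (Fg t) (DFg t).
Proof.
  assert (ht : s <= t <= t) by lra.
  assert (Dsupp : forall w g, 2 * B < wnorm n w -> In g (LG n) -> DFg t g w = 0)
    by (intros; apply Fg_zero_critical; auto using Fg_supp).
  assert (rp : forall w, 0 < 1 + DFg t GZ w).
  { intros w. simpl. pose proof (rat_pos t (U t w) ht). lra. }
  destruct Fg_C1f as [cF [cD fr]].
  assert (iZ : In GZ (LG n)) by (now apply in_LG).
  destruct (periodic_bounded_LG n (2 * B) (Fg t) 0 cF Fg_tick Fg_supp) as [C1 [C10 b1]].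
  destruct (bound_family (fun i => DFg t (GY i))) as [C2 [C20 b2]].
  { intros i hi. apply cD. now apply in_LG. }
  { intros i w k hi. apply DFg_tick. now apply in_LG. }
  { intros i w hi hw. apply Dsupp; auto. now apply in_LG. }
  destruct (bound_family (fun i w => w (GY i) - (w (GY i) - DFg t (GX i) w) / (1 + DFg t GZ w))) as [C3 [C30 b3]].
  { intros i hi w. assert (cont_at (LG n) (fun w : gidx -> R => w (GY i)) w) by (apply (cont_coord (LG n)); now apply in_LG).
    apply cont_minus; auto. apply cont_div; [specialize (rp w); lra| |].
    - apply cont_minus; auto. apply cD. now apply in_LG.
    - apply cont_plus; [apply cont_const|]. now apply cD. }
  { intros i w k hi. rewrite !DFg_tick by (apply in_LG; auto). reflexivity. }
  { intros i w hi hw. rewrite !Dsupp by (auto; apply in_LG; auto). field. }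
  destruct (periodic_bounded_LG n (2 * B) (fun w => 1 + DFg t GZ w) 1) as [C4 [C40 b4]].
  { intros w. apply cont_plus; [apply cont_const|now apply cD]. }
  { intros w k. now rewrite DFg_tick. }
  { intros w hw. rewrite Dsupp by auto. ring. }
  destruct (periodic_bounded_LG n (2 * B) (fun w => / (1 + DFg t GZ w)) 1) as [C5 [C50 b5]].
  { intros w. apply cont_inv; [specialize (rp w); lra|]. apply cont_plus; [apply cont_const|now apply cD]. }
  { intros w k. now rewrite DFg_tick. }
  { intros w hw. rewrite Dsupp by auto. rewrite Rplus_0_r. apply Rinv_1. }
  exists (C1 + C2 + C3), (/ (C5 + 1)), (C4 + 1).
  split; [lra|]. split.
  { split; [apply Rinv_0_lt_compat; lra|]. rewrite <- Rinv_1. apply Rinv_le_contravar; lra. }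
  split; [lra|]. constructor.
  - exact Fg_C1f.
  - intros w. split; [apply Fg_nonneg|]. specialize (b1 w). pose proof (RRle_abs (Fg t w)). lra.
  - intros w i hi. specialize (b2 i w hi). simpl in *. lra.
  - intros w. specialize (b4 w). specialize (b5 w). specialize (rp w). split.
    + rewrite <- (Rinv_inv (1 + DFg t GZ w)). apply Rinv_le_contravar; [now apply Rinv_0_lt_compat|].
      pose proof (RRle_abs (/ (1 + DFg t GZ w))). lra.
    + pose proof (RRle_abs (1 + DFg t GZ w)). lra.
  - intros w i hi. specialize (b3 i w hi). cbv beta in b3. lra.
  - exact Fg_tick.
  - intros w k g hg. now apply DFg_tick.
  - exact Fg_supp.
  - intros w g hw hg. now apply Dsupp.
Qed.

Lemma step_point w : exists u,
  (forall i, (i < n)%nat -> Ph s u i = w (GX i) /\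
     Ph s u (n + i)%nat = (w (GY i) - DFg t (GX i) w) / (1 + DFg t GZ w) /\
     Ph t u i = w (GX i) - DFg t (GY i) w /\ Ph t u (n + i)%nat = w (GY i)) /\
  Ph s u zi = w GZ /\
  Ph t u zi = w GZ + Fg t w - sn (fun i => w (GY i) * DFg t (GY i) w) /\
  cf n Ph D t u = (1 + DFg t GZ w) * cf n Ph D s u.
Proof.
  assert (ht : s <= t <= t) by lra. exists (U t w).
  pose proof (rat_pos t (U t w) ht) as rp.
  split; [|split; [|split]].
  - intros i hi. repeat split.
    + now apply U_x.
    + simpl. field. lra.
    + simpl. ring.
    + now apply U_y.
  - now apply U_z.
  - unfold Fg. simpl. ring.
  - simpl. unfold rat. pose proof (fl_cf n Ph D B fl s (U t w) s01). field. lra.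
Qed.
End Step.

(** * The spectrum of the iterates *)

Lemma step_bounds_mono n C lam Lam B F DF C' lam' Lam' : 0 < lam' ->
  C <= C' -> lam' <= lam -> Lam <= Lam' ->
  step_bounds n C lam Lam B F DF -> step_bounds n C' lam' Lam' B F DF.
Proof.
  intros l0 h1 h2 h3 [a b c d e f g h i]. constructor; auto.
  - intros w. specialize (b w). lra.
  - intros w k hk. specialize (c w k hk). lra.
  - intros w. specialize (d w). lra.
  - intros w k hk. specialize (e w k hk). lra.
Qed.

Lemma step_bounds_zero n C lam Lam B : 0 <= C -> 0 < lam <= 1 -> 1 <= Lam ->
  step_bounds n C lam Lam B (fun _ => 0) (fun _ _ => 0).
Proof.
  intros h1 h2 h3. constructor; intros; auto; rewrite ?Rabs_R0; try lra.
  - split; [intros p; apply cont_const|]. split; [intros a _ p; apply cont_const|].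
    intros p e e0. exists 1. split; [lra|]. intros q _. rewrite sumL_zero by (intros; ring).
    rewrite !Rminus_0_r, Rabs_R0. apply Rmult_le_pos; [lra|]. apply sumL_nonneg. intros; apply Rabs_pos.
  - replace (w (GY i) - (w (GY i) - 0) / (1 + 0)) with 0 by field. rewrite Rabs_R0. auto.
Qed.

Section Chain.
Variables (n : nat) (Ph : R -> pt -> pt) (D : nat -> nat -> pt -> R) (B : R).
Hypothesis fl : flow n Ph D B.
Hypothesis npos : (0 < n)%nat.
Hypothesis nontrivial : exists p j, (j < 2 * n + 1)%nat /\ Ph 1 p j <> p j.
Notation zi := (2 * n)%nat.
Notation sn := (sumL (seq 0 n)).
Notation cf := (cf n Ph D).

(** What orbits need from a step: each argument [w] comes from a point [u] whose images at times [s]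
    and [t] are the two ends of the step, and zeros of [F] are critical. *)
Definition step_fact (s t : R) (F : (gidx -> R) -> R) (DF : gidx -> (gidx -> R) -> R) : Prop :=
  (forall w, exists u,
    (forall i, (i < n)%nat -> Ph s u i = w (GX i) /\
       Ph s u (n + i)%nat = (w (GY i) - DF (GX i) w) / (1 + DF GZ w) /\
       Ph t u i = w (GX i) - DF (GY i) w /\ Ph t u (n + i)%nat = w (GY i)) /\
    Ph s u zi = w GZ /\
    Ph t u zi = w GZ + F w - sn (fun i => w (GY i) * DF (GY i) w) /\
    cf t u = (1 + DF GZ w) * cf s u) /\
  (forall w g, F w = 0 -> In g (LG n) -> DF g w = 0).

Lemma steps_exist : exists N Fs DFs C lam Lam, (0 < N)%nat /\ 0 <= C /\ 0 < lam <= 1 /\ 1 <= Lam /\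
  forall i, (i < N)%nat -> step_bounds n C lam Lam (2 * B) (Fs i) (DFs i) /\
    step_fact (INR i / INR N) (INR (S i) / INR N) (Fs i) (DFs i).
Proof.
  destruct (subdivision n Ph D B fl) as [N [N0 ug]]. exists N.
  assert (one : forall i, (i < N)%nat -> exists F DF C lam Lam, 0 <= C /\ 0 < lam <= 1 /\ 1 <= Lam /\
    step_bounds n C lam Lam (2 * B) F DF /\ step_fact (INR i / INR N) (INR (S i) / INR N) F DF).
  { intros i hi. destruct (ug i hi) as [hs [ht [kap [k0 ex]]]].
    assert (le : INR i / INR N <= INR (S i) / INR N).
    { apply Rmult_le_compat_r; [left; now apply Rinv_0_lt_compat, lt_0_INR|]. apply le_INR. lia. }
    destruct (step_generating n Ph D B fl _ _ kap hs ht le k0 ex) as [C [lam [Lam [h1 [h2 [h3 h4]]]]]].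
    eexists _, _, C, lam, Lam. do 4 (split; [eassumption|]). split.
    - intros w. eapply step_point; eauto.
    - intros w g. eapply Fg_zero_critical; eauto. }
  assert (all : forall m, (m <= N)%nat -> exists Fs DFs C lam Lam, 0 <= C /\ 0 < lam <= 1 /\ 1 <= Lam /\
    forall i, (i < m)%nat -> step_bounds n C lam Lam (2 * B) (Fs i) (DFs i) /\
    step_fact (INR i / INR N) (INR (S i) / INR N) (Fs i) (DFs i)).
  { induction m as [|m IH]; intros hm.
    - exists (fun _ _ => 0), (fun _ _ _ => 0), 0, 1, 1. repeat split; try lra; intros; lia.
    - destruct (IH ltac:(lia)) as [Fs [DFs [C [lam [Lam [h1 [h2 [h3 h4]]]]]]]].
      destruct (one m ltac:(lia)) as [F [DF [C' [lam' [Lam' [k1 [k2 [k3 [k4 k5]]]]]]]]].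
      exists (fun i => if Nat.eq_dec i m then F else Fs i), (fun i => if Nat.eq_dec i m then DF else DFs i),
        (Rmax C C'), (Rmin lam lam'), (Rmax Lam Lam').
      pose proof (Rmax_l C C'). pose proof (Rmax_r C C'). pose proof (Rmin_l lam lam'). pose proof (Rmin_r lam lam').
      pose proof (Rmax_l Lam Lam'). pose proof (Rmax_r Lam Lam').
      assert (0 < Rmin lam lam') by (apply Rmin_pos; lra).
      split; [lra|]. split; [lra|]. split; [lra|]. intros i hi. destruct (Nat.eq_dec i m) as [->|ne].
      + split; auto. now apply (step_bounds_mono n C' lam' Lam').
      + destruct (h4 i ltac:(lia)). split; auto. now apply (step_bounds_mono n C lam Lam). }
  destruct (all N (le_n N)) as [Fs [DFs [C [lam [Lam h]]]]]. exists Fs, DFs, C, lam, Lam. tauto.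
Qed.

Lemma D_initial j a p : (j < 2 * n + 1)%nat -> (a < 2 * n + 1)%nat ->
  D j a (st n 0 p) = if Nat.eq_dec a j then 1 else 0.
Proof.
  intros hj ha. apply (uniqueness_limite (fun s => Ph 0 (updn p a s) j) (p a)).
  - now apply (D_space n Ph D B fl).
  - eapply (derivable_eq (fun s => updn p a s j));
      [|intros s; symmetry; apply (fl_0 n Ph D B fl); exact hj|reflexivity].
    unfold upd. destruct (Nat.eq_dec a j); [apply derivable_pt_lim_id|apply derivable_pt_lim_const].
Qed.

Lemma cf_initial p : cf 0 p = 1.
Proof.
  unfold Submission.cf, aD. rewrite D_initial by lia. destruct (Nat.eq_dec zi zi); [|congruence].
  rewrite sumL_zero; [ring|]. intros i hi. apply in_seq in hi. rewrite D_initial by lia.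
  destruct (Nat.eq_dec zi i); [lia|ring].
Qed.

Lemma cf_ext t p q : (forall a, (a < 2 * n + 1)%nat -> p a = q a) -> cf t p = cf t q.
Proof.
  intros E. apply (cont_ext (LE n)); [apply (cont_cf n Ph D B fl)|]. intros a ha. apply E. now apply in_LE.
Qed.

Lemma LE_cases (P : nat -> Prop) : (forall i, (i < n)%nat -> P i) -> (forall i, (i < n)%nat -> P (n + i)%nat) ->
  P zi -> forall a, (a < 2 * n + 1)%nat -> P a.
Proof.
  intros h1 h2 h3 a ha. destruct (lt_dec a n) as [l|l]; [auto|].
  destruct (lt_dec a (2 * n)) as [l2|l2].
  - replace a with (n + (a - n))%nat by lia. apply h2. lia.
  - replace a with zi by lia. auto.
Qed.

(** * Iterates with a common number of steps *)

Section Blocks.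
Variables (N : nat) (Fs : nat -> (gidx -> R) -> R) (DFs : nat -> gidx -> (gidx -> R) -> R) (C lam Lam : R).
Hypothesis (Npos : (0 < N)%nat) (C0 : 0 <= C) (lam01 : 0 < lam <= 1) (Lam1 : 1 <= Lam).
Hypothesis steps : forall i, (i < N)%nat -> step_bounds n C lam Lam (2 * B) (Fs i) (DFs i) /\
    step_fact (INR i / INR N) (INR (S i) / INR N) (Fs i) (DFs i).
Variable L : nat.
Hypothesis Lpos : (0 < L)%nat.
Notation M := (L * N)%nat.

(** Of [L] blocks of [N] steps the first [k] run the isotopy and the others are idle, so that all
    iterates up to [L] share their variables; step [M] is the extra one. *)
Definition FK (K : R -> R) (k j : nat) : (gidx -> R) -> R :=
  if lt_dec j M then if lt_dec j (k * N) then Fs (j mod N) else fun _ => 0 else kF K.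
Definition DFK (K' : R -> R) (k j : nat) : gidx -> (gidx -> R) -> R :=
  if lt_dec j M then if lt_dec j (k * N) then DFs (j mod N) else fun _ _ => 0 else kDF K'.

Lemma ksteps_FK K K' CK k : (forall y, 0 <= K y <= CK) -> (forall y, derivable_pt_lim K y (K' y)) ->
  (forall y, continuity_pt K' y) ->
  ksteps n M C lam Lam (2 * B) CK K K' (FK K k) (DFK K' k).
Proof.
  intros h1 h2 h3. constructor; auto.
  - apply Nat.mul_pos_pos; auto.
  - pose proof (fl_B n Ph D B fl). lra.
  - intros j hj. unfold FK, DFK. destruct (lt_dec j M); [|lia]. destruct (lt_dec j (k * N)).
    + apply steps. apply Nat.mod_upper_bound. lia.
    + now apply step_bounds_zero.
  - unfold FK. destruct (lt_dec M M); auto; lia.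
  - unfold DFK. destruct (lt_dec M M); auto; lia.
Qed.

(** * Critical points as orbits of the iterate *)

Section Critical.
Variables (K K' : R -> R) (CK : R) (k : nat) (u : cidx -> R).
Hypothesis (HK : forall y, 0 <= K y <= CK) (HK' : forall y, derivable_pt_lim K y (K' y))
  (HKc : forall y, continuity_pt K' y) (kL : (k <= L)%nat).
Notation F := (FK K k).
Notation DF := (DFK K' k).
Hypothesis crit : forall W, dact n M F DF u W = 0.
Notation DFa := (DFa n M F DF u).
Notation eta := (eta n M F DF u).
Notation zz := (zz n M F u).
Notation prho := (prho n M F DF u).

Lemma Mpos : (0 < M)%nat.
Proof. apply Nat.mul_pos_pos; auto. Qed.

Lemma rho_pos j : (j <= M)%nat -> 0 < 1 + DFa j GZ.
Proof.
  intros hj. pose proof (ksteps_FK K K' CK k HK HK' HKc) as HS.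
  destruct (Nat.eq_dec j M) as [->|ne].
  - unfold Submission.DFa. rewrite (ks_DF _ _ _ _ _ _ _ _ _ _ _ HS). simpl. lra.
  - pose proof (sb_rho _ _ _ _ _ _ _ (ks_steps _ _ _ _ _ _ _ _ _ _ _ HS j ltac:(lia))
      (arg u j (zz j))). unfold Submission.DFa. lra.
Qed.

(** The point of [R^(2n+1)] at which step [j] starts. *)
Definition chain (j : nat) : pt :=
  fun a => if lt_dec a n then u (CX j a) else if lt_dec a (2 * n) then eta j (a - n) else zz j.

Lemma chain_x j i : (i < n)%nat -> chain j i = u (CX j i).
Proof. intros. unfold chain. destruct (lt_dec i n); auto; lia. Qed.
Lemma chain_y j i : (i < n)%nat -> chain j (n + i) = eta j i.
Proof.
  intros. unfold chain. destruct (lt_dec (n + i) n); [lia|]. destruct (lt_dec (n + i) (2 * n)); [|lia].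
  f_equal. lia.
Qed.
Lemma chain_z j : chain j zi = zz j.
Proof. unfold chain. destruct (lt_dec zi n); [lia|]. destruct (lt_dec zi zi); auto; lia. Qed.

Lemma next_x j i : (j < M)%nat -> (i < n)%nat -> u (CX (S j) i) = u (CX j i) - DFa j (GY i).
Proof.
  intros hj hi. pose proof (crit_x n M F DF u Mpos rho_pos crit j i ltac:(lia) hi) as e.
  unfold aa, nx in e. destruct (Nat.eq_dec j M); [lia|]. lra.
Qed.
Lemma next_y j i : (j < M)%nat -> (i < n)%nat -> eta (S j) i = u (CY j i).
Proof. intros hj hi. symmetry. now apply (crit_y n M F DF u Mpos rho_pos crit). Qed.
Lemma next_z j : (j < M)%nat -> zz (S j) = zz j + F j (arg u j (zz j)) - sn (fun i => u (CY j i) * DFa j (GY i)).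
Proof.
  intros hj. cbn [Submission.zz]. unfold Rminus. f_equal.
  replace (- sn (fun i => u (CY j i) * DFa j (GY i))) with (-1 * sn (fun i => u (CY j i) * DFa j (GY i))) by ring.
  rewrite <- sumL_scal. apply sumL_ext. intros i hi. apply in_seq in hi.
  rewrite (crit_x n M F DF u Mpos rho_pos crit) by lia. ring.
Qed.

Lemma chain_step j : (j < k * N)%nat -> exists v,
  (forall a, (a < 2 * n + 1)%nat -> Ph (INR (j mod N) / INR N) v a = chain j a) /\
  (forall a, (a < 2 * n + 1)%nat -> Ph (INR (S (j mod N)) / INR N) v a = chain (S j) a) /\
  cf (INR (S (j mod N)) / INR N) v = (1 + DFa j GZ) * cf (INR (j mod N) / INR N) v.
Proof.
  intros hj. assert (jM : (j < M)%nat) by nia.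
  destruct (steps (j mod N) ltac:(apply Nat.mod_upper_bound; lia)) as [_ [sp _]].
  assert (EF : F j = Fs (j mod N)) by (unfold FK; destruct (lt_dec j M); [|lia]; destruct (lt_dec j (k * N)); auto; lia).
  assert (ED : DF j = DFs (j mod N)) by (unfold DFK; destruct (lt_dec j M); [|lia]; destruct (lt_dec j (k * N)); auto; lia).
  destruct (sp (arg u j (zz j))) as [v [h1 [h2 [h3 h4]]]]. exists v.
  rewrite <- EF, <- ED in *. split; [|split].
  - apply LE_cases.
    + intros i hi. rewrite chain_x by auto. now apply h1.
    + intros i hi. rewrite chain_y by auto. now apply h1.
    + rewrite chain_z. exact h2.
  - apply LE_cases.
    + intros i hi. rewrite chain_x, next_x by auto. now apply h1.
    + intros i hi. rewrite chain_y, next_y by auto. now apply h1.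
    + rewrite chain_z, next_z by auto. exact h3.
  - exact h4.
Qed.

Lemma chain_idle j a : (k * N <= j)%nat -> (j < M)%nat -> (a < 2 * n + 1)%nat -> chain (S j) a = chain j a.
Proof.
  intros h1 h2. assert (EF : F j = fun _ => 0) by (unfold FK; destruct (lt_dec j M); [|lia]; destruct (lt_dec j (k * N)); auto; lia).
  assert (ED : forall g, DFa j g = 0).
  { intros g. unfold Submission.DFa, DFK. destruct (lt_dec j M); [|lia]. destruct (lt_dec j (k * N)); auto; lia. }
  revert a. apply LE_cases.
  - intros i hi. rewrite !chain_x, next_x, ED by auto. ring.
  - intros i hi. rewrite !chain_y, next_y by auto. unfold Submission.eta. rewrite !ED. field.
  - rewrite !chain_z, next_z, EF by auto. rewrite sumL_zero; [ring|]. intros. rewrite ED. ring.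
Qed.

(** Consecutive steps share an end point, so injectivity of the map at time [i / N] identifies the
    point behind step [i] with the start of the block. *)
Lemma chain_block b i : (b < k)%nat -> (i <= N)%nat ->
  (forall a, (a < 2 * n + 1)%nat -> Ph (INR i / INR N) (chain (b * N)) a = chain (b * N + i) a) /\
  prho (b * N + i) = prho (b * N) * cf (INR i / INR N) (chain (b * N)).
Proof.
  intros hb. assert (Nr : 0 < INR N) by (now apply lt_0_INR).
  induction i as [|i IH]; intros hi.
  - rewrite Nat.add_0_r. replace (INR 0 / INR N) with 0 by (simpl; field; lra). split.
    + intros a ha. now apply (fl_0 n Ph D B fl).
    + rewrite cf_initial. ring.
  - destruct (IH ltac:(lia)) as [h1 h2].
    assert (jk : (b * N + i < k * N)%nat) by nia.
    destruct (chain_step (b * N + i) jk) as [v [e1 [e2 e3]]].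
    assert (Em : ((b * N + i) mod N = i)%nat).
    { rewrite Nat.add_comm, Nat.Div0.mod_add. apply Nat.mod_small. lia. }
    rewrite Em in *.
    assert (ht : 0 <= INR i / INR N <= 1).
    { split; [apply Rmult_le_pos; [apply pos_INR|left; now apply Rinv_0_lt_compat]|].
      apply Rmult_le_reg_r with (INR N); auto. unfold Rdiv. rewrite Rmult_assoc, Rinv_l, Rmult_1_r, Rmult_1_l by lra.
      apply le_INR. lia. }
    assert (Ev : forall a, (a < 2 * n + 1)%nat -> v a = chain (b * N) a).
    { apply (Ph_inj n Ph D B fl (INR i / INR N)); auto. intros j hj. rewrite e1, h1; auto. }
    replace (b * N + S i)%nat with (S (b * N + i)) by lia. split.
    + intros a ha. rewrite <- e2 by auto. apply (f_equal (fun q : pt => q a)), (fl_ext n Ph D B fl).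
      intros; symmetry; auto.
    + cbn [Submission.prho]. rewrite h2.
      rewrite <- (cf_ext (INR (S i) / INR N) v (chain (b * N))) by auto.
      rewrite e3, (cf_ext (INR i / INR N) v (chain (b * N))) by auto. ring.
Qed.

Definition phi (p : pt) : pt := Ph 1 p.
Fixpoint cprod (m : nat) (p : pt) : R :=
  match m with O => 1 | S m => cf 1 (Nat.iter m phi p) * cprod m p end.

Lemma chain_iter b : (b <= k)%nat ->
  (forall a, (a < 2 * n + 1)%nat -> Nat.iter b phi (chain 0) a = chain (b * N) a) /\
  prho (b * N) = cprod b (chain 0).
Proof.
  assert (Nr : 0 < INR N) by (now apply lt_0_INR).
  induction b as [|b IH]; intros hb; [split; reflexivity|].
  destruct (IH ltac:(lia)) as [h1 h2]. destruct (chain_block b N ltac:(lia) (le_n N)) as [e1 e2].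
  replace (INR N / INR N) with 1 in * by (field; lra).
  replace (S b * N)%nat with (b * N + N)%nat by lia. split.
  - intros a ha. simpl. rewrite <- e1 by auto. apply (f_equal (fun q : pt => q a)), (fl_ext n Ph D B fl). auto.
  - rewrite e2, h2. cbn [cprod]. rewrite (cf_ext _ _ _ h1). ring.
Qed.

Lemma chain_end a : (a < 2 * n + 1)%nat -> Nat.iter k phi (chain 0) a = chain M a.
Proof.
  intros ha. destruct (chain_iter k (le_n k)) as [h _]. rewrite h by auto.
  assert (E : forall d, (k * N + d <= M)%nat -> chain (k * N + d) a = chain (k * N) a).
  { induction d as [|d IH]; intros hd; [now rewrite Nat.add_0_r|].
    rewrite <- IH by lia. replace (k * N + S d)%nat with (S (k * N + d)) by lia. apply chain_idle; auto; lia. }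
  assert (k * N <= M)%nat by nia. rewrite <- (E (M - k * N)%nat) by lia. f_equal. lia.
Qed.

(** Idle steps and the extra step have conformal factor 1, so [crit_rho] concerns the [k] blocks
    only. *)
Lemma cprod_one : cprod k (chain 0) = 1.
Proof.
  destruct (chain_iter k (le_n k)) as [_ h]. rewrite <- h.
  pose proof (crit_rho n M F DF u Mpos crit) as e. cbn [Submission.prho] in e.
  assert (EM : DFa M GZ = 0).
  { unfold Submission.DFa, DFK. destruct (lt_dec M M); [lia|]. reflexivity. }
  rewrite EM in e.
  assert (E : forall d, (k * N + d <= M)%nat -> prho (k * N + d) = prho (k * N)).
  { induction d as [|d IH]; intros hd; [now rewrite Nat.add_0_r|].
    replace (k * N + S d)%nat with (S (k * N + d)) by lia. cbn [Submission.prho]. rewrite IH by lia.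
    assert (Z : DFa (k * N + d) GZ = 0).
    { unfold Submission.DFa, DFK. destruct (lt_dec (k * N + d) M); [|lia].
      destruct (lt_dec (k * N + d) (k * N)); [lia|reflexivity]. }
    rewrite Z. ring. }
  assert (k * N <= M)%nat by nia. rewrite <- (E (M - k * N)%nat) by lia.
  replace (k * N + (M - k * N))%nat with M by lia. lra.
Qed.

Lemma last_D i : DFa M (GY i) = match i with O => K' (u (CY M 0)) | _ => 0 end.
Proof. unfold Submission.DFa, DFK. destruct (lt_dec M M); [lia|]. now destruct i. Qed.

Lemma return_y i : (i < n)%nat -> Nat.iter k phi (chain 0) (n + i)%nat = chain 0 (n + i).
Proof.
  intros hi. rewrite chain_end, !chain_y by lia.
  rewrite <- (crit_closing n M F DF u Mpos rho_pos crit) by auto.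
  unfold Submission.eta. assert (E : forall g, DFa M g = match g with GY 0 => K' (u (CY M 0)) | _ => 0 end).
  { intros g. unfold Submission.DFa, DFK. destruct (lt_dec M M); [lia|]. now destruct g as [|[]|]. }
  rewrite !E. field.
Qed.
(** The iterate is followed by the extra step before the trajectory closes up, hence the correction
    by [K']. *)
Lemma return_x i : (i < n)%nat -> chain 0 i = Nat.iter k phi (chain 0) i -
  match i with O => K' (chain 0 n) | _ => 0 end.
Proof.
  intros hi. rewrite chain_end, !chain_x by lia.
  pose proof (crit_x n M F DF u Mpos rho_pos crit M i (le_n _) hi) as e.
  unfold aa, nx in e. destruct (Nat.eq_dec M M); [|lia]. rewrite last_D in e.
  replace (K' (chain 0 n)) with (K' (u (CY M 0))); [destruct i; lra|].
  f_equal. pose proof (chain_y 0 0 npos) as c. rewrite Nat.add_0_r in c. rewrite c.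
  now apply (crit_closing n M F DF u Mpos rho_pos crit).
Qed.
Lemma return_z : (forall y, K y = 0) -> (forall y, K' y = 0) ->
  Nat.iter k phi (chain 0) zi = chain 0 zi + act n M F u.
Proof.
  intros k0 k0'. rewrite chain_end, !chain_z by lia. unfold act. cbn [Submission.zz].
  assert (EF : F M = kF K) by (unfold FK; destruct (lt_dec M M); [lia|reflexivity]).
  rewrite EF. unfold kF. rewrite k0. rewrite (sumL_zero (seq 0 n)); [ring|].
  intros i hi. apply in_seq in hi. rewrite (crit_x n M F DF u Mpos rho_pos crit) by lia.
  rewrite last_D. rewrite k0'. destruct i; ring.
Qed.
End Critical.

Lemma iter_fixed m p : (forall a, (a < 2 * n + 1)%nat -> Ph 1 p a = p a) ->
  forall a, (a < 2 * n + 1)%nat -> Nat.iter m phi p a = p a.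
Proof.
  intros h. induction m as [|m IH]; intros a ha; [reflexivity|]. simpl.
  rewrite <- (h a ha). apply (f_equal (fun q : pt => q a)), (fl_ext n Ph D B fl). auto.
Qed.

Lemma iter_inj m p q : (forall a, (a < 2 * n + 1)%nat -> Nat.iter m phi p a = Nat.iter m phi q a) ->
  forall a, (a < 2 * n + 1)%nat -> p a = q a.
Proof.
  induction m as [|m IH]; intros h; [exact h|]. apply IH.
  apply (Ph_inj n Ph D B fl 1); [lra|]. exact h.
Qed.

Lemma xyn_iter m p : xyn n p <= B -> xyn n (Nat.iter m phi p) <= B.
Proof.
  intros h. induction m as [|m IH]; [exact h|]. simpl. unfold phi at 1.
  apply (xyn_Ph n Ph D B fl); auto. lra.
Qed.

(** If all generating functions vanished they would be critical everywhere, no step would move a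
    point, and the time-1 map would be the identity. *)
Lemma some_positive : exists i w, (i < N)%nat /\ 0 < Fs i w.
Proof.
  assert (Nr : 0 < INR N) by (now apply lt_0_INR).
  apply Classical_Prop.NNPP. intros no.
  assert (F0 : forall i w, (i < N)%nat -> Fs i w = 0).
  { intros i w hi. destruct (steps i hi) as [sb _].
    destruct (sb_F _ _ _ _ _ _ _ sb w) as [h _]. apply Rle_antisym; auto.
    apply Rnot_lt_le. intros lt. apply no. eauto. }
  destruct nontrivial as [p [j [hj hne]]]. apply hne.
  assert (H : forall i, (i <= N)%nat -> forall a, (a < 2 * n + 1)%nat -> Ph (INR i / INR N) p a = p a).
  { induction i as [|i IH]; intros hi a ha.
    - replace (INR 0 / INR N) with 0 by (simpl; field; lra). now apply (fl_0 n Ph D B fl).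
    - specialize (IH ltac:(lia)). destruct (steps i ltac:(lia)) as [_ [sp cr]].
      set (w := fun g => match g with GX i => p i | GY i => p (n + i)%nat | GZ => p zi end).
      assert (dz : forall g, In g (LG n) -> DFs i g w = 0) by (intros; apply cr; auto; apply F0; lia).
      destruct (sp w) as [u [h1 [h2 [h3 _]]]].
      assert (ht : 0 <= INR i / INR N <= 1).
      { split; [apply Rmult_le_pos; [apply pos_INR|left; now apply Rinv_0_lt_compat]|].
        apply Rmult_le_reg_r with (INR N); auto. unfold Rdiv. rewrite Rmult_assoc, Rinv_l, Rmult_1_r, Rmult_1_l by lra.
        apply le_INR. lia. }
      assert (Es : forall a, (a < 2 * n + 1)%nat -> Ph (INR i / INR N) u a = p a).
      { apply LE_cases; [intros b hb; now apply h1|intros b hb|exact h2].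
        destruct (h1 b hb) as [_ [e _]]. rewrite e, !dz by (apply in_LG; auto). simpl. field. }
      assert (Et : forall a, (a < 2 * n + 1)%nat -> Ph (INR (S i) / INR N) u a = p a).
      { apply LE_cases; [intros b hb|intros b hb; now apply h1|].
        - destruct (h1 b hb) as [_ [_ [e _]]]. rewrite e, !dz by (apply in_LG; auto). simpl. ring.
        - rewrite h3, F0 by lia. rewrite sumL_zero; [simpl; ring|].
          intros b hb. apply in_seq in hb. rewrite dz by (apply in_LG; lia). ring. }
      assert (Eu : forall a, (a < 2 * n + 1)%nat -> u a = p a).
      { apply (Ph_inj n Ph D B fl (INR i / INR N)); auto. intros b hb. now rewrite Es, IH. }
      rewrite <- (Et a ha). apply (f_equal (fun q : pt => q a)), (fl_ext n Ph D B fl). intros; symmetry; auto. }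
  specialize (H N (le_n N) j hj). replace (INR N / INR N) with 1 in H by (field; lra). exact H.
Qed.

Definition K0 (y : R) : R := 0.
Lemma K0_bound y : 0 <= K0 y <= 0. Proof. unfold K0; lra. Qed.
Lemma K0_der y : derivable_pt_lim K0 y (K0 y). Proof. apply derivable_pt_lim_const. Qed.
Lemma K0_cont y : continuity_pt K0 y.
Proof. apply derivable_continuous_pt. exists 0. apply derivable_pt_lim_const. Qed.

(* A bounded function of one momentum whose flow displaces the support. *)
Definition capA : R := (2 * B + 1) * (1 + B * B).
Definition capK (y : R) : R := capA * (atan y + PI / 2).
Definition capK' (y : R) : R := capA * / (1 + y * y).
Definition cap : R := capA * PI.

Lemma capA_pos : 0 < capA.
Proof. unfold capA. pose proof (fl_B n Ph D B fl). apply Rmult_lt_0_compat; nra. Qed.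
Lemma capK_bound y : 0 <= capK y <= cap.
Proof.
  unfold capK, cap. pose proof capA_pos. pose proof (atan_bound y).
  split; [apply Rmult_le_pos; lra|apply Rmult_le_compat_l; lra].
Qed.
Lemma capK_der y : derivable_pt_lim capK y (capK' y).
Proof.
  unfold capK, capK'. apply (derivable_pt_lim_scal (fun y => atan y + PI / 2)).
  replace (/ (1 + y * y)) with (/ (1 + y ^ 2) + 0) by (simpl; field; nra).
  apply (derivable_pt_lim_plus atan (fun _ => PI / 2)); [|apply derivable_pt_lim_const].
  apply derivable_pt_lim_atan.
Qed.
Lemma capK'_cont y : continuity_pt capK' y.
Proof.
  unfold capK'. apply (continuity_pt_mult (fun _ => capA) (fun y => / (1 + y * y))).
  - apply derivable_continuous_pt, derivable_pt_const.
  - apply (continuity_pt_inv (fun y => 1 + y * y)); [|nra].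
    apply derivable_continuous_pt. apply derivable_pt_plus; [apply derivable_pt_const|].
    apply derivable_pt_mult; apply derivable_pt_id.
Qed.
Lemma capK'_pos y : 0 < capK' y.
Proof. apply Rmult_lt_0_compat; [apply capA_pos|]. apply Rinv_0_lt_compat. nra. Qed.
(** [2 * B + 1] exceeds the extent [2 * B] of the ball in the direction [x_0]; [capA] is chosen for
    this. *)
Lemma capK'_big y : Rabs y <= B -> 2 * B + 1 <= capK' y.
Proof.
  intros h. pose proof (fl_B n Ph D B fl) as b0.
  assert (y * y <= B * B) by (revert h; unfold Rabs; destruct (Rcase_abs y); intros; nra).
  apply Rmult_le_reg_r with (1 + y * y); [nra|]. unfold capK', capA.
  rewrite Rmult_assoc, Rinv_l by nra. nra.
Qed.

Lemma zz_agree F F' m u j : (forall i, (i < m)%nat -> F i = F' i) -> (j <= m)%nat ->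
  zz n M F u j = zz n M F' u j.
Proof.
  intros E. induction j as [|j IH]; intros hj; [reflexivity|]. cbn [zz].
  rewrite IH by lia. now rewrite E by lia.
Qed.

Lemma act_cap_le k u : act n M (FK K0 k) u <= act n M (FK capK k) u.
Proof.
  assert (E : forall i, (i < M)%nat -> FK K0 k i = FK capK k i) by (intros i hi; unfold FK; destruct (lt_dec i M); auto; lia).
  unfold act. cbn [zz]. rewrite (zz_agree _ _ M u M E) by lia.
  assert (E1 : FK K0 k M = kF K0) by (unfold FK; destruct (lt_dec M M); auto; lia).
  assert (E2 : FK capK k M = kF capK) by (unfold FK; destruct (lt_dec M M); auto; lia).
  rewrite E1, E2. unfold kF, K0. pose proof (capK_bound (arg u M (zz n M (FK capK k) u M) (GY 0))). lra.
Qed.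

Lemma FK_low K k j : (j < k * N)%nat -> (k <= L)%nat -> FK K k j = Fs (j mod N).
Proof. intros h kL. unfold FK. destruct (lt_dec j M); [|nia]. destruct (lt_dec j (k * N)); auto; lia. Qed.
Lemma FK0_high k j w : (k * N <= j)%nat -> FK K0 k j w = 0.
Proof.
  intros h. unfold FK. destruct (lt_dec j M); [destruct (lt_dec j (k * N)); [lia|reflexivity]|reflexivity].
Qed.

(** Up to step [k * N] both trajectories coincide; afterwards the terms on the left are zero and
    those on the right nonnegative. *)
Lemma act_next_terms k u : (S k <= L)%nat -> forall j, (j <= M)%nat ->
  FK K0 k j (arg u j (zz n M (FK K0 k) u j)) <= FK K0 (S k) j (arg u j (zz n M (FK K0 (S k)) u j)).
Proof.
  intros kL j hj. destruct (lt_dec j (k * N)) as [l|l].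
  - rewrite (zz_agree (FK K0 k) (FK K0 (S k)) (k * N) u j) by
      (try lia; intros i hi; rewrite !FK_low by nia; reflexivity).
    rewrite !FK_low by nia. lra.
  - rewrite FK0_high by lia.
    apply (F_nonneg _ _ _ _ _ _ _ _ _ _ _ (ksteps_FK K0 K0 0 (S k) K0_bound K0_der K0_cont) j); auto.
Qed.

Lemma act_next_le k u : (S k <= L)%nat -> act n M (FK K0 k) u <= act n M (FK K0 (S k)) u.
Proof.
  intros kL. rewrite !act_formula. apply Rplus_le_compat_r. apply sumL_le. intros j hj.
  apply in_seq in hj. apply act_next_terms; auto. lia.
Qed.

Lemma sumL_eq_terms (l : list nat) (f g : nat -> R) : (forall j, In j l -> f j <= g j) ->
  sumL l f = sumL l g -> forall j, In j l -> f j = g j.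
Proof.
  intros le E j hj.
  assert (g j - f j <= 0).
  { replace 0 with (sumL l (fun j => g j - f j)) by (rewrite sumL_minus; lra).
    apply (sumL_term l (fun j => g j - f j)); auto. intros b hb. specialize (le b hb). lra. }
  specialize (le j hj). lra.
Qed.

Lemma level_FK K K' CK k : (1 <= k <= L)%nat -> (forall y, 0 <= K y <= CK) ->
  (forall y, derivable_pt_lim K y (K' y)) -> (forall y, continuity_pt K' y) ->
  exists c, level n M (FK K k) c /\ 0 < c.
Proof.
  intros hk h1 h2 h3. destruct some_positive as [i [w [hi pos]]].
  pose proof (ksteps_FK K K' CK k h1 h2 h3) as HS.
  assert (ik : (i < k * N)%nat) by nia. assert (kM : (k * N <= M)%nat) by nia.
  assert (E : FK K k i = Fs i) by (rewrite FK_low by lia; now rewrite Nat.mod_small).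
  destruct (value_lower_bound _ _ _ _ _ _ _ _ _ _ _ HS w i) as [d [d0 hd]]; [lia|now rewrite E|].
  destruct (level_exists n M (FK K k) d hd (value_exists _ _ _ _ _ _ _ _ _ _ _ HS)) as [c [hc dc]].
  exists c. split; auto. lra.
Qed.

(** With [capK] inserted the level rises; were it above [cap], it would be critical and give a point
    that [phi^k] moves by [capK'] in [x_0] and not at all in [y]. Outside the ball nothing moves,
    and inside it a move of [2 * B + 1] does not fit. *)
Lemma level_le_cap k c : (1 <= k <= L)%nat -> level n M (FK K0 k) c -> c <= cap.
Proof.
  intros hk lev. apply Rnot_lt_le. intros big.
  destruct (level_FK capK capK' cap k hk capK_bound capK_der capK'_cont) as [c' [lev' _]].
  pose proof (level_mono n M _ _ _ _ (act_cap_le k) lev lev') as le.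
  pose proof (ksteps_FK capK capK' cap k capK_bound capK_der capK'_cont) as HS.
  destruct (critical_point _ _ _ _ _ _ _ _ _ _ _ HS c' lev' ltac:(lra)) as [u [_ crit]].
  set (P := chain capK capK' k u 0).
  assert (ry : forall i, (i < n)%nat -> Nat.iter k phi P (n + i)%nat = P (n + i)%nat).
  { intros i hi. apply (return_y capK capK' cap k u capK_bound capK_der capK'_cont); auto; lia. }
  assert (rx := return_x capK capK' cap k u capK_bound capK_der capK'_cont ltac:(lia) crit 0 npos).
  fold P in rx. pose proof (capK'_pos (P n)) as kp.
  destruct (Rlt_dec B (xyn n P)) as [out|inn].
  - rewrite iter_fixed in rx; [lra| |lia]. intros a ha. apply (fl_supp n Ph D B fl); auto. lra.
  - assert (coord : forall q i, xyn n q <= B -> (i < 2 * n)%nat -> Rabs (q i) <= B).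
    { intros q i hq hi. eapply Rle_trans; [|exact hq].
      apply (sumL_term (seq 0 (2 * n)) (fun i => Rabs (q i))); [apply in_seq; lia|intros; apply Rabs_pos]. }
    pose proof (coord P 0%nat ltac:(lra) ltac:(lia)) as b1.
    pose proof (coord _ 0%nat (xyn_iter k P ltac:(lra)) ltac:(lia)) as b2.
    pose proof (capK'_big (P n) (coord P n ltac:(lra) ltac:(lia))) as b3.
    revert b1 b2. unfold Rabs. repeat destruct (Rcase_abs _); lra.
Qed.

Lemma level_strict k c c' : (1 <= k)%nat -> (S k <= L)%nat ->
  level n M (FK K0 k) c -> 0 < c -> level n M (FK K0 (S k)) c' -> c < c'.
Proof.
  intros k1 kL lev c0 lev'. apply Rnot_le_lt. intros le.
  pose proof (ksteps_FK K0 K0 0 k K0_bound K0_der K0_cont) as HS.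
  pose proof (ksteps_FK K0 K0 0 (S k) K0_bound K0_der K0_cont) as HS'.
  destruct (critical_level _ _ _ _ _ _ _ _ _ _ _ HS _ _ _ _ _ _ _ _ _ c c' HS'
    (fun u => act_next_le k u kL) lev lev' le c0) as [u [e1 [e2 crit]]].
  (* Where the two actions touch, their terms agree one by one, so the added terms vanish. *)
  assert (terms : forall j, (k * N <= j <= M)%nat ->
    FK K0 (S k) j (arg u j (zz n M (FK K0 (S k)) u j)) = 0).
  { intros j hj. rewrite !act_formula in e1, e2.
    pose proof (sumL_eq_terms (seq 0 (S M)) (fun j => FK K0 k j (arg u j (zz n M (FK K0 k) u j)))
      (fun j => FK K0 (S k) j (arg u j (zz n M (FK K0 (S k)) u j)))) as T.
    assert (T1 := T ltac:(intros i hi; apply in_seq in hi; apply act_next_terms; auto; lia) ltac:(lra) j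
      ltac:(apply in_seq; lia)). cbv beta in T1. rewrite <- T1. apply FK0_high. lia. }
  assert (zzE : forall j, (j <= M)%nat -> zz n M (FK K0 (S k)) u j = zz n M (FK K0 k) u j).
  { induction j as [|j IH]; intros hj; [reflexivity|]. cbn [zz].
    destruct (lt_dec j (k * N)) as [l|l].
    - rewrite IH by lia. rewrite !FK_low by nia. reflexivity.
    - rewrite terms, FK0_high, IH by lia. reflexivity. }
  set (ch := chain K0 K0 k u). set (w0 := ch (k * N)%nat).
  assert (kM : (k * N + N <= M)%nat) by nia.
  assert (idle : forall d, (d <= N)%nat -> forall a, (a < 2 * n + 1)%nat -> ch (k * N + d)%nat a = w0 a).
  { induction d as [|d IH]; intros hd a ha; [unfold w0; now rewrite Nat.add_0_r|].
    rewrite <- IH by (auto; lia). replace (k * N + S d)%nat with (S (k * N + d)) by lia.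
    apply (chain_idle K0 K0 0 k u K0_bound K0_der K0_cont); auto; lia. }
  (* Zeros of the generating functions are critical, so each step of the added block fixes [w0]. *)
  assert (fixed : forall i, (i <= N)%nat -> forall a, (a < 2 * n + 1)%nat -> Ph (INR i / INR N) w0 a = w0 a).
  { assert (Nr : 0 < INR N) by (now apply lt_0_INR).
    induction i as [|i IH]; intros hi a ha.
    - replace (INR 0 / INR N) with 0 by (simpl; field; lra). now apply (fl_0 n Ph D B fl).
    - specialize (IH ltac:(lia)). destruct (steps i ltac:(lia)) as [_ [sp cr]].
      set (j := (k * N + i)%nat). set (w := arg u j (zz n M (FK K0 k) u j)).
      assert (jm : (j mod N = i)%nat).
      { unfold j. rewrite Nat.add_comm, Nat.Div0.mod_add. apply Nat.mod_small. lia. }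
      assert (Fw : Fs i w = 0).
      { pose proof (terms j ltac:(lia)) as T. rewrite zzE in T by lia.
        rewrite FK_low in T by (unfold j; lia). rewrite jm in T. exact T. }
      assert (dz : forall g, In g (LG n) -> DFs i g w = 0) by (intros; now apply cr).
      destruct (sp w) as [v [h1 [h2 [h3 _]]]].
      assert (DFz : forall g, DFa n M (FK K0 k) (DFK K0 k) u j g = 0).
      { intros g. unfold DFa, DFK. destruct (lt_dec j M); [|lia].
        destruct (lt_dec j (k * N)); [unfold j in *; lia|reflexivity]. }
      assert (cx : forall b, (b < n)%nat -> w (GX b) = w0 b).
      { intros b hb. rewrite <- (idle i) by lia. symmetry. unfold ch. rewrite (chain_x K0 K0 k u) by (auto; lia). reflexivity. }
      assert (cy : forall b, (b < n)%nat -> w (GY b) = w0 (n + b)%nat).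
      { intros b hb. rewrite <- (idle i) by lia. unfold ch. rewrite (chain_y K0 K0 k u) by (auto; lia).
        fold j. unfold eta. rewrite !DFz. simpl. field. }
      assert (cz : w GZ = w0 zi).
      { rewrite <- (idle i) by lia. unfold ch. rewrite (chain_z K0 K0 k u) by lia. reflexivity. }
      assert (ht : 0 <= INR i / INR N <= 1).
      { split; [apply Rmult_le_pos; [apply pos_INR|left; now apply Rinv_0_lt_compat]|].
        apply Rmult_le_reg_r with (INR N); auto. unfold Rdiv. rewrite Rmult_assoc, Rinv_l, Rmult_1_r, Rmult_1_l by lra.
        apply le_INR. lia. }
      assert (Es : forall a, (a < 2 * n + 1)%nat -> Ph (INR i / INR N) v a = w0 a).
      { apply LE_cases.
        - intros b hb. rewrite <- cx by auto. now apply h1.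
        - intros b hb. rewrite <- cy by auto. destruct (h1 b hb) as [_ [e _]].
          rewrite e, !dz by (apply in_LG; auto). field.
        - rewrite <- cz. exact h2. }
      assert (Et : forall a, (a < 2 * n + 1)%nat -> Ph (INR (S i) / INR N) v a = w0 a).
      { apply LE_cases.
        - intros b hb. rewrite <- cx by auto. destruct (h1 b hb) as [_ [_ [e _]]].
          rewrite e, !dz by (apply in_LG; auto). ring.
        - intros b hb. rewrite <- cy by auto. now apply h1.
        - rewrite <- cz, h3, Fw, sumL_zero; [ring|].
          intros b hb. apply in_seq in hb. rewrite dz by (apply in_LG; lia). ring. }
      assert (Eu : forall a, (a < 2 * n + 1)%nat -> v a = w0 a).
      { apply (Ph_inj n Ph D B fl (INR i / INR N)); auto. intros b hb. now rewrite Es, IH. }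
      rewrite <- (Et a ha). apply (f_equal (fun q : pt => q a)), (fl_ext n Ph D B fl). intros; symmetry; auto. }
  assert (one : INR N / INR N = 1) by (field; apply not_0_INR; lia).
  assert (fix1 : forall a, (a < 2 * n + 1)%nat -> Ph 1 w0 a = w0 a).
  { intros a ha. rewrite <- one. now apply fixed. }
  destruct (chain_iter K0 K0 0 k u K0_bound K0_der K0_cont ltac:(lia) crit k (le_n k)) as [it _].
  (* [w0] is fixed by [phi] and is the image of the start under [phi^k]; by injectivity the start is
     [w0], where the action vanishes, against [0 < c]. *)
  assert (same : forall a, (a < 2 * n + 1)%nat -> ch 0%nat a = w0 a).
  { apply (iter_inj k). intros a ha. rewrite (iter_fixed k w0) by auto. now apply it. }
  pose proof (return_z K0 K0 0 k u K0_bound K0_der K0_cont ltac:(lia) crit ltac:(reflexivity) ltac:(reflexivity)) as rz.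
  fold ch in rz, it. rewrite it in rz by lia. fold w0 in rz. rewrite (same zi) in rz by lia.
  rewrite e1 in rz. lra.
Qed.

Lemma spectrum_blocks : exists c : nat -> R,
  (forall k, (1 <= k)%nat -> (S k <= L)%nat -> c k < c (S k)) /\
  forall k, (1 <= k <= L)%nat -> 0 < c k <= cap /\ exists p,
    (forall a, (a < 2 * n)%nat -> Nat.iter k phi p a = p a) /\
    Nat.iter k phi p zi = p zi + c k /\ cprod k p = 1.
Proof.
  set (c := fun k => epsilon (inhabits 0) (fun c => level n M (FK K0 k) c /\ 0 < c)).
  assert (hc : forall k, (1 <= k <= L)%nat -> level n M (FK K0 k) (c k) /\ 0 < c k).
  { intros k hk. unfold c. apply epsilon_spec. apply (level_FK K0 K0 0); auto using K0_bound, K0_der, K0_cont. }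
  exists c. split.
  - intros k k1 kL. destruct (hc k ltac:(lia)) as [l1 p1]. destruct (hc (S k) ltac:(lia)) as [l2 _].
    apply (level_strict k); auto.
  - intros k hk. destruct (hc k hk) as [l1 p1]. split; [split; auto; now apply (level_le_cap k)|].
    pose proof (ksteps_FK K0 K0 0 k K0_bound K0_der K0_cont) as HS.
    destruct (critical_point _ _ _ _ _ _ _ _ _ _ _ HS (c k) l1 p1) as [u [e crit]].
    exists (chain K0 K0 k u 0). split; [|split].
    + intros a ha. destruct (lt_dec a n) as [l|l].
      * pose proof (return_x K0 K0 0 k u K0_bound K0_der K0_cont ltac:(lia) crit a l) as rx.
        rewrite rx. unfold K0. destruct a; ring.
      * replace a with (n + (a - n))%nat by lia.
        apply (return_y K0 K0 0 k u K0_bound K0_der K0_cont); auto; lia.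
    + rewrite <- e. apply (return_z K0 K0 0 k u K0_bound K0_der K0_cont); auto; lia.
    + apply (cprod_one K0 K0 0 k u K0_bound K0_der K0_cont); auto; lia.
Qed.
End Blocks.

Theorem spectrum L : (0 < L)%nat -> exists c : nat -> R,
  (forall k, (1 <= k)%nat -> (S k <= L)%nat -> c k < c (S k)) /\
  forall k, (1 <= k <= L)%nat -> 0 < c k <= cap /\ exists p,
    (forall a, (a < 2 * n)%nat -> Nat.iter k phi p a = p a) /\
    Nat.iter k phi p zi = p zi + c k /\ cprod k p = 1.
Proof.
  intros L0. destruct steps_exist as [N [Fs [DFs [C [lam [Lam [h1 [h2 [h3 [h4 h5]]]]]]]]]].
  eapply spectrum_blocks; eauto.
Qed.
End Chain.

(** * Contact isotopies as flows *)

Definition toV (m : nat) (p : pt) : vec m := fun i => p (proj1_sig i).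

Lemma get_toV m p i : (i < m)%nat -> get (toV m p) i = p i.
Proof. intros h. unfold get. destruct (lt_dec i m); [reflexivity|contradiction]. Qed.

Lemma get_proj m (v : vec m) i : get v (proj1_sig i) = v i.
Proof.
  destruct i as [i h]. unfold get; simpl. destruct (lt_dec i m) as [h'|]; [|contradiction].
  f_equal. f_equal. apply Peano_dec.le_unique.
Qed.

Lemma toV_get m (v : vec m) : toV m (get v) = v.
Proof. apply functional_extensionality. intros i. unfold toV. apply get_proj. Qed.

Lemma toV_ext m p q : (forall a, (a < m)%nat -> p a = q a) -> toV m p = toV m q.
Proof. intros h. apply functional_extensionality. intros [i hi]. apply h. exact hi. Qed.

Lemma vec_ext m (u v : vec m) : (forall i, (i < m)%nat -> get u i = get v i) -> u = v.
Proof. intros h. rewrite <- (toV_get m u), <- (toV_get m v). now apply toV_ext. Qed.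

Lemma rsum_sumL k f : rsum k f = sumL (seq 0 k) f.
Proof. induction k as [|k IH]; [reflexivity|]. rewrite seq_S, sumL_app, <- IH. simpl. ring. Qed.

Lemma get_vadd m (u v : vec m) i : get (vadd u v) i = get u i + get v i.
Proof. unfold get, vadd. destruct (lt_dec i m); auto. ring. Qed.
Lemma get_vsub m (u v : vec m) i : get (vsub u v) i = get u i - get v i.
Proof. unfold get, vsub. destruct (lt_dec i m); auto. ring. Qed.
Lemma get_vscale m s (v : vec m) i : get (vscale s v) i = s * get v i.
Proof. unfold get, vscale. destruct (lt_dec i m); auto. ring. Qed.
Lemma get_ebasis m a i : (i < m)%nat -> get (ebasis m a) i = if Nat.eq_dec i a then 1 else 0.
Proof. intros h. unfold get, ebasis. destruct (lt_dec i m); [reflexivity|contradiction]. Qed.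

Lemma get_le_vnorm m (v : vec m) i : (i < m)%nat -> Rabs (get v i) <= vnorm v.
Proof.
  intros h. unfold vnorm. rewrite rsum_sumL.
  apply (sumL_term (seq 0 m) (fun i => Rabs (get v i))); [apply in_seq; lia|]. intros; apply Rabs_pos.
Qed.

Lemma cont_contL m (f : vec m -> R) : Defs.cont f -> contL (seq 0 m) (fun p => f (toV m p)).
Proof.
  intros cf p e e0. destruct (cf (toV m p) e e0) as [d [d0 hd]].
  pose proof (pos_INR m) as mp.
  exists (d / (INR m + 1)). split; [apply Rdiv_lt_0_compat; lra|]. intros q nr. apply hd.
  unfold vnorm. rewrite rsum_sumL. apply Rle_lt_trans with (INR (length (seq 0 m)) * (d / (INR m + 1))).
  - apply sumL_bound. intros i hi. assert (hi' := hi). apply in_seq in hi'.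
    rewrite get_vsub, !get_toV by lia. left. now apply nr.
  - rewrite length_seq. apply Rmult_lt_reg_r with (INR m + 1); [lra|].
    replace (INR m * (d / (INR m + 1)) * (INR m + 1)) with (INR m * d) by (field; lra). nra.
Qed.

Lemma Ck_C1 m (f : vec m -> R) : Ck 1 f ->
  exists D, C1 Nat.eq_dec (seq 0 m) (fun p => f (toV m p)) D.
Proof.
  intros [cf [D hD]]. exists (fun a p => D a (toV m p)). split; [now apply cont_contL|].
  intros a ha. apply in_seq in ha. destruct (hD a ltac:(lia)) as [der [cD _]].
  split; [now apply cont_contL|]. intros p t e e0.
  destruct (der (toV m (updn p a t)) e e0) as [d hd]. exists d. intros h hn hh.
  specialize (hd h hn hh).
  assert (E : forall s, vadd (toV m (updn p a t)) (vscale s (ebasis m a)) = toV m (updn p a (t + s))).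
  { intros s. apply vec_ext. intros i hi. rewrite get_vadd, get_vscale, !get_toV, get_ebasis by auto.
    unfold upd. destruct (Nat.eq_dec a i), (Nat.eq_dec i a); subst; try congruence; ring. }
  rewrite !E in hd. replace (t + (0 + h)) with (t + h) in hd by ring.
  replace (t + 0) with t in hd by ring. exact hd.
Qed.

Section Setup.
Variables (n : nat) (Phi : R -> E n -> E n) (H : R -> E n -> R).
Hypothesis smooth_Phi : st_smooth n Phi.
Hypothesis Phi0 : forall p, Phi 0 p = p.
Hypothesis contact : forall t, 0 <= t <= 1 -> contactomorphism n (Phi t).
Hypothesis periodic : forall t p, 0 <= t <= 1 -> Phi t (vadd p (ez n)) = vadd (Phi t p) (ez n).
Hypothesis compact : exists B, forall t p, 0 <= t <= 1 -> B < xy_norm n p -> Phi t p = p.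
Hypothesis gen : generates n Phi H.
Hypothesis pos : positive_ham n H.
Notation toE := (toV (2 * n + 1)).
Notation zi := (2 * n)%nat.
Notation ti := (2 * n + 1)%nat.

Definition Ph (t : R) (p : pt) : pt := get (Phi t (toE p)).

Lemma toE_Ph t p : toE (Ph t p) = Phi t (toE p).
Proof. apply toV_get. Qed.

Lemma Ph_C1 : exists D : nat -> nat -> pt -> R, forall j, (j < 2 * n + 1)%nat ->
  C1 Nat.eq_dec (LT n) (fun v => Ph (v ti) v j) (D j).
Proof.
  assert (ex : forall j, exists Dj, (j < 2 * n + 1)%nat -> C1 Nat.eq_dec (LT n) (fun v => Ph (v ti) v j) Dj).
  { intros j. destruct (lt_dec j (2 * n + 1)) as [hj|hj]; [|exists (fun _ _ => 0); intros; lia].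
    destruct (Ck_C1 _ _ (smooth_Phi j hj 1%nat)) as [Dj hD]. exists Dj. intros _.
    replace (fun v => Ph (v ti) v j) with (fun p => get (Phi (get (toV (2 * n + 2) p) (2 * n + 1))
      (fun i => get (toV (2 * n + 2) p) (proj1_sig i))) j); [exact hD|].
    apply functional_extensionality. intros v. rewrite get_toV by lia. unfold Ph. f_equal. f_equal.
    apply functional_extensionality. intros [i hi]. unfold toV at 2. simpl proj1_sig. apply get_toV. lia. }
  exists (fun j => proj1_sig (constructive_indefinite_description _ (ex j))).
  intros j hj. exact (proj2_sig (constructive_indefinite_description _ (ex j)) hj).
Qed.

Lemma toE_zshift1 p : toE (zshift n p 1) = vadd (toE p) (ez n).
Proof.
  apply vec_ext. intros i hi. unfold ez. rewrite get_vadd, !get_toV, get_ebasis by auto. unfold zshift.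
  destruct (Nat.eq_dec i zi); ring.
Qed.

Lemma Ph_ext t p q : (forall a, (a < 2 * n + 1)%nat -> p a = q a) -> Ph t p = Ph t q.
Proof. intros h. unfold Ph. now rewrite (toV_ext _ p q h). Qed.

Lemma zshift_ext p q k a : p a = q a -> zshift n p k a = zshift n q k a.
Proof. intros h. unfold zshift. now rewrite h. Qed.

Lemma Ph_per1 t p j : 0 <= t <= 1 -> (j < 2 * n + 1)%nat -> Ph t (zshift n p 1) j = zshift n (Ph t p) 1 j.
Proof.
  intros ht hj. unfold Ph at 1. rewrite toE_zshift1, periodic by auto.
  unfold ez. rewrite get_vadd, get_ebasis by auto. unfold zshift, Ph. destruct (Nat.eq_dec j zi); ring.
Qed.

Lemma Ph_per t p k j : 0 <= t <= 1 -> (j < 2 * n + 1)%nat -> Ph t (zshift n p k) j = zshift n (Ph t p) k j.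
Proof.
  intros ht.
  assert (nonneg : forall m p j, (j < 2 * n + 1)%nat ->
    Ph t (zshift n p (Z.of_nat m)) j = zshift n (Ph t p) (Z.of_nat m) j).
  { clear p j. induction m as [|m IH]; intros p j hj; [now rewrite !zshift_0|].
    rewrite Nat2Z.inj_succ. unfold Z.succ. rewrite <- !zshift_zshift, Ph_per1 by auto.
    apply zshift_ext. now apply IH. }
  intros hj. destruct (Z_le_dec 0 k) as [l|l].
  - rewrite <- (Z2Nat.id k) by auto. now apply nonneg.
  (* Negative shifts follow from positive ones applied to the shifted point. *)
  - set (m := Z.to_nat (- k)). assert (Ek : k = (- Z.of_nat m)%Z) by (unfold m; rewrite Z2Nat.id; lia).
    pose proof (nonneg m (zshift n p k) j hj) as e. rewrite zshift_zshift in e.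
    replace (k + Z.of_nat m)%Z with 0%Z in e by lia. rewrite zshift_0 in e.
    transitivity (zshift n (zshift n (Ph t (zshift n p k)) (Z.of_nat m)) k j).
    + rewrite zshift_zshift. replace (Z.of_nat m + k)%Z with 0%Z by lia. now rewrite zshift_0.
    + apply zshift_ext. now rewrite e.
Qed.

Lemma xyn_toE p : xy_norm n (toE p) = xyn n p.
Proof.
  unfold xy_norm, xyn. rewrite rsum_sumL. apply sumL_ext. intros i hi. apply in_seq in hi.
  rewrite get_toV by lia. reflexivity.
Qed.

Lemma alpha_toE (q w : E n) : alpha n q w =
  get w zi - sumL (seq 0 n) (fun i => get q (n + i)%nat * get w i).
Proof. unfold alpha, zc, yc, xc. now rewrite rsum_sumL. Qed.

Lemma alpha_ebasis p a : (a < 2 * n + 1)%nat -> alpha n (toE p) (ebasis (2 * n + 1) a) = alphac n p a.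
Proof.
  intros ha. rewrite alpha_toE. rewrite get_ebasis by lia. unfold alphac.
  destruct (lt_dec a n) as [l|l].
  - destruct (Nat.eq_dec zi a); [lia|].
    rewrite (sumL_ext (seq 0 n) _ (fun i => if Nat.eq_dec a i then p (n + i)%nat else 0)).
    + rewrite (sumL_delta Nat.eq_dec (seq 0 n) a (fun i => p (n + i)%nat)); [ring|apply seq_NoDup|apply in_seq; lia].
    + intros i hi. apply in_seq in hi. rewrite get_toV, get_ebasis by lia.
      destruct (Nat.eq_dec i a), (Nat.eq_dec a i); try congruence; ring.
  - rewrite sumL_zero.
    + destruct (Nat.eq_dec zi a), (Nat.eq_dec a zi); try congruence; ring.
    + intros i hi. apply in_seq in hi. rewrite get_ebasis by lia. destruct (Nat.eq_dec i a); [lia|ring].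
Qed.

Section WithD.
Variable D : nat -> nat -> pt -> R.
Hypothesis HD : forall j, (j < 2 * n + 1)%nat -> C1 Nat.eq_dec (LT n) (fun v => Ph (v ti) v j) (D j).

Lemma Ph_st0 t p s : Ph s (st n t p) = Ph s p.
Proof. apply Ph_ext. intros. now apply st_E. Qed.

Lemma space_der j a t p : (j < 2 * n + 1)%nat -> (a < 2 * n + 1)%nat ->
  derivable_pt_lim (fun s => Ph t (updn p a s) j) (p a) (D j a (st n t p)).
Proof.
  intros hj ha. destruct (HD j hj) as [_ h].
  destruct (h a ltac:(apply in_LT; lia)) as [_ der]. specialize (der (st n t p) (p a)).
  eapply derivable_eq; [exact der| |].
  - intros s. cbv beta. rewrite upd_other by lia. rewrite st_T.
    apply (f_equal (fun q : pt => q j)), Ph_ext. intros b hb. unfold upd.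
    destruct (Nat.eq_dec a b); auto. now apply st_E.
  - f_equal. replace (p a) with (st n t p a) by (apply st_E; auto). apply upd_id.
Qed.

Lemma time_der j t p : (j < 2 * n + 1)%nat ->
  derivable_pt_lim (fun s => Ph s p j) t (D j ti (st n t p)).
Proof.
  intros hj. destruct (HD j hj) as [_ h].
  destruct (h ti ltac:(apply in_LT; lia)) as [_ der]. specialize (der (st n t p) t).
  eapply derivable_eq; [exact der| |].
  - intros s. cbv beta. rewrite upd_same.
    apply (f_equal (fun q : pt => q j)), Ph_ext. intros b hb. unfold upd.
    destruct (Nat.eq_dec ti b); [lia|]. now apply st_E.
  - f_equal. rewrite <- (st_T n t p) at 2. apply upd_id.
Qed.

Lemma contact_D t p : 0 <= t <= 1 -> exists g, forall a, (a < 2 * n + 1)%nat ->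
  aD n Ph D t p a = exp g * alphac n p a.
Proof.
  intros ht. destruct (contact t ht) as [_ [_ [g hg]]]. exists (g (toE p)). intros a ha.
  set (w := toE (fun j => D j a (st n t p))).
  assert (dd : has_dderiv n (Phi t) (toE p) (ebasis (2 * n + 1) a) w).
  { intros j hj. unfold w. rewrite get_toV by auto.
    intros e e0. destruct (space_der j a t p hj ha e e0) as [d hd]. exists d. intros h hn hh.
    specialize (hd h hn hh).
    assert (Ee : forall s, vadd (toE p) (vscale s (ebasis (2 * n + 1) a)) = toE (updn p a (p a + s))).
    { intros s. apply vec_ext. intros i hi. rewrite get_vadd, get_vscale, !get_toV, get_ebasis by auto.
      unfold upd. destruct (Nat.eq_dec a i), (Nat.eq_dec i a); subst; try congruence; ring. }
    rewrite !Ee. replace (p a + (0 + h)) with (p a + h) by ring. replace (p a + 0) with (p a) by ring.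
    exact hd. }
  pose proof (hg _ _ _ dd) as e. rewrite alpha_ebasis in e by auto. rewrite <- e, alpha_toE.
  unfold aD, w. rewrite get_toV by lia. f_equal. apply sumL_ext. intros i hi. apply in_seq in hi.
  rewrite get_toV by lia. reflexivity.
Qed.

Lemma ham_value t p : 0 <= t <= 1 -> H t (Phi t (toE p)) = aD n Ph D t p ti.
Proof.
  intros ht. rewrite (gen t (toE p) (toE (fun j => D j ti (st n t p))) ht).
  - rewrite alpha_toE, get_toV by lia. unfold aD. f_equal. apply sumL_ext. intros i hi. apply in_seq in hi.
    rewrite get_toV by lia. reflexivity.
  - intros j hj. rewrite get_toV by auto. now apply time_der.
Qed.

Lemma cont_Ph0 j t : (j < 2 * n + 1)%nat -> contL (LE n) (fun p => Ph t p j).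
Proof.
  intros hj p. destruct (HD j hj) as [c _]. eapply cont_eq; [|apply (cont_st_f n _ t c p)].
  intros q. cbv beta. now rewrite st_T, Ph_st0.
Qed.

Lemma inverse t : 0 <= t <= 1 -> exists Psi DPsi,
    (forall j, (j < 2 * n + 1)%nat -> C1 Nat.eq_dec (LE n) (fun p : pt => Psi p j) (DPsi j)) /\
    (forall p j, (j < 2 * n + 1)%nat -> Psi (Ph t p) j = p j) /\
    (forall p j, (j < 2 * n + 1)%nat -> Ph t (Psi p) j = p j).
Proof.
  intros ht. destruct (contact t ht) as [_ [[psi [sm [i1 i2]]] _]].
  set (Psi := fun p : pt => get (psi (toE p)) : pt).
  assert (ex : forall j, exists Dj, (j < 2 * n + 1)%nat -> C1 Nat.eq_dec (LE n) (fun p => Psi p j) Dj).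
  { intros j. destruct (lt_dec j (2 * n + 1)) as [hj|hj]; [|exists (fun _ _ => 0); intros; lia].
    destruct (Ck_C1 _ _ (sm j hj 1%nat)) as [Dj hDj]. exists Dj. intros _. exact hDj. }
  exists Psi, (fun j => proj1_sig (constructive_indefinite_description _ (ex j))).
  split; [|split].
  - intros j hj. exact (proj2_sig (constructive_indefinite_description _ (ex j)) hj).
  - intros p j hj. unfold Psi. rewrite toE_Ph, i1. now apply get_toV.
  - intros p j hj. unfold Psi, Ph. rewrite toV_get, i2. now apply get_toV.
Qed.

(** A negative value would persist on a ball around [q] by continuity, which puts [q] in the
    interior of the support. Continuity of [H t] is read off [ham_value] through the inverse of
    [Phi t]. *)
Lemma ham_nonneg t q : 0 <= t <= 1 -> 0 <= H t q.
Proof.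
  intros ht. apply Rnot_lt_le. intros neg.
  destruct (inverse t ht) as [Psi [DPsi [cP [_ i2]]]].
  assert (val : forall p, H t (toE p) = aD n Ph D t (Psi p) ti).
  { intros p. rewrite <- ham_value by auto. f_equal. rewrite <- toE_Ph. apply toV_ext.
    intros a ha. symmetry. now apply i2. }
  assert (cH : contL (LE n) (fun p => H t (toE p))).
  { intros p. eapply cont_eq; [intros r; symmetry; apply val|].
    apply (cont_comp (LE n) (LE n) (fun p => aD n Ph D t p ti) Psi).
    - unfold aD. apply cont_minus.
      + apply (cont_st_f n (D zi ti) t). destruct (HD zi ltac:(lia)) as [_ h].
        apply h. apply in_LT. lia.
      + apply cont_sumL. intros i hi. apply in_seq in hi. apply cont_mult; [apply cont_Ph0; lia|].
        apply (cont_st_f n (D i ti) t). destruct (HD i ltac:(lia)) as [_ h].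
        apply h. apply in_LT. lia.
    - intros b hb. apply in_LE in hb. destruct (cP b hb) as [c _]. apply c. }
  enough (inn : Defs.interior (Defs.support (H t)) q) by (specialize (pos t q ht inn); lra).
  destruct (cH (get q) (- H t q) ltac:(lra)) as [d [d0 hd]]. rewrite toV_get in hd.
  exists d. split; auto. intros q' hq' e e0. exists q'. split.
  - assert (nr : near (LE n) d (get q) (get q')).
    { intros a ha. apply in_LE in ha. rewrite <- get_vsub. eapply Rle_lt_trans; [now apply get_le_vnorm|auto]. }
    specialize (hd (get q') nr). rewrite toV_get in hd. apply Rabs_def2 in hd. lra.
  - unfold vnorm. rewrite rsum_sumL, sumL_zero; auto. intros i _. rewrite get_vsub, Rminus_diag. apply Rabs_R0.
Qed.
End WithD.

Theorem flow_exists : exists D B, flow n Ph D B.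
Proof.
  (* The given radius may be negative, while [fl_B] asks for a nonnegative one. *)
  destruct Ph_C1 as [D HD]. destruct compact as [B hB]. exists D, (Rmax B 0). constructor.
  - apply Rmax_r.
  - exact HD.
  - exact Ph_ext.
  - intros p j hj. unfold Ph. rewrite Phi0. now apply get_toV.
  - intros. now apply Ph_per.
  - intros t p j ht hp hj. unfold Ph. rewrite hB; auto; [now apply get_toV|].
    rewrite xyn_toE. eapply Rle_lt_trans; [apply Rmax_l|exact hp].
  - intros t p a ht ha. destruct (contact_D D HD t p ht) as [g hg].
    unfold cf. rewrite !hg by (auto; lia). unfold alphac at 2.
    destruct (lt_dec zi n); [lia|]. destruct (Nat.eq_dec zi zi); [ring|congruence].
  - intros t p ht. destruct (contact_D D HD t p ht) as [g hg].
    unfold cf. rewrite hg by lia. unfold alphac.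
    destruct (lt_dec zi n); [lia|]. destruct (Nat.eq_dec zi zi); [|congruence].
    rewrite Rmult_1_r. apply exp_pos.
  - exact inverse.
  - intros t p ht. rewrite <- (ham_value D HD) by auto. now apply (ham_nonneg D HD).
Qed.

(** * Translated points of the iterates *)

Section Iterates.
Variables (D : nat -> nat -> pt -> R) (B : R).
Hypothesis fl : flow n Ph D B.
Notation phi := (phi Ph).
Notation cprod := (cprod n Ph D).

Lemma toE_iter k p : toE (Nat.iter k phi p) = Nat.iter k (Phi 1) (toE p).
Proof. induction k as [|k IH]; [reflexivity|].
  change (toE (phi (Nat.iter k phi p)) = Phi 1 (Nat.iter k (Phi 1) (toE p))). rewrite <- IH. apply toE_Ph. Qed.

Lemma cprod_pos k p : 0 < cprod k p.
Proof.
  induction k as [|k IH]; simpl; [lra|]. apply Rmult_lt_0_compat; auto. apply (fl_cf n Ph D B fl). lra.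
Qed.

Lemma alphac_sum p w : sumL (LE n) (fun a => alphac n p a * w a) =
  w zi - sumL (seq 0 n) (fun i => p (n + i)%nat * w i).
Proof.
  rewrite sumL_LE. unfold alphac at 1. destruct (lt_dec zi n); [lia|]. destruct (Nat.eq_dec zi zi); [|congruence].
  rewrite (sumL_zero (seq 0 n) (fun i => alphac n p (n + i)%nat * _)).
  - rewrite (sumL_ext (seq 0 n) (fun a => alphac n p a * w a) (fun i => -1 * (p (n + i)%nat * w i))).
    + rewrite sumL_scal. ring.
    + intros i hi. apply in_seq in hi. unfold alphac. destruct (lt_dec i n); [ring|lia].
  - intros i hi. apply in_seq in hi. unfold alphac. destruct (lt_dec (n + i) n); [lia|].
    destruct (Nat.eq_dec (n + i) zi); [lia|ring].
Qed.

(** The chain rule for iterates: each application multiplies the value of the contact form by the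
    conformal factor at the current point. *)
Lemma iter_derivative k p (v : pt) : exists w : pt,
  (forall j, (j < 2 * n + 1)%nat ->
    derivable_pt_lim (fun s => Nat.iter k phi (fun a => p a + s * v a) j) 0 (w j)) /\
  sumL (LE n) (fun a => alphac n (Nat.iter k phi p) a * w a) =
    cprod k p * sumL (LE n) (fun a => alphac n p a * v a).
Proof.
  induction k as [|k [w [h1 h2]]].
  - exists v. split; [|simpl; ring]. intros j hj. apply derivable_affine.
  - set (q := Nat.iter k phi p) in *.
    assert (q0 : Nat.iter k phi (fun a => p a + 0 * v a) = q).
    { unfold q. f_equal. apply functional_extensionality. intros; ring. }
    exists (fun j => sumL (LE n) (fun a => D j a (st n 1 q) * w a)). split.
    + intros j hj. simpl.
      apply (frechet_curve (LE n) (fun r => Ph 1 r j) (fun s => Nat.iter k phi (fun a => p a + s * v a)) 0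
        (fun a => D j a (st n 1 q)) w).
      * rewrite q0. apply (C1_frechet Nat.eq_dec (LE n) (fun r => Ph 1 r j) (fun a r => D j a (st n 1 r)));
          [apply seq_NoDup|]. now apply (C1_Ph n Ph D B fl).
      * intros a ha. apply in_LE in ha. now apply h1.
    + rewrite alphac_sum. cbn [Submission.cprod]. fold q. rewrite Rmult_assoc, <- h2.
      rewrite <- sumL_scal.
      rewrite (sumL_ext (LE n) (fun a => cf n Ph D 1 q * _) (fun a => aD n Ph D 1 q a * w a)).
      2:{ intros a ha. apply in_LE in ha. rewrite (fl_contact n Ph D B fl) by (auto; lra). ring. }
      change (Nat.iter (S k) phi p) with (Ph 1 q).
      rewrite (sumL_ext (LE n) (fun a => aD n Ph D 1 q a * w a) (fun a => D zi a (st n 1 q) * w a -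
        sumL (seq 0 n) (fun i => Ph 1 q (n + i)%nat * D i a (st n 1 q) * w a))).
      2:{ intros a _. unfold aD. rewrite Rmult_minus_distr_r, (Rmult_comm (sumL (seq 0 n) _)), <- sumL_scal.
          f_equal. apply sumL_ext. intros; ring. }
      rewrite sumL_minus. f_equal.
      rewrite (sumL_swap (LE n) (seq 0 n)). apply sumL_ext. intros i _. rewrite <- sumL_scal.
      apply sumL_ext. intros; ring.
Qed.

Lemma iter_conformal k : conformal_factor n (Nat.iter k (Phi 1)) (fun q => ln (cprod k (get q))).
Proof.
  intros q v w dd. rewrite exp_ln by apply cprod_pos.
  destruct (iter_derivative k (get q) (get v)) as [w' [h1 h2]].
  assert (Ew : forall j, (j < 2 * n + 1)%nat -> get w j = w' j).
  { intros j hj. apply (uniqueness_limite (fun s => get (Nat.iter k (Phi 1) (vadd q (vscale s v))) j) 0); [now apply dd|].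
    eapply derivable_eq; [apply (h1 j hj)| |reflexivity]. intros s. cbv beta.
    replace (vadd q (vscale s v)) with (toE (fun a => get q a + s * get v a)).
    - rewrite <- toE_iter. symmetry. now apply get_toV.
    - apply vec_ext. intros i hi. rewrite get_toV, get_vadd, get_vscale by auto. reflexivity. }
  rewrite !alpha_toE. rewrite <- (alphac_sum (get q) (get v)), <- h2, alphac_sum.
  rewrite Ew by lia. f_equal. apply sumL_ext. intros i hi. apply in_seq in hi. rewrite Ew by lia.
  rewrite <- (get_toV (2 * n + 1) (Nat.iter k phi (get q))) by lia. rewrite toE_iter, toV_get. reflexivity.
Qed.

Lemma translated_iter k p : (forall a, (a < 2 * n)%nat -> Nat.iter k phi p a = p a) -> cprod k p = 1 ->
  translated_point n (Nat.iter k (Phi 1)) (toE p).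
Proof.
  intros h1 h2. split.
  - intros i hi. unfold xc, yc. rewrite <- toE_iter, !get_toV by lia. split; apply h1; lia.
  - exists (fun q => ln (cprod k (get q))). split; [apply iter_conformal|].
    replace (cprod k (get (toE p))) with (cprod k p); [rewrite h2; apply ln_1|].
    assert (Eg : forall b a, (a < 2 * n + 1)%nat -> Nat.iter b phi p a = Nat.iter b phi (get (toE p)) a).
    { induction b as [|b IH]; intros a ha; simpl; [symmetry; now apply get_toV|].
      apply (f_equal (fun q : pt => q a)), Ph_ext. auto. }
    clear h1 h2. induction k as [|k IH]; simpl; auto. rewrite IH. f_equal. apply (cf_ext n Ph D B fl). auto.
Qed.

Lemma action_iter k p : action n (Nat.iter k (Phi 1)) (toE p) = Nat.iter k phi p zi - p zi.
Proof. unfold action, zc. rewrite <- toE_iter, !get_toV by lia. reflexivity. Qed.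
End Iterates.
End Setup.

(** * Counting *)

Lemma infinite_sequence {T : Type} (nontrivial_iterated : T -> Prop) :
  (forall l : list T, exists x, nontrivial_iterated x /\ ~ In x l) ->
  exists q : nat -> T, (forall a b, q a = q b -> a = b) /\ forall a, nontrivial_iterated (q a).
Proof.
  intros h. set (ch := fun l => proj1_sig (constructive_indefinite_description _ (h l))).
  assert (hch : forall l, nontrivial_iterated (ch l) /\ ~ In (ch l) l).
  { intros l. exact (proj2_sig (constructive_indefinite_description _ (h l))). }
  set (g := fix g m := match m with O => [] | S m => ch (g m) :: g m end).
  assert (mem : forall a b, (a < b)%nat -> In (ch (g a)) (g b)).
  { intros a b ab. induction ab as [|b ab IH]; [left; reflexivity|right; exact IH]. }
  exists (fun a => ch (g a)). split; [|intros a; apply hch].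
  intros a b e. destruct (lt_eq_lt_dec a b) as [[l|l]|l]; auto; exfalso.
  - apply (proj2 (hch (g b))). rewrite <- e. now apply mem.
  - apply (proj2 (hch (g a))). rewrite e. now apply mem.
Qed.

(** In the application [Q k] is a translated point, [S k] its image and [f k] an integer part; [S k]
    is known to be in [l] when the same point occurs again for a later index. *)
Lemma pigeonhole {T : Type} (l : list T) (L X : nat) (Q S : nat -> T) (f : nat -> nat) :
  (forall k, (1 <= k <= L)%nat -> In (Q k) l) ->
  (forall k, (1 <= k <= L)%nat -> (f k < X)%nat) ->
  (forall k k', (1 <= k)%nat -> (k < k')%nat -> (k' <= L)%nat -> Q k = Q k' -> In (S k) l) ->
  (length l * (X * (1 + length l)) < L)%nat ->
  exists k k', (1 <= k)%nat /\ (k < k')%nat /\ (k' <= L)%nat /\ Q k = Q k' /\ f k = f k' /\ S k = S k'.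
Proof.
  intros hQ hf hS big. apply NNPP. intros no.
  (* the last k with a given Q k need not have S k in l, hence the extra value None *)
  set (again := fun k => exists k', (k < k')%nat /\ (k' <= L)%nat /\ Q k = Q k').
  set (o := fun k => if excluded_middle_informative (again k) then Some (S k) else None).
  set (t := fun k => (Q k, (f k, o k))).
  set (cod := list_prod l (list_prod (seq 0 X) (None :: map Some l))).
  assert (sep : forall k k', (1 <= k)%nat -> (k < k')%nat -> (k' <= L)%nat -> t k <> t k').
  { intros k k' h1 h2 h3 e. injection e as e1 e2 e3. apply no. exists k, k'. repeat (split; auto).
    unfold o in e3. destruct (excluded_middle_informative (again k)) as [_|n].
    - destruct (excluded_middle_informative (again k')); congruence.
    - exfalso. apply n. now exists k'. }
  assert (nd : NoDup (map t (seq 1 L))).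
  { apply NoDup_map_NoDup_ForallPairs; [|apply seq_NoDup].
    intros a b ha hb e. apply in_seq in ha, hb.
    destruct (lt_eq_lt_dec a b) as [[l0|l0]|l0]; auto; exfalso.
    - apply (sep a b); auto; lia.
    - apply (sep b a); auto; lia. }
  assert (inc : incl (map t (seq 1 L)) cod).
  { intros y hy. apply in_map_iff in hy. destruct hy as [k [<- hk]]. apply in_seq in hk.
    unfold t, cod. apply in_prod; [apply hQ; lia|]. apply in_prod.
    - apply in_seq. specialize (hf k ltac:(lia)). lia.
    - unfold o. destruct (excluded_middle_informative (again k)) as [[k' [h1 [h2 h3]]]|]; [|now left].
      right. apply in_map. apply (hS k k'); auto. lia. }
  pose proof (NoDup_incl_length nd inc) as le. unfold cod in le.
  rewrite !length_prod in le. cbn [length] in le. rewrite !length_map, !length_seq in le.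
  lia.
Qed.

Lemma Int_part_bounds x : IZR (Int_part x) <= x < IZR (Int_part x) + 1.
Proof. destruct (base_Int_part x). lra. Qed.

Section Counting.
Variables (n : nat) (Phi : R -> E n -> E n) (D : nat -> nat -> pt -> R) (B : R).
Hypothesis fl : flow n (Ph n Phi) D B.
Notation toE := (toV (2 * n + 1)).
Notation zi := (2 * n)%nat.
Notation phi := (phi (Ph n Phi)).
Notation cprod := (cprod n (Ph n Phi) D).
Notation zshift := (zshift n).

Definition nontrivial_iterated (q : E n) : Prop :=
  0 <= zc q < 1 /\ exists k : nat, (1 <= k)%nat /\
    translated_point n (Nat.iter k (Phi 1)) q /\ action n (Nat.iter k (Phi 1)) q <> 0.

Definition returns (k : nat) (p : pt) (c : R) : Prop :=
  (forall a, (a < 2 * n)%nat -> Nat.iter k phi p a = p a) /\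
  Nat.iter k phi p zi = p zi + c /\ cprod k p = 1.

(** The representative with [0 <= z < 1] of a point of the quotient. *)
Definition nrm (p : pt) : pt := zshift p (- Int_part (p zi)).

Lemma nrm_z p : nrm p zi = p zi - IZR (Int_part (p zi)).
Proof. unfold nrm, Submission.zshift. destruct (Nat.eq_dec zi zi); [|congruence]. rewrite opp_IZR. ring. Qed.

Lemma iter_ext k p q : (forall a, (a < 2 * n + 1)%nat -> p a = q a) ->
  forall a, (a < 2 * n + 1)%nat -> Nat.iter k phi p a = Nat.iter k phi q a.
Proof.
  intros h. induction k as [|k IH]; auto. intros a ha.
  apply (f_equal (fun r : pt => r a)), (Ph_ext n Phi 1). exact IH.
Qed.

Lemma cprod_ext k p q : (forall a, (a < 2 * n + 1)%nat -> p a = q a) -> cprod k p = cprod k q.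
Proof.
  intros h. induction k as [|k IH]; auto. cbn [Submission.cprod]. rewrite IH. f_equal.
  apply (cf_ext n _ D B fl). now apply iter_ext.
Qed.

Lemma returns_ext k p q c : (forall a, (a < 2 * n + 1)%nat -> p a = q a) -> returns k p c -> returns k q c.
Proof.
  intros h [r1 [r2 r3]]. split; [|split].
  - intros a ha. rewrite <- (iter_ext k p q), <- h by (auto; lia). now apply r1.
  - rewrite <- (iter_ext k p q), <- h by (auto; lia). exact r2.
  - now rewrite <- (cprod_ext k p q).
Qed.

Lemma iter_zshift k p m : forall a, (a < 2 * n + 1)%nat -> Nat.iter k phi (zshift p m) a = zshift (Nat.iter k phi p) m a.
Proof.
  induction k as [|k IH]; auto. intros a ha.
  change (Ph n Phi 1 (Nat.iter k phi (zshift p m)) a = zshift (Ph n Phi 1 (Nat.iter k phi p)) m a).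
  rewrite (Ph_ext n Phi 1 _ _ IH). apply (fl_per _ _ _ _ fl); auto. lra.
Qed.

Lemma cf_zshift p m : cf n (Ph n Phi) D 1 (zshift p m) = cf n (Ph n Phi) D 1 p.
Proof.
  unfold cf, aD. rewrite (D_zshift n _ D B fl) by (lra || lia). f_equal. apply sumL_ext. intros i hi.
  apply in_seq in hi. rewrite (D_zshift n _ D B fl) by (lra || lia). f_equal.
  rewrite (fl_per _ _ _ _ fl) by (lra || lia). unfold Submission.zshift. destruct (Nat.eq_dec (n + i) zi); [lia|reflexivity].
Qed.

Lemma cprod_zshift k p m : cprod k (zshift p m) = cprod k p.
Proof.
  induction k as [|k IH]; auto. cbn [Submission.cprod]. rewrite IH. f_equal.
  rewrite (cf_ext n _ D B fl 1 _ (zshift (Nat.iter k phi p) m)); [apply cf_zshift|]. apply iter_zshift.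
Qed.

Lemma returns_zshift k p m c : returns k p c -> returns k (zshift p m) c.
Proof.
  intros [r1 [r2 r3]]. split; [|split].
  - intros a ha. rewrite iter_zshift by lia. apply zshift_ext. now apply r1.
  - rewrite iter_zshift by lia. unfold Submission.zshift. destruct (Nat.eq_dec zi zi); [|congruence]. rewrite r2. ring.
  - now rewrite cprod_zshift.
Qed.

Lemma cprod_add m k p : cprod (m + k) p = cprod m (Nat.iter k phi p) * cprod k p.
Proof.
  induction m as [|m IH]; [simpl; ring|]. cbn [Nat.add Submission.cprod]. rewrite IH, Nat.iter_add. ring.
Qed.

Lemma returns_later k k' p c c' : (k <= k')%nat -> returns k p c -> returns k' p c' ->
  returns (k' - k) (Nat.iter k phi p) (c' - c).
Proof.
  intros le [r1 [r2 r3]] [s1 [s2 s3]]. unfold returns. rewrite <- Nat.iter_add.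
  replace (k' - k + k)%nat with k' by lia. split; [|split].
  - intros a ha. rewrite r1, s1; auto.
  - rewrite r2, s2. ring.
  - replace k' with (k' - k + k)%nat in s3 by lia. rewrite cprod_add, r3 in s3. lra.
Qed.

Lemma good_nrm k p c : (1 <= k)%nat -> returns k p c -> c <> 0 -> nontrivial_iterated (toE (nrm p)).
Proof.
  intros k1 r c0. split.
  - unfold zc. rewrite get_toV, nrm_z by lia. pose proof (Int_part_bounds (p zi)). lra.
  - exists k. split; auto. apply (returns_zshift k p (- Int_part (p zi))) in r. fold (nrm p) in r.
    destruct r as [r1 [r2 r3]]. split.
    + now apply (translated_iter n Phi D B fl).
    + rewrite action_iter, r2. lra.
Qed.

(** Shared by all dimensions. Equal points with equal images modulo the period have actions that
    differ by an integer. For [n > 0], with [f] the integer part of the final [z], this is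
    contradictory; for [n = 0] it yields a rational point. *)
Lemma recurrence l L X (P : nat -> pt) (c : nat -> R) (f : nat -> nat) :
  (forall q, nontrivial_iterated q -> In q l) ->
  (forall k, (1 <= k <= L)%nat -> returns k (P k) (c k) /\ c k <> 0 /\ 0 <= P k zi < 1 /\ (f k < X)%nat) ->
  (forall k k', (1 <= k)%nat -> (k < k')%nat -> (k' <= L)%nat ->
    (forall a, (a < 2 * n + 1)%nat -> P k a = P k' a) -> c k <> c k') ->
  (length l * (X * (1 + length l)) < L)%nat ->
  exists k k', (1 <= k)%nat /\ (k < k')%nat /\ (k' <= L)%nat /\ f k = f k' /\
    (forall a, (a < 2 * n + 1)%nat -> P k a = P k' a) /\
    exists m : Z, c k' - c k = IZR m /\
      P k zi + c k - IZR (Int_part (P k zi + c k)) = P k zi + c k' - IZR (Int_part (P k zi + c k')).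
Proof.
  intros all hP sep big.
  assert (coord : forall p q, toE p = toE q -> forall a, (a < 2 * n + 1)%nat -> p a = q a).
  { intros p q e a ha. rewrite <- (get_toV (2 * n + 1) p), e, get_toV by auto. reflexivity. }
  assert (nP : forall k, (1 <= k <= L)%nat -> nrm (P k) = P k).
  { intros k hk. destruct (hP k hk) as [_ [_ [hz _]]]. unfold nrm.
    replace (Int_part (P k zi)) with 0%Z; [apply zshift_0|].
    pose proof (Int_part_bounds (P k zi)) as [b1 b2].
    assert (u1 : IZR (Int_part (P k zi)) < IZR 1) by lra.
    assert (u2 : IZR (-1) < IZR (Int_part (P k zi))) by lra.
    apply lt_IZR in u1, u2. lia. }
  destruct (pigeonhole l L X (fun k => toE (P k)) (fun k => toE (nrm (Nat.iter k phi (P k)))) f)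
    as [k [k' [k1 [kk [kL [eQ [ef eS]]]]]]]; auto.
  - intros k hk. apply all. rewrite <- (nP k hk). destruct (hP k hk) as [r [c0 _]].
    apply (good_nrm k (P k) (c k)); auto. lia.
  - intros k hk. apply hP; auto.
  - intros k k' k1 kk kL e. apply all. pose proof (coord _ _ e) as e'.
    destruct (hP k ltac:(lia)) as [r _]. destruct (hP k' ltac:(lia)) as [r' _].
    apply (returns_ext k' (P k') (P k)) in r'; [|intros; symmetry; auto].
    apply (good_nrm (k' - k) _ (c k' - c k)); [lia|apply returns_later; auto; lia|].
    pose proof (sep k k' k1 kk kL e'). lra.
  - exists k, k'. pose proof (coord _ _ eQ) as e'. do 5 (split; [assumption|]).
    destruct (hP k ltac:(lia)) as [[_ [z _]] _]. destruct (hP k' ltac:(lia)) as [[_ [z' _]] _].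
    pose proof (coord _ _ eS zi ltac:(lia)) as ez. rewrite !nrm_z, z, z', <- e' in ez by lia.
    exists (Int_part (P k zi + c k') - Int_part (P k zi + c k))%Z. rewrite minus_IZR. split; lra.
Qed.

Lemma good_outside_list : (0 < n)%nat -> (exists p j, (j < 2 * n + 1)%nat /\ Ph n Phi 1 p j <> p j) ->
  forall l, exists q, nontrivial_iterated q /\ ~ In q l.
Proof.
  intros npos nontrivial l. apply NNPP. intros no.
  assert (all : forall q, nontrivial_iterated q -> In q l).
  { intros q hq. apply NNPP. intros h. apply no. now exists q. }
  pose proof (Int_part_bounds (1 + cap B)) as fb.
  (* The final [z] lies between 0 and [1 + cap B], which leaves [X] possible integer parts. *)
  set (X := S (Z.to_nat (Int_part (1 + cap B)))). set (L := S (length l * (X * (1 + length l)))).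
  destruct (spectrum n (Ph n Phi) D B fl npos nontrivial L ltac:(unfold L; lia)) as [c [inc hc]].
  assert (ex : forall k, exists p, (1 <= k <= L)%nat -> returns k p (c k)).
  { intros k. destruct (le_dec 1 k); [destruct (le_dec k L)|]; [|exists (fun _ => 0); lia..].
    destruct (hc k ltac:(lia)) as [_ [p hp]]. exists p. intros _. exact hp. }
  set (p := fun k => proj1_sig (constructive_indefinite_description _ (ex k))).
  assert (hp : forall k, (1 <= k <= L)%nat -> returns k (p k) (c k)).
  { intros k. exact (proj2_sig (constructive_indefinite_description _ (ex k))). }
  set (P := fun k => nrm (p k)). set (f := fun k => Z.to_nat (Int_part (P k zi + c k))).
  assert (mono : forall k k', (1 <= k)%nat -> (k < k')%nat -> (k' <= L)%nat -> c k < c k').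
  { intros k k' k1 kk. induction kk as [|k' kk IH]; intros kL; [now apply inc|].
    apply Rlt_trans with (c k'); [apply IH; lia|apply inc; lia]. }
  assert (Pz : forall k, 0 <= P k zi < 1).
  { intros k. unfold P. rewrite nrm_z. pose proof (Int_part_bounds (p k zi)). lra. }
  assert (Ipos : forall k, (1 <= k <= L)%nat -> (0 <= Int_part (P k zi + c k) <= Int_part (1 + cap B))%Z).
  { intros k hk. destruct (hc k hk) as [hck _]. specialize (Pz k).
    pose proof (Int_part_bounds (P k zi + c k)) as ib.
    assert (u1 : IZR (-1) < IZR (Int_part (P k zi + c k))) by lra.
    assert (u2 : IZR (Int_part (P k zi + c k)) < IZR (Int_part (1 + cap B) + 1)) by (rewrite plus_IZR; lra).
    apply lt_IZR in u1, u2. lia. }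
  destruct (recurrence l L X P c f all) as [k [k' [k1 [kk [kL [ef [eP [m [em er]]]]]]]]].
  - intros k hk. destruct (hc k hk) as [hck _]. split; [now apply returns_zshift, hp|]. split; [lra|].
    split; [apply Pz|]. unfold f, X. specialize (Ipos k hk). lia.
  - intros k k' k1 kk kL _. specialize (mono k k' k1 kk kL). lra.
  - unfold L. lia.
  - unfold f in ef. rewrite <- (eP zi) in ef by lia.
    pose proof (Ipos k ltac:(lia)). pose proof (Ipos k' ltac:(lia)) as i'. rewrite <- (eP zi) in i' by lia.
    apply Z2Nat.inj in ef; [|lia..]. rewrite ef in er. specialize (mono k k' k1 kk kL). lra.
Qed.
End Counting.

(** * Circle diffeomorphisms *)

Lemma avoid_near (l : list R) a z : a < z -> exists y, a < y <= z /\ forall x, In x l -> ~ a < x < y.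
Proof.
  intros az. induction l as [|w l [y [hy hl]]]; [exists z; split; [lra|now intros]|].
  destruct (Rlt_dec a w) as [aw|aw].
  - exists (Rmin w y). unfold Rmin. destruct (Rle_dec w y); split; try lra; intros x [<-|hx] hh; try lra;
      apply (hl x hx); lra.
  - exists y. split; auto. intros x [<-|hx] hh; [lra|]. now apply (hl x hx).
Qed.

(** The supremum of the points of [[r,z]] at which [g] is not positive. *)
Lemma last_zero (g : R -> R) r z : (forall x, continuity_pt g x) -> r < z -> g r <= 0 -> 0 < g z ->
  exists a, r <= a < z /\ g a = 0 /\ forall x, a < x <= z -> 0 < g x.
Proof.
  intros cg rz gr gz.
  destruct (completeness (fun x => r <= x <= z /\ g x <= 0)) as [a [ub lub]].
  { exists z. intros x hx. apply hx. }
  { exists r. split; [lra|auto]. }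
  assert (ra : r <= a) by (apply ub; split; [lra|auto]).
  assert (az : a <= z) by (apply lub; intros x hx; apply hx).
  assert (after : forall x, a < x <= z -> 0 < g x).
  { intros x hx. apply Rnot_le_lt. intros h. specialize (ub x). cbv beta in ub. lra. }
  assert (ga : g a <= 0).
  { apply Rnot_lt_le. intros h. destruct (cg a (g a) h) as [d [d0 hd]].
    assert (a <= a - Rmin d (a - r) / 2).
    { apply lub. intros x [hx gx]. apply Rnot_lt_le. intros lt. specialize (ub x (conj hx gx)).
      destruct (Req_dec x a) as [->|ne]; [lra|].
      pose proof (Rmin_l d (a - r)). 
      assert (xd : Rabs (x - a) < d) by (apply Rabs_def1; lra).
      specialize (hd x). cbn in hd. unfold Rdist, D_x, no_cond in hd.
      assert (Rabs (g x - g a) < g a) as b by (apply hd; split; [split; [exact I|congruence]|exact xd]).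
      apply Rabs_def2 in b. lra. }
    assert (r <> a) by (intros ->; lra). unfold Rmin in *. destruct (Rle_dec d (a - r)); lra. }
  assert (a <> z) by (intros ->; lra).
  exists a. split; [lra|]. split; auto. apply Rle_antisym; auto. apply Rnot_lt_le. intros h.
  destruct (cg a (- g a) ltac:(lra)) as [d [d0 hd]].
  set (x := a + Rmin d (z - a) / 2).
  assert (hx : a < x <= z /\ x < a + d) by (unfold x, Rmin; destruct (Rle_dec d (z - a)); lra).
  specialize (hd x). cbn in hd. unfold Rdist, D_x, no_cond in hd.
  assert (Rabs (g x - g a) < - g a) as b.
  { apply hd; split; [split; [exact I|lra]|]. apply Rabs_def1; lra. }
  apply Rabs_def2 in b. specialize (after x ltac:(lra)). lra.
Qed.

Lemma continuity_minus_id T x : continuity_pt T x -> continuity_pt (fun x => T x - x) x.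
Proof. intros h. apply (continuity_pt_minus T id); auto. apply derivable_continuous_pt, derivable_pt_id. Qed.

Lemma iter_continuous T k : (forall x, continuity_pt T x) -> forall x, continuity_pt (Nat.iter k T) x.
Proof.
  intros h. induction k as [|k IH]; intros x.
  - apply (derivable_continuous_pt id), derivable_pt_id.
  - apply (continuity_pt_comp (Nat.iter k T) T); auto.
Qed.

Lemma iter_increasing T k : (forall x y, x < y -> T x < T y) -> forall x y, x < y -> Nat.iter k T x < Nat.iter k T y.
Proof. intros h x y xy. induction k as [|k IH]; auto. simpl. now apply h. Qed.

Lemma iter_fix (T : R -> R) k a : T a = a -> Nat.iter k T a = a.
Proof. intros h. induction k as [|k IH]; auto. simpl. now rewrite IH. Qed.

(* An orbit starting just above a climbs to b, so the largest gain of a high iterate is almost b - a,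
   which only points close to a can achieve. *)
Lemma max_gain_near T a b y : (forall x y, x < y -> T x < T y) -> (forall x, continuity_pt T x) ->
  T a = a -> T b = b -> a < y <= b -> (forall x, a < x < b -> x < T x) ->
  exists k q, (1 <= k)%nat /\ a < q < y /\
    (forall x, a <= x <= b -> Nat.iter k T x - x <= Nat.iter k T q - q) /\ a <= Nat.iter k T q <= b.
Proof.
  (* An orbit from [z0] that passes [be] gains more than [be - z0 = b - y], which no starting point
     at or above [y] can. *)
  intros mono ct Ta Tb ay up. set (z0 := (a + y) / 2). set (be := b - (y - a) / 2).
  assert (mw : forall k x y, x <= y -> Nat.iter k T x <= Nat.iter k T y).
  { intros k x y' [h| ->]; [left; now apply iter_increasing|lra]. }
  (* While the orbit stays in [[z0, be]], each iteration gains at least the minimum of [T x - x]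
     there, which is positive. *)
  assert (reach : exists k, (1 <= k)%nat /\ be < Nat.iter k T z0).
  { apply NNPP. intros no.
    destruct (Rle_dec z0 be) as [zb|zb].
    2:{ apply no. exists 1%nat. split; auto. simpl. specialize (up z0). unfold z0, be in *. lra. }
    destruct (continuity_ab_min (fun x => T x - x) z0 be zb) as [mx [hm [m1 m2]]].
    { intros. now apply continuity_minus_id. }
    assert (m0 : 0 < T mx - mx).
    { specialize (up mx). unfold z0, be in *. lra. }
    assert (climb : forall k, z0 + INR k * (T mx - mx) <= Nat.iter k T z0 <= be).
    { induction k as [|k IH]; [simpl; lra|]. rewrite S_INR. split.
      - specialize (hm (Nat.iter k T z0)). cbv beta in hm.
        assert (0 <= INR k * (T mx - mx)) by (apply Rmult_le_pos; [apply pos_INR|lra]).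
        specialize (hm ltac:(lra)). simpl. lra.
      - apply Rnot_lt_le. intros h. apply no. exists (S k). split; [lia|exact h]. }
    destruct (INR_unbounded ((be - z0) / (T mx - mx))) as [k hk].
    apply (Rmult_lt_compat_r (T mx - mx)) in hk; auto.
    replace ((be - z0) / (T mx - mx) * (T mx - mx)) with (be - z0) in hk by (field; lra).
    specialize (climb k). lra. }
  destruct reach as [k [k1 hk]].
  destruct (continuity_ab_maj (fun x => Nat.iter k T x - x) a b ltac:(lra)) as [q [hq qab]].
  { intros. apply continuity_minus_id. now apply iter_continuous. }
  cbv beta in hq.
  assert (range : a <= Nat.iter k T q <= b).
  { split; [rewrite <- (iter_fix T k a Ta) at 1|rewrite <- (iter_fix T k b Tb) at 1]; apply mw; lra. }
  assert (gain : b - y < Nat.iter k T q - q).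
  { specialize (hq z0 ltac:(unfold z0; lra)). unfold be, z0 in *. lra. }
  exists k, q. repeat (split; auto); try lra.
  assert (a <> q); [|lra]. intros <-. rewrite iter_fix in gain by auto. lra.
Qed.

(** [a] and [b] are the ends of the component of the complement of [Fix(T)] that contains [z]; the
    point [q] is then found so close to [a] that no entry of [l] lies in between. *)
Lemma attracting T r r' z (l : list R) : (forall x y, x < y -> T x < T y) -> (forall x, continuity_pt T x) ->
  T r = r -> T r' = r' -> r < z < r' -> z < T z ->
  exists k q a b, (1 <= k)%nat /\ r <= a < q /\ q < b <= r' /\ ~ In q l /\
    (forall x, a < x < b -> Nat.iter k T x - x <= Nat.iter k T q - q) /\ r <= Nat.iter k T q <= r'.
Proof.
  intros mono ct Tr Tr' rz Tz.
  destruct (last_zero (fun x => T x - x) r z) as [a [ra [Ta above]]]; try lra.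
  { intros x. now apply continuity_minus_id. }
  destruct (last_zero (fun x => T (- x) - - x) (- r') (- z)) as [b' [rb [Tb below]]]; try lra.
  { intros x. apply (continuity_pt_comp Ropp (fun x => T x - x)); [|now apply continuity_minus_id].
    apply derivable_continuous_pt. exists (- (1)). apply (derivable_pt_lim_opp id), derivable_pt_lim_id. }
  { rewrite Ropp_involutive. lra. }
  { rewrite Ropp_involutive. lra. }
  set (b := - b').
  assert (hb : z < b <= r' /\ T b = b) by (unfold b; lra).
  assert (up : forall x, a < x < b -> x < T x).
  { intros x hx. destruct (Rle_dec x z) as [xz|xz].
    - specialize (above x). lra.
    - specialize (below (- x)). rewrite Ropp_involutive in below. unfold b in *. lra. }
  destruct (avoid_near l a b ltac:(lra)) as [y [hy hl]].
  destruct (max_gain_near T a b y mono ct) as [k [q [k1 [aq [hq range]]]]]; try lra; auto.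
  exists k, q, a, b. repeat (split; auto); try lra.
  - intros hin. now apply (hl q).
  - intros x hx. apply hq. lra.
Qed.

Lemma extremum_derivative f q a b v : a < q < b ->
  (forall x, a < x < b -> f x - x <= f q - q) \/ (forall x, a < x < b -> f q - q <= f x - x) ->
  derivable_pt_lim f q v -> v = 1.
Proof.
  intros hq hm der.
  assert (d1 : derivable_pt_lim (fun x => f x - x) q (v - 1)).
  { apply (derivable_pt_lim_minus f id); auto. apply derivable_pt_lim_id. }
  destruct hm as [hm|hm].
  - pose proof (deriv_maximum (fun x => f x - x) a b q (exist _ _ d1)) as e. cbn in e.
    specialize (e ltac:(lra) ltac:(lra)). cbv beta in e. specialize (e ltac:(intros; apply hm; lra)). lra.
  - pose proof (deriv_minimum (fun x => f x - x) a b q (exist _ _ d1)) as e. cbn in e.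
    specialize (e ltac:(lra) ltac:(lra)). cbv beta in e. specialize (e ltac:(intros; apply hm; lra)). lra.
Qed.

Section Lift.
Variables (h : R -> R) (dh : nat -> R -> R).
Hypothesis mono : forall x y, x < y -> h x < h y.
Hypothesis der : forall k x, derivable_pt_lim (Nat.iter k h) x (dh k x).
Hypothesis per : forall x m, h (x + IZR m) = h x + IZR m.
Hypothesis up : forall x, x <= h x.

Lemma iter_per k x m : Nat.iter k h (x + IZR m) = Nat.iter k h x + IZR m.
Proof. induction k as [|k IH]; auto. simpl. now rewrite IH, per. Qed.

Lemma iter_up k k' x : (k <= k')%nat -> Nat.iter k h x <= Nat.iter k' h x.
Proof. induction 1; [lra|]. simpl. eapply Rle_trans; [eassumption|apply up]. Qed.

Lemma continuous k x : continuity_pt (Nat.iter k h) x.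
Proof. apply derivable_continuous_pt. exists (dh k x). apply der. Qed.

(** By periodicity the maximum over [[0,1]] is global, so its translate in [[0,1)] is an extremum in
    an open interval. *)
Lemma max_point k : exists q, 0 <= q < 1 /\ dh k q = 1 /\ forall x, Nat.iter k h x - x <= Nat.iter k h q - q.
Proof.
  destruct (continuity_ab_maj (fun x => Nat.iter k h x - x) 0 1 ltac:(lra)) as [q0 [hq q01]].
  { intros. apply continuity_minus_id, continuous. }
  cbv beta in hq.
  assert (glob : forall x, Nat.iter k h x - x <= Nat.iter k h q0 - q0).
  { intros x. pose proof (base_Int_part x). set (m := Int_part x) in *.
    specialize (hq (x - IZR m) ltac:(lra)).
    replace x with (x - IZR m + IZR m) at 1 by ring. rewrite iter_per. lra. }
  set (m := Int_part q0). assert (mb := base_Int_part q0). fold m in mb.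
  assert (E : Nat.iter k h (q0 - IZR m) = Nat.iter k h q0 - IZR m).
  { replace q0 with (q0 - IZR m + IZR m) at 2 by ring. rewrite iter_per. ring. }
  exists (q0 - IZR m). split; [lra|].
  assert (glob' : forall x, Nat.iter k h x - x <= Nat.iter k h (q0 - IZR m) - (q0 - IZR m)).
  { intros x. rewrite E. specialize (glob x). lra. }
  split; auto.
  apply (extremum_derivative (Nat.iter k h) (q0 - IZR m) (q0 - IZR m - 1) (q0 - IZR m + 1)); [lra| |apply der].
  left. auto.
Qed.

Lemma iter_moves k k' q : (k < k')%nat -> q < Nat.iter k h q -> Nat.iter k h q < Nat.iter k' h q.
Proof.
  intros kk hq. apply Rlt_le_trans with (Nat.iter (S k) h q); [|now apply iter_up].
  assert (q < h q) as lt.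
  { destruct (up q) as [l|e]; auto. rewrite iter_fix in hq by auto. lra. }
  apply (iter_increasing h k mono) in lt. rewrite <- Nat.iter_succ_r in lt. exact lt.
Qed.

Lemma rational_case m r (j : Z) (l : list R) : (1 <= m)%nat -> (1 <= j)%Z -> Nat.iter m h r = r + IZR j ->
  exists k q, (1 <= k)%nat /\ r < q < r + 1 /\ ~ In q l /\ dh k q = 1 /\ Nat.iter k h q <> q.
Proof.
  intros m1 j1 hr. assert (j1' : 1 <= IZR j) by (apply (IZR_le 1); lia).
  set (T := fun x => Nat.iter m h x + IZR (- j)).
  assert (Tmono : forall x y, x < y -> T x < T y).
  { intros x y xy. unfold T. apply Rplus_lt_compat_r. now apply iter_increasing. }
  assert (Tct : forall x, continuity_pt T x).
  { intros x. apply (continuity_pt_plus (Nat.iter m h) (fun _ => IZR (- j))); [apply continuous|].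
    apply continuity_pt_const. intros ? ?; reflexivity. }
  assert (Titer : forall k x, Nat.iter k T x = Nat.iter (k * m) h x + IZR (- (Z.of_nat k * j))).
  { induction k as [|k IH]; intros x; [simpl; ring|].
    change (Nat.iter (S k) T x) with (T (Nat.iter k T x)). rewrite IH. unfold T. rewrite iter_per.
    cbn [Nat.mul]. rewrite Nat.iter_add.
    rewrite Nat2Z.inj_succ, !opp_IZR, !mult_IZR, succ_IZR. ring. }
  assert (Tr : T r = r) by (unfold T; rewrite hr, opp_IZR; ring).
  assert (Tr1 : T (r + 1) = r + 1) by (unfold T; rewrite (iter_per m r 1), hr, opp_IZR; ring).
  (* A point fixed by the iterate [k * m] of [h] would be lowered by [k * j >= 1] under the [k]-th
     iterate of [T], hence pushed below [r]. *)
  assert (moved : forall k x, (1 <= k)%nat -> x < r + 1 -> r <= Nat.iter k T x -> Nat.iter (k * m) h x <> x).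
  { intros k x k1 hx hk e. rewrite Titer, e, opp_IZR, mult_IZR in hk.
    assert (1 <= IZR (Z.of_nat k)) by (apply (IZR_le 1); lia). nra. }
  assert (conclude : forall k q a b, (1 <= k)%nat -> r <= a < q -> q < b <= r + 1 -> ~ In q l ->
     ((forall x, a < x < b -> Nat.iter k T x - x <= Nat.iter k T q - q) \/
      (forall x, a < x < b -> Nat.iter k T q - q <= Nat.iter k T x - x)) ->
     r <= Nat.iter k T q ->
     exists k q, (1 <= k)%nat /\ r < q < r + 1 /\ ~ In q l /\ dh k q = 1 /\ Nat.iter k h q <> q).
  { intros k q a b k1 aq qb nin hm hr'. exists (k * m)%nat, q.
    split; [nia|]. split; [lra|]. split; auto. split; [|apply moved; auto; lra].
    apply (extremum_derivative (Nat.iter (k * m) h) q a b); [lra| |apply der].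
    rewrite Titer in hm.
    destruct hm as [hm|hm]; [left|right]; intros x hx; specialize (hm x hx); rewrite Titer in hm; lra. }
  destruct (classic (exists z, r < z < r + 1 /\ T z <> z)) as [[z [rz Tz]]|all].
  - destruct (Rtotal_order (T z) z) as [lt|[e|gt]]; [|contradiction|].
    (* Where [T] moves points down, reflection in the origin exchanges the directions and turns the
       maximum into a minimum. *)
    + set (S := fun x => - T (- x)).
      assert (Siter : forall k x, Nat.iter k S x = - Nat.iter k T (- x)).
      { induction k as [|k IH]; intros x; [simpl; ring|]. simpl. rewrite IH. unfold S. now rewrite Ropp_involutive. }
      destruct (attracting S (- (r + 1)) (- r) (- z) (map Ropp l)) as [k [q [a [b [k1 [aq [qb [nin [hm rg]]]]]]]]].
      * intros x y xy. unfold S. specialize (Tmono (- y) (- x)). lra.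
      * intros x. unfold S. apply (continuity_pt_opp (fun x => T (- x))).
        apply (continuity_pt_comp Ropp T); auto.
        apply derivable_continuous_pt. exists (- (1)). apply (derivable_pt_lim_opp id), derivable_pt_lim_id.
      * unfold S. rewrite Ropp_involutive. lra.
      * unfold S. rewrite Ropp_involutive. lra.
      * lra.
      * unfold S. rewrite Ropp_involutive. lra.
      * rewrite Siter in rg.
        apply (conclude k (- q) (- b) (- a)); auto; try lra.
        -- intros hin. apply nin. apply in_map_iff. exists (- q). split; [ring|auto].
        -- right. intros x hx. specialize (hm (- x) ltac:(lra)). rewrite !Siter, Ropp_involutive in hm. lra.
    + destruct (attracting T r (r + 1) z l) as [k [q [a [b [k1 [aq [qb [nin [hm rg]]]]]]]]]; auto.
      apply (conclude k q a b); auto. lra.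
  (* If [T] is the identity on the whole interval, any point of it off the list will do, since
     [h^m q = q + j]. *)
  - assert (id : forall z, r < z < r + 1 -> T z = z).
    { intros z hz. apply NNPP. intros ne. apply all. now exists z. }
    destruct (avoid_near l r (r + 1) ltac:(lra)) as [y [hy hl]].
    set (q := (r + y) / 2). assert (hq : r < q < y) by (unfold q; lra).
    apply (conclude 1%nat q r (r + 1)); auto; try lra.
    + intros hin. now apply (hl q).
    + left. intros x hx. simpl. rewrite !id by lra. lra.
    + simpl. rewrite id; lra.
Qed.
End Lift.

(** * The case n = 0 *)

Section DimensionZero.
Variables (Phi : R -> E 0 -> E 0) (D : nat -> nat -> pt -> R) (B : R).
Hypothesis fl : flow 0 (Ph 0 Phi) D B.
Notation Ph := (Ph 0 Phi).
Notation phi := (phi Ph).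

(** For [n = 0] coordinate 0 is the Reeb coordinate and the only one that matters; the conformal
    factor is the derivative of the circle map. *)
Definition lift (x : R) : pt := fun _ => x.
Definition circle (x : R) : R := Ph 1 (lift x) 0%nat.

Lemma lift_ext (p : pt) : forall a, (a < 2 * 0 + 1)%nat -> p a = lift (p 0%nat) a.
Proof. intros a ha. unfold lift. f_equal. lia. Qed.

Lemma circle_iter k x : Nat.iter k circle x = Nat.iter k phi (lift x) 0%nat.
Proof.
  induction k as [|k IH]; [reflexivity|]. cbn [Nat.iter nat_rect]. fold (Nat.iter k circle x). rewrite IH.
  unfold circle. apply (f_equal (fun q : pt => q 0%nat)), (Ph_ext 0 Phi). intros a ha. symmetry. now apply lift_ext.
Qed.

Lemma circle_der x : derivable_pt_lim circle x (cf 0 Ph D 1 (lift x)).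
Proof.
  pose proof (D_space 0 Ph D B fl 0 0 1 (lift x) ltac:(lia) ltac:(lia)) as d.
  eapply derivable_eq; [exact d| |unfold cf, aD; simpl; ring].
  intros t. apply (f_equal (fun q : pt => q 0%nat)), (Ph_ext 0 Phi). intros a ha.
  replace a with 0%nat by lia. reflexivity.
Qed.

Lemma circle_iter_der k x : derivable_pt_lim (Nat.iter k circle) x (cprod 0 Ph D k (lift x)).
Proof.
  induction k as [|k IH]; [apply derivable_pt_lim_id|]. cbn [cprod].
  apply (derivable_pt_lim_comp (Nat.iter k circle) circle); auto.
  rewrite (cf_ext 0 Ph D B fl 1 _ (lift (Nat.iter k circle x))); [apply circle_der|].
  intros a ha. rewrite circle_iter. now apply lift_ext.
Qed.

Lemma circle_mono x y : x < y -> circle x < circle y.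
Proof.
  intros xy. destruct (MVT_cor2 circle (fun x => cf 0 Ph D 1 (lift x)) x y xy) as [c [e _]].
  - intros; apply circle_der.
  - assert (0 < cf 0 Ph D 1 (lift c)) by (apply (fl_cf _ _ _ _ fl); lra). nra.
Qed.

Lemma circle_per x m : circle (x + IZR m) = circle x + IZR m.
Proof.
  unfold circle. pose proof (fl_per _ _ _ _ fl 1 (lift x) m 0 ltac:(lra) ltac:(lia)) as e.
  unfold zshift at 2 in e. simpl in e. rewrite <- e.
  apply (f_equal (fun q : pt => q 0%nat)), (Ph_ext 0 Phi). intros a ha. replace a with 0%nat by lia. reflexivity.
Qed.

Lemma circle_up x : x <= circle x.
Proof.
  destruct (MVT_cor2 (fun t => Ph t (lift x) 0%nat) (fun t => D 0%nat 1%nat (st 0 t (lift x))) 0 1 ltac:(lra)) as [c [e hc]].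
  - intros c _. apply (D_time 0 Ph D B fl 0). lia.
  - rewrite (fl_0 _ _ _ _ fl) in e by lia.
    pose proof (fl_pos _ _ _ _ fl c (lift x) ltac:(lra)) as hp. unfold aD in hp. simpl in hp.
    unfold circle. unfold lift at 2 in e. lra.
Qed.

Lemma returns_circle k x c : Nat.iter k circle x = x + c -> cprod 0 Ph D k (lift x) = 1 ->
  returns 0 Phi D k (lift x) c.
Proof.
  intros h1 h2. split; [intros; lia|]. split; auto. rewrite circle_iter in h1. exact h1.
Qed.

Lemma good_outside_list0 : (exists p, forall k : Z, Phi 1 p <> vadd p (vscale (IZR k) (ez 0))) ->
  forall l, exists q, nontrivial_iterated 0 Phi q /\ ~ In q l.
Proof.
  intros [p0 np] l. apply NNPP. intros no.
  assert (all : forall q, nontrivial_iterated 0 Phi q -> In q l).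
  { intros q hq. apply NNPP. intros h. apply no. now exists q. }
  assert (ex0 : exists x, x < circle x).
  { exists (get p0 0). destruct (circle_up (get p0 0)) as [lt|e]; auto. exfalso. apply (np 0%Z).
    apply vec_ext. intros i hi. rewrite get_vadd, get_vscale. replace i with 0%nat by lia.
    rewrite Rmult_0_l, Rplus_0_r, e at 1. unfold circle, Submission.Ph. f_equal. f_equal.
    apply vec_ext. intros a ha. rewrite get_toV by auto. unfold lift. f_equal. lia. }
  destruct ex0 as [x0 hx0].
  set (dh := fun k x => cprod 0 Ph D k (lift x)).
  pose proof (max_point circle dh circle_iter_der circle_per) as mp.
  set (q := fun k => proj1_sig (constructive_indefinite_description _ (mp k))).
  assert (hq : forall k, 0 <= q k < 1 /\ dh k (q k) = 1 /\
    forall x, Nat.iter k circle x - x <= Nat.iter k circle (q k) - q k).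
  { intros k. exact (proj2_sig (constructive_indefinite_description _ (mp k))). }
  clearbody q. set (c := fun k => Nat.iter k circle (q k) - q k).
  assert (cpos : forall k, (1 <= k)%nat -> 0 < c k).
  { intros k k1. unfold c. destruct (hq k) as [_ [_ h]]. specialize (h x0).
    pose proof (iter_up circle circle_up 1 k x0 k1) as u. simpl in u. lra. }
  (* No upper bound for these actions is available here, so the integer part is left out, with [f]
     constant. *)
  destruct (recurrence 0 Phi D B fl l (S (length l * (1 * (1 + length l)))) 1 (fun k => lift (q k)) c (fun _ => O) all)
    as [k [k' [k1 [kk [_ [_ [eP [m [em _]]]]]]]]].
  - intros k hk. destruct (hq k) as [h1 [h2 _]]. split; [|split; [|split; [|lia]]].
    + apply returns_circle; [unfold c; ring|exact h2].
    + specialize (cpos k ltac:(lia)). lra.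
    + exact h1.
  - intros k k' k1 kk _ e. specialize (e 0%nat ltac:(lia)). unfold lift in e.
    pose proof (cpos k k1) as ck. unfold c in *. rewrite <- e.
    pose proof (iter_moves circle circle_mono circle_up k k' (q k) kk ltac:(lra)). lra.
  - lia.
  - specialize (eP 0%nat ltac:(lia)). unfold lift in eP. pose proof (cpos k k1) as ck. unfold c in em, ck.
    rewrite <- eP in em.
    pose proof (iter_moves circle circle_mono circle_up k k' (q k) kk ltac:(lra)) as mv.
    assert (m1 : 0 < IZR m) by lra. apply lt_IZR in m1.
    set (r0 := Nat.iter k circle (q k)) in *. set (fr := Int_part r0). pose proof (Int_part_bounds r0) as rb. fold fr in rb.
    set (r := r0 + IZR (- fr)). assert (hr : 0 <= r < 1) by (unfold r; rewrite opp_IZR; lra).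
    assert (er : Nat.iter (k' - k) circle r = r + IZR m).
    { unfold r. rewrite (iter_per circle circle_per). unfold r0. rewrite <- Nat.iter_add.
      replace (k' - k + k)%nat with k' by lia. fold r0. lra. }
    (* The new point lies in [(r, r + 1)], inside [(0, 2)], so for each listed point both lifts that
       may occur there are excluded. *)
    destruct (rational_case circle dh circle_mono circle_iter_der circle_per (k' - k) r m
      (map zc l ++ map (fun q => zc q + 1) l) ltac:(lia) ltac:(lia) er) as [i [x [i1 [rx [nin [d1 mvx]]]]]].
    pose proof (good_nrm 0 Phi D B fl i (lift x) (Nat.iter i circle x - x) i1
      ltac:(apply returns_circle; [ring|exact d1]) ltac:(lra)) as g.
    apply all in g. apply nin. apply in_or_app.
    assert (zx : zc (toV (2 * 0 + 1) (nrm 0 (lift x)) : E 0) = x - IZR (Int_part x)).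
    { unfold zc. rewrite get_toV, nrm_z by lia. reflexivity. }
    pose proof (Int_part_bounds x) as xb.
    assert (u1 : IZR (-1) < IZR (Int_part x)) by lra.
    assert (u2 : IZR (Int_part x) < IZR 2) by lra.
    apply lt_IZR in u1, u2.
    assert (ix : Int_part x = 0%Z \/ Int_part x = 1%Z) by lia.
    destruct ix as [ix|ix]; rewrite ix in zx; [left|right]; apply in_map_iff;
      exists (toV (2 * 0 + 1) (nrm 0 (lift x))); (split; [rewrite zx; ring|exact g]).
Qed.
End DimensionZero.

Theorem theorem4p1 (n : nat) (Phi : R -> E n -> E n) (H : R -> E n -> R) :
  st_smooth n Phi ->
  (forall p, Phi 0 p = p) ->
  (forall t, 0 <= t <= 1 -> contactomorphism n (Phi t)) ->
  (forall t p, 0 <= t <= 1 -> Phi t (vadd p (ez n)) = vadd (Phi t p) (ez n)) ->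
  (exists B, forall t p, 0 <= t <= 1 -> B < xy_norm n p -> Phi t p = p) ->
  generates n Phi H ->
  positive_ham n H ->
  (exists p, forall k : Z, Phi 1 p <> vadd p (vscale (IZR k) (ez n))) ->
  exists q : nat -> E n,
    (forall a b, q a = q b -> a = b) /\
    forall a, 0 <= zc (q a) < 1 /\
      exists k : nat, (1 <= k)%nat /\
        translated_point n (Nat.iter k (Phi 1)) (q a) /\
        action n (Nat.iter k (Phi 1)) (q a) <> 0.
Proof.
  intros smooth_Phi Phi0 contact periodic compact gen pos nontrivial.
  destruct (flow_exists n Phi H smooth_Phi Phi0 contact periodic compact gen pos) as [D [B fl]].
  apply (infinite_sequence (nontrivial_iterated n Phi)). destruct n as [|n].
  - now apply (good_outside_list0 Phi D B).
  - apply (good_outside_list (S n) Phi D B fl); [lia|]. destruct nontrivial as [p np].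
    exists (get p). apply NNPP. intros fixed. apply (np 0%Z). apply vec_ext. intros i hi.
    rewrite get_vadd, get_vscale, Rmult_0_l, Rplus_0_r. apply NNPP. intros ne. apply fixed. exists i.
    split; [exact hi|]. unfold Ph. now rewrite toV_get.
Qed.
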